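(* Assume that $a=0$ and $b=-\frac{2}{9}$. Then the fourth Painlevé equation $$\ddot{y}=\frac{1}{2y}(\dot y)^2+\frac32 y^3+4t\,y^2+2(t^2-a)\,y+\frac{b}{y},$$ regarded as the autonomous Hamiltonian system on $\mathbb{C}^4$ with Hamiltonian $$H=y\,p^2-y^2p-2t\,y\,p-2(v_1-v_2)\,p-2(v_2-v_3)\,y+F,\qquad v_1=\tfrac13,\ v_2=0,\ v_3=-\tfrac13,$$ is not integrable in the Liouville-Arnold sense by meromorphic functions which are rational in $t$.
   Context: Hamiltonian form of the fourth Painlevé equation. For $v_1,v_2,v_3\in\mathbb{C}$ with $v_1+v_2+v_3=0$, put $H_{IV}=y p^2-y^2p-2typ-2(v_1-v_2)p-2(v_2-v_3)y$. The system $\dot y=\partial H_{IV}/\partial p$, $\dot p=-\partial H_{IV}/\partial y$ (dot is $d/dt$) is equivalent to the fourth Painlevé equation with $a=1+3v_3$, $b=-2(v_1-v_2)^2$. It is extended to an autonomous system with two degrees of freedom on $\mathbb{C}^4$ with coordinates $(y,p,t,F)$, symplectic form $\Omega=dp\wedge dy+dF\wedge dt$ and Hamiltonian $H=H_{IV}+F$: $$\frac{dy}{ds}=\frac{\partial H}{\partial p},\quad \frac{dp}{ds}=-\frac{\partial H}{\partial y},\quad \frac{dt}{ds}=\frac{\partial H}{\partial F},\quad \frac{dF}{ds}=-\frac{\partial H}{\partial t}.$$ Integrability in the Liouville-Arnold sense by meromorphic functions rational in $t$ means: there exist two first integrals $f_1=H$, $f_2$ of this system, functionally independent and in involution with respect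 to the Poisson bracket of $\Omega$, which are meromorphic functions of $(y,p,t,F)$ and rational in $t$. For $a=0$, $b=-\frac29$ the choice of parameters is $v_1=-v_3=\frac13$, $v_2=0$. *)

(* Defs.v *)
From HB Require Import structures.
From mathcomp Require Import all_boot all_order all_algebra.
From mathcomp Require Import all_classical all_reals all_analysis.
From mathcomp Require Import complex.
From mathcomp Require Import ring.
Set Implicit Arguments.
Unset Strict Implicit.
Unset Printing Implicit Defensive.
Import Order.TTheory GRing.Theory Num.Theory.
Import numFieldNormedType.Exports.
Local Open Scope classical_set_scope.
Local Open Scope ring_scope.

(* The topology and norm of the field C = R[i], as for any numFieldType. *)
HB.instance Definition _ (R : rcfType) := NormedModule.copy R[i] R[i]^o.

Section Meromorphic.
Context {R : realType} {n : nat}.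
Implicit Types (f g h : 'rV[R[i]]_n -> R[i]) (x : 'rV[R[i]]_n).

(* [differentiable] is taken over the field R[i], so this is complex
   differentiability in a neighbourhood of x. *)
Definition holomorphic_at f x := \forall z \near x, differentiable f z.

(* A meromorphic function on C^n is locally a quotient g / h of holomorphic
   functions, h vanishing identically on no nonempty open set. It is represented
   by a total function whose values at points where h vanishes are irrelevant;
   statements about such an f only look at points where f is holomorphic. *)
Definition meromorphic f := forall x, exists V g h,
  [/\ open_nbhs x V,
      forall z, V z -> holomorphic_at g z /\ holomorphic_at h z,
      forall z, V z -> ~ (\forall w \near z, h w = 0)
    & forall z, V z -> h z != 0 -> f z = g z / h z].

Definition partial f (k : 'I_n) x : R[i] := 'D_(delta_mx 0 k) f x.

Definition gradient f x : 'rV[R[i]]_n := \row_k partial f k x.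

Definition functionally_independent f g :=
  dense [set x | [/\ holomorphic_at f x, holomorphic_at g x
                   & row_free (col_mx (gradient f x) (gradient g x))]].

End Meromorphic.

Section Phase_space.
Context {R : realType}.
Local Notation C := R[i].
Local Notation phase := 'rV[C]_4.
Implicit Types (f g H : phase -> C) (x : phase).

Definition iy : 'I_4 := @Ordinal 4 0 isT.
Definition ip : 'I_4 := @Ordinal 4 1 isT.
Definition it : 'I_4 := @Ordinal 4 2 isT.
Definition iF : 'I_4 := @Ordinal 4 3 isT.

Definition point (y p t F : C) : phase := \row_k [:: y; p; t; F]`_k.

(* For fixed (y, p, F) the function of t is the quotient P / Q; if the whole
   line lies in the polar set of f there is nothing to check. *)
Definition rational_in_t f := forall y p F, exists P Q : {poly C},
  Q != 0 /\ forall t, holomorphic_at f (point y p t F) ->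
                      f (point y p t F) * Q.[t] = P.[t].

(* The Hamiltonian vector field of H for dp /\ dy + dF /\ dt. *)
Definition hamiltonian_field H x : phase :=
  point (partial H ip x) (- partial H iy x) (partial H iF x) (- partial H it x).

Definition poisson f g x : C :=
  partial f iy x * partial g ip x - partial f ip x * partial g iy x
  + partial f it x * partial g iF x - partial f iF x * partial g it x.

Definition first_integral H f :=
  forall x, holomorphic_at f x -> 'D_(hamiltonian_field H x) f x = 0.

Definition in_involution f g := forall x,
  holomorphic_at f x -> holomorphic_at g x -> poisson f g x = 0.

Definition integrable_rational_in_t H := exists f1 f2,
  [/\ f1 = H,
      meromorphic f1 /\ meromorphic f2,
      rational_in_t f1 /\ rational_in_t f2,
      first_integral H f1 /\ first_integral H f2
    & in_involution f1 f2 /\ functionally_independent f1 f2].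

Definition HIV (v1 v2 v3 y p t : C) : C :=
  y * p ^+ 2 - y ^+ 2 * p - 2 * t * y * p
  - 2 * (v1 - v2) * p - 2 * (v2 - v3) * y.

Definition hamiltonian4 (v1 v2 v3 : C) (x : phase) : C :=
  HIV v1 v2 v3 (x 0 iy) (x 0 ip) (x 0 it) + x 0 iF.

Definition painleve4 (a b : C) (y : C -> C) (t : C) :=
  derive1n 2 y t = (derive1 y t) ^+ 2 / (2 * y t) + 3 / 2 * y t ^+ 3
    + 4 * t * y t ^+ 2 + 2 * (t ^+ 2 - a) * y t + b / y t.

Let is_derive_coord (k : 'I_4) x v :
  is_derive x v (fun z : phase => z 0 k : C) (v 0 k).
Proof.
apply: DeriveDef; first exact/diff_derivable/differentiable_coord.
rewrite deriveE; last exact: differentiable_coord.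
have @f : {linear phase -> C}.
  by exists (fun N : phase => N 0 k); do 2![eexists]; do ?[constructor];
     rewrite ?mxE// => ? *; rewrite ?mxE//; move=> ?; rewrite !mxE.
have fc : continuous f by exact: coord_continuous.
by rewrite (_ : (fun z : phase => z 0 k : C) = f)// (diff_lin _ fc).
Qed.

Lemma hamiltonian_field4E v1 v2 v3 x :
  let y := x 0 iy in let p := x 0 ip in let t := x 0 it in
  hamiltonian_field (hamiltonian4 v1 v2 v3) x =
  point (2 * y * p - y ^+ 2 - 2 * t * y - 2 * (v1 - v2))
    (- (p ^+ 2 - 2 * y * p - 2 * t * p - 2 * (v2 - v3)))
    1 (2 * y * p).
Proof.
move=> y p t; set c1 := 2 * (v1 - v2); set c2 := 2 * (v2 - v3).
have D v : 'D_v (hamiltonian4 v1 v2 v3) x =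
    (2 * y * p - y ^+ 2 - 2 * t * y - c1) * v 0 ip
    + (p ^+ 2 - 2 * y * p - 2 * t * p - c2) * v 0 iy
    - 2 * y * p * v 0 it + v 0 iF.
  pose X k : phase -> C := fun z => z 0 k.
  have -> : hamiltonian4 v1 v2 v3 =
      X iy * (X ip * X ip) - X iy * X iy * X ip
      - (cst 2 : phase -> C) * X it * X iy * X ip
      - (cst c1 : phase -> C) * X ip - (cst c2 : phase -> C) * X iy + X iF.
    apply/funext => z; rewrite /hamiltonian4 /HIV /X !fctE /= /c1 /c2; ring.
  pose dX k := is_derive_coord k x v.
  pose cc (c : C) := is_derive_cst c x v.
  apply: (@derive_val _ _ _ _ _ _ _ (is_derive_eq (is_deriveD (is_deriveB (is_deriveB
     (is_deriveB (is_deriveB (is_deriveM (dX iy) (is_deriveM (dX ip) (dX ip)))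
        (is_deriveM (is_deriveM (dX iy) (dX iy)) (dX ip)))
      (is_deriveM (is_deriveM (is_deriveM (cc 2) (dX it)) (dX iy)) (dX ip)))
     (is_deriveM (cc c1) (dX ip))) (is_deriveM (cc c2) (dX iy))) (dX iF)) _)).
  rewrite /X !fctE /= /GRing.scale /=; rewrite /y /p /t; ring.
rewrite /hamiltonian_field /partial !D !mxE /= !mulr1 !mulr0.
by congr point; rewrite /c1 /c2; ring.
Qed.

Let is_derive_curve (g : C -> phase) (s : C) w k :
  is_derive s (1 : C) g w -> is_derive s (1 : C) (fun z => g z 0 k : C) (w 0 k).
Proof.
move=> [dg <-].
have cv : (fun h : C => h^-1 *: ((fun z => g z 0 k : C) (h *: (1 : C) + s)
            - (fun z => g z 0 k : C) s)) @ 0^' --> ('D_(1 : C) g s) 0 k.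
  rewrite (_ : (fun h : C => _) = (fun M : phase => M 0 k) \o (fun h : C =>
    h^-1 *: ((g \o shift s) (h *: (1 : C)) - g s))).
    exact: (cvg_comp _ _ dg (@coord_continuous _ 1 4 0 k _)).
  by apply/funext => h /=; rewrite !mxE.
by apply: DeriveDef; [apply/cvg_ex; exists (('D_(1 : C) g s) 0 k)|apply: cvg_lim cv].
Qed.

(* Along the solutions, parametrized so that s = t, y solves the fourth
   Painleve equation. *)
Lemma hamiltonian4_painleve4 v1 v2 v3 (g : C -> phase) (s : C) :
  v1 + v2 + v3 = 0 ->
  (\forall z \near s, g z 0 it = z /\
     is_derive z (1 : C) g (hamiltonian_field (hamiltonian4 v1 v2 v3) (g z))) ->
  g s 0 iy != 0 ->
  painleve4 (1 + 3 * v3) (- 2 * (v1 - v2) ^+ 2) (fun z => g z 0 iy) s.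
Proof.
move=> v0 gs y0; set c1 := 2 * (v1 - v2); set c2 := 2 * (v2 - v3).
pose y z : C := g z 0 iy; pose p z : C := g z 0 ip.
pose y' z : C := 2 * y z * p z - y z ^+ 2 - 2 * z * y z - c1.
pose p' z : C := - (p z ^+ 2 - 2 * y z * p z - 2 * z * p z - c2).
have E : \forall z \near s, is_derive z (1 : C) y (y' z)
                            /\ is_derive z (1 : C) p (p' z).
  apply: filterS gs => z [tz dz]; rewrite hamiltonian_field4E tz in dz.
  split.
  - by have := is_derive_curve iy dz; rewrite mxE.
  - by have := is_derive_curve ip dz; rewrite mxE.
have [dy dp] := nbhs_singleton E.
have Dy : \near s, derive1 y s = y' s.
  by apply: filterS E => z [dz _]; rewrite derive1E derive_val.
pose y'' := 2 * y' s * p s + 2 * y s * p' s - 2 * y s * y' s - 2 * y s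
            - 2 * s * y' s.
have D2 : derive1n 2 y s = y''.
  have D : is_derive s (1 : C) y' y''.
    rewrite (_ : y' = (cst 2 : C -> C) * y * p - y * y - (cst 2 : C -> C) * id * y
                      - cst c1); last by apply/funext => z; rewrite !fctE /y' /=; ring.
    apply: (is_derive_eq (is_deriveB (is_deriveB (is_deriveB
      (is_deriveM (is_deriveM (is_derive_cst (2 : C) s 1) dy) dp)
      (is_deriveM dy dy))
      (is_deriveM (is_deriveM (is_derive_cst (2 : C) s 1) (is_derive_id s 1)) dy))
      (is_derive_cst c1 s 1))).
    rewrite !fctE /= /GRing.scale /= /y''; ring.
  rewrite /derive1n /= derive1E.
  have -> : 'D_(1 : C) (derive1 y) s = 'D_(1 : C) y' s.
    by apply: near_eq_derive Dy; rewrite oner_neq0.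
  exact: derive_val.
rewrite /painleve4 D2 (nbhs_singleton Dy) /y'' /y' /p' /c1 /c2.
rewrite -[g s 0 iy]/(y s) in y0 *.
have -> : v1 = - (v2 + v3) by apply/eqP; rewrite -addr_eq0 addrA v0.
move: (y s) (p s) y0 => Y P Y0; field.
exact: Y0.
Qed.

Corollary hamiltonian4_painleve4_0_29 (g : C -> phase) (s : C) :
  let H := hamiltonian4 (1 / 3) 0 (- (1 / 3)) in
  (\forall z \near s, g z 0 it = z /\
     is_derive z (1 : C) g (hamiltonian_field H (g z))) ->
  g s 0 iy != 0 ->
  painleve4 0 (- (2 / 9)) (fun z => g z 0 iy) s.
Proof.
move=> H gs y0.
have -> : 0 = 1 + 3 * (- (1 / 3)) :> C by field.
have -> : - (2 / 9) = - 2 * (1 / 3 - 0) ^+ 2 :> C by field.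
by apply: hamiltonian4_painleve4 gs y0; ring.
Qed.

End Phase_space.

(* Main.v *)
(* On y != 0 use the coordinates (z, q, t, F) with y = exp z, p = q / y. There
   the flow is d_t - 2 t d_z + D0 with D0 independent of t, so the coefficients of
   the expansion at t = infinity of a first integral rational in t obey a recursion
   giving d_z c_(k+1) in terms of c_k and c_(k-1). Since the integral is meromorphic
   on all of C^4, going once around the circle y -> exp(2 pi i) y forbids a term
   linear in z, so every coefficient is a Laurent polynomial in y, and the
   solvability of the recursion forces polynomial dependence on F. Hence, for fixed
   q, the integral is rational in (y, F, t). Applying the same argument once more
   on a level set H = h0, with F eliminated, makes its restriction rational in
   (y, q, t).

   With om a primitive cube root of unity, u = y + 2t/3, v = p - 2t/3,
   x = u + om v and s = u + om^2 v, the field becomes x' = lam t x - s^2,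
   s' = - lam t s - x^2, and with xi = x / s^2 it is regular along s = 0:
   xi' = 3 lam t xi - 1 + 2 xi^3 s^3, s' = - lam t s - xi^2 s^4. Comparing lowest
   terms in s, and then leading terms in xi, shows that numerator and denominator
   of a rational integral are proportional. So the second integral is constant on
   level sets of H, its gradient is a multiple of that of H, and the two are
   nowhere independent. *)
Require Import Defs.
From mathcomp Require Import all_boot all_order all_algebra.
From mathcomp Require Import all_classical all_reals all_analysis.
From mathcomp Require Import complex ring lra zify polyXY perm.
Set Implicit Arguments.
Unset Strict Implicit.
Unset Printing Implicit Defensive.
Import Order.TTheory GRing.Theory Num.Theory.
Import numFieldNormedType.Exports.
Local Open Scope classical_set_scope.
Local Open Scope complex_scope.
Local Open Scope ring_scope.

(** Rationality in [t] is assumed line by line, with no bound on degrees. Baire gives a box with one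
    bound, and Cramer's rule then expresses numerator and denominator through finitely many values
    of the integral. The coordinates come from the scaling (y, p) -> (c y, p / c), which fixes q = y
    p: the part of the field linear in [t] generates it, whence -2t d_z. The first pass leaves the
    dependence on q open, since every step has an integration constant depending on q. On a level
    set of H the resonant equations determine these constants except the first; the top coefficients
    are the Taylor coefficients of one function of q, and a linear recurrence makes that function
    rational. The point u = v = 0 is the rational solution y = -2t/3, p = 2t/3 of this equation; x
    and s diagonalize the linearization there, and (s, xi) is a chart of a weighted blow-up. On s =
    0 the field is xi' = 3 lam t xi - 1, whose solutions involve the error function. The obstruction
    to integrability is thus that r' = mu t r + c with mu != 0 has no nonzero polynomial
    solution. *)

Section ComplexIntegral.
Variable R : realType.
Local Notation C := R[i].
Local Notation ReC := (@complex.Re R).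
Local Notation ImC := (@complex.Im R).
Local Notation mu := (@lebesgue_measure R).
Implicit Types (h : R -> C) (a b c d : R).

(** * Complex integrals over segments *)

Lemma normc_ge_Im (z : C) : `|ImC z|%:C <= `|z|.
Proof.
case: z => a b; rewrite normc_def /= lecR -sqrtr_sqr ler_wsqrtr//.
by rewrite lerDr sqr_ge0.
Qed.

Lemma normc_le_ReIm (z : C) : `|z| <= (`|ReC z| + `|ImC z|)%:C.
Proof.
case: z => a b; rewrite normc_def /= lecR -(ler_sqr (sqrtr_ge0 _)) ?nnegrE ?addr_ge0//.
rewrite sqr_sqrtr ?addr_ge0 ?sqr_ge0// sqrrD !real_normK ?num_real//.
by rewrite -addrA lerD2l lerDr mulrn_wge0// mulr_ge0.
Qed.

(** For b < a the interval is empty and the value is 0, not minus the reversed integral; hence the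
    ordering hypotheses in the lemmas below. *)
Definition cint h a b : C :=
  (\int[mu]_(x in `[a, b]) ReC (h x)) +i* (\int[mu]_(x in `[a, b]) ImC (h x)).

Definition cintegrable a b h :=
  mu.-integrable `[a, b] (EFin \o (ReC \o h)) /\
  mu.-integrable `[a, b] (EFin \o (ImC \o h)).

Lemma ReZ (k z : C) : ReC (k * z) = ReC k * ReC z - ImC k * ImC z.
Proof. by case: k z => ? ? []. Qed.

Lemma ImZ (k z : C) : ImC (k * z) = ReC k * ImC z + ImC k * ReC z.
Proof. by case: k z => ? ? []. Qed.

Lemma ReD (w z : C) : ReC (w + z) = ReC w + ReC z.
Proof. by case: w z => ? ? []. Qed.

Lemma ImD (w z : C) : ImC (w + z) = ImC w + ImC z.
Proof. by case: w z => ? ? []. Qed.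

Lemma integrableZ' a b (r : R) (f : R -> R) : mu.-integrable `[a, b] (EFin \o f) ->
  mu.-integrable `[a, b] (EFin \o (fun x => r * f x)).
Proof.
move=> fi; rewrite (_ : _ \o _ = (fun x => r%:E * (EFin \o f) x)%E); last by apply/funext.
exact: integrableZl.
Qed.

Lemma cintD a b h1 h2 : cintegrable a b h1 -> cintegrable a b h2 ->
  cint (fun x => h1 x + h2 x) a b = cint h1 a b + cint h2 a b.
Proof.
move=> [a1 a2] [b1 b2]; rewrite /cint; apply/eqP; rewrite eq_complex /=; apply/andP; split; apply/eqP.
  under eq_Rintegral do rewrite ReD.
  exact: RintegralD.
under eq_Rintegral do rewrite ImD.
exact: RintegralD.
Qed.

Lemma cintZ a b (k : C) h : cintegrable a b h ->
  cint (fun x => k * h x) a b = k * cint h a b.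
Proof.
move=> [a1 a2]; rewrite /cint; apply/eqP; rewrite eq_complex ReZ ImZ /=; apply/andP; split; apply/eqP.
  under eq_Rintegral do rewrite ReZ.
  rewrite RintegralB ?RintegralZl//; exact: integrableZ'.
under eq_Rintegral do rewrite ImZ.
rewrite RintegralD ?RintegralZl//; exact: integrableZ'.
Qed.

Lemma eq_cint a b h1 h2 : (forall x, a <= x <= b -> h1 x = h2 x) -> cint h1 a b = cint h2 a b.
Proof.
by move=> e; rewrite /cint; congr (_ +i* _); apply: eq_Rintegral => x;
  rewrite inE /= in_itv /= => /e ->.
Qed.

Lemma cintegrable_cst a b (k : C) : cintegrable a b (cst k).
Proof.
have H (r : R) : mu.-integrable `[a, b] (EFin \o (cst r : R -> R)).
  apply: (@continuous_compact_integrable R (cst r)); first exact: segment_compact.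
  by move=> x; exact: cst_continuous.
by split; exact: H.
Qed.

Lemma cint_cst a b (k : C) : a <= b -> cint (cst k) a b = k * (b - a)%:C.
Proof.
move=> ab; rewrite /cint; apply/eqP; rewrite eq_complex ReZ ImZ /= !mulr0 subr0 add0r.
by rewrite !Rintegral_cst//= lebesgue_measure_itv /= lte_fin; case: ltgtP ab => //= [_ _|-> _];
  rewrite ?subrr ?mulr0 !eqxx.
Qed.

Lemma cint_split a c b h : a <= c -> c <= b -> cintegrable a b h ->
  cint h a b = cint h a c + cint h c b.
Proof.
move=> ac cb [a1 a2]; rewrite /cint; apply/eqP; rewrite eq_complex /=.
have sub : `]c, b]%classic `<=` `[a, b]%classic.
  move=> x /=; rewrite !in_itv /= => /andP[cx ->]; rewrite andbT.
  exact: le_trans ac (ltW cx).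
have key (f : R -> R) : mu.-integrable `[a, b] (EFin \o f) ->
    \int[mu]_(x in `[a, b]) f x = \int[mu]_(x in `[a, c]) f x + \int[mu]_(x in `[c, b]) f x.
  move=> fi; rewrite -(@Rintegral_itv_obnd_cbnd _ c); last exact: integrableS fi.
  by rewrite -(@Rintegral_itvB _ _ _ _ c fi) ?bnd_simp// addrC subrK.
by rewrite !key// !eqxx.
Qed.

Lemma Rint_bound a b (f : R -> R) (M : R) : a <= b -> mu.-integrable `[a, b] (EFin \o f) ->
  (forall x, a <= x <= b -> `|f x| <= M) -> `|\int[mu]_(x in `[a, b]) f x| <= M * (b - a).
Proof.
move=> ab fi fM; apply: (le_trans (le_normr_Rintegral _ fi)) => //.
have -> : M * (b - a) = \int[mu]_(x in `[a, b]) (cst M x).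
  rewrite Rintegral_cst//= lebesgue_measure_itv /= lte_fin.
  by case: ltgtP ab => //= -> _; rewrite subrr mulr0.
have ci := (cintegrable_cst a b (M%:C)).1.
apply: le_Rintegral => //; first exact: (integrable_abse fi).
Qed.

(** Real and imaginary parts are bounded separately, which costs the factor 2; later estimates
    depend only on the order of magnitude. *)
Lemma cint_bound a b h (M : R) : a <= b -> cintegrable a b h ->
  (forall x, a <= x <= b -> `|h x| <= M%:C) -> `|cint h a b| <= (2 * M * (b - a))%:C.
Proof.
move=> ab [h1 h2] hM; apply: (le_trans (normc_le_ReIm _)).
rewrite lecR /= -mulrA mulrDl mul1r lerD// Rint_bound// => x xab; rewrite -lecR.
  exact: le_trans (normc_ge_Re _) (hM _ xab).
exact: le_trans (normc_ge_Im _) (hM _ xab).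
Qed.

Lemma near_dist (K : numFieldType) (V : normedModType K) (z : V) (e : K) : 0 < e ->
  \forall w \near z, `|z - w| < e.
Proof. by move=> e0; apply/nbhs_normP; exists e. Qed.

Lemma Re_continuous : continuous (ReC : C -> R).
Proof.
move=> z; apply/(@cvgrPdist_lt _ _ _ (nbhs z) (nbhs_filter z)) => e e0.
have e0' : (0 : C) < e%:C by rewrite ltcR.
apply: (@filterS _ (nbhs z) _ _ _ _ (near_dist z e0')) => w zw; rewrite -ltcR -raddfB.
exact: le_lt_trans (normc_ge_Re _) zw.
Qed.

Lemma Im_continuous : continuous (ImC : C -> R).
Proof.
move=> z; apply/(@cvgrPdist_lt _ _ _ (nbhs z) (nbhs_filter z)) => e e0.
have e0' : (0 : C) < e%:C by rewrite ltcR.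
apply: (@filterS _ (nbhs z) _ _ _ _ (near_dist z e0')) => w zw; rewrite -ltcR -raddfB.
exact: le_lt_trans (normc_ge_Im _) zw.
Qed.

Lemma RtoC_continuous : continuous (fun x : R => x%:C : C).
Proof.
move=> z; apply/(@cvgrPdist_lt _ _ _ (nbhs z) (nbhs_filter z)) => e e0.
have e0' : 0 < ReC e by move: e0; rewrite ltcE => /andP[].
have ee : e = (ReC e)%:C.
  by move: e0; rewrite ltcE /= => /andP[/eqP H _]; case: e H {e0'} => ? ? /= ->.
apply: (@filterS _ (nbhs z) _ _ _ _ (near_dist z e0')) => w zw.
by rewrite -raddfB /= normc_def /= expr0n /= addr0 sqrtr_sqr ee ltcR.
Qed.

Lemma cintegrable_continuous a b h :
  (forall x, a <= x <= b -> {for x, continuous h}) -> cintegrable a b h.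
Proof.
move=> hc; split; apply: (@continuous_compact_integrable R); try exact: segment_compact;
 apply: continuous_in_subspaceT => x; rewrite inE /= in_itv /= => /hc hx.
  by apply: continuous_comp hx _; exact: Re_continuous.
by apply: continuous_comp hx _; exact: Im_continuous.
Qed.

End ComplexIntegral.

(** * Goursat's theorem for rectangles *)

Section Goursat.
Variable R : realType.
Local Notation C := R[i].
Local Notation ReC := (@complex.Re R).
Local Notation ImC := (@complex.Im R).
Local Notation ii := (0 +i* 1 : C).
Implicit Types (u v : C -> C) (a b c d : R) (z w : C).

Lemma complexE (x y : R) : x +i* y = x%:C + ii * y%:C.
Proof. by apply/eqP; rewrite eq_complex /=; apply/andP; split; apply/eqP; ring. Qed.

Lemma horizontal_continuous (y : R) : continuous (fun x : R => x +i* y).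
Proof.
move=> x.
have -> : (fun x : R => x +i* y) = (fun x : R => x%:C + (0 +i* y)).
  by apply/funext => s; apply/eqP; rewrite eq_complex /= addr0 add0r !eqxx.
apply: cvgD; first exact: RtoC_continuous.
exact: cvg_cst.
Qed.

Lemma vertical_continuous (x : R) : continuous (fun y : R => x +i* y).
Proof.
move=> y.
have -> : (fun y : R => x +i* y) = (fun y : R => ii * y%:C + x%:C).
  by apply/funext => s; rewrite complexE addrC.
apply: cvgD; last exact: cvg_cst.
apply: cvgM; first exact: cvg_cst.
exact: RtoC_continuous.
Qed.

(** The contour integral of [u] along the boundary of [a, b] x [c, d], counterclockwise. *)
Definition rint u a b c d : C :=
  cint (fun x => u (x +i* c)) a b - cint (fun x => u (x +i* d)) a b
  + ii * (cint (fun y => u (b +i* y)) c d - cint (fun y => u (a +i* y)) c d).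

Definition edge a b c d w := (exists2 x, a <= x <= b & w = x +i* c \/ w = x +i* d)
  \/ (exists2 y, c <= y <= d & w = a +i* y \/ w = b +i* y).

Definition edge_continuous u a b c d := forall w, edge a b c d w -> {for w, continuous u}.

Lemma edge_cintegrable u a b c d : edge_continuous u a b c d ->
  [/\ cintegrable a b (fun x => u (x +i* c)), cintegrable a b (fun x => u (x +i* d)),
      cintegrable c d (fun y => u (a +i* y)) & cintegrable c d (fun y => u (b +i* y))].
Proof.
move=> uc; split; apply: cintegrable_continuous => x xab.
- apply: (@continuous_comp _ _ _ (fun x : R => x +i* c) u); first exact: horizontal_continuous.
  by apply: uc; left; exists x => //; left.
- apply: (@continuous_comp _ _ _ (fun x : R => x +i* d) u); first exact: horizontal_continuous.
  by apply: uc; left; exists x => //; right.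
- apply: (@continuous_comp _ _ _ (fun x : R => a +i* x) u); first exact: vertical_continuous.
  by apply: uc; right; exists x => //; left.
- apply: (@continuous_comp _ _ _ (fun x : R => b +i* x) u); first exact: vertical_continuous.
  by apply: uc; right; exists x => //; right.
Qed.

Lemma eq_rint u v a b c d : (forall w, edge a b c d w -> u w = v w) -> rint u a b c d = rint v a b c d.
Proof.
move=> e; rewrite /rint; congr (_ - _ + _ * (_ - _)); apply: eq_cint => x xab; apply: e.
- by left; exists x => //; left.
- by left; exists x => //; right.
- by right; exists x => //; right.
- by right; exists x => //; left.
Qed.

Lemma rintD u v a b c d : edge_continuous u a b c d -> edge_continuous v a b c d ->
  rint (fun w => u w + v w) a b c d = rint u a b c d + rint v a b c d.
Proof.
move=> /edge_cintegrable[u1 u2 u3 u4] /edge_cintegrable[v1 v2 v3 v4].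
rewrite /rint !cintD//; ring.
Qed.

Lemma rintZ (k : C) u a b c d : edge_continuous u a b c d ->
  rint (fun w => k * u w) a b c d = k * rint u a b c d.
Proof.
move=> /edge_cintegrable[u1 u2 u3 u4]; rewrite /rint !cintZ//; ring.
Qed.

Lemma rint_cst (k : C) a b c d : rint (cst k) a b c d = 0.
Proof. by rewrite /rint /= !subrr mulr0 addr0. Qed.

(** Opposite edges differ by a constant translation, so the horizontal pair contributes -i (d - c)(b
    - a) and the vertical pair the opposite. *)
Lemma rint_id a b c d : a <= b -> c <= d -> rint id a b c d = 0.
Proof.
move=> ab cd; rewrite /rint /=.
have H y : cintegrable a b (fun x : R => x +i* y).
  by apply: cintegrable_continuous => x _; exact: horizontal_continuous.
have V x : cintegrable c d (fun y : R => x +i* y).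
  by apply: cintegrable_continuous => y _; exact: vertical_continuous.
have -> : cint (fun x => x +i* d) a b = cint (fun x => x +i* c) a b + ii * (d - c)%:C * (b - a)%:C.
  rewrite -cint_cst// -cintD//; last exact: cintegrable_cst.
  by apply: eq_cint => x _ /=; rewrite (complexE x d) (complexE x c) rmorphB/=; ring.
have -> : cint (fun y => b +i* y) c d = cint (fun y => a +i* y) c d + (b - a)%:C * (d - c)%:C.
  rewrite -cint_cst// -cintD//; last exact: cintegrable_cst.
  by apply: eq_cint => x _ /=; rewrite (complexE b x) (complexE a x) rmorphB/=; ring.
by ring.
Qed.

Lemma rint_affine (k0 k1 : C) a b c d : a <= b -> c <= d ->
  rint (fun w => k0 + k1 * w) a b c d = 0.
Proof.
move=> ab cd.
have ci : edge_continuous id a b c d by move=> w _; exact: cvg_id.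
rewrite (rintD (u := cst k0)).
- by rewrite rint_cst rintZ// rint_id// mulr0 addr0.
- by move=> w _; exact: cst_continuous.
- by move=> w _; apply: (@continuousM _ _ (cst k1) id w); [exact: cst_continuous|exact: cvg_id].
Qed.

Lemma rint_bound u a b c d (M : R) : a <= b -> c <= d -> edge_continuous u a b c d ->
  (forall w, edge a b c d w -> `|u w| <= M%:C) ->
  `|rint u a b c d| <= (4 * M * ((b - a) + (d - c)))%:C.
Proof.
move=> ab cd /edge_cintegrable[u1 u2 u3 u4] uM; rewrite /rint.
have b1 := cint_bound ab u1 (fun x h => uM _ (or_introl (ex_intro2 _ _ x h (or_introl erefl)))).
have b2 := cint_bound ab u2 (fun x h => uM _ (or_introl (ex_intro2 _ _ x h (or_intror erefl)))).
have b3 := cint_bound cd u3 (fun x h => uM _ (or_intror (ex_intro2 _ _ x h (or_introl erefl)))).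
have b4 := cint_bound cd u4 (fun x h => uM _ (or_intror (ex_intro2 _ _ x h (or_intror erefl)))).
apply: (le_trans (ler_normD _ _)); rewrite normrM.
have -> : `|ii| = 1 :> C by rewrite normc_def /= expr0n expr1n add0r sqrtr1.
rewrite mul1r.
apply: (le_trans (lerD (ler_normB _ _) (ler_normB _ _))).
apply: (le_trans (lerD (lerD b1 b2) (lerD b4 b3))).
by rewrite -!rmorphD/= lecR le_eqVlt; apply/orP; left; apply/eqP; ring.
Qed.

Definition cts u a b c d := forall x y, a <= x <= b -> c <= y <= d -> {for (x +i* y), continuous u}.

Lemma cts_edge u a b c d : a <= b -> c <= d -> cts u a b c d -> edge_continuous u a b c d.
Proof.
move=> ab cd uc w [[x xab]|[y ycd]] [->|->]; apply: uc; rewrite ?lexx ?ab ?cd//.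
Qed.

Lemma rint_splitx u a m b c d : a <= m <= b -> c <= d -> cts u a b c d ->
  rint u a b c d = rint u a m c d + rint u m b c d.
Proof.
move=> /andP[am mb] cd /(cts_edge (le_trans am mb) cd)/edge_cintegrable[u1 u2 u3 u4].
by rewrite /rint (cint_split am mb u1) (cint_split am mb u2); ring.
Qed.

Lemma rint_splity u a b c m d : a <= b -> c <= m <= d -> cts u a b c d ->
  rint u a b c d = rint u a b c m + rint u a b m d.
Proof.
move=> ab /andP[cm md] /(cts_edge ab (le_trans cm md))/edge_cintegrable[u1 u2 u3 u4].
by rewrite /rint (cint_split cm md u3) (cint_split cm md u4); ring.
Qed.

Lemma ctsS u a b c d a' b' c' d' : a <= a' -> b' <= b -> c <= c' -> d' <= d ->
  cts u a b c d -> cts u a' b' c' d'.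
Proof.
move=> aa bb cc dd uc x y /andP[x1 x2] /andP[y1 y2]; apply: uc.
  by rewrite (le_trans aa x1) (le_trans x2 bb).
by rewrite (le_trans cc y1) (le_trans y2 dd).
Qed.

(** The norm of [C] takes its values in [C]; its real part lets the order lemmas on R and [lra]
    apply. *)
Definition nrm (z : C) : R := ReC `|z|.

Lemma nrmE z : `|z| = (nrm z)%:C.
Proof. by rewrite /nrm normc_def. Qed.

Lemma nrm_ge0 z : 0 <= nrm z.
Proof. by rewrite -lecR -nrmE; exact: (normr_ge0 z). Qed.

Lemma le_nrmD w z : nrm (w + z) <= nrm w + nrm z.
Proof. by rewrite -lecR rmorphD/= -!nrmE ler_normD. Qed.

Lemma nrm0_eq0 z : nrm z = 0 -> z = 0.
Proof. by move=> h; apply/eqP; rewrite -normr_eq0 nrmE h. Qed.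

Lemma nested_intervals (s t : nat -> R) : (forall n, s n <= s n.+1) -> (forall n, t n.+1 <= t n) ->
  (forall n, s n <= t n) -> exists x, forall n, s n <= x <= t n.
Proof.
move=> s1 t1 st.
have smono n k : s n <= s (n + k)%N.
  by elim: k => [|k IH]; rewrite ?addn0// addnS (le_trans IH).
have tmono n k : t (n + k)%N <= t n.
  by elim: k => [|k IH]; rewrite ?addn0// addnS (le_trans _ IH).
have stmn m n : s m <= t n.
  apply: (le_trans (smono m n)); apply: (le_trans (st _)); by rewrite addnC tmono.
have hs : has_sup (range s).
  split; first by exists (s 0%N); exists 0%N.
  by exists (t 0%N) => _ [m _ <-].
exists (sup (range s)) => n; apply/andP; split.
  by apply: ub_le_sup; [case: hs|exists n].
apply: ge_sup; first by exists (s 0%N); exists 0%N.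
by move=> _ [m _ <-].
Qed.

(** The expansion form involves no quotient and includes w = z, so it can be integrated along a
    contour as it stands. *)
Lemma derivable_expand u z : derivable u z 1 -> exists k : C, forall e : R, 0 < e ->
  exists2 dl : R, 0 < dl & forall w, nrm (w - z) < dl -> nrm (u w - u z - k * (w - z)) <= e * nrm (w - z).
Proof.
move=> /cvg_ex[/= k /cvgrPdist_le duz]; exists k => e e0.
have /duz : (0 : C) < e%:C by rewrite ltcR.
rewrite /dnbhs /within => /nbhs_normP[dl /= dl0 H].
have dlE : dl = (ReC dl)%:C.
  by move: dl0; rewrite ltcE /= => /andP[/eqP E _]; case: dl E {H} => ? ? /= ->.
exists (ReC dl); first by rewrite -ltcR -dlE.
move=> w wz; have [->|wz0] := eqVneq w z.
  by rewrite !subrr mulr0 subr0 /nrm normr0 mulr0.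
have := H (w - z); rewrite /ball_ /= sub0r normrN nrmE dlE ltcR subr_eq0 => /(_ wz wz0).
rewrite -lecR rmorphM/= -!nrmE /GRing.scale /= mulr1 subrK => E.
have -> : u w - u z - k * (w - z) = - (k - (w - z)^-1 * (u w - u z)) * (w - z).
  by field; rewrite subr_eq0.
by rewrite normrM normrN ler_wpM2r.
Qed.

Lemma rint_quarter u x y l k : 0 <= l -> 0 <= k -> cts u x (x + (l + l)) y (y + (k + k)) ->
  nrm (rint u x (x + (l + l)) y (y + (k + k))) <=
    nrm (rint u x (x + l) y (y + k)) + nrm (rint u x (x + l) (y + k) (y + k + k)) +
    (nrm (rint u (x + l) (x + l + l) y (y + k)) + nrm (rint u (x + l) (x + l + l) (y + k) (y + k + k))).
Proof.
move=> l0 k0; rewrite (addrA x) (addrA y) => uc.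
have xl : x <= x + l <= x + l + l by rewrite !lerDl l0.
have yk : y <= y + k <= y + k + k by rewrite !lerDl k0.
have [[x1 x2] [y1 y2]] := (andP xl, andP yk).
rewrite (@rint_splitx u x (x + l))//; last exact: le_trans y1 y2.
rewrite (@rint_splity u x _ y (y + k))//; last exact: ctsS uc.
rewrite (@rint_splity u (x + l) _ y (y + k))//; last exact: ctsS uc.
by apply: (le_trans (le_nrmD _ _)); apply: lerD; exact: le_nrmD.
Qed.

(** Bisection: some quarter keeps at least a fourth of the modulus, so the n-th rectangle carries at
    least e0 / 4^n. Differentiability at the common point of the rectangles bounds the same quantity
    by a smaller multiple of 4^-n. *)
Lemma goursat u a b c d : a <= b -> c <= d ->
  (forall x y, a <= x <= b -> c <= y <= d -> derivable u (x +i* y) 1) -> rint u a b c d = 0.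
Proof.
move=> ab cd du.
have uc : cts u a b c d.
  by move=> x y xab ycd; apply: differentiable_continuous; apply/derivable1_diffP; exact: du.
apply: nrm0_eq0; apply/eqP; apply: contraT => E0.
have {}E0 : 0 < nrm (rint u a b c d) by rewrite lt_def E0 nrm_ge0.
have [e0 e0E] : exists e0, e0 = nrm (rint u a b c d) by eexists.
rewrite -e0E in E0.
(* The existential hides the definition of [L] and [K], so that [lra] treats the side lengths as
   atoms. *)
have [L LE] : exists L : nat -> R, forall n, L n = (b - a) / 2 ^+ n by exists (fun n => (b - a) / 2 ^+ n).
have [K KE] : exists K : nat -> R, forall n, K n = (d - c) / 2 ^+ n by exists (fun n => (d - c) / 2 ^+ n).
have L0 n : 0 <= L n by rewrite LE divr_ge0 ?subr_ge0// exprn_ge0.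
have K0 n : 0 <= K n by rewrite KE divr_ge0 ?subr_ge0// exprn_ge0.
have LS n : L n = L n.+1 + L n.+1.
  by rewrite !LE exprS; field; rewrite expf_eq0 /= pnatr_eq0 andbF.
have KS n : K n = K n.+1 + K n.+1.
  by rewrite !KE exprS; field; rewrite expf_eq0 /= pnatr_eq0 andbF.
pose N n (p : R * R) := nrm (rint u p.1 (p.1 + L n) p.2 (p.2 + K n)).
pose inside n (p : R * R) := [/\ a <= p.1, p.1 + L n <= b, c <= p.2 & p.2 + K n <= d].
(* The premise [inside n p] makes the successor total, as [choice] demands: a corner outside the
   rectangle gets an arbitrary one. *)
pose Q n (p q : R * R) := inside n p -> [/\ inside n.+1 q, p.1 <= q.1, q.1 + L n.+1 <= p.1 + L n,
   p.2 <= q.2 & q.2 + K n.+1 <= p.2 + K n] /\ N n p <= 4 * N n.+1 q.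
have step (np : nat * (R * R)) : exists q, Q np.1 np.2 q.
  case: np => n [x y]; rewrite /Q /=.
  have [ins|?] := pselect (inside n (x, y)); last by exists (x, y).
  have [/= i1 i2 i3 i4] := ins.
  have [l1 k1] := (L0 n.+1, K0 n.+1); have [l2 k2] := (LS n, KS n).
  have uc' : cts u x (x + L n) y (y + K n) by apply: ctsS uc.
  rewrite l2 k2 in uc' i2 i4.
  have := rint_quarter l1 k1 uc'; rewrite -l2 -k2 -/(N n (x, y)).
  rewrite -/(N n.+1 (x, y)) -/(N n.+1 (x, y + K n.+1)) -/(N n.+1 (x + L n.+1, y))
    -/(N n.+1 (x + L n.+1, y + K n.+1)).
  have sub q1 q2 : q1 = x \/ q1 = x + L n.+1 -> q2 = y \/ q2 = y + K n.+1 ->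
     [/\ inside n.+1 (q1, q2), x <= q1, q1 + L n.+1 <= x + L n, y <= q2 & q2 + K n.+1 <= y + K n].
    rewrite /inside /= l2 k2; move: (L n.+1) (K n.+1) l1 k1 i1 i2 i3 i4 => l k.
    by clear; move=> l1 k1 i1 i2 i3 i4 [->|->] [->|->]; do ?split; lra.
  have [h1 _|h1] := lerP (N n (x, y)) (4 * N n.+1 (x, y)).
    by exists (x, y) => _; split => //; apply: sub; [left|left].
  have [h2 _|h2] := lerP (N n (x, y)) (4 * N n.+1 (x, y + K n.+1)).
    by exists (x, y + K n.+1) => _; split => //; apply: sub; [left|right].
  have [h3 _|h3] := lerP (N n (x, y)) (4 * N n.+1 (x + L n.+1, y)).
    by exists (x + L n.+1, y) => _; split => //; apply: sub; [right|left].
  have [h4 _|h4] := lerP (N n (x, y)) (4 * N n.+1 (x + L n.+1, y + K n.+1)).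
    by exists (x + L n.+1, y + K n.+1) => _; split => //; apply: sub; [right|right].
  move: (N n (x, y)) (N n.+1 (x, y)) (N n.+1 (x, y + K n.+1)) (N n.+1 (x + L n.+1, y))
    (N n.+1 (x + L n.+1, y + K n.+1)) h1 h2 h3 h4; clear.
  by move=> m m1 m2 m3 m4 h1 h2 h3 h4 h; lra.
have {step}[f fP] := choice step.
pose fix p n := if n is m.+1 then f (m, p m) else (a, c).
have pin n : inside n (p n).
  elim: n => [|n IH]; last by have [] := fP (n, p n) IH => -[].
  by rewrite /inside /= LE KE expr0 !divr1; clear -ab cd; split; lra.
have pN n : e0 <= 4 ^+ n * N n (p n).
  elim: n => [|n IH].
    by rewrite mul1r /N /= LE KE expr0 !divr1 !(addrC _ (_ - _)) !subrK e0E.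
  have [_ h] := fP (n, p n) (pin n); apply: (le_trans IH).
  by rewrite exprSr -mulrA ler_wpM2l ?exprn_ge0.
have [X XP] : exists X, forall n, (p n).1 <= X <= (p n).1 + L n.
  apply: (@nested_intervals (fun n => (p n).1) (fun n => (p n).1 + L n)) => n; last by rewrite lerDl.
    by have [[]] := fP (n, p n) (pin n).
  by have [[]] := fP (n, p n) (pin n).
have [Y YP] : exists Y, forall n, (p n).2 <= Y <= (p n).2 + K n.
  apply: (@nested_intervals (fun n => (p n).2) (fun n => (p n).2 + K n)) => n; last by rewrite lerDl.
    by have [[]] := fP (n, p n) (pin n).
  by have [[]] := fP (n, p n) (pin n).
have [k kP] : exists k : C, forall e : R, 0 < e ->
  exists2 dl : R, 0 < dl & forall w, nrm (w - (X +i* Y)) < dl ->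
    nrm (u w - u (X +i* Y) - k * (w - (X +i* Y))) <= e * nrm (w - (X +i* Y)).
  apply: derivable_expand; apply: du.
    by move: (XP 0%N); rewrite /= LE expr0 divr1 addrC subrK.
  by move: (YP 0%N); rewrite /= KE expr0 divr1 addrC subrK.
pose S := (b - a) + (d - c).
have S0 : 0 <= S by rewrite addr_ge0// subr_ge0.
have SS0 : 0 < 4 * S ^+ 2 + 1 by rewrite ltr_wpDl// mulr_ge0// sqr_ge0.
(* With this error rate the final bound is e0 * 4 S^2 / (4 S^2 + 1) < e0; the summand 1 also covers
   S = 0. *)
have e1 : 0 < e0 / (4 * S ^+ 2 + 1) by rewrite divr_gt0.
have [dl dl0 dlP] := kP _ e1.
have [n nP] : exists n, S / 2 ^+ n < dl.
  exists (Num.truncn (S / dl)).+1; rewrite ltr_pdivrMr ?exprn_gt0// mulrC -ltr_pdivrMr//.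
  apply: (lt_le_trans (truncnS_gt _)); rewrite -natrX ler_nat; exact/ltnW/ltn_expl.
have [i1 i2 i3 i4] := pin n.
have [l0 kk0] := (L0 n, K0 n).
have LKS : L n + K n = S / 2 ^+ n by rewrite LE KE -mulrDl.
set z := X +i* Y in dlP.
have near w : edge (p n).1 ((p n).1 + L n) (p n).2 ((p n).2 + K n) w -> nrm (w - z) <= S / 2 ^+ n.
  move=> ew; rewrite -LKS -lecR -nrmE; apply: (le_trans (normc_le_ReIm _)); rewrite lecR.
  have [X1 Y1] := (XP n, YP n); move: (p n).1 (p n).2 (L n) (K n) X1 Y1 l0 kk0 ew; clear.
  move=> p q l k X1 Y1 l0 k0 ew.
  by apply: lerD; case: ew => -[x xb [->|->]] /=; rewrite ler_norml; lra.
have uc1 : cts u (p n).1 ((p n).1 + L n) (p n).2 ((p n).2 + K n) by apply: ctsS uc.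
have [al ck] : (p n).1 <= (p n).1 + L n /\ (p n).2 <= (p n).2 + K n by rewrite !lerDl.
have ue := cts_edge al ck uc1.
have ae : edge_continuous (fun w => - (u z - k * z) + (- k) * w) (p n).1 ((p n).1 + L n) (p n).2 ((p n).2 + K n).
  move=> w _; apply: (@continuousD _ _ _ (cst _) (fun w => - k * w)); first exact: cst_continuous.
  by apply: (@continuousM _ _ (cst (- k)) id); [exact: cst_continuous|exact: cvg_id].
(* Affine functions integrate to zero, so only the error of the expansion at [z] contributes to the
   integral. *)
have Eaff : rint u (p n).1 ((p n).1 + L n) (p n).2 ((p n).2 + K n) =
   rint (fun w => u w + (- (u z - k * z) + (- k) * w)) (p n).1 ((p n).1 + L n) (p n).2 ((p n).2 + K n).
  by rewrite rintD// rint_affine// addr0.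
have : N n (p n) <= 4 * (e0 / (4 * S ^+ 2 + 1) * (S / 2 ^+ n)) * (S / 2 ^+ n).
  have [M ME] : exists M, M = e0 / (4 * S ^+ 2 + 1) * (S / 2 ^+ n) by eexists.
  rewrite /N Eaff -lecR -nrmE -ME.
  have -> : S / 2 ^+ n = ((p n).1 + L n - (p n).1) + ((p n).2 + K n - (p n).2).
    by rewrite -LKS; ring.
  apply: rint_bound; [exact: al|exact: ck| | ].
    by move=> w ew; apply: continuousD; [exact: ue|exact: ae].
  move=> w ew; rewrite nrmE lecR.
  have -> : u w + (- (u z - k * z) + - k * w) = u w - u z - k * (w - z) by ring.
  have wn := near _ ew.
  apply: (le_trans (dlP _ (le_lt_trans wn nP))); rewrite ME ler_wpM2l ?(ltW e1)//.
move=> /(ler_wpM2l (exprn_ge0 n (ler0n R 4))) /(le_trans (pN n)).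
have -> : 4 ^+ n * (4 * (e0 / (4 * S ^+ 2 + 1) * (S / 2 ^+ n)) * (S / 2 ^+ n)) =
    e0 * (4 * S ^+ 2 / (4 * S ^+ 2 + 1)) :> R.
  have -> : 4 ^+ n = 2 ^+ n * 2 ^+ n :> R by rewrite -exprMn; congr (_ ^+ _); ring.
  by field; rewrite expf_eq0 pnatr_eq0 andbF /= (gt_eqF SS0).
rewrite ler_pMr// ler_pdivlMr// mul1r.
by rewrite gerDl ler10.
Qed.

End Goursat.

(** * Real-valued modulus, neighbourhoods, Goursat with an exceptional point *)

Section Cauchy.
Variable R : realType.
Local Notation C := R[i].
Local Notation mu := (@lebesgue_measure R).
Local Notation ReC := (@complex.Re R).
Local Notation ImC := (@complex.Im R).
Local Notation ii := (0 +i* 1 : C).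
Implicit Types (u v : C -> C) (a b c d : R) (z w : C).

Lemma nrmM w z : nrm (w * z) = nrm w * nrm z.
Proof. by apply: complexI; rewrite rmorphM/= -!nrmE normrM. Qed.

Lemma nrmX w n : nrm (w ^+ n) = nrm w ^+ n.
Proof. by apply: complexI; rewrite rmorphXn/= -!nrmE normrX. Qed.

Lemma nrmV w : nrm w^-1 = (nrm w)^-1.
Proof. by apply: complexI; rewrite fmorphV/= -!nrmE normfV. Qed.

Lemma nrmN w : nrm (- w) = nrm w.
Proof. by rewrite /nrm normrN. Qed.

Lemma nrm0 : nrm (0 : C) = 0.
Proof. by rewrite /nrm normr0. Qed.

Lemma nrm1 : nrm (1 : C) = 1.
Proof. by rewrite /nrm normr1. Qed.

Lemma nrm_distC w z : nrm (w - z) = nrm (z - w).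
Proof. by rewrite /nrm distrC. Qed.

Lemma nrm_eq0 z : (nrm z == 0) = (z == 0).
Proof. by apply/eqP/eqP => [/nrm0_eq0//|->]; rewrite nrm0. Qed.

Lemma nrm_gt0 z : (0 < nrm z) = (z != 0).
Proof. by rewrite lt_def nrm_ge0 andbT nrm_eq0. Qed.

Lemma nrm_triangle x y z : nrm (x - z) <= nrm (x - y) + nrm (y - z).
Proof. by apply: le_trans (le_nrmD _ _); rewrite addrA subrK. Qed.

Lemma nrm_ge_Re z : `|ReC z| <= nrm z.
Proof. by rewrite -lecR -nrmE normc_ge_Re. Qed.

Lemma nrm_ge_Im z : `|ImC z| <= nrm z.
Proof. by rewrite -lecR -nrmE normc_ge_Im. Qed.

Lemma nrm_le_ReIm z : nrm z <= `|ReC z| + `|ImC z|.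
Proof. by rewrite -lecR -nrmE normc_le_ReIm. Qed.

Lemma near_nrm z (r : R) : 0 < r -> \forall w \near z, nrm (w - z) < r.
Proof.
move=> r0; have r0' : (0 : C) < r%:C by rewrite ltcR.
apply: (@filterS _ (nbhs z) _ _ _ _ (near_dist z r0')) => w.
by rewrite distrC nrmE ltcR.
Qed.

Lemma nearP z (P : C -> Prop) : (\forall w \near z, P w) <->
  exists2 r : R, 0 < r & forall w, nrm (w - z) < r -> P w.
Proof.
split=> [/nbhs_normP[dl /= dl0 H]|[r r0 H]].
  have dlE : dl = (ReC dl)%:C.
    by move: dl0; rewrite ltcE /= => /andP[/eqP E _]; case: dl E {H} => ? ? /= ->.
  exists (ReC dl); first by rewrite -ltcR -dlE.
  by move=> w wz; apply: H; rewrite /= distrC nrmE dlE ltcR.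
exact: (@filterS _ (nbhs z) _ _ _ _ (near_nrm z r0)).
Qed.

Lemma continuous_nrmP u z : {for z, continuous u} <->
  (forall e : R, 0 < e -> exists2 dl : R, 0 < dl & forall w, nrm (w - z) < dl -> nrm (u w - u z) <= e).
Proof.
split=> [|H].
  move=> /cvgrPdist_le uz e e0; have /uz/nearP[dl dl0 H] : (0 : C) < e%:C by rewrite ltcR.
  by exists dl => // w /H; rewrite distrC nrmE lecR.
apply/(@cvgrPdist_le _ _ _ (nbhs z) (nbhs_filter z)) => e e0.
have eE : e = (ReC e)%:C.
  by move: e0; rewrite ltcE /= => /andP[/eqP E _]; case: e E => ? ? /= ->.
have [|dl dl0 dlP] := H (ReC e); first by rewrite -ltcR -eE.
by apply/nearP; exists dl => // w /dlP; rewrite distrC nrmE eE lecR.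
Qed.

Lemma derivable_expandP u z : derivable u z 1 <-> exists k : C, forall e : R, 0 < e ->
  exists2 dl : R, 0 < dl & forall w, nrm (w - z) < dl -> nrm (u w - u z - k * (w - z)) <= e * nrm (w - z).
Proof.
split=> [|[k H]]; first exact: derivable_expand.
apply/cvg_ex; exists k; apply/cvgrPdist_le => e e0.
have eE : e = (ReC e)%:C.
  by move: e0; rewrite ltcE /= => /andP[/eqP E _]; case: e E => ? ? /= ->.
have [|dl dl0 dlP] := H (ReC e); first by rewrite -ltcR -eE.
rewrite /dnbhs /within /=; apply/nearP; exists dl => // h; rewrite subr0 => hd h0.
have := dlP (h + z); rewrite addrK => /(_ hd) dh.
rewrite /GRing.scale /= mulr1 [leRHS]eE nrmE lecR.
have -> : k - h^-1 * (u (h + z) - u z) = - (u (h + z) - u z - k * h) / h by field.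
by rewrite nrmM nrmN nrmV ler_pdivrMr ?nrm_gt0.
Qed.

Lemma derivable_continuous u z : derivable u z 1 -> {for z, continuous u}.
Proof. by move=> /derivable1_diffP/differentiable_continuous. Qed.

(** Four strips around a small square centred at [z] integrate to zero by Goursat. On the square of
    half-side h continuity bounds [u] by M, so its contribution is at most 16 M h, which is
    arbitrarily small. *)
Lemma goursat_except u a b c d z : a < ReC z < b -> c < ImC z < d -> cts u a b c d ->
  (forall x y, a <= x <= b -> c <= y <= d -> x +i* y != z -> derivable u (x +i* y) 1) ->
  rint u a b c d = 0.
Proof.
move=> /andP[aX Xb] /andP[cY Yd] uc du; set X := ReC z in aX Xb; set Y := ImC z in cY Yd.
apply: nrm0_eq0; apply/eqP; rewrite eq_le nrm_ge0 andbT leNgt; apply/negP => E0.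
have zE : z = X +i* Y by rewrite /X /Y; case: (z).
have : {for z, continuous u} by rewrite zE; apply: uc; rewrite !ltW.
move=> /continuous_nrmP /(_ 1 ltr01)[dl dl0 dlP].
pose M := nrm (u z) + 1.
have M0 : 0 < M by rewrite ltr_wpDl// nrm_ge0.
have [h [h0 h1 h2 h3 [h4 h5 h6]]] : exists h : R, [/\ 0 < h, h <= X - a, h <= b - X, h <= Y - c &
    [/\ h <= d - Y, 2 * h < dl & 16 * M * h < nrm (rint u a b c d)]].
  near (0 : R)^'+ => h; exists h; split; try split.
  - by near: h; exact: nbhs_right_gt.
  - by near: h; apply: nbhs_right_le; rewrite subr_gt0.
  - by near: h; apply: nbhs_right_le; rewrite subr_gt0.
  - by near: h; apply: nbhs_right_le; rewrite subr_gt0.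
  - by near: h; apply: nbhs_right_le; rewrite subr_gt0.
  - rewrite mulrC -ltr_pdivlMr//; near: h; apply: nbhs_right_lt; exact: divr_gt0.
  - rewrite mulrC -ltr_pdivlMr ?mulr_gt0//; near: h; apply: nbhs_right_lt; rewrite divr_gt0// mulr_gt0//.
have [ab cd] : a <= b /\ c <= d by split; lra.
have ucs a' b' c' d' : a <= a' -> b' <= b -> c <= c' -> d' <= d -> cts u a' b' c' d'.
  by move=> ? ? ? ?; apply: ctsS uc.
have Z a' b' c' d' : a' <= b' -> c' <= d' -> a <= a' -> b' <= b -> c <= c' -> d' <= d ->
    [\/ b' < X, X < a', d' < Y | Y < c'] -> rint u a' b' c' d' = 0.
  move=> ab' cd' aa bb cc dd out; apply: goursat => // x y xab ycd; apply: du; [lra|lra|].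
  apply/negP => /eqP; rewrite zE => -[xX yY].
  by move: xab ycd; rewrite xX yY => ? ?; case: out => ?; lra.
have : nrm (rint u a b c d) = nrm (rint u (X - h) (X + h) (Y - h) (Y + h)).
  congr nrm; rewrite (@rint_splitx _ u a (X - h))//; last lra.
  rewrite (Z a)//; [|lra|lra|constructor 1; lra]; rewrite add0r.
  rewrite (@rint_splitx _ u _ (X + h))//; [|lra|by apply: ucs; lra].
  rewrite (Z (X + h))//; [|lra|lra|constructor 2; lra]; rewrite addr0.
  rewrite (@rint_splity _ u _ _ c (Y - h))//; [|lra|lra|by apply: ucs; lra].
  rewrite (Z _ _ c)//; [|lra|lra|lra|lra|lra|constructor 3; lra]; rewrite add0r.
  rewrite (@rint_splity _ u _ _ _ (Y + h))//; [|lra|lra|by apply: ucs; lra].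
  by rewrite (Z _ _ (Y + h))//; [rewrite addr0|lra|lra|lra|lra|lra|constructor 4; lra].
move=> E; move: h6; rewrite E ltNge => /negP; apply.
rewrite -lecR -nrmE.
have -> : 16 * M * h = 4 * M * ((X + h - (X - h)) + (Y + h - (Y - h))) by ring.
apply: rint_bound; [lra|lra|apply: cts_edge; [lra|lra|by apply: ucs; lra]|].
move=> w ew; rewrite nrmE lecR; have : nrm (w - z) <= 2 * h.
  apply: (le_trans (nrm_le_ReIm _)); rewrite zE mulrDl mul1r.
  move: ew; clear -h0 => ew; apply: lerD; case: ew => -[x xb [->|->]] /=; rewrite ler_norml; lra.
move=> /le_lt_trans/(_ h5)/dlP wz; rewrite /M -(subrK (u z) (u w)) addrC.
by apply: (le_trans (le_nrmD _ _)); rewrite lerD2l.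
Unshelve. all: by end_near. Qed.

Lemma Rint_ge a b (f : R -> R) (M : R) : a <= b -> mu.-integrable `[a, b] (EFin \o f) ->
  (forall x, a <= x <= b -> M <= f x) -> M * (b - a) <= \int[mu]_(x in `[a, b]) f x.
Proof.
move=> ab fi fM; have -> : M * (b - a) = \int[mu]_(x in `[a, b]) (cst M x).
  rewrite Rintegral_cst//= lebesgue_measure_itv /= lte_fin.
  by case: ltgtP ab => //= -> _; rewrite subrr mulr0.
apply: le_Rintegral => //.
exact: (cintegrable_cst a b (M%:C)).1.
Qed.

Lemma Rint_le a b (f : R -> R) (M : R) : a <= b -> mu.-integrable `[a, b] (EFin \o f) ->
  (forall x, a <= x <= b -> f x <= M) -> \int[mu]_(x in `[a, b]) f x <= M * (b - a).
Proof.
move=> ab fi fM; have -> : M * (b - a) = \int[mu]_(x in `[a, b]) (cst M x).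
  rewrite Rintegral_cst//= lebesgue_measure_itv /= lte_fin.
  by case: ltgtP ab => //= -> _; rewrite subrr mulr0.
apply: le_Rintegral => //.
exact: (cintegrable_cst a b (M%:C)).1.
Qed.

Lemma Re_inv z : ReC z^-1 = ReC z / (ReC z ^+ 2 + ImC z ^+ 2).
Proof. by case: z. Qed.

Lemma Im_inv z : ImC z^-1 = - ImC z / (ReC z ^+ 2 + ImC z ^+ 2).
Proof. by case: z => x y; rewrite mulNr. Qed.

End Cauchy.

(** * Flat holomorphic functions vanish *)

Section Flat.
Variable R : realType.
Local Notation C := R[i].
Local Notation mu := (@lebesgue_measure R).
Local Notation ReC := (@complex.Re R).
Local Notation ImC := (@complex.Im R).
Local Notation ii := (0 +i* 1 : C).
Implicit Types (u v : C -> C) (a b c d : R) (z w : C).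

Lemma edge_bounded u a b c d : a <= b -> c <= d -> edge_continuous u a b c d ->
  exists M, forall w, edge a b c d w -> nrm (u w) <= M.
Proof.
move=> ab cd uc.
have nc : continuous (@nrm R).
  move=> z; apply: (@continuous_comp _ _ _ (fun z : C => `|z| : C) ReC); last exact: Re_continuous.
  exact: norm_continuous.
have key (p : R -> C) (s t : R) : s <= t -> continuous p -> (forall x, s <= x <= t -> edge a b c d (p x)) ->
    exists M, forall x, s <= x <= t -> nrm (u (p x)) <= M.
  move=> st pc pe.
  have [|m _ mP] := @EVT_max _ (fun x => nrm (u (p x))) s t st.
    apply: continuous_in_subspaceT => x; rewrite inE /= in_itv /= => xst.
    apply: (@continuous_comp _ _ _ (fun x => u (p x)) (@nrm R)); last exact: nc.
    by apply: (@continuous_comp _ _ _ p u); [exact: pc|apply: uc; exact: pe].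
  by exists (nrm (u (p m))) => x xst; apply: mP; rewrite in_itv.
have [M1 h1] := key _ _ _ ab (@horizontal_continuous R c) (fun x h => or_introl (ex_intro2 _ _ x h (or_introl erefl))).
have [M2 h2] := key _ _ _ ab (@horizontal_continuous R d) (fun x h => or_introl (ex_intro2 _ _ x h (or_intror erefl))).
have [M3 h3] := key _ _ _ cd (@vertical_continuous R a) (fun x h => or_intror (ex_intro2 _ _ x h (or_introl erefl))).
have [M4 h4] := key _ _ _ cd (@vertical_continuous R b) (fun x h => or_intror (ex_intro2 _ _ x h (or_intror erefl))).
exists (Num.max (Num.max M1 M2) (Num.max M3 M4)) => w [[x xab]|[y ycd]] [->|->]; rewrite !le_max.
- by rewrite h1.
- by rewrite h2// orbT.
- by rewrite h3// !orbT.
- by rewrite h4// !orbT.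
Qed.

Lemma edge_neq a b c d z w : a < ReC z < b -> c < ImC z < d -> edge a b c d w -> w != z.
Proof.
move=> /andP[aX Xb] /andP[cY Yd]; case: z aX Xb cY Yd => X Y /= aX Xb cY Yd.
by case=> -[x xb [->|->]]; rewrite eq_complex /= negb_and ?(gt_eqF aX) ?(lt_eqF aX) ?(lt_eqF Xb) ?(gt_eqF Xb)
   ?(gt_eqF cY) ?(lt_eqF cY) ?(lt_eqF Yd) ?(gt_eqF Yd) ?orbT.
Qed.

Lemma inv_continuous_edge a b c d z : a < ReC z < b -> c < ImC z < d ->
  edge_continuous (fun w => (w - z)^-1) a b c d.
Proof.
move=> Xab Ycd w ew; apply: derivable_continuous; apply: derivableV; last first.
  by apply: derivableB; [exact: derivable_id|exact: derivable_cst].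
by rewrite subr_eq0; exact: edge_neq ew.
Qed.

(* All four edges contribute positively to the imaginary part: it is the angle
   under which the boundary is seen from z. *)
Lemma rint_inv_neq0 a b c d z : a < ReC z < b -> c < ImC z < d ->
  rint (fun w => (w - z)^-1) a b c d != 0.
Proof.
move=> Xab Ycd; have [e1 e2 e3 e4] := edge_cintegrable (inv_continuous_edge Xab Ycd).
move: Xab Ycd => /andP[aX Xb] /andP[cY Yd].
have zE : z = ReC z +i* ImC z by case: (z).
set X := ReC z in aX Xb zE; set Y := ImC z in cY Yd zE.
have [ab cd] : a <= b /\ c <= d by split; lra.
have ReE (s t : R) : ReC ((s +i* t) - z) = s - X by rewrite zE.
have ImE (s t : R) : ImC ((s +i* t) - z) = t - Y by rewrite zE.
apply/eqP => /(congr1 ImC); apply/eqP; rewrite gt_eqF//.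
pose D := (b - a) ^+ 2 + (d - c) ^+ 2.
have D0 : 0 < D by rewrite ltr_pwDr ?sqr_ge0// exprn_gt0//; lra.
have h1 : (Y - c) / D * (b - a) <= ImC (cint (fun x => ((x +i* c) - z)^-1) a b).
  apply: Rint_ge => //; first exact: e1.2.
  move=> x xab; rewrite Im_inv ReE ImE opprB.
  have Q0 : 0 < (x - X) ^+ 2 + (c - Y) ^+ 2.
    by rewrite ltr_wpDl ?sqr_ge0// lt_def sqr_ge0 sqrf_eq0 subr_eq0 (lt_eqF cY).
  rewrite ler_pdivrMr// mulrAC ler_pdivlMr//; rewrite ler_wpM2l//; first lra.
  apply: lerD; rewrite -[leLHS]real_normK ?num_real// -[leRHS]real_normK ?num_real// lerXn2r ?nnegrE//.
    by rewrite (ger0_norm (x := b - a)) ?subr_ge0// ler_norml; lra.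
  by rewrite (ger0_norm (x := d - c)) ?subr_ge0// ler_norml; lra.
have h2 : ImC (cint (fun x => ((x +i* d) - z)^-1) a b) <= 0 * (b - a).
  apply: Rint_le => //; first exact: e2.2.
  move=> x xab; rewrite Im_inv ReE ImE mulNr oppr_le0 divr_ge0 ?subr_ge0 ?(ltW Yd)//.
  by rewrite addr_ge0 ?sqr_ge0.
have h3 : 0 * (d - c) <= ReC (cint (fun y => ((b +i* y) - z)^-1) c d).
  apply: Rint_ge => //; first exact: e4.1.
  move=> x xab; rewrite Re_inv ReE ImE divr_ge0 ?subr_ge0 ?(ltW Xb)//.
  by rewrite addr_ge0 ?sqr_ge0.
have h4 : ReC (cint (fun y => ((a +i* y) - z)^-1) c d) <= 0 * (d - c).
  apply: Rint_le => //; first exact: e3.1.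
  move=> x xab; rewrite Re_inv ReE ImE -[leLHS]opprK -mulNr opprB oppr_le0 divr_ge0 ?subr_ge0 ?(ltW aX)//.
  by rewrite addr_ge0 ?sqr_ge0.
have p1 : 0 < (Y - c) / D * (b - a) by rewrite mulr_gt0 ?divr_gt0 ?subr_gt0//; lra.
rewrite /rint.
move: (cint _ _ _) (cint _ _ _) (cint _ _ _) (cint _ _ _) h1 h2 h3 h4.
move=> [r1 s1] [r2 s2] [r3 s3] [r4 s4] /= h1 h2 h3 h4; move: h1 h2 h3 h4 p1.
by move: ((Y - c) / D * (b - a)); clear; move=> m; rewrite !mul0r => *; lra.
Qed.

Lemma derivable_exprn u z n : derivable u z 1 -> derivable (fun w => u w ^+ n) z 1.
Proof.
move=> du; elim: n => [|n IH].
  exact: (@derivable_cst C C C 1).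
have -> : (fun w => u w ^+ n.+1) = (fun w => u w * u w ^+ n).
  by apply/funext => w; rewrite exprS.
exact: (derivableM du IH).
Qed.

(** Vanishing to infinite order, expressed by growth bounds instead of higher derivatives. *)
Definition flat_at u w0 := forall n : nat, exists M dl : R, 0 < dl /\
  forall w, nrm (w - w0) < dl -> nrm (u w) <= M * nrm (w - w0) ^+ n.

Lemma geometric_eq0 (s K : R) : 0 <= s -> (forall n, s <= K / 2 ^+ n.+1) -> s = 0.
Proof.
move=> s0 H; apply/eqP; rewrite eq_le s0 andbT leNgt; apply/negP => sp.
have [n nP] : exists n : nat, K / s < 2 ^+ n.+1.
  exists (Num.truncn (K / s)); apply: (lt_le_trans (truncnS_gt _)).
  by rewrite -natrX ler_nat ltnW// ltn_expl.
have := H n; rewrite ler_pdivlMr ?exprn_gt0// mulrC -ler_pdivlMr// leNgt nP.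
by [].
Qed.

(** Cauchy's formula at [z] for u / (w - w0)^(n+1), which flatness makes holomorphic at [w0] as
    well. With r = 4 a the contour stays at distance at least a from [w0] and [z] is closer than a /
    2, so u z = O(2^-n) for every n. *)
Lemma flat_zero u w0 (r : R) : 0 < r -> (forall w, nrm (w - w0) < r -> derivable u w 1) ->
  flat_at u w0 -> forall z, nrm (z - w0) < r / 8 -> u z = 0.
Proof.
move=> r0 du fl z zw0.
have [zE|zn] := eqVneq z w0.
  apply: nrm0_eq0; apply/eqP; rewrite eq_le nrm_ge0 andbT.
  have [M [dl [dl0 H]]] := fl 1%N.
  by have := H w0; rewrite zE subrr nrm0 expr1 mulr0; apply.
pose a := r / 4; have a0 : 0 < a by rewrite divr_gt0.
have ra : r = 4 * a by rewrite /a; field.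
have za : nrm (z - w0) < a / 2 by rewrite /a; apply: (lt_le_trans zw0); lra.
clearbody a; rewrite {zw0}ra in r0 du.
set X := ReC w0; set Y := ImC w0; have w0E : w0 = X +i* Y by rewrite /X /Y; case: (w0).
have in_sq x y : X - a <= x <= X + a -> Y - a <= y <= Y + a -> nrm ((x +i* y) - w0) < 4 * a.
  move=> hx hy; apply: (le_lt_trans (nrm_le_ReIm _)); rewrite w0E /=.
  have : `|x - X| <= a by rewrite ler_norml; lra.
  have : `|y - Y| <= a by rewrite ler_norml; lra.
  by lra.
have XaX : X - a <= X + a by lra.
have YaY : Y - a <= Y + a by lra.
have edge_sq w : edge (X - a) (X + a) (Y - a) (Y + a) w -> nrm (w - w0) < 4 * a.
  by case=> -[x xb [->|->]]; apply: in_sq; rewrite ?lexx ?XaX ?YaY.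
have edge_far w : edge (X - a) (X + a) (Y - a) (Y + a) w -> a <= nrm (w - w0).
  rewrite w0E; case=> -[x xb [->|->]].
  - by apply: (le_trans _ (nrm_ge_Im _)); rewrite /= addrAC subrr sub0r normrN gtr0_norm.
  - by apply: (le_trans _ (nrm_ge_Im _)); rewrite /= addrAC subrr add0r gtr0_norm.
  - by apply: (le_trans _ (nrm_ge_Re _)); rewrite /= addrAC subrr sub0r normrN gtr0_norm.
  - by apply: (le_trans _ (nrm_ge_Re _)); rewrite /= addrAC subrr add0r gtr0_norm.
have edge_farz w : edge (X - a) (X + a) (Y - a) (Y + a) w -> a / 2 <= nrm (w - z).
  by move=> /edge_far wa; have := nrm_triangle w z w0; lra.
have zX : X - a < ReC z < X + a.
  have := le_lt_trans (nrm_ge_Re (z - w0)) za; rewrite raddfB /= -/X ltr_norml; lra.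
have zY : Y - a < ImC z < Y + a.
  have := le_lt_trans (nrm_ge_Im (z - w0)) za; rewrite raddfB /= -/Y ltr_norml; lra.
have uc : edge_continuous u (X - a) (X + a) (Y - a) (Y + a).
  by move=> w /edge_sq wr; apply: derivable_continuous; exact: du.
have [M MP] := edge_bounded XaX YaY uc.
have ic := inv_continuous_edge zX zY.
have cn0 := rint_inv_neq0 zX zY.
set cz := rint _ _ _ _ _ in cn0.
have cz0 : 0 < nrm cz by rewrite nrm_gt0.
have zw0 : 0 < nrm (z - w0) by rewrite nrm_gt0 subr_eq0.
(* The contour estimate is |k z| |cz| <= 4 (2 M / a^(n+2)) 4 a, and |z - w0|^(n+1) < (a / 2)^(n+1);
   together they give 32 M / |cz| over 2^(n+1). *)
apply: nrm0_eq0; apply: (@geometric_eq0 _ (32 * M / nrm cz)); first exact: nrm_ge0.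
(* As the inverse of 0 is 0, [k] takes at [w0] the value 0, which is also its limit by flatness. *)
move=> n; pose k w := u w * ((w - w0) ^+ n.+1)^-1.
have dk w : nrm (w - w0) < 4 * a -> derivable k w 1.
  move=> wr; have [wE|wn] := eqVneq w w0; last first.
    apply: derivableM; first exact: du.
    apply: derivableV; first by rewrite expf_eq0 subr_eq0 (negbTE wn) andbF.
    apply: derivable_exprn.
    by apply: derivableB; [exact: derivable_id|exact: derivable_cst].
  apply/derivable_expandP; exists 0 => e e0; rewrite wE.
  (* Order n + 3 leaves a factor |v - w0|^2 after division by the power n + 1: one factor for the
     derivative, one to absorb the constant. *)
  have [N [dl [dl0 H]]] := fl n.+3.
  have N1 : 0 < `|N| + 1 by rewrite ltr_wpDl.
  exists (Num.min dl (e / (`|N| + 1))); first by rewrite lt_min dl0 divr_gt0.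
  move=> v; rewrite lt_min => /andP[/H vd ve].
  rewrite mul0r subr0 /k subrr expr0n /= invr0 mulr0 subr0.
  have [->|vn] := eqVneq v w0; first by rewrite subrr expr0n /= invr0 mulr0 nrm0 mulr0.
  have v0 : 0 < nrm (v - w0) by rewrite nrm_gt0 subr_eq0.
  rewrite nrmM nrmV nrmX ler_pdivrMr ?exprn_gt0//; apply: (le_trans vd).
  set s := nrm _ in v0 ve *.
  have Ns : N * s <= e.
    apply: (le_trans (y := (`|N| + 1) * s)); last by rewrite -ler_pdivlMl// mulrC ltW.
    by rewrite ler_wpM2r ?(ltW v0)// (le_trans (ler_norm _))// lerDl.
  have -> : N * s ^+ n.+3 = N * s * (s * s ^+ n.+1) by rewrite !exprS; ring.
  by rewrite -[leRHS]mulrA ler_wpM2r// mulr_ge0 ?exprn_ge0 ?(ltW v0).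
have [k' k'P] : exists k' : C, forall e : R, 0 < e ->
  exists2 dl : R, 0 < dl & forall w, nrm (w - z) < dl -> nrm (k w - k z - k' * (w - z)) <= e * nrm (w - z).
  by apply: derivable_expand; apply: dk; apply: (lt_le_trans za); lra.
(* The difference quotient of [k], made continuous at [z] by inserting the derivative. That its
   contour integral vanishes is Cauchy's formula. *)
pose K w := if w == z then k' else (k w - k z) * (w - z)^-1.
have dK w : nrm (w - w0) < 4 * a -> w != z -> derivable K w 1.
  move=> wr wz; apply: (@near_eq_derivable _ _ _ (fun w => (k w - k z) * (w - z)^-1)).
    apply/nearP; exists (nrm (w - z)); first by rewrite nrm_gt0 subr_eq0.
    by move=> v vw; rewrite /K; case: eqVneq => // vz; move: vw; rewrite vz nrm_distC ltxx.
  apply: derivableM.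
    by apply: derivableB; [exact: dk|exact: derivable_cst].
  apply: derivableV; first by rewrite subr_eq0.
  by apply: derivableB; [exact: derivable_id|exact: derivable_cst].
have cK : cts K (X - a) (X + a) (Y - a) (Y + a).
  move=> x y hx hy; have [wz|wz] := eqVneq (x +i* y) z; last first.
    by apply: derivable_continuous; apply: dK => //; exact: in_sq.
  apply/continuous_nrmP => e e0; rewrite wz.
  have [dl dl0 H] := k'P _ e0; exists dl => // w /H wd.
  rewrite /K eqxx; case: eqVneq => [_|wn]; first by rewrite subrr nrm0 ltW.
  have -> : (k w - k z) * (w - z)^-1 - k' = (k w - k z - k' * (w - z)) / (w - z).
    by field; rewrite subr_eq0.
  by rewrite nrmM nrmV ler_pdivrMr// nrm_gt0 subr_eq0.
have : rint K (X - a) (X + a) (Y - a) (Y + a) = 0.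
  by apply: (goursat_except zX zY cK) => x y hx hy; apply: dK; exact: in_sq.
rewrite (@eq_rint _ _ (fun w => k w * (w - z)^-1 + (- k z) * (w - z)^-1)); last first.
  by move=> w /(edge_neq zX zY) wz; rewrite /K (negbTE wz) mulrBl mulNr.
have kc : edge_continuous (fun w => k w * (w - z)^-1) (X - a) (X + a) (Y - a) (Y + a).
  by move=> w ew; apply: continuousM; [apply: derivable_continuous; apply: dk; exact: edge_sq|exact: ic].
have zc : edge_continuous (fun w => (- k z) * (w - z)^-1) (X - a) (X + a) (Y - a) (Y + a).
  by move=> w ew; apply: (@continuousM _ _ (cst (- k z)) (fun w => (w - z)^-1)); [exact: cst_continuous|exact: ic].
have -> := rintD kc zc.
have -> := rintZ (- k z) ic.
rewrite -/cz mulNr => /eqP; rewrite subr_eq0 => /eqP E.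
have B : nrm (k z) * nrm cz <= 4 * (2 * M / a ^+ n.+2) * (4 * a).
  rewrite -nrmM -E -lecR -nrmE.
  have -> : 4 * (2 * M / a ^+ n.+2) * (4 * a) =
      4 * (2 * M / a ^+ n.+2) * ((X + a - (X - a)) + (Y + a - (Y - a))) by ring.
  apply: rint_bound => // w ew; rewrite nrmE lecR nrmM nrmM !nrmV nrmX.
  have -> : 2 * M / a ^+ n.+2 = M * (a ^+ n.+1)^-1 * (a / 2)^-1.
    by rewrite [a ^+ n.+2]exprS; field; rewrite expf_eq0 (gt_eqF a0) andbF.
  have f1 := edge_far _ ew; have f2 := edge_farz _ ew.
  apply: ler_pM; rewrite ?mulr_ge0 ?invr_ge0 ?exprn_ge0 ?nrm_ge0//.
    apply: ler_pM; rewrite ?invr_ge0 ?exprn_ge0 ?nrm_ge0//; first exact: MP.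
    rewrite lef_pV2 ?posrE ?exprn_gt0//; last exact: lt_le_trans f1.
    by apply: lerXn2r; rewrite ?nnegrE ?nrm_ge0 ?(ltW a0).
  by rewrite lef_pV2 ?posrE ?divr_gt0//; apply: lt_le_trans f2; rewrite divr_gt0.
have M0 : 0 <= M.
  apply: le_trans (MP ((X - a) +i* Y) _); first exact: nrm_ge0.
  by right; exists Y; [lra|left].
have -> : nrm (u z) = nrm (k z) * nrm (z - w0) ^+ n.+1.
  by rewrite /k nrmM nrmV nrmX divfK// gt_eqF// exprn_gt0.
move: B; rewrite -ler_pdivlMr// => B.
apply: (le_trans (y := 4 * (2 * M / a ^+ n.+2) * (4 * a) / nrm cz * (a / 2) ^+ n.+1)).
  apply: ler_pM; rewrite ?nrm_ge0 ?exprn_ge0 ?nrm_ge0//.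
  by apply: lerXn2r; rewrite ?nnegrE ?nrm_ge0 ?(ltW za)// divr_ge0// ltW.
rewrite le_eqVlt; apply/orP; left; apply/eqP.
rewrite expr_div_n [a ^+ n.+2]exprS; field.
by rewrite !expf_eq0 /= (gt_eqF a0) (gt_eqF cz0) pnatr_eq0.
Qed.

End Flat.

(** * The identity theorem and the complex exponential *)

Section Identity.
Variable R : realType.
Local Notation C := R[i].
Local Notation ReC := (@complex.Re R).
Local Notation ImC := (@complex.Im R).
Implicit Types (u v : C -> C) (z w : C).

Definition hol u w0 (r : R) := forall w, nrm (w - w0) < r -> derivable u w 1.

Definition zero_near u z := exists2 e : R, 0 < e & forall w, nrm (w - z) < e -> u w = 0.

Lemma zero_near_flat u z : zero_near u z -> flat_at u z.
Proof. by move=> [e e0 H] n; exists 0, e; split=> // w /H ->; rewrite nrm0 mul0r. Qed.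

Lemma nrm_segment (w0 z1 z2 : C) (s rho : R) : 0 <= s <= 1 -> nrm (z1 - w0) <= rho -> nrm (z2 - w0) <= rho ->
  nrm (z1 + s%:C * (z2 - z1) - w0) <= rho.
Proof.
move=> /andP[s0 s1] h1 h2.
have -> : z1 + s%:C * (z2 - z1) - w0 = (1 - s)%:C * (z1 - w0) + s%:C * (z2 - w0).
  by rewrite rmorphB/= rmorph1; ring.
apply: (le_trans (le_nrmD _ _)); rewrite !nrmM.
have nr (x : R) : 0 <= x -> nrm x%:C = x by move=> x0; rewrite /nrm ger0_norm// lecR.
rewrite !nr ?subr_ge0//.
have -> : rho = (1 - s) * rho + s * rho by ring.
by apply: lerD; apply: ler_wpM2l => //; rewrite subr_ge0.
Qed.

(** Continuation along the segment from [z1] to [z2]. All its points have distance at least dl from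
    the boundary, so each vanishing spreads to a disc of radius dl / 8, and the steps are shorter
    than that. *)
Lemma identity_ball u w0 (r : R) z1 : hol u w0 r -> nrm (z1 - w0) < r -> zero_near u z1 ->
  forall z, nrm (z - w0) < r -> u z = 0.
Proof.
move=> du z1r u1 z2 z2r.
have [rho [rho1 rho2 rhor]] : exists rho, [/\ nrm (z1 - w0) <= rho, nrm (z2 - w0) <= rho & rho < r].
  by exists (Num.max (nrm (z1 - w0)) (nrm (z2 - w0))); rewrite !le_max !lexx orbT gt_max z1r z2r.
pose dl := r - rho; have dl0 : 0 < dl by rewrite subr_gt0.
have [n nP] : exists n : nat, nrm (z2 - z1) / n.+1%:R < dl / 8.
  exists (Num.truncn (nrm (z2 - z1) / (dl / 8))); rewrite ltr_pdivrMr// mulrC -ltr_pdivrMr ?divr_gt0//.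
  exact: truncnS_gt.
pose p (j : nat) : C := z1 + (j%:R / n.+1%:R)%:C * (z2 - z1).
have pin j : (j <= n.+1)%N -> nrm (p j - w0) <= rho.
  by move=> jn; apply: nrm_segment => //; rewrite divr_ge0//= ler_pdivrMr// mul1r ler_nat.
have pS j : nrm (p j.+1 - p j) = nrm (z2 - z1) / n.+1%:R.
  have -> : p j.+1 - p j = (n.+1%:R^-1)%:C * (z2 - z1).
    rewrite /p -addn1 natrD mulrDl div1r rmorphD/=; ring.
  rewrite nrmM mulrC; congr (_ * _); rewrite /nrm ger0_norm// lecR invr_ge0//.
have stp j : (j <= n.+1)%N -> zero_near u (p j) -> forall w, nrm (w - p j) < dl / 8 -> u w = 0.
  move=> jn pz; apply: flat_zero => //; last exact: zero_near_flat.
  move=> w wp; apply: du; have := nrm_triangle w (p j) w0; have := pin j jn; move: wp; rewrite /dl.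
  by clear; lra.
have all j : (j <= n.+1)%N -> zero_near u (p j).
  elim: j => [_|j IH jn]; first by rewrite /p mul0r rmorph0 mul0r addr0.
  have H := stp j (ltnW jn) (IH (ltnW jn)).
  exists (dl / 8 - nrm (z2 - z1) / n.+1%:R); first by rewrite subr_gt0.
  move=> w wp; apply: H; have := nrm_triangle w (p j.+1) (p j); rewrite pS.
  by move: wp; move: (nrm (z2 - z1) / _); clear; move=> q *; lra.
have [e e0] := all n.+1 (leqnn _).
have -> : p n.+1 = z2 by rewrite /p divff ?pnatr_eq0// rmorph1 mul1r addrC subrK.
by apply; rewrite subrr nrm0.
Qed.

Lemma is_derive_expandP u z (k : C) : is_derive z 1 u k <-> (forall e : R, 0 < e ->
  exists2 dl : R, 0 < dl & forall w, nrm (w - z) < dl -> nrm (u w - u z - k * (w - z)) <= e * nrm (w - z)).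
Proof.
have sufficient (l : C) : (forall e : R, 0 < e ->
  exists2 dl : R, 0 < dl & forall w, nrm (w - z) < dl -> nrm (u w - u z - l * (w - z)) <= e * nrm (w - z)) ->
  is_derive z 1 u l.
  move=> H; have cv : (fun h : C => h^-1 *: (u (h *: 1 + z) - u z)) @ 0^' --> l.
    apply/cvgrPdist_le => e e0.
    have eE : e = (ReC e)%:C.
      by move: e0; rewrite ltcE /= => /andP[/eqP E _]; case: e E => ? ? /= ->.
    have [|dl dl0 dlP] := H (ReC e); first by rewrite -ltcR -eE.
    rewrite /dnbhs /within /=; apply/nearP; exists dl => // h; rewrite subr0 => hd h0.
    have := dlP (h + z); rewrite addrK => /(_ hd) dh.
    rewrite /GRing.scale /= mulr1 [leRHS]eE nrmE lecR.
    have -> : l - h^-1 * (u (h + z) - u z) = - (u (h + z) - u z - l * h) / h by field.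
    by rewrite nrmM nrmN nrmV ler_pdivrMr ?nrm_gt0.
  by apply: DeriveDef; [apply/cvg_ex; exists l|apply: cvg_lim cv].
split=> [[du uk]|]; last exact: sufficient.
have [l lP] := derivable_expand du.
by have [_ lE] := sufficient l lP; rewrite -uk lE.
Qed.

Lemma real_expand (f : R -> R) (x k : R) : is_derive x 1 f k ->
  forall e : R, 0 < e -> exists2 dl : R, 0 < dl &
    forall h, `|h| < dl -> `|f (x + h) - f x - k * h| <= e * `|h|.
Proof.
move=> [dx <-] e e0; have /cvgrPdist_le/(_ e e0) : (fun h => h^-1 *: (f (h *: 1 + x) - f x)) @ 0^' --> 'D_1 f x.
  exact: dx.
rewrite /dnbhs /within => /nbhs_normP[dl /= dl0 H]; exists dl => // h hd.
have [->|h0] := eqVneq h 0; first by rewrite addr0 subrr mulr0 subr0 normr0 mulr0.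
have := H h; rewrite /ball_ /= sub0r normrN => /(_ hd h0).
rewrite /GRing.scale /= mulr1 => E.
have -> : f (x + h) - f x - 'D_1 f x * h = - ('D_1 f x - h^-1 * (f (h + x) - f x)) * h.
  by rewrite (addrC h); field.
by rewrite normrM normrN ler_wpM2r.
Qed.

Lemma ReDs (w z : C) : ReC (w - z) = ReC w - ReC z. Proof. by rewrite raddfB. Qed.
(** The real mean value theorem for Re (k u) along the segment, with k = 1 and k = -i to recover
    both components. *)
Lemma derive0_cst u w0 (r : R) : (forall w, nrm (w - w0) < r -> is_derive w 1 u 0) ->
  forall z, nrm (z - w0) < r -> u z = u w0.
Proof.
move=> du z zr.
have r0 : 0 < r by apply: le_lt_trans zr; exact: nrm_ge0.
have exp0 w : nrm (w - w0) < r -> forall e : R, 0 < e ->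
  exists2 dl : R, 0 < dl & forall w', nrm (w' - w) < dl -> nrm (u w' - u w) <= e * nrm (w' - w).
  move=> wr e e0; have [dl dl0 H] := (is_derive_expandP u w 0).1 (du w wr) e e0.
  by exists dl => // w' /H; rewrite mul0r subr0.
have key (k : C) : ReC (k * u z) = ReC (k * u w0).
  pose p (s : R) : C := w0 + s%:C * (z - w0).
  have pin (s : R) : 0 <= s <= 1 -> nrm (p s - w0) < r.
    move=> s01; apply: le_lt_trans zr; apply: nrm_segment => //; first by rewrite subrr nrm0 nrm_ge0.
  pose h s := ReC (k * u (p s)).
  have hd (s : R) : 0 <= s <= 1 -> is_derive s 1 h 0.
    move=> s01.
    have cv : (fun t : R => t^-1 *: (h (t *: 1 + s) - h s)) @ 0^' --> (0 : R).
      apply/cvgrPdist_le => e e0.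
      have B0 : 0 < nrm k * nrm (z - w0) + 1 by rewrite ltr_wpDl// mulr_ge0// nrm_ge0.
      have [dl dl0 H] := exp0 _ (pin s s01) _ (divr_gt0 e0 B0).
      have S0 : 0 < nrm (z - w0) + 1 by rewrite ltr_wpDl// nrm_ge0.
      rewrite /dnbhs /within /=; apply/nbhs_normP; exists (dl / (nrm (z - w0) + 1)); first exact: divr_gt0.
      move=> t; rewrite /ball_ /= sub0r normrN ltr_pdivlMr// => td t0.
      have pts : p (t + s) - p s = t%:C * (z - w0) by rewrite /p rmorphD/=; ring.
      have nt : nrm t%:C = `|t| by rewrite /nrm normc_def /= expr0n /= addr0 sqrtr_sqr.
      have := H (p (t + s)); rewrite pts nrmM nt => Hp.
      rewrite sub0r normrN /GRing.scale /= mulr1 /h -ReDs -mulrBr normrM normfV.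
      rewrite ler_pdivrMl ?normr_gt0//; apply: (le_trans (nrm_ge_Re _)); rewrite nrmM.
      apply: (le_trans (ler_wpM2l (nrm_ge0 k) (Hp _))).
        by apply: le_lt_trans td; rewrite ler_wpM2l// lerDl.
      set B := _ + 1 in B0 *; set Z := nrm (z - w0).
      have -> : nrm k * (e / B * (`|t| * Z)) = `|t| * e * (nrm k * Z / B) by ring.
      by rewrite ler_piMr ?mulr_ge0 ?(ltW e0)// ler_pdivrMr// mul1r lerDl.
    by apply: DeriveDef; [apply/cvg_ex; exists 0|apply: cvg_lim cv].
  have [||c _] := @MVT_segment _ h (fun=> 0) 0 1 ler01.
  - by move=> s; rewrite in_itv /= => /andP[s0 s1]; apply: hd; rewrite !ltW.
  - apply: continuous_in_subspaceT => s; rewrite inE /= in_itv /= => /hd[ds _].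
    by apply: differentiable_continuous; apply/derivable1_diffP.
  rewrite mul0r => /eqP; rewrite subr_eq0 /h /p rmorph1 mul1r rmorph0 mul0r addr0 => /eqP.
  by rewrite addrC subrK.
have := key 1; have := key (0 +i* -1); rewrite !mul1r.
case: (u z) (u w0) => a b [c d] /=; rewrite !mul0r !mulN1r !sub0r !opprK => -> ->.
by [].
Qed.

Definition cexp z : C := (expR (ReC z) * cos (ImC z)) +i* (expR (ReC z) * sin (ImC z)).

Lemma cexpD z w : cexp (z + w) = cexp z * cexp w.
Proof.
case: z w => a b [c d]; rewrite /cexp /= expRD cosD sinD.
by apply/eqP; rewrite eq_complex /=; apply/andP; split; apply/eqP; ring.
Qed.

Lemma cexp0 : cexp 0 = 1.
Proof. by rewrite /cexp /= expR0 cos0 sin0 mulr1 mulr0. Qed.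

Lemma cexp_neq0 z : cexp z != 0.
Proof.
have : cexp z * cexp (- z) != 0 by rewrite -cexpD subrr cexp0 oner_neq0.
by rewrite mulf_eq0 negb_or => /andP[].
Qed.

Lemma cexpN z : cexp (- z) = (cexp z)^-1.
Proof. by apply: (mulfI (cexp_neq0 z)); rewrite -cexpD subrr cexp0 mulfV// cexp_neq0. Qed.

Definition twopii : C := 0 +i* (pi *+ 2).

Lemma cexp_periodic z : cexp (z + twopii) = cexp z.
Proof. by rewrite cexpD [cexp twopii]/cexp /= expR0 cos2pi sin2pi mulr1 mulr0 mulr1. Qed.

Lemma cexp_expand0 (e : R) : 0 < e -> exists2 dl : R, 0 < dl &
  forall h : C, nrm h < dl -> nrm (cexp h - 1 - h) <= e * nrm h.
Proof.
(* The estimates below add up to seven times e' N, hence e / 8; the minimum with 1 serves to bound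
   |exp a| by 3. *)
move=> e0; have e8 : 0 < Num.min (e / 8) 1 by rewrite lt_min divr_gt0//=.
set e' := Num.min _ _ in e8.
have e'1 : e' <= 1 by rewrite ge_min lexx orbT.
have e'e : e' <= e / 8 by rewrite ge_min lexx.
have [d1 d10 h1] := real_expand (is_derive_expR 0) e8.
have [d2 d20 h2] := real_expand (is_derive_cos 0) e8.
have [d3 d30 h3] := real_expand (is_derive_sin 0) e8.
exists (Num.min (Num.min d1 d2) (Num.min d3 (e' / 2))); first by rewrite !lt_min d10 d20 d30 divr_gt0.
move=> [a b]; rewrite !lt_min => /andP[/andP[n1 n2] /andP[n3 n4]].
have na := nrm_ge_Re (a +i* b); have nb := nrm_ge_Im (a +i* b); rewrite /= in na nb.
set N := nrm (a +i* b) in n1 n2 n3 n4 na nb *.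
have := h1 a (le_lt_trans na n1); have := h2 b (le_lt_trans nb n2); have := h3 b (le_lt_trans nb n3).
rewrite !add0r expR0 sin0 cos0 oppr0 mul0r ?subr0 ?addr0 !mul1r => s1 c1 x1.
apply: (le_trans (nrm_le_ReIm _)); rewrite /cexp /= subr0.
have -> : expR a * cos b - 1 - a = (expR a - 1 - a) * cos b + (1 + a) * (cos b - 1) by ring.
have -> : expR a * sin b - b = expR a * (sin b - b) + (expR a - 1) * b by ring.
have N0 : 0 <= N by exact: nrm_ge0.
have a1 : `|a| <= 1 by apply: (le_trans na); apply: (le_trans (ltW n4)); lra.
have E1 : `|expR a - 1| <= 2 * `|a|.
  have -> : expR a - 1 = (expR a - 1 - a) + a by ring.
  apply: (le_trans (ler_normD _ _)); apply: (le_trans (lerD x1 (lexx _))).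
  have := normr_ge0 a; move: e'1 e8; move: (`|a|) => A; clear; nra.
have E2 : `|expR a| <= 3.
  have -> : expR a = (expR a - 1) + 1 by ring.
  apply: (le_trans (ler_normD _ _)); rewrite normr1; lra.
have eN : 0 <= e' * N by rewrite mulr_ge0// ltW.
have t1 : `|(expR a - 1 - a) * cos b| <= e' * N.
  rewrite normrM -[leRHS]mulr1 ler_pM ?normr_ge0//; last by rewrite ler_norml cos_geN1 cos_le1.
  by apply: (le_trans x1); rewrite ler_wpM2l// ltW.
have t2 : `|(1 + a) * (cos b - 1)| <= 2 * (e' * N).
  rewrite normrM ler_pM ?normr_ge0//.
    by apply: (le_trans (ler_normD _ _)); rewrite normr1; lra.
  by apply: (le_trans c1); rewrite ler_wpM2l// ltW.
have t3 : `|expR a * (sin b - b)| <= 3 * (e' * N).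
  
  by rewrite normrM ler_pM ?normr_ge0//; apply: (le_trans s1); rewrite ler_wpM2l// ltW.
have t4 : `|(expR a - 1) * b| <= e' * N.
  rewrite normrM ler_pM ?normr_ge0//; apply: (le_trans E1).
  by apply: (le_trans (ler_wpM2l _ na)) => //; lra.
have h6 := ler_normD ((expR a - 1 - a) * cos b) ((1 + a) * (cos b - 1)).
have h7 := ler_normD (expR a * (sin b - b)) ((expR a - 1) * b).
have h5 : e' * N <= e * N / 8 by rewrite mulrAC ler_wpM2r.
apply: (le_trans (lerD h6 h7)).
apply: (le_trans (lerD (lerD t1 t2) (lerD t3 t4))).
by move: h5 eN; move: (e * N) (e' * N); clear; move=> E E' *; lra.
Qed.

Lemma is_derive_cexp z : is_derive z 1 cexp (cexp z).
Proof.
apply/is_derive_expandP => e e0.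
have cz : 0 < nrm (cexp z) by rewrite nrm_gt0 cexp_neq0.
have [dl dl0 H] := cexp_expand0 (divr_gt0 e0 cz).
exists dl => // w wd.
have -> : cexp w - cexp z - cexp z * (w - z) = (cexp (w - z) - 1 - (w - z)) * cexp z.
  have -> : cexp w = cexp (w - z) * cexp z by rewrite -cexpD subrK.
  by ring.
by rewrite nrmM -ler_pdivlMr// mulrAC; exact: H.
Qed.

End Identity.

(** * Boxes in C^3, Baire category, classes closed under ring operations *)

Section Polydisc.
Variable R : realType.
Local Notation C := R[i].
Local Notation B := (C * C * C)%type.
Local Notation ReC := (@complex.Re R).
Local Notation ImC := (@complex.Im R).
Implicit Types (c : B) (r : R).

(** The triple is read as (z, q, F) in the chart, as (q, t, F) in the tube around a circle, and as
    (z, q, t) on a level set. *)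
Definition pd c r (b : B) := [/\ nrm (b.1.1 - c.1.1) < r, nrm (b.1.2 - c.1.2) < r & nrm (b.2 - c.2) < r].

Lemma pd_center c r : 0 < r -> pd c r c.
Proof. by move=> r0; split; rewrite subrr nrm0. Qed.

Lemma pd_sub c r b : pd c r b -> exists2 s, 0 < s & forall b', pd b s b' -> pd c r b'.
Proof.
move=> [h1 h2 h3].
exists (Num.min (r - nrm (b.1.1 - c.1.1)) (Num.min (r - nrm (b.1.2 - c.1.2)) (r - nrm (b.2 - c.2)))).
  by rewrite !lt_min !subr_gt0 h1 h2 h3.
move=> b' [g1 g2 g3]; move: g1 g2 g3; rewrite !lt_min => /and3P[g1 _ _] /and3P[_ g2 _] /and3P[_ _ g3].
split.
- by have := nrm_triangle b'.1.1 b.1.1 c.1.1; lra.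
- by have := nrm_triangle b'.1.2 b.1.2 c.1.2; lra.
- by have := nrm_triangle b'.2 b.2 c.2; lra.
Qed.

Lemma pd_le c r s b : r <= s -> pd c r b -> pd c s b.
Proof. by move=> rs [h1 h2 h3]; split; apply: lt_le_trans rs. Qed.

(* By nested boxes in the six real coordinates. *)
Lemma pd_baire (E : nat -> B -> Prop) c r : 0 < r ->
  (forall k b, ~ E k b -> exists2 s, 0 < s & forall b', pd b s b' -> ~ E k b') ->
  (forall b, pd c r b -> exists k, E k b) ->
  exists k c' r', [/\ 0 < r', forall b, pd c' r' b -> pd c r b & forall b, pd c' r' b -> E k b].
Proof.
move=> r0 cE cov; apply: contrapT => none.
(* The box of four times the chosen radius still avoids [E k]. This leaves room for the limit point,
   whose real and imaginary coordinates are each within the radius, hence whose distance is at most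
   twice the radius. *)
have step (kcr : nat * (B * R)) : exists cr : B * R,
   0 < kcr.2.2 -> (forall b, pd kcr.2.1 kcr.2.2 b -> pd c r b) ->
   [/\ 0 < cr.2, forall b, pd cr.1 (4 * cr.2) b -> pd kcr.2.1 kcr.2.2 b &
       forall b, pd cr.1 (4 * cr.2) b -> ~ E kcr.1 b].
  case: kcr => k [c1 r1] /=.
  have [[r10 sub1]|n] := pselect (0 < r1 /\ (forall b, pd c1 r1 b -> pd c r b)); last first.
    by exists (c1, r1) => r10 s1; case: n.
  have [b b1 Eb] : exists2 b, pd c1 r1 b & ~ E k b.
    apply: contrapT => h; apply: none; exists k, c1, r1; split=> // b bb.
    by apply: contrapT => nE; apply: h; exists b.
  have [s s0 sP] := cE _ _ Eb; have [s' s'0 s'P] := pd_sub b1.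
  exists (b, Num.min s s' / 4) => _ _ /=.
  have -> : 4 * (Num.min s s' / 4) = Num.min s s' by field.
  split; first by rewrite divr_gt0// lt_min s0.
    by move=> b' bb; apply: s'P; apply: pd_le bb; rewrite ge_min lexx orbT.
  by move=> b' bb; apply: sP; apply: pd_le bb; rewrite ge_min lexx.
have [f fP] := choice step.
pose fix cr n := if n is m.+1 then f (m, cr m) else (c, r).
have crP n : 0 < (cr n).2 /\ (forall b, pd (cr n).1 (cr n).2 b -> pd c r b).
  elim: n => [|n [IH1 IH2]]; first by split.
  have [h1 h2 _] := fP (n, cr n) IH1 IH2; split=> // b bb; apply/IH2/h2.
  by apply: pd_le bb => /=; move: h1 => /=; lra.
have crS n : [/\ 0 < (cr n.+1).2, forall b, pd (cr n.+1).1 (4 * (cr n.+1).2) b -> pd (cr n).1 (cr n).2 b &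
       forall b, pd (cr n.+1).1 (4 * (cr n.+1).2) b -> ~ E n b].
  by have [h1 h2] := crP n; apply: (fP (n, cr n)).
have nr x : nrm x%:C = `|x| :> R by rewrite /nrm normc_def /= expr0n /= addr0 sqrtr_sqr.
have ni x : nrm (0 +i* x) = `|x| :> R by rewrite /nrm normc_def /= expr0n /= add0r sqrtr_sqr.
(* Nested intervals for one of the six real coordinates: [pr] reads it and [mv] moves a point along
   it. *)
have nest (pr : B -> R) (mv : B -> R -> B) :
   (forall b x, pr (mv b x) = pr b + x) ->
   (forall b x s, `|x| < s -> pd b s (mv b x)) ->
   (forall b c s, pd c s b -> `|pr b - pr c| < s) ->
   exists x, forall n, `|x - pr (cr n.+1).1| <= (cr n.+1).2.
  move=> h1 h2 h3.
  have e n : [/\ pr (cr n).1 - (cr n).2 <= pr (cr n.+1).1 - (cr n.+1).2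
      & pr (cr n.+1).1 + (cr n.+1).2 <= pr (cr n).1 + (cr n).2].
    have [s0 s1 _] := crS n; set s := (cr n.+1).2 in s0 s1 *; set b := (cr n.+1).1 in s1 *.
    have p1 : `|s| < 4 * s by rewrite gtr0_norm//; lra.
    have p2 : `|- s| < 4 * s by rewrite normrN.
    have := h3 _ _ _ (s1 _ (h2 b _ _ p1)); have := h3 _ _ _ (s1 _ (h2 b _ _ p2)); rewrite !h1 !ltr_norml.
    by clear -s0; move=> *; split; lra.
  have [|||x xP] := @nested_intervals R (fun n => pr (cr n).1 - (cr n).2) (fun n => pr (cr n).1 + (cr n).2).
  - by move=> n; have [] := e n.
  - by move=> n; have [] := e n.
  - by move=> n; have [h _] := crP n; lra.
  exists x => n; have := xP n.+1; rewrite ler_norml; lra.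
have [x1 x1P] : exists x, forall n, `|x - ReC (cr n.+1).1.1.1| <= (cr n.+1).2.
  apply: (nest (fun b => ReC b.1.1) (fun b x => (b.1.1 + x%:C, b.1.2, b.2))).
  - by move=> b x; rewrite raddfD.
  - by move=> b x s xs; split; rewrite /= ?subrr ?nrm0 ?(addrAC _ _ (- b.1.1)) ?subrr ?add0r ?nr// (le_lt_trans _ xs).
  - by move=> b c' s [h _ _]; rewrite -raddfB; apply: le_lt_trans h; exact: nrm_ge_Re.
have [y1 y1P] : exists x, forall n, `|x - ImC (cr n.+1).1.1.1| <= (cr n.+1).2.
  apply: (nest (fun b => ImC b.1.1) (fun b x => (b.1.1 + (0 +i* x), b.1.2, b.2))).
  - by move=> b x; rewrite raddfD.
  - by move=> b x s xs; split; rewrite /= ?subrr ?nrm0 ?(addrAC _ _ (- b.1.1)) ?subrr ?add0r ?ni// (le_lt_trans _ xs).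
  - by move=> b c' s [h _ _]; rewrite -raddfB; apply: le_lt_trans h; exact: nrm_ge_Im.
have [x2 x2P] : exists x, forall n, `|x - ReC (cr n.+1).1.1.2| <= (cr n.+1).2.
  apply: (nest (fun b => ReC b.1.2) (fun b x => (b.1.1, b.1.2 + x%:C, b.2))).
  - by move=> b x; rewrite raddfD.
  - by move=> b x s xs; split; rewrite /= ?subrr ?nrm0 ?(addrAC _ _ (- b.1.2)) ?subrr ?add0r ?nr// (le_lt_trans _ xs).
  - by move=> b c' s [_ h _]; rewrite -raddfB; apply: le_lt_trans h; exact: nrm_ge_Re.
have [y2 y2P] : exists x, forall n, `|x - ImC (cr n.+1).1.1.2| <= (cr n.+1).2.
  apply: (nest (fun b => ImC b.1.2) (fun b x => (b.1.1, b.1.2 + (0 +i* x), b.2))).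
  - by move=> b x; rewrite raddfD.
  - by move=> b x s xs; split; rewrite /= ?subrr ?nrm0 ?(addrAC _ _ (- b.1.2)) ?subrr ?add0r ?ni// (le_lt_trans _ xs).
  - by move=> b c' s [_ h _]; rewrite -raddfB; apply: le_lt_trans h; exact: nrm_ge_Im.
have [x3 x3P] : exists x, forall n, `|x - ReC (cr n.+1).1.2| <= (cr n.+1).2.
  apply: (nest (fun b => ReC b.2) (fun b x => (b.1.1, b.1.2, b.2 + x%:C))).
  - by move=> b x; rewrite raddfD.
  - by move=> b x s xs; split; rewrite /= ?subrr ?nrm0 ?(addrAC _ _ (- b.2)) ?subrr ?add0r ?nr// (le_lt_trans _ xs).
  - by move=> b c' s [_ _ h]; rewrite -raddfB; apply: le_lt_trans h; exact: nrm_ge_Re.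
have [y3 y3P] : exists x, forall n, `|x - ImC (cr n.+1).1.2| <= (cr n.+1).2.
  apply: (nest (fun b => ImC b.2) (fun b x => (b.1.1, b.1.2, b.2 + (0 +i* x)))).
  - by move=> b x; rewrite raddfD.
  - by move=> b x s xs; split; rewrite /= ?subrr ?nrm0 ?(addrAC _ _ (- b.2)) ?subrr ?add0r ?ni// (le_lt_trans _ xs).
  - by move=> b c' s [_ _ h]; rewrite -raddfB; apply: le_lt_trans h; exact: nrm_ge_Im.
pose b : B := (x1 +i* y1, x2 +i* y2, x3 +i* y3).
have bin n : pd (cr n.+1).1 (4 * (cr n.+1).2) b.
  have [s0 _ _] := crS n.
  have aux (x y : R) (w : C) : `|x - ReC w| <= (cr n.+1).2 -> `|y - ImC w| <= (cr n.+1).2 ->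
      nrm ((x +i* y) - w) < 4 * (cr n.+1).2.
    move=> hx hy; apply: (le_lt_trans (nrm_le_ReIm _)); rewrite !raddfB /=.
    by move: s0 hx hy; clear; lra.
  by split; apply: aux.
have [k Ek] : exists k, E k b.
  by apply: cov; have [_ s1 _] := crS 0%N; exact: (s1 _ (bin 0%N)).
by have [_ _] := crS k; move=> /(_ _ (bin k)).
Qed.

(** Continuity, differentiability, meromorphy, periodicity, independence of a variable and
    rationality are all treated as instances, so that each explicit formula for the coefficients has
    to be examined once only. *)
Definition ringclass (T : Type) (S : (T -> C) -> Prop) := [/\ forall k, S (cst k),
  forall f g, S f -> S g -> S (fun b => f b + g b) & forall f g, S f -> S g -> S (fun b => f b * g b)].

Section RingClass.
Variables (T : Type) (S : (T -> C) -> Prop).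
Hypothesis Sr : ringclass S.

Lemma ringclass_sum (I : Type) (s : seq I) (P : pred I) (f : I -> T -> C) : (forall i, S (f i)) ->
  S (fun b => \sum_(i <- s | P i) f i b).
Proof.
case: Sr => Sc SD SM Sf; elim: s => [|i s IH].
  by rewrite (_ : (fun b => _) = cst 0) //; apply/funext => b; rewrite big_nil.
case Pi : (P i).
  rewrite (_ : (fun b => _) = (fun b => f i b + \sum_(j <- s | P j) f j b)); first exact: SD.
  by apply/funext => b; rewrite big_cons Pi.
by rewrite (_ : (fun b => _) = (fun b => \sum_(j <- s | P j) f j b))//; apply/funext => b; rewrite big_cons Pi.
Qed.

Lemma ringclass_prod (I : Type) (s : seq I) (P : pred I) (f : I -> T -> C) : (forall i, S (f i)) ->
  S (fun b => \prod_(i <- s | P i) f i b).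
Proof.
case: Sr => Sc SD SM Sf; elim: s => [|i s IH].
  by rewrite (_ : (fun b => _) = cst 1) //; apply/funext => b; rewrite big_nil.
case Pi : (P i).
  rewrite (_ : (fun b => _) = (fun b => f i b * \prod_(j <- s | P j) f j b)); first exact: SM.
  by apply/funext => b; rewrite big_cons Pi.
by rewrite (_ : (fun b => _) = (fun b => \prod_(j <- s | P j) f j b))//; apply/funext => b; rewrite big_cons Pi.
Qed.

Lemma ringclassN f : S f -> S (fun b => - f b).
Proof.
case: Sr => Sc SD SM Sf; rewrite (_ : (fun b => _) = (fun b => cst (-1) b * f b)); first exact: SM.
by apply/funext => b; rewrite /= mulN1r.
Qed.

Lemma ringclassB f g : S f -> S g -> S (fun b => f b - g b).
Proof. by case: Sr => Sc SD SM Sf Sg; apply: SD => //; exact: ringclassN. Qed.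

Lemma ringclassX f n : S f -> S (fun b => f b ^+ n).
Proof.
case: Sr => Sc SD SM Sf; elim: n => [|n IH].
  by rewrite (_ : (fun b => _) = cst 1)//; apply/funext => b; rewrite expr0.
by rewrite (_ : (fun b => _) = (fun b => f b * f b ^+ n)); [exact: SM|apply/funext => b; rewrite exprS].
Qed.

(** By the Leibniz formula. Through it the properties of the integral pass to the coefficients
    obtained from Cramer's rule. *)
Lemma ringclass_det n (M : 'I_n -> 'I_n -> T -> C) : (forall i j, S (M i j)) ->
  S (fun b => \det (\matrix_(i, j) M i j b)).
Proof.
move=> SM; rewrite (_ : (fun b => _) =
    (fun b => \sum_(s : {perm 'I_n}) (cst ((-1) ^+ s) b * \prod_i M i (s i) b))).
  apply: ringclass_sum => s; case: Sr => Sc _ SMul; apply: SMul; first exact: Sc.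
  by apply: ringclass_prod => i; exact: SM.
apply/funext => b; rewrite /determinant; apply: eq_bigr => s _; congr (_ * _).
by apply: eq_bigr => i _; rewrite mxE.
Qed.

End RingClass.

Lemma continuous_ringclass (T : topologicalType) (x : T) :
  @ringclass T (fun f => {for x, continuous f}).
Proof.
split=> [k|f g cf cg|f g cf cg]; first exact: cst_continuous.
  exact: (@continuousD _ _ _ f g x cf cg).
exact: (@continuousM _ _ f g x cf cg).
Qed.

Lemma derivable_ringclass (x : C) : @ringclass C (fun f => derivable f x 1).
Proof.
split=> [k|f g cf cg|f g cf cg]; first exact: (@derivable_cst C C C k x 1).
  exact: (@derivableD C C C f g x 1 cf cg).
exact: (derivableM cf cg).
Qed.

Lemma continuous_neq0 (f : B -> C) (b : B) : {for b, continuous f} -> f b != 0 ->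
  exists2 s, 0 < s & forall b', pd b s b' -> f b' != 0.
Proof.
move=> cf fb.
have /cf : nbhs (f b) [set y | y != 0].
  apply/nearP; exists (nrm (f b)); first by rewrite nrm_gt0.
  by move=> w wf; apply/eqP => w0; move: wf; rewrite w0 sub0r nrmN ltxx.
move=> [[A1 A2] /= [[[P1 P2] /= [/nearP[s1 s10 h1] /nearP[s2 s20 h2]] PA] /nearP[s3 s30 h3]] AA].
exists (Num.min s1 (Num.min s2 s3)); first by rewrite !lt_min s10 s20.
move=> [[b1 b2] b3] [/=]; rewrite !lt_min => /and3P[g1 _ _] /and3P[_ g2 _] /and3P[_ _ g3].
by apply: (AA (b1, b2, b3)); split; [apply: (PA (b1, b2)); split; [exact: h1|exact: h2]|exact: h3].
Qed.

(** The points t0 + r / (i + 2) are distinct and lie in the disc, so [p] would have more roots than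
    its degree allows. *)
Lemma poly_disc0 (p : {poly C}) (t0 : C) r : 0 < r -> (forall t, nrm (t - t0) < r -> p.[t] = 0) -> p = 0.
Proof.
move=> r0 h; apply/eqP; apply: contraT => p0.
pose pt (i : nat) : C := t0 + (r / i.+2%:R)%:C.
pose s := map pt (iota 0 (size p)).
have /(max_poly_roots p0) : all (root p) s.
  apply/allP => _ /mapP[i _ ->]; rewrite rootE; apply/eqP/h.
  rewrite /pt addrC addKr /nrm ger0_norm/= ?lecR ?divr_ge0 ?(ltW r0)//.
  by rewrite ltr_pdivrMr// ltr_pMr// ltr1n.
rewrite map_inj_uniq ?iota_uniq ?size_map ?size_iota ?ltnn//; first by move=> /(_ isT).
move=> i j /addrI /complexI /(mulfI (lt0r_neq0 r0)) /invr_inj /eqP; rewrite eqr_nat => /eqP [].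
by [].
Qed.

End Polydisc.

(** * Power series at t = infinity *)

Section Series.
Variable K : fieldType.
Implicit Types (c : nat -> K) (p q : {poly K}).

(** Congruence to 0 modulo X^n: power series are handled as truncated polynomials up to such
    congruences. *)
Definition low_zero n (p : {poly K}) := forall i, (i < n)%N -> p`_i = 0.

Lemma low_zeroD n p q : low_zero n p -> low_zero n q -> low_zero n (p + q).
Proof. by move=> hp hq i ni; rewrite coefD hp// hq// addr0. Qed.

Lemma low_zeroN n p : low_zero n p -> low_zero n (- p).
Proof. by move=> hp i ni; rewrite coefN hp// oppr0. Qed.

Lemma low_zeroM n p q : low_zero n p -> low_zero n (q * p).
Proof.
move=> hp i ni; rewrite coefM big1// => j _; rewrite hp ?mulr0//.
by apply: leq_ltn_trans ni; exact: leq_subr.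
Qed.

Lemma low_zero_cancel n p q : q`_0 != 0 -> low_zero n (q * p) -> low_zero n p.
Proof.
move=> q0 h i; elim/ltn_ind: i => i IH ni.
have := h i ni; rewrite coefM big_ord_recl /= subn0 big1 ?addr0.
  by move=> /eqP; rewrite mulf_eq0 (negbTE q0) => /eqP.
move=> j _; rewrite /bump /= add1n.
have ji : (i - j.+1 < i)%N by rewrite ltn_subrL /= (leq_ltn_trans (leq0n j)).
by rewrite IH ?mulr0// (ltn_trans ji).
Qed.

Lemma low_zero_deriv n p : low_zero n p -> low_zero n ('X^3 * p^`()).
Proof.
move=> h i ni; rewrite coefXnM; case: ltnP => // i3; rewrite coef_deriv h ?mul0rn//.
by case: i i3 ni => [|[|[|i]]]// _ ni; rewrite !subSS subn0; apply: ltn_trans ni; rewrite !ltnS leqnSn.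
Qed.

(* With x = 1/t, rev_der n a a_z a_0 is x^(n+1) times the derivative of x^-n a. *)
Definition rev_der (n : nat) (a az a0 : {poly K}) := - 2 * az + 'X * a0 + 'X^2 * (n%:R * a - 'X * a^`()).

(** The quotient is the sum of c k t^(l-m-k), and the field d_t - 2t d_z + D0 annihilates it; the
    claim is the coefficient of t^(l-m-k+1). The argument is formal: [cz] and [c0] stand for the
    derivatives of the coefficients and are known through the differentiated convolution
    identities. *)
Lemma series_recursion (l m : nat) (Q Qz Q0 P Pz P0 : {poly K}) c cz c0 :
  Q`_0 != 0 ->
  (forall k, \sum_(i < k.+1) Q`_i * c (k - i)%N = P`_k) ->
  (forall k, \sum_(i < k.+1) (Qz`_i * c (k - i)%N + Q`_i * cz (k - i)%N) = Pz`_k) ->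
  (forall k, \sum_(i < k.+1) (Q0`_i * c (k - i)%N + Q`_i * c0 (k - i)%N) = P0`_k) ->
  P * rev_der m Q Qz Q0 = Q * rev_der l P Pz P0 ->
  forall k, 2 * cz k = (if k is k1.+1 then c0 k1 + (if k1 is k2.+1 then (l%:R - m%:R - k2%:R) * c k2 else 0) else 0).
Proof.
move=> q0 hP hPz hP0 E k; set n := k.+1.
pose A := \poly_(i < n) c i; pose Az := \poly_(i < n) cz i; pose A0 := \poly_(i < n) c0 i.
have tr (f : nat -> K) (S : {poly K}) i : (i < n)%N ->
    (S * \poly_(i < n) f i)`_i = \sum_(j < i.+1) S`_j * f (i - j)%N.
  move=> ni; rewrite coefM; apply: eq_bigr => j _; rewrite coef_poly.
  by rewrite (leq_ltn_trans (leq_subr _ _) ni).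
have e1 : low_zero n (Q * A - P).
  by move=> i ni; rewrite coefB tr// hP subrr.
have e2 : low_zero n (Qz * A + Q * Az - Pz).
  by move=> i ni; rewrite coefB coefD !tr// -big_split /= hPz subrr.
have e3 : low_zero n (Q0 * A + Q * A0 - P0).
  by move=> i ni; rewrite coefB coefD !tr// -big_split /= hP0 subrr.
pose Z := - 2 * Az + 'X * A0 + 'X^2 * ((l%:R - m%:R) * A - 'X * A^`()).
(* Q^2 times the residue of the recursion is a combination of the three truncation errors and a
   derivative of the first. As Q is invertible as a power series, the residue vanishes to the same
   order. *)
have ZE : Q * (Q * Z) = - (rev_der m Q Qz Q0) * (Q * A - P) + (Q * - 2) * (Qz * A + Q * Az - Pz)
   + (Q * 'X) * (Q0 * A + Q * A0 - P0) + (Q * 'X^2 * l%:R) * (Q * A - P) - Q * ('X^3 * (Q * A - P)^`()).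
  apply/eqP; rewrite -subr_eq0; apply/eqP.
  transitivity (Q * rev_der l P Pz P0 - P * rev_der m Q Qz Q0); last by rewrite E subrr.
  rewrite /rev_der /Z derivB derivM; ring.
have : low_zero n (Q * (Q * Z)).
  rewrite ZE; do !apply: low_zeroD; try apply: low_zeroN; apply: low_zeroM => //.
  exact: low_zero_deriv.
move=> /(low_zero_cancel q0)/(low_zero_cancel q0)/(_ k (ltnSn k)).
have nat1 j : (j%:R : {poly K}) = (j%:R : K)%:P by rewrite rmorph_nat.
have ZE2 : Z = (- 2 : K)%:P * Az + 'X * A0 + 'X^2 * ((l%:R - m%:R : K)%:P * A - 'X * A^`()).
  by rewrite /Z rmorphB rmorphN/= !rmorph_nat.
rewrite ZE2 !coefD !coefCM coefXM coefXnM coefB coefCM coefXM coef_deriv !coef_poly ltnSn.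
move=> H; apply/eqP; rewrite -subr_eq0 -oppr_eq0 -[X in _ == X]H; apply/eqP.
have kn : (k < n)%N by [].
clearbody n; clear -kn; case: k kn => [|k1] kn /=.
  by ring.
rewrite (ltnW kn); case: k1 kn => [|k2] kn /=; first by ring.
rewrite !subSS !subn0 (ltnW (ltnW kn)); case: k2 kn => [|k3] kn /=; first by ring.
rewrite (ltnW (ltnW kn)) -mulr_natr; ring.
Qed.

(** Long division of power series. A coefficient depends on all the earlier ones, so the recursion
    runs on a fuel exceeding the index. *)
Fixpoint sdiv_fuel (q p : nat -> K) (f k : nat) : K :=
  if f is f'.+1 then (p k - \sum_(i < k) q (k - i)%N * sdiv_fuel q p f' i) / q 0%N else 0.

Definition sdiv (q p : nat -> K) k := sdiv_fuel q p k.+1 k.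

Lemma sdiv_fuelE (q p : nat -> K) f k : (k < f)%N -> sdiv_fuel q p f k = sdiv q p k.
Proof.
elim/ltn_ind: k f => k IH [//|f] kf; rewrite /sdiv /=; congr ((_ - _) / _).
apply: eq_bigr => i _; rewrite IH//; last exact: leq_trans (ltn_ord i) _.
by rewrite IH.
Qed.

Lemma sdivE (q p : nat -> K) k : sdiv q p k = (p k - \sum_(i < k) q (k - i)%N * sdiv q p i) / q 0%N.
Proof.
rewrite /sdiv /=; congr ((_ - _) / _); apply: eq_bigr => i _.
by rewrite sdiv_fuelE.
Qed.

Lemma sdivP (q p : nat -> K) k : q 0%N != 0 -> \sum_(i < k.+1) q i * sdiv q p (k - i)%N = p k.
Proof.
move=> q0; rewrite big_ord_recl subn0 sdivE mulrC divfK// addrC.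
rewrite [X in X + _](_ : _ = \sum_(i < k) q (k - i)%N * sdiv q p i); first by rewrite addrC subrK.
rewrite (reindex_inj rev_ord_inj); apply: eq_bigr => i _ /=.
by rewrite /bump /= add1n subnSK// subKn// ltnW.
Qed.

Lemma rev_poly_horner n (a : nat -> K) x : x != 0 ->
  (\poly_(i < n.+1) a (n - i)%N).[x] = x ^+ n * (\poly_(i < n.+1) a i).[x^-1].
Proof.
move=> x0; rewrite !horner_poly mulr_sumr (reindex_inj rev_ord_inj); apply: eq_bigr => i _ /=.
have ni : (i <= n)%N by rewrite -ltnS.
by rewrite subSS subKn// mulrCA exprVn -expfB_cond ?(negbTE x0).
Qed.

(** Reversal exchanges the exponents i and n - i, hence turns the Euler operator X d/dX into n minus
    itself; both sides weight a (n - i) by n - i. *)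
Lemma rev_poly_deriv n (a : nat -> K) :
  n%:R * \poly_(i < n.+1) a (n - i)%N - 'X * (\poly_(i < n.+1) a (n - i)%N)^`() =
  \poly_(i < n.+1) (('X * (\poly_(i < n.+1) a i)^`())`_(n - i)%N).
Proof.
apply/polyP => i; rewrite coefB -mulr_natl.
have -> : n%:R * 1 = (n%:R : K)%:P :> {poly K} by rewrite mulr1 rmorph_nat.
rewrite coefCM coefXM coef_deriv !coef_poly.
have [ni|ni] := ltnP i n.+1; last first.
  by case: i ni => //= i ni; rewrite ltnNge ni /= mul0rn mulr0 subr0.
rewrite coefXM coef_deriv coef_poly.
case: i ni => [|i] ni /=.
  rewrite subn0 subr0; case: n ni => [|n] _ /=; first by rewrite mul0r.
  by rewrite ?coef_deriv ?coef_poly ltnSn mulr_natl.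
rewrite ?coef_deriv ?coef_poly ?ni; have ni' : (i < n)%N by [].
have E : (n - i.+1).+1 = (n - i)%N by rewrite subnSK.
case: (n - i.+1)%N E (subnK ni') => [|k] E nE /=.
  rewrite -nE add0n mulr_natl subrr//.
rewrite ?coef_deriv ?coef_poly; have -> : (k.+1 < n.+1)%N by rewrite ltnS -nE leq_addr.
by rewrite -nE mulr_natl mulrnDr addrK.
Qed.

End Series.

Lemma is_derive_horner (R : realType) (P : {poly R[i]}) (t : R[i]) :
  is_derive t 1 (fun w => P.[w]) P^`().[t].
Proof.
elim/poly_ind: P => [|p c [dp pE]].
  rewrite (_ : (fun w => _) = cst 0); last by apply/funext => w; rewrite horner0.
  by rewrite deriv0 horner0; exact: is_derive_cst.
have F : (fun w => (p * 'X + c%:P).[w]) = (fun w => p.[w] * w + cst c w).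
  by apply/funext => w; rewrite hornerD hornerM hornerX hornerC.
have di : derivable (fun w : R[i] => w) t 1 by exact: (@derivable_id R[i] R[i] t 1).
have [rc rD rM] := derivable_ringclass t.
have dM : derivable (fun w => p.[w] * w) t 1 by exact: (rM (fun w => p.[w]) (fun w => w) dp di).
have EM : 'D_1 (fun w => p.[w] * w) t = p.[t] *: 'D_1 (fun w : R[i] => w) t + t *: 'D_1 (fun w => p.[w]) t.
  exact: (@deriveM R[i] R[i] (fun w => p.[w]) (fun w => w) t 1 dp di).
have dc : derivable (cst c : R[i] -> R[i]) t 1 by exact: rc.
rewrite F; apply: DeriveDef; first exact: (rD (fun w => p.[w] * w) (cst c) dM dc).
have -> : 'D_1 (fun w => p.[w] * w + cst c w) t = 'D_1 (fun w => p.[w] * w) t + 'D_1 (cst c : R[i] -> R[i]) t.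
  exact: (@deriveD R[i] R[i] R[i] (fun w => p.[w] * w) (cst c) t 1 dM dc).
have -> : 'D_1 (cst c : R[i] -> R[i]) t = 0 by exact: (@derive_cst R[i] R[i] R[i] c t 1).
have did : 'D_1 (fun w : R[i] => w) t = 1 by exact: (@derive_id R[i] R[i] t 1).
rewrite EM pE did /GRing.scale /= derivD derivM derivX derivC addr0 mulr1.
by rewrite !hornerE; ring.
Qed.

(** * Derivations in the chart and the recursion in functional form *)

Section Derivations.
Variable R : realType.
Local Notation C := R[i].
Local Notation B := (C * C * C)%type.
Implicit Types (u v f g : B -> C).

Definition sder u (b : B) := [/\ derivable (fun z => u (z, b.1.2, b.2)) b.1.1 1,
  derivable (fun q => u (b.1.1, q, b.2)) b.1.2 1 & derivable (fun F => u (b.1.1, b.1.2, F)) b.2 1].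

Definition dz u (b : B) : C := 'D_1 (fun z => u (z, b.1.2, b.2)) b.1.1.
Definition dq u (b : B) : C := 'D_1 (fun q => u (b.1.1, q, b.2)) b.1.2.
Definition dF u (b : B) : C := 'D_1 (fun F => u (b.1.1, b.1.2, F)) b.2.

(** Along the flow q = y p has derivative al q * y + be q / y, where [t] has cancelled. *)
Definition al (q : C) : C := q + 2 / 3.
Definition be (q : C) : C := q * (q - 2 / 3).

(* The part of the vector field that is constant in t; the full field is
   d/dt - 2 t dz + D0, in the coordinates y = cexp z, p = q / y. *)
Definition D0 u (b : B) : C :=
  ((2 * b.1.2 - 2 / 3) / cexp b.1.1 - cexp b.1.1) * dz u b
  + (al b.1.2 * cexp b.1.1 + be b.1.2 / cexp b.1.1) * dq u b + 2 * b.1.2 * dF u b.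

Lemma sder_ringclass b : ringclass (fun u => sder u b).
Proof.
have [c1 d1 m1] := derivable_ringclass b.1.1.
have [c2 d2 m2] := derivable_ringclass b.1.2.
have [c3 d3 m3] := derivable_ringclass b.2.
split=> [k|f g [f1 f2 f3] [g1 g2 g3]|f g [f1 f2 f3] [g1 g2 g3]].
- by split; [exact: c1|exact: c2|exact: c3].
- by split; [exact: (d1 (fun z => f (z, b.1.2, b.2)) (fun z => g (z, b.1.2, b.2)) f1 g1)
            |exact: (d2 (fun z => f (b.1.1, z, b.2)) (fun z => g (b.1.1, z, b.2)) f2 g2)
            |exact: (d3 (fun z => f (b.1.1, b.1.2, z)) (fun z => g (b.1.1, b.1.2, z)) f3 g3)].
- by split; [exact: (m1 (fun z => f (z, b.1.2, b.2)) (fun z => g (z, b.1.2, b.2)) f1 g1)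
            |exact: (m2 (fun z => f (b.1.1, z, b.2)) (fun z => g (b.1.1, z, b.2)) f2 g2)
            |exact: (m3 (fun z => f (b.1.1, b.1.2, z)) (fun z => g (b.1.1, b.1.2, z)) f3 g3)].
Qed.

Lemma sderV u b : u b != 0 -> sder u b -> sder (fun b => (u b)^-1) b.
Proof.
case: b => [[z q] F] /= ub [/= u1 u2 u3]; split.
- exact: (@derivableV _ _ (fun z => u (z, q, F)) z 1 ub u1).
- exact: (@derivableV _ _ (fun q => u (z, q, F)) q 1 ub u2).
- exact: (@derivableV _ _ (fun F => u (z, q, F)) F 1 ub u3).
Qed.

(** The Leibniz and sum rules ask for [sder] because the derivative of a nondifferentiable function
    has an arbitrary value. The last clause, locality, allows identities known on a box only to be
    differentiated. *)
Definition derivation_at (b : B) (dl : (B -> C) -> C) :=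
  [/\ forall k, dl (cst k) = 0,
      forall f g, sder f b -> sder g b -> dl (fun b => f b + g b) = dl f + dl g,
      forall f g, sder f b -> sder g b -> dl (fun b => f b * g b) = dl f * g b + f b * dl g
    & forall f g, (exists2 s, 0 < s & forall b', pd b s b' -> f b' = g b') -> dl f = dl g].

Lemma derive_local (f g : C -> C) (x : C) (s : R) : 0 < s -> (forall w, nrm (w - x) < s -> f w = g w) ->
  'D_1 f x = 'D_1 g x.
Proof.
move=> s0 H; apply: near_eq_derive.
by apply/nearP; exists s.
Qed.

Lemma derivable_local (f g : C -> C) (x : C) (s : R) : 0 < s -> (forall w, nrm (w - x) < s -> f w = g w) ->
  derivable f x 1 -> derivable g x 1.
Proof.
move=> s0 H; apply: near_eq_derivable.
by apply/nearP; exists s.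
Qed.

Lemma derivation_comp (b : B) (p : C -> B) (x : C) : p x = b ->
  (forall s w, nrm (w - x) < s -> pd b s (p w)) ->
  (forall f, sder f b -> derivable (fun w => f (p w)) x 1) ->
  derivation_at b (fun f => 'D_1 (fun w => f (p w)) x).
Proof.
move=> pb pn sd; split=> [k|f g /sd df /sd dg|f g /sd df /sd dg|f g [s s0 H]].
- exact: (@derive_cst C C C k x 1).
- exact: (@deriveD C C C (fun w => f (p w)) (fun w => g (p w)) x 1 df dg).
- have E : 'D_1 (fun w => f (p w) * g (p w)) x = f (p x) *: 'D_1 (fun w => g (p w)) x + g (p x) *: 'D_1 (fun w => f (p w)) x.
    exact: (@deriveM _ _ (fun w => f (p w)) (fun w => g (p w)) x 1 df dg).
  by rewrite E /GRing.scale /= pb addrC mulrC.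
- by apply: (derive_local s0) => w /pn/H.
Qed.

Lemma dz_derivation b : derivation_at b (fun u => dz u b).
Proof.
apply: (@derivation_comp b (fun z => (z, b.1.2, b.2)) b.1.1); first by case: b => [[? ?] ?].
- by move=> s w ws; split; rewrite //= subrr nrm0 (le_lt_trans _ ws)// nrm_ge0.
- move=> f [h _ _]; exact: h.
Qed.

Lemma dq_derivation b : derivation_at b (fun u => dq u b).
Proof.
apply: (@derivation_comp b (fun z => (b.1.1, z, b.2)) b.1.2); first by case: b => [[? ?] ?].
- by move=> s w ws; split; rewrite //= subrr nrm0 (le_lt_trans _ ws)// nrm_ge0.
- move=> f [_ h _]; exact: h.
Qed.

Lemma dF_derivation b : derivation_at b (fun u => dF u b).
Proof.
apply: (@derivation_comp b (fun z => (b.1.1, b.1.2, z)) b.2); first by case: b => [[? ?] ?].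
- by move=> s w ws; split; rewrite //= subrr nrm0 (le_lt_trans _ ws)// nrm_ge0.
- move=> f [_ _ h]; exact: h.
Qed.

Lemma derivation_lin b (d1 d2 d3 : (B -> C) -> C) (a1 a2 a3 : C) :
  derivation_at b d1 -> derivation_at b d2 -> derivation_at b d3 ->
  derivation_at b (fun u => a1 * d1 u + a2 * d2 u + a3 * d3 u).
Proof.
move=> [z1 z2 z3 z4] [q1 q2 q3 q4] [F1 F2 F3 F4].
split=> [k|f g df dg|f g df dg|f g H].
- by rewrite z1 q1 F1; ring.
- rewrite (z2 _ _ df dg) (q2 _ _ df dg) (F2 _ _ df dg); ring.
- rewrite (z3 _ _ df dg) (q3 _ _ df dg) (F3 _ _ df dg); ring.
- by rewrite (z4 f g H) (q4 f g H) (F4 f g H).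
Qed.

Lemma D0_derivation b : derivation_at b (fun u => D0 u b).
Proof. exact: derivation_lin (dz_derivation b) (dq_derivation b) (dF_derivation b). Qed.

Section Der.
Variables (b : B) (dl : (B -> C) -> C).
Hypothesis ddl : derivation_at b dl.

Lemma derivation_sum n (f : 'I_n -> B -> C) : (forall i, sder (f i) b) ->
  dl (fun b => \sum_(i < n) f i b) = \sum_(i < n) dl (f i).
Proof.
case: ddl => d1 d2 d3 d4; elim: n f => [|n IH] f sf.
  rewrite big_ord0 -[RHS](d1 0); apply: d4; exists 1 => // b' _; by rewrite big_ord0.
rewrite big_ord_recl -IH// -d2//; last exact: (ringclass_sum (sder_ringclass b)).
by apply: d4; exists 1 => // b' _; rewrite big_ord_recl.
Qed.

Lemma derivationZ k f : sder f b -> dl (fun b => f b * k) = dl f * k.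
Proof.
case: ddl => d1 d2 d3 d4 sf; have [sc _ _] := sder_ringclass b.
have -> : dl (fun b => f b * k) = dl f * k + f b * dl (cst k) := d3 f (cst k) sf (sc k).
by rewrite d1 mulr0 addr0.
Qed.

Lemma derivation_conv k (q c p : nat -> B -> C) : (forall i, sder (q i) b) -> (forall i, sder (c i) b) ->
  (exists2 s, 0 < s & forall b', pd b s b' -> \sum_(i < k.+1) q i b' * c (k - i)%N b' = p k b') ->
  \sum_(i < k.+1) (dl (q i) * c (k - i)%N b + q i b * dl (c (k - i)%N)) = dl (p k).
Proof.
case: ddl => d1 d2 d3 d4 sq sc H; have [_ _ sm] := sder_ringclass b.
rewrite -(d4 _ _ H) (derivation_sum (f := fun i b' => q i b' * c (k - i)%N b')).
  by apply: eq_bigr => i _; rewrite d3.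
by move=> i; apply: (sm).
Qed.

End Der.

Lemma sder_sdiv (q p : nat -> B -> C) b : q 0%N b != 0 -> (forall i, sder (q i) b) -> (forall i, sder (p i) b) ->
  forall k, sder (fun b => sdiv (q ^~ b) (p ^~ b) k) b.
Proof.
move=> q0 sq sp; have Sr := sder_ringclass b; have [_ _ sm] := Sr.
elim/ltn_ind => k IH.
rewrite (_ : (fun b => _) = (fun b => (p k b - \sum_(i < k) q (k - i)%N b * sdiv (q ^~ b) (p ^~ b) i) * (q 0%N b)^-1)).
  apply: (sm); last exact: sderV.
  apply: (ringclassB Sr (g := fun b => \sum_(i < k) q (k - i)%N b * sdiv (q ^~ b) (p ^~ b) i)) => //.
  by apply: (ringclass_sum Sr) => i; apply: (sm) => //; exact: IH.
by apply/funext => b'; rewrite sdivE.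
Qed.

End Derivations.

Section RevIdentity.
Variable K : fieldType.

Lemma rev_der_horner n (a az a0 : nat -> K) x : x != 0 ->
  (rev_der n (\poly_(i < n.+1) a (n - i)%N) (\poly_(i < n.+1) az (n - i)%N) (\poly_(i < n.+1) a0 (n - i)%N)).[x]
  = x ^+ n.+1 * ((\poly_(i < n.+1) a i)^`() - 2 * 'X * (\poly_(i < n.+1) az i) + \poly_(i < n.+1) a0 i).[x^-1].
Proof.
move=> x0; rewrite /rev_der rev_poly_deriv.
set A := \poly_(i < n.+1) a i.
have two : (2 : {poly K}) = (2 : K)%:P by rewrite rmorph_nat.
have mtwo : (- 2 : {poly K}) = (- 2 : K)%:P by rewrite rmorphN rmorph_nat.
rewrite mtwo two !(hornerD, hornerN, hornerM, hornerX, hornerC, hornerXn).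
rewrite (rev_poly_horner _ az)// (rev_poly_horner _ a0)//.
rewrite (rev_poly_horner n (fun i => ('X * A^`())`_i))//.
have -> : (\poly_(i < n.+1) ('X * A^`())`_i).[x^-1] = x^-1 * A^`().[x^-1].
  have -> : \poly_(i < n.+1) ('X * A^`())`_i = 'X * A^`(); last by rewrite hornerM hornerX.
  apply/polyP => i; rewrite coef_poly; case: ltnP => // ni; rewrite coefXM coef_deriv coef_poly.
  by case: i ni => // i ni /=; rewrite ltnNge ni mul0rn.
by rewrite exprS; field.
Qed.

End RevIdentity.

(** The substitution t = 1 / x, verified by evaluating at the points x of a disc around 1, which
    avoids x = 0. *)
Lemma rev_identity (R : realType) l m (q qz q0 p pz p0 : nat -> R[i]) :
  let Q := \poly_(i < m.+1) q i in let Qz := \poly_(i < m.+1) qz i in let Q0 := \poly_(i < m.+1) q0 i in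
  let P := \poly_(i < l.+1) p i in let Pz := \poly_(i < l.+1) pz i in let P0 := \poly_(i < l.+1) p0 i in
  P * (Q^`() - 2 * 'X * Qz + Q0) = Q * (P^`() - 2 * 'X * Pz + P0) ->
  (\poly_(i < l.+1) p (l - i)%N) * rev_der m (\poly_(i < m.+1) q (m - i)%N)
     (\poly_(i < m.+1) qz (m - i)%N) (\poly_(i < m.+1) q0 (m - i)%N)
  = (\poly_(i < m.+1) q (m - i)%N) * rev_der l (\poly_(i < l.+1) p (l - i)%N)
     (\poly_(i < l.+1) pz (l - i)%N) (\poly_(i < l.+1) p0 (l - i)%N).
Proof.
move=> Q Qz Q0 P Pz P0 I1.
apply/eqP; rewrite -subr_eq0; apply/eqP; apply: (@poly_disc0 _ _ 1 1) => // x x1.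
have x0 : x != 0 by apply/eqP => x0; move: x1; rewrite x0 sub0r nrmN nrm1 ltxx.
rewrite hornerD hornerN !hornerM (rev_der_horner m q qz q0 x0) (rev_der_horner l p pz p0 x0).
rewrite (rev_poly_horner m q x0) (rev_poly_horner l p x0) -/Q -/P -/Qz -/Q0 -/Pz -/P0.
have := congr1 (fun S : {poly R[i]} => S.[x^-1]) I1; rewrite /= !hornerM => I2.
set A := (_ + Q0).[_] in I2 *; set D := (_ + P0).[_] in I2 *.
transitivity (x ^+ l * x ^+ m * x * (P.[x^-1] * A - Q.[x^-1] * D)); first by rewrite !exprS; ring.
by rewrite I2 subrr mulr0.
Qed.

Lemma pde_cofactor (K : comPzRingType) (t ph x y w Q Qd Qz Q0 P Pd Pz P0 : K) :
  Pz = y * Q + ph * Qz -> P0 = w * Q + ph * Q0 -> P = ph * Q -> Pd = x * Q + ph * Qd ->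
  x - 2 * t * y + w = 0 -> P * (Qd - 2 * t * Qz + Q0) - Q * (Pd - 2 * t * Pz + P0) = 0.
Proof.
move=> -> -> -> -> pde; transitivity (- Q ^+ 2 * (x - 2 * t * y + w)); first by ring.
by rewrite pde mulr0.
Qed.

(** Coefficients of the reversed polynomial, in the variable 1 / t; [z] is the zero used beyond the
    degree. *)
Definition rv (T V : Type) (z : V) (q : nat -> T -> V) m i : T -> V := if (i <= m)%N then q (m - i)%N else cst z.

(** [Cf k] is the coefficient of t^(l-m-k) in the expansion of [phi] at infinity. The field
    [ls_ring] records that [q] and [p] are polynomial expressions in finitely many values of [phi]
    at fixed times, so that they inherit whatever these values share; global information in z enters
    only this way. In [ls_lead] the numerator degree is exact unless the numerator is zero. *)
Record local_series (R : realType) (phi : R[i] * R[i] * R[i] -> R[i] -> R[i]) t0 (r0 : R) c (r : R) l m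
   (p q Cf : nat -> R[i] * R[i] * R[i] -> R[i]) : Prop := LocalSeries {
  ls_q : forall b, pd c r b -> q m b != 0;
  ls_eq : forall b t, pd c r b -> nrm (t - t0) < r0 ->
    phi b t * (\poly_(i < m.+1) q i b).[t] = (\poly_(i < l.+1) p i b).[t];
  ls_sder : forall b k, pd c r b -> sder (Cf k) b;
  ls_conv : forall b k, pd c r b -> \sum_(i < k.+1) rv 0 q m i b * Cf (k - i)%N b = rv 0 p l k b;
  ls_rec : forall b k, pd c r b -> 2 * dz (Cf k) b =
    if k is k1.+1 then D0 (Cf k1) b + (if k1 is k2.+1 then (l%:R - m%:R - k2%:R) * Cf k2 b else 0) else 0;
  ls_ring : forall S, ringclass S -> (forall t, nrm (t - t0) < r0 -> S (phi ^~ t)) -> forall i, S (q i) /\ S (p i);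
  ls_lead : (forall b, pd c r b -> p l b != 0) \/ (forall b i, pd c r b -> p i b = 0) }.

(** * A common degree bound for rationality in t *)

Section LocalRat.
Variable R : realType.
Local Notation C := R[i].
Local Notation B := (C * C * C)%type.
Variables (phi : B -> C -> C) (c0 : B) (t0 : C) (r0 : R).
Hypothesis r0_gt0 : 0 < r0.
Hypothesis phi_cont : forall b t, pd c0 r0 b -> nrm (t - t0) < r0 -> {for b, continuous (phi ^~ t)}.
Hypothesis phi_sder : forall b t, pd c0 r0 b -> nrm (t - t0) < r0 -> sder (phi ^~ t) b.
Hypothesis phi_dert : forall b t, pd c0 r0 b -> nrm (t - t0) < r0 -> derivable (phi b) t 1.
Hypothesis phi_pde : forall b t, pd c0 r0 b -> nrm (t - t0) < r0 ->
  'D_1 (phi b) t - 2 * t * dz (phi ^~ t) b + D0 (phi ^~ t) b = 0.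
Hypothesis phi_rat : forall b, pd c0 r0 b -> exists P Q : {poly C}, Q != 0 /\
  forall t, nrm (t - t0) < r0 -> phi b t * Q.[t] = P.[t].

Local Notation disc t := (nrm (t - t0) < r0).

(** The sequence 1, phi, t, t phi, t^2, ... of functions of [t]: rationality of phi is a linear
    dependence among finitely many of them. *)
Let e (j : nat) (b : B) (t : C) : C := if odd j then phi b t * t ^+ j./2 else t ^+ j./2.

(** These sampled determinants vanish for all choices of [tau] in the disc exactly if the first k
    functions are dependent there; in this form dependence is a closed condition on [b]. *)
Let Dk k (b : B) (tau : 'I_k -> C) : C := \det (\matrix_(i, j) e (nat_of_ord j) b (tau i)).

Let ring_e (S : (B -> C) -> Prop) : ringclass S -> forall t, S (phi ^~ t) -> forall j, S (fun b => e j b t).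
Proof.
case=> Sc _ SM t St j; rewrite /e; case: (odd j); last exact: Sc.
exact: (SM _ (cst (t ^+ j./2))).
Qed.

Let ring_Dk (S : (B -> C) -> Prop) : ringclass S -> forall k (tau : 'I_k -> C),
  (forall i, S (phi ^~ (tau i))) -> S (fun b => Dk b tau).
Proof.
move=> Sr k tau St; apply: (ringclass_det Sr (M := fun i j b => e (nat_of_ord j) b (tau i))) => i j.
exact: ring_e.
Qed.

(** Off the large box [E k] holds vacuously, which keeps its complement open. *)
Let E k (b : B) := pd c0 r0 b -> forall tau : 'I_k -> C, (forall i, disc (tau i)) -> Dk b tau = 0.

(** The coefficients of Q at odd and of -P at even places form a kernel vector of the sampled
    matrix, of length 2 (size P + size Q). It is nonzero at the place of the leading coefficient of
    Q. *)
Let EP b : pd c0 r0 b -> exists k, E k b.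
Proof.
move=> b0; have [P [Q [Q0 H]]] := phi_rat b0; set d := (size P + size Q)%N.
exists d.*2 => _ tau tt; rewrite /Dk; set A := \matrix_(i, j) _.
pose v : 'cV[C]_d.*2 := \col_(j < d.*2) (if odd j then Q`_j./2 else - P`_j./2).
have Av : A *m v = 0.
  apply/matrixP => i j0; rewrite !mxE.
  transitivity (\sum_(j < d.*2) (if odd j then phi b (tau i) * (Q`_j./2 * tau i ^+ j./2) else - (P`_j./2 * tau i ^+ j./2))).
    by apply: eq_bigr => j _; rewrite !mxE /e; case: (odd j); ring.
  have step n : \sum_(j < n.*2) (if odd j then phi b (tau i) * (Q`_j./2 * tau i ^+ j./2) else - (P`_j./2 * tau i ^+ j./2))
     = phi b (tau i) * (\sum_(j < n) Q`_j * tau i ^+ j) - \sum_(j < n) P`_j * tau i ^+ j.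
    elim: n => [|n IH]; first by rewrite !big_ord0 mulr0 subr0.
    rewrite doubleS !big_ord_recr /= IH odd_double /= doubleK.
    have -> : uphalf n.*2 = n by rewrite uphalf_double.
    by ring.
  rewrite step -(horner_coef_wide (tau i) (leq_addl (size P) (size Q))) -(horner_coef_wide (tau i) (leq_addr (size Q) (size P))).
  by rewrite H// subrr.
have : \det A *: v = 0.
  by rewrite -mul_scalar_mx -mul_adj_mx -mulmxA Av mulmx0.
move=> /matrixP vz.
have lead : (((size Q).-1).*2.+1 < d.*2)%N.
  by rewrite ltn_Sdouble (leq_trans _ (leq_addl _ _))// ltn_predL size_poly_gt0.
have := vz (Ordinal lead) 0; rewrite !mxE /= odd_double /= uphalf_double => /eqP.
by rewrite mulf_eq0 -[Q`_ _]/(lead_coef Q) lead_coef_eq0 (negbTE Q0) orbF => /eqP.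
Qed.

Let cont_Dk k (tau : 'I_k -> C) b : pd c0 r0 b -> (forall i, disc (tau i)) ->
  {for b, continuous (fun b => Dk b tau)}.
Proof.
move=> b0 dt; have := @ring_Dk _ (@continuous_ringclass R _ b) k tau; apply=> i; exact: phi_cont.
Qed.

Let E_closed k b : ~ E k b -> exists2 s, 0 < s & forall b', pd b s b' -> ~ E k b'.
Proof.
move=> nE; have [b0 [tau [dt D]]] : pd c0 r0 b /\ exists tau : 'I_k -> C, (forall i, disc (tau i)) /\ Dk b tau != 0.
  apply: contrapT => h; apply: nE => b0 tau dt; apply: contrapT => D; apply: h; split=> //.
  by exists tau; split=> //; apply/eqP.
have [s s0 sP] := continuous_neq0 (cont_Dk b0 dt) D; have [s' s'0 s'P] := pd_sub b0.
exists (Num.min s s'); first by rewrite lt_min s0.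
move=> b' bb' H; have b's : pd b s b' by apply: pd_le bb'; rewrite ge_min lexx.
have b's' : pd b s' b' by apply: pd_le bb'; rewrite ge_min lexx orbT.
by have := sP _ b's; rewrite (H (s'P _ b's')) ?eqxx.
Qed.

Lemma derivation_poly (b : B) (dl : (B -> C) -> C) n (q : nat -> B -> C) t : derivation_at b dl ->
  (forall i, sder (q i) b) ->
  dl (fun b => (\poly_(i < n) q i b).[t]) = (\poly_(i < n) dl (q i)).[t].
Proof.
move=> ddl sq; have [_ _ _ dloc] := ddl; have [sc _ sm] := sder_ringclass b.
transitivity (\sum_(i < n) dl (fun b => q i b * t ^+ i)); last first.
  by rewrite horner_poly; apply: eq_bigr => i _; exact: (derivationZ ddl (t ^+ i) (sq i)).
rewrite -(derivation_sum ddl (f := fun i b => q i b * t ^+ i)).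
  by apply: dloc; exists 1 => // b' _; rewrite horner_poly.
by move=> i; apply: (sm (q i) (cst (t ^+ i))).
Qed.

Lemma sder_poly (b : B) n (q : nat -> B -> C) t : (forall i, sder (q i) b) ->
  sder (fun b => (\poly_(i < n) q i b).[t]) b.
Proof.
move=> sq; have Sr := sder_ringclass b; have [sc _ sm] := Sr.
rewrite (_ : (fun b => _) = (fun b => \sum_(i < n) q i b * t ^+ i)).
  by apply: (ringclass_sum Sr) => i; apply: (sm (q i) (cst (t ^+ i))).
by apply/funext => b'; rewrite horner_poly.
Qed.

(** phi Q = P is differentiated along dz, D0 and d/dt at [b], which brings the equation for phi into
    the form that the formal recursion takes as input. *)
Lemma ls_recursion (b : B) (s : R) l m (q p Cf : nat -> B -> C) : 0 < s ->
  (forall b', pd b s b' -> pd c0 r0 b') ->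
  (forall b' t, pd b s b' -> disc t ->
     phi b' t * (\poly_(i < m.+1) q i b').[t] = (\poly_(i < l.+1) p i b').[t]) ->
  (forall i, sder (q i) b) -> (forall i, sder (p i) b) -> (forall i, sder (Cf i) b) -> q m b != 0 ->
  (forall b' k, pd b s b' -> \sum_(i < k.+1) rv 0 q m i b' * Cf (k - i)%N b' = rv 0 p l k b') ->
  forall k, 2 * dz (Cf k) b =
    if k is k1.+1 then D0 (Cf k1) b + (if k1 is k2.+1 then (l%:R - m%:R - k2%:R) * Cf k2 b else 0) else 0.
Proof.
move=> s0 sub eqn sq sp sC qm conv.
have bb := pd_center b s0; have b0 := sub _ bb.
have [sc _ sm] := sder_ringclass b.
have der_eq (dl : (B -> C) -> C) t : derivation_at b dl -> disc t ->
    dl (phi ^~ t) * (\poly_(i < m.+1) q i b).[t] + phi b t * (\poly_(i < m.+1) dl (q i)).[t]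
    = (\poly_(i < l.+1) dl (p i)).[t].
  move=> ddl dt; have [_ _ dM dloc] := ddl.
  rewrite -(derivation_poly _ _ ddl sp) -(derivation_poly _ _ ddl sq).
  rewrite -(dM _ _ (phi_sder b0 dt) (sder_poly _ _ sq)).
  by apply: dloc; exists s => // b' bb'; exact: eqn.
pose Q := \poly_(i < m.+1) q i b; pose P := \poly_(i < l.+1) p i b.
pose Qz := \poly_(i < m.+1) dz (q i) b; pose Pz := \poly_(i < l.+1) dz (p i) b.
pose Q0 := \poly_(i < m.+1) D0 (q i) b; pose P0 := \poly_(i < l.+1) D0 (p i) b.
have dt_eq t : disc t -> 'D_1 (phi b) t * Q.[t] + phi b t * Q^`().[t] = P^`().[t].
  move=> dt; have s1 : 0 < r0 - nrm (t - t0) by rewrite subr_gt0.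
  have PE : 'D_1 (fun w => P.[w]) t = P^`().[t] by have [_ ->] := is_derive_horner P t.
  have QE : 'D_1 (fun w => Q.[w]) t = Q^`().[t] by have [_ ->] := is_derive_horner Q t.
  have Qd : derivable (fun w => Q.[w]) t 1 by have [h _] := is_derive_horner Q t.
  have dP := phi_dert b0 dt.
  rewrite -PE -QE.
  have -> : 'D_1 (fun w => P.[w]) t = 'D_1 (fun w => phi b w * Q.[w]) t.
    apply: (derive_local s1) => w wt; rewrite eqn//.
    by apply: (le_lt_trans (nrm_triangle w t t0)); rewrite -ltrBrDr.
  have -> : 'D_1 (fun w => phi b w * Q.[w]) t = phi b t *: 'D_1 (fun w => Q.[w]) t + Q.[t] *: 'D_1 (phi b) t.
    exact: (@deriveM _ _ (phi b) (fun w => Q.[w]) t 1 dP Qd).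
  by rewrite /GRing.scale /= addrC [Q.[t] * _]mulrC.
have I1 : P * (Q^`() - 2 * 'X * Qz + Q0) = Q * (P^`() - 2 * 'X * Pz + P0).
  apply/eqP; rewrite -subr_eq0; apply/eqP; apply: (@poly_disc0 _ _ t0 r0) => // t dt.
  have two : (2 : {poly C}) = (2 : C)%:P by rewrite rmorph_nat.
  rewrite two !(hornerD, hornerN, hornerM, hornerX, hornerC).
  have Ez : Pz.[t] = dz (phi ^~ t) b * Q.[t] + phi b t * Qz.[t] := esym (der_eq _ t (dz_derivation b) dt).
  have E0 : P0.[t] = D0 (phi ^~ t) b * Q.[t] + phi b t * Q0.[t] := esym (der_eq _ t (D0_derivation b) dt).
  have Ep : P.[t] = phi b t * Q.[t] := esym (eqn _ _ bb dt).
  exact: (pde_cofactor Ez E0 Ep (esym (dt_eq _ dt)) (phi_pde b0 dt)).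
have qE (f : (B -> C) -> C) : f (cst 0) = 0 -> forall i, (\poly_(i < m.+1) f (q (m - i)%N))`_i = f (rv 0 q m i).
  by move=> f0 i; rewrite coef_poly /rv ltnS; case: leqP.
have pE (f : (B -> C) -> C) : f (cst 0) = 0 -> forall i, (\poly_(i < l.+1) f (p (l - i)%N))`_i = f (rv 0 p l i).
  by move=> f0 i; rewrite coef_poly /rv ltnS; case: leqP.
have dz0 : dz (cst 0 : B -> C) b = 0 by have [h _ _ _] := dz_derivation b; exact: h.
have D00 : D0 (cst 0 : B -> C) b = 0 by have [h _ _ _] := D0_derivation b; exact: h.
have rsq i : sder (rv 0 q m i) b by rewrite /rv; case: leqP => _ //; exact: sc.
have rsp i : sder (rv 0 p l i) b by rewrite /rv; case: leqP => _ //; exact: sc.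
apply: (@series_recursion _ l m (\poly_(i < m.+1) q (m - i)%N b) (\poly_(i < m.+1) dz (q (m - i)%N) b)
   (\poly_(i < m.+1) D0 (q (m - i)%N) b) (\poly_(i < l.+1) p (l - i)%N b) (\poly_(i < l.+1) dz (p (l - i)%N) b)
   (\poly_(i < l.+1) D0 (p (l - i)%N) b) (fun k => Cf k b) (fun k => dz (Cf k) b) (fun k => D0 (Cf k) b)).
- by rewrite coef_poly /= subn0.
- move=> k; apply: etrans (etrans _ (conv _ _ bb)) (esym (pE (fun u => u b) erefl k)).
  by apply: eq_bigr => i _; congr (_ * _); exact: (qE (fun u => u b) erefl i).
- move=> k; apply: etrans (etrans _ (derivation_conv (dz_derivation b) rsq sC (k := k) (p := rv 0 p l) _)) (esym (pE (fun u => dz u b) dz0 k)).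
    apply: eq_bigr => i _; congr (_ * _ + _ * _); first exact: (qE (fun u => dz u b) dz0 i).
    exact: (qE (fun u => u b) erefl i).
  exists s; [exact: s0|move=> b' bb'; exact: (conv b' k bb')].
- move=> k; apply: etrans (etrans _ (derivation_conv (D0_derivation b) rsq sC (k := k) (p := rv 0 p l) _)) (esym (pE (fun u => D0 u b) D00 k)).
    apply: eq_bigr => i _; congr (_ * _ + _ * _); first exact: (qE (fun u => D0 u b) D00 i).
    exact: (qE (fun u => u b) erefl i).
  exists s; [exact: s0|move=> b' bb'; exact: (conv b' k bb')].
exact: (rev_identity (q := fun i => q i b) (qz := fun i => dz (q i) b) (q0 := fun i => D0 (q i) b)
  (p := fun i => p i b) (pz := fun i => dz (p i) b) (p0 := fun i => D0 (p i) b) I1).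
Qed.

Section Cofactors.
Variables (k : nat) (tau : 'I_k -> C).
Hypothesis tau_disc : forall i, disc (tau i).

(** Cofactors of the first row of the matrix of order k + 1 whose first row is sampled at a free
    time and the others at [tau]. Laplace expansion turns the vanishing determinant into a linear
    relation with these coefficients, valid at every time. *)
Let v (j : nat) (b : B) : C :=
  if (j <= k)%N then (-1) ^+ j * \det (\matrix_(i, j') e (bump j (nat_of_ord (j' : 'I_k))) b (tau i)) else 0.

Let ring_v (S : (B -> C) -> Prop) : ringclass S -> (forall t, disc t -> S (phi ^~ t)) -> forall j, S (v j).
Proof.
move=> Sr St j; have [Sc _ SM] := Sr; rewrite /v; case: leqP => _; last exact: Sc.
apply: (SM (cst ((-1) ^+ j)) (fun b => \det (\matrix_(i, j') e (bump j (nat_of_ord (j' : 'I_k))) b (tau i)))).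
  exact: Sc.
apply: (ringclass_det Sr (M := fun i (j' : 'I_k) b => e (bump j (nat_of_ord j')) b (tau i))) => i j'.
by apply: (ring_e Sr); apply: St.
Qed.

Let v_last b : v k b = (-1) ^+ k * Dk b tau.
Proof.
rewrite /v leqnn; congr (_ * \det _); apply/matrixP => i j; rewrite !mxE.
by rewrite /bump leqNgt ltn_ord add0n.
Qed.

Let v_eq b t : pd c0 r0 b -> disc t -> E k.+1 b -> \sum_(j < k.+1) e j b t * v j b = 0.
Proof.
move=> b0 dt Eb.
pose tau' (i : 'I_k.+1) := if unlift ord0 i is Some i' then tau i' else t.
have dt' i : disc (tau' i) by rewrite /tau'; case: unlift.
have := Eb b0 tau' dt'; rewrite /Dk (expand_det_row _ ord0) => H; rewrite -[RHS]H.
apply: eq_bigr => j _; rewrite mxE /tau' unlift_none; congr (_ * _).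
rewrite /v leq_ord /cofactor add0n; congr (_ * \det _).
by apply/matrixP => i j'; rewrite !mxE liftK.
Qed.

Lemma double_sum (V : nmodType) (f : nat -> V) n :
  \sum_(j < n.*2) f j = \sum_(i < n) f i.*2 + \sum_(i < n) f i.*2.+1.
Proof.
elim: n => [|n IH]; first by rewrite !big_ord0 addr0.
by rewrite doubleS !big_ord_recr /= IH -!addrA; congr (_ + _); rewrite [RHS]addrCA addrA addrAC -!addrA addrCA.
Qed.

Let v_rel b t : pd c0 r0 b -> disc t -> E k.+1 b ->
  phi b t * (\poly_(i < k.+1) v i.*2.+1 b).[t] = (\poly_(i < k.+1) - v i.*2 b).[t].
Proof.
move=> b0 dt Eb; have := v_eq b0 dt Eb.
have -> : \sum_(j < k.+1) e j b t * v j b = \sum_(j < k.+1.*2) e j b t * v j b.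
  rewrite -!(big_mkord xpredT (fun j => e j b t * v j b)).
  rewrite [RHS](@big_cat_nat _ _ _ k.+1)//=; last by rewrite -addnn leq_addr.
  have -> : \sum_(k.+1 <= j < k.+1.*2) e j b t * v j b = 0; last by rewrite addr0.
  rewrite big_nat_cond big1// => j /andP[/andP[kj _] _].
  by rewrite /v leqNgt kj mulr0.
rewrite (double_sum (fun j => e j b t * v j b)) !horner_poly => /eqP; rewrite addrC addr_eq0 => /eqP H.
transitivity (\sum_(i < k.+1) e i.*2.+1 b t * v i.*2.+1 b).
  rewrite mulr_sumr; apply: eq_bigr => i _; rewrite /e /= odd_double /= uphalf_double; ring.
rewrite H -sumrN; apply: eq_bigr => i _; rewrite /e odd_double doubleK; ring.
Qed.

(** The odd cofactors give the denominator and the even ones, negated, the numerator. The box is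
    then shrunk twice so that both leading coefficients have no zeros, apart from the case of a zero
    numerator. *)
Lemma local_rat_step b1 s1 : 0 < s1 -> (forall b, pd b1 s1 b -> pd c0 r0 b) ->
  (forall b, pd b1 s1 b -> E k.+1 b) -> (forall b, pd b1 s1 b -> Dk b tau != 0) ->
  exists c r l m p q Cf, [/\ 0 < r, forall b, pd c r b -> pd b1 s1 b & local_series phi t0 r0 c r l m p q Cf].
Proof.
move=> s10 sub E1 D1.
pose q i b := v i.*2.+1 b; pose p i b := - v i.*2 b.
have vc j b : pd b1 s1 b -> {for b, continuous (v j)}.
  by move=> /sub b0; apply: (ring_v (@continuous_ringclass R _ b)) => t dt; apply: phi_cont.
have vs j b : pd b1 s1 b -> sder (v j) b.
  by move=> /sub b0; apply: (ring_v (sder_ringclass b)) => t dt; apply: phi_sder.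
have pc j b : pd b1 s1 b -> {for b, continuous (p j)}.
  by move=> /(vc j.*2) h; apply: (ringclassN (@continuous_ringclass R _ b)).
(* If all odd cofactors vanished, the relation would annihilate the even ones too, against v k !=
   0. *)
have q_ex b : pd b1 s1 b -> exists2 i, (i <= k)%N & q i b != 0.
  move=> b1b; apply: contrapT => h.
  have q0 i : (i <= k)%N -> q i b = 0.
    by move=> ik; apply: contrapT => /eqP qn; apply: h; exists i.
  have Q0 : \poly_(i < k.+1) v i.*2.+1 b = 0.
    by apply/polyP => i; rewrite coef_poly coef0; case: ltnP => // /q0.
  have P0 : \poly_(i < k.+1) - v i.*2 b = 0.
    apply: (@poly_disc0 _ _ t0 r0) => // t dt.
    by rewrite -(v_rel (sub _ b1b) dt (E1 _ b1b)) Q0 horner0 mulr0.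
  have : v k b = 0.
    rewrite -(odd_double_half k); case: (odd k) (odd_double_half k) => /= kE.
      by rewrite add1n; apply: q0; rewrite -[X in (_ <= X)%N]kE add1n (leq_trans _ (leqnSn _))// -addnn leq_addr.
    rewrite add0n; apply/eqP; rewrite -oppr_eq0; apply/eqP.
    have := congr1 (fun P : {poly C} => P`_k./2) P0; rewrite coef_poly coef0 ifT//.
    by rewrite ltnS -[X in (_ <= X)%N]kE add0n -addnn leq_addr.
  by rewrite v_last => /eqP; rewrite mulf_eq0 signr_eq0 (negbTE (D1 _ b1b)).
have exm : exists m, `[< exists2 b, pd b1 s1 b & (m <= k)%N /\ q m b != 0 >].
  have [i ik qi] := q_ex b1 (pd_center b1 s10); exists i; apply/asboolP; exists b1 => //; exact: pd_center.
have bm m : `[< exists2 b, pd b1 s1 b & (m <= k)%N /\ q m b != 0 >] -> (m <= k)%N.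
  by move=> /asboolP[b _ []].
(* The largest index whose coefficient is nonzero somewhere on the box: all higher coefficients
   vanish identically there. *)
have [m /asboolP[b2 b12 [mk qm]] m_max] := ex_maxnP exm bm.
have [s2 s20 s2P] := continuous_neq0 (vc m.*2.+1 _ b12) qm; have [s2' s2'0 s2'P] := pd_sub b12.
pose s3 := Num.min s2 s2'; have s30 : 0 < s3 by rewrite lt_min s20.
have s3q b : pd b2 s3 b -> q m b != 0.
  by move=> h; apply: s2P; apply: pd_le h; rewrite ge_min lexx.
have s3s b : pd b2 s3 b -> pd b1 s1 b.
  by move=> h; apply: s2'P; apply: pd_le h; rewrite ge_min lexx orbT.
have q_hi b i : pd b2 s3 b -> (m < i <= k)%N -> q i b = 0.
  move=> /s3s bb /andP[mi ik]; apply: contrapT => /eqP qi.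
  have : (i <= m)%N by apply: m_max; apply/asboolP; exists b.
  by rewrite leqNgt mi.
have [l [b3 [s4 [s40 lk s4s p_hi lead]]]] : exists l b3 s4, [/\ 0 < s4, (l <= k)%N,
    forall b, pd b3 s4 b -> pd b2 s3 b, forall b i, pd b3 s4 b -> (l < i)%N -> p i b = 0 &
    (forall b, pd b3 s4 b -> p l b != 0) \/ (forall b i, pd b3 s4 b -> p i b = 0)].
  have p_big b i : (k < i)%N -> p i b = 0.
    by move=> ki; rewrite /p /v leqNgt (leq_trans ki) ?oppr0// -addnn leq_addr.
  have [exl|nexl] := pselect (exists l, `[< exists2 b, pd b2 s3 b & p l b != 0 >]); last first.
    exists 0%N, b2, s3; have pz b i : pd b2 s3 b -> p i b = 0.
      by move=> bb; apply: contrapT => /eqP pn; apply: nexl; exists i; apply/asboolP; exists b.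
    by split=> //; [move=> b i bb _; exact: pz|right].
  have bl l : `[< exists2 b, pd b2 s3 b & p l b != 0 >] -> (l <= k)%N.
    by move=> /asboolP[b _ pl]; rewrite leqNgt; apply/negP => /(p_big b) pl0; rewrite pl0 eqxx in pl.
  have [l /asboolP[b3 b23 pl] l_max] := ex_maxnP exl bl.
  have [s5 s50 s5P] := continuous_neq0 (pc l _ (s3s _ b23)) pl; have [s5' s5'0 s5'P] := pd_sub b23.
  have sub5 b : pd b3 (Num.min s5 s5') b -> pd b2 s3 b.
    by move=> h; apply: s5'P; apply: pd_le h; rewrite ge_min lexx orbT.
  exists l, b3, (Num.min s5 s5'); split=> //.
  - by rewrite lt_min s50.
  - by apply: bl; apply/asboolP; exists b3.
  - move=> b i bb li; apply: contrapT => /eqP pn.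
    have : (i <= l)%N by apply: l_max; apply/asboolP; exists b => //; exact: sub5.
    by rewrite leqNgt li.
  - by left=> b h; apply: s5P; apply: pd_le h; rewrite ge_min lexx.
have in1 b : pd b3 s4 b -> pd b1 s1 b by move=> /s4s/s3s.
have QE b : pd b3 s4 b -> \poly_(i < k.+1) v i.*2.+1 b = \poly_(i < m.+1) q i b.
  move=> bb; apply/polyP => i; rewrite !coef_poly; case: (ltnP i k.+1) => ik; last first.
    by have -> : (i < m.+1)%N = false by apply/negbTE; rewrite -leqNgt (leq_trans _ ik).
  case: (ltnP i m.+1) => // mi; apply: q_hi; [exact: s4s|].
  by rewrite mi.
have PE b : pd b3 s4 b -> \poly_(i < k.+1) - v i.*2 b = \poly_(i < l.+1) p i b.
  move=> bb; apply/polyP => i; rewrite !coef_poly; case: (ltnP i k.+1) => ik; last first.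
    by have -> : (i < l.+1)%N = false by apply/negbTE; rewrite -leqNgt (leq_trans _ ik).
  by case: (ltnP i l.+1) => // li; apply: p_hi.
have eqn b t : pd b3 s4 b -> disc t -> phi b t * (\poly_(i < m.+1) q i b).[t] = (\poly_(i < l.+1) p i b).[t].
  by move=> bb dt; rewrite -QE// -PE//; apply: v_rel => //; [exact/sub/in1|exact/E1/in1].
have qs j b : pd b3 s4 b -> sder (q j) b by move=> /in1; exact: vs.
have ps j b : pd b3 s4 b -> sder (p j) b.
  by move=> /in1/(vs j.*2) h; apply: (ringclassN (sder_ringclass b)).
have scst (b : B) : sder (cst 0 : B -> C) b by have [h _ _] := sder_ringclass b; exact: h.
have rqs j b : pd b3 s4 b -> sder (rv 0 q m j) b by move=> bb; rewrite /rv; case: leqP => _; [exact: qs|exact: scst].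
have rps j b : pd b3 s4 b -> sder (rv 0 p l j) b by move=> bb; rewrite /rv; case: leqP => _; [exact: ps|exact: scst].
have q0 b : pd b3 s4 b -> rv 0 q m 0 b != 0 by move=> bb; rewrite /rv leq0n subn0; exact/s3q/s4s.
pose Cf i b := sdiv (rv 0 q m ^~ b) (rv 0 p l ^~ b) i.
have Cfs b i : pd b3 s4 b -> sder (Cf i) b.
  by move=> bb; apply: sder_sdiv; [exact: q0|move=> j; exact: rqs|move=> j; exact: rps].
have conv b i : pd b3 s4 b -> \sum_(j < i.+1) rv 0 q m j b * Cf (i - j)%N b = rv 0 p l i b.
  by move=> bb; apply: (@sdivP _ (rv 0 q m ^~ b)); exact: q0.
exists b3, s4, l, m, p, q, Cf; split; [exact: s40|exact: in1|split].
- by move=> b bb; exact/s3q/s4s.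
- by move=> b t bb dt; exact: eqn.
- by move=> b i bb; exact: Cfs.
- by move=> b i bb; exact: conv.
- move=> b i bb; have [s' s'0 s'P] := pd_sub bb.
  apply: (@ls_recursion b s' l m q p Cf s'0).
  + by move=> b' bb'; exact/sub/in1/s'P.
  + by move=> b' t bb' dt; apply: eqn => //; exact: s'P.
  + by move=> j; exact: qs.
  + by move=> j; exact: ps.
  + by move=> j; exact: Cfs.
  + exact/s3q/s4s.
  + by move=> b' j bb'; apply: conv; exact: s'P.
- move=> S Sr St i; split; first exact: ring_v.
  by apply: (ringclassN Sr); exact: ring_v.
- exact: lead.
Qed.

End Cofactors.

(** Baire gives a box on which one [E k] holds. With k least over all boxes, some determinant of
    order k - 1 is nonzero at a point of the box, hence on a smaller box. *)
Theorem local_rat : exists c r l m p q Cf, [/\ 0 < r, forall b, pd c r b -> pd c0 r0 b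
  & local_series phi t0 r0 c r l m p q Cf].
Proof.
have [k0 [c1 [r1 [r10 sub1 E1]]]] := pd_baire r0_gt0 E_closed EP.
pose Pk k := `[< exists c r, [/\ 0 < r, forall b, pd c r b -> pd c0 r0 b & forall b, pd c r b -> E k b] >].
have exk : exists k, Pk k by exists k0; apply/asboolP; exists c1, r1.
have [k /asboolP[c2 [r2 [r20 sub2 E2]]] k_min] := ex_minnP exk.
(* Order 0 is excluded because the empty determinant is 1. *)
case: k E2 k_min => [|k] E2 k_min.
  have : Dk c2 (fun _ : 'I_0 => t0) = 0.
    by apply: (E2 c2 (pd_center _ r20) (sub2 _ (pd_center _ r20))) => -[].
  by rewrite /Dk det_mx00 => /eqP; rewrite oner_eq0.
have [b1 b12 [b10 [tau [dt D]]]] : exists2 b1, pd c2 r2 b1 & pd c0 r0 b1 /\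
    exists tau : 'I_k -> C, (forall i, disc (tau i)) /\ Dk b1 tau != 0.
  apply: contrapT => h; have : (k.+1 <= k)%N; last by rewrite ltnn.
  apply: k_min; apply/asboolP; exists c2, r2; split=> // b bb b0 tau dt; apply: contrapT => D.
  by apply: h; exists b => //; split=> //; exists tau; split=> //; apply/eqP.
have [s s0 sP] := continuous_neq0 (cont_Dk b10 dt) D; have [s' s'0 s'P] := pd_sub b12.
pose s1 := Num.min s s'; have s10 : 0 < s1 by rewrite lt_min s0.
have h1 b : pd b1 s1 b -> pd c2 r2 b.
  by move=> h; apply: s'P; apply: pd_le h; rewrite ge_min lexx orbT.
have h2 b : pd b1 s1 b -> Dk b tau != 0.
  by move=> h; apply: sP; apply: pd_le h; rewrite ge_min lexx.
have [c [r [l [m [p [q [Cf [rr sub ls]]]]]]]] := local_rat_step dt s10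
  (fun b h => sub2 _ (h1 b h)) (fun b h => E2 _ (h1 b h)) h2.
exists c, r, l, m, p, q, Cf; split=> // b /sub/h1; exact: sub2.
Qed.

End LocalRat.

(** Linear algebra over a domain without fractions: if k + 1 is the least order at which all sampled
    determinants vanish, the cofactors belonging to a nonzero minor of order k give one relation
    valid for every row. *)
Lemma kernel_vector (A : idomainType) (I : Type) n (e : I -> nat -> A) :
  (forall tau : 'I_n -> I, \det (\matrix_(i < n, j < n) e (tau i) j) = 0) ->
  exists v : nat -> A, (exists2 j, (j < n)%N & v j != 0) /\ forall i, \sum_(j < n) v j * e i j = 0.
Proof.
move=> dn; pose Pk k := `[< forall tau : 'I_k -> I, \det (\matrix_(i < k, j < k) e (tau i) j) = 0 >].
have exk : exists k, Pk k by exists n; apply/asboolP.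
have [[|k] /asboolP Pk1 k_min] := ex_minnP exk.
  have f0 : 'I_0 -> I by case.
  by have := Pk1 f0; rewrite det_mx00 => /eqP; rewrite oner_eq0.
have kn : (k < n)%N by apply: k_min; apply/asboolP.
have [tau D] : exists tau : 'I_k -> I, \det (\matrix_(i < k, j < k) e (tau i) j) != 0.
  apply: contrapT => h; have : (k < k)%N; last by rewrite ltnn.
  by apply: k_min; apply/asboolP => tau; apply: contrapT => D; apply: h; exists tau; apply/eqP.
pose v j := if (j <= k)%N then (-1) ^+ j * \det (\matrix_(i < k, j' < k) e (tau i) (bump j j')) else 0.
exists v; split.
  exists k => //; rewrite /v leqnn mulf_neq0 ?signr_eq0//.
  rewrite (_ : \matrix_(_, _) _ = \matrix_(i, j) e (tau i) j)//; apply/matrixP => i j; rewrite !mxE.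
  by rewrite /bump leqNgt ltn_ord add0n.
move=> i; pose tau' (a : 'I_k.+1) := if unlift ord0 a is Some a' then tau a' else i.
have := Pk1 tau'; rewrite (expand_det_row _ ord0) => H.
have -> : \sum_(j < n) v j * e i j = \sum_(j < k.+1) v j * e i j.
  rewrite -!(big_mkord xpredT (fun j => v j * e i j)) (@big_cat_nat _ _ _ k.+1)//=.
  rewrite [X in _ + X]big_nat_cond [X in _ + X]big1 ?addr0// => j /andP[/andP[kj _] _].
  by rewrite /v leqNgt kj mul0r.
rewrite -[RHS]H; apply: eq_bigr => j _; rewrite mxE /tau' unlift_none mulrC; congr (_ * _).
rewrite /v leq_ord /cofactor add0n; congr (_ * \det _).
by apply/matrixP => a j'; rewrite !mxE liftK.
Qed.

Lemma det0_kernel (A : idomainType) n (M : 'M[A]_n) (v : 'cV[A]_n) j : M *m v = 0 -> v j 0 != 0 -> \det M = 0.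
Proof.
move=> Mv vj; have /matrixP/(_ j 0) : \det M *: v = 0 by rewrite -mul_scalar_mx -mul_adj_mx -mulmxA Mv mulmx0.
by rewrite !mxE => /eqP; rewrite mulf_eq0 (negbTE vj) orbF => /eqP.
Qed.

(** * Kronecker's criterion over a ring of functions *)

Section SeriesRat.
Variables (R : realType) (A : idomainType) (X : Type) (ev : X -> {rmorphism A -> R[i]}).
Local Notation C := R[i].
Hypothesis sep : forall a, (forall x, ev x a = 0) -> a = 0.

Lemma common_denominator (c : X -> nat -> C) :
  (forall k, exists d n, forall x, ev x d != 0 /\ c x k * ev x d = ev x n) ->
  forall N, exists2 d, forall x, ev x d != 0 &
    exists n : nat -> A, forall k x, (k < N)%N -> c x k * ev x d = ev x (n k).
Proof.
move=> den; elim=> [|N [D D0 [n nE]]]; first by exists 1; [move=> x; rewrite rmorph1 oner_eq0|exists (fun=> 0)].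
have [d [a da]] := den N; exists (D * d).
  by move=> x; rewrite rmorphM mulf_neq0//; have [] := da x.
exists (fun k => if k == N then a * D else n k * d) => k x; rewrite ltnS leq_eqVlt.
have [-> _|_ /= kN] := eqVneq k N; rewrite !rmorphM.
  by have [_ <-] := da x; rewrite mulrCA mulrC.
by rewrite mulrA nE.
Qed.

Variables (l m : nat) (q p c : X -> nat -> C).
Hypothesis q0 : forall x, q x m != 0.
Let rq x i := if (i <= m)%N then q x (m - i)%N else 0.
Let rp x i := if (i <= l)%N then p x (l - i)%N else 0.
Hypothesis conv : forall x k, \sum_(i < k.+1) rq x i * c x (k - i)%N = rp x k.
Hypothesis den : forall k, exists d n, forall x, ev x d != 0 /\ c x k * ev x d = ev x n.
Variable x0 : X.

Lemma sum_trunc (V : pzRingType) (f g : nat -> V) k : (m <= k)%N -> (forall i, (m < i)%N -> f i = 0) ->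
  \sum_(i < k.+1) f i * g i = \sum_(i < m.+1) f i * g i.
Proof.
move=> mk f0; rewrite -!(big_mkord xpredT (fun j => f j * g j)) (@big_cat_nat _ _ _ m.+1)//=.
rewrite [X in _ + X]big_nat_cond [X in _ + X]big1 ?addr0// => j /andP[/andP[kj _] _].
by rewrite f0// mul0r.
Qed.

Lemma series_kernel : exists v : nat -> A, exists N (w : nat -> A), [/\ (m < N)%N, 
  exists2 j, (j <= m)%N & v j != 0, forall j, (m < j)%N -> v j = 0,
  forall x k, (k < N)%N -> \sum_(i < k.+1) ev x (v i) * c x (k - i)%N = ev x (w k) &
  forall x k, (N <= k)%N -> \sum_(i < k.+1) ev x (v i) * c x (k - i)%N = 0].
Proof.
pose N := (maxn l m).+1.
have mN : (m < N)%N by rewrite ltnS leq_maxr.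
have lN : (l < N)%N by rewrite ltnS leq_maxl.
have /choice[D DP] k : exists D : A * (nat -> A), (forall x, ev x D.1 != 0) /\
    forall i x, (i < k)%N -> c x i * ev x D.1 = ev x (D.2 i).
  by have [d d0 [n nE]] := common_denominator den k; exists (d, n).
have rq0 x i : (m < i)%N -> rq x i = 0 by move=> mi; rewrite /rq leqNgt mi.
pose e i j := (D (i + N).+1).2 (i + N - j)%N.
have eE i j x : ev x (e i j) = c x (i + N - j)%N * ev x (D (i + N).+1).1.
  by have [_ ->] := DP (i + N).+1; rewrite // ltnS leq_subr.
have mk i : (m <= i + N)%N by rewrite (leq_trans (ltnW mN))// leq_addl.
have row0 i x : \sum_(j < m.+1) rq x j * ev x (e i j) = 0.
  transitivity (ev x (D (i + N).+1).1 * \sum_(j < (i + N).+1) rq x j * c x (i + N - j)%N).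
    rewrite (sum_trunc (f := rq x) (fun j => c x (i + N - j)%N) (mk i))//; last exact: rq0.
    by rewrite mulr_sumr; apply: eq_bigr => j _; rewrite eE; ring.
  by rewrite conv /rp leqNgt (leq_trans lN) ?leq_addl// mulr0.
have [|v [[j0 j0m vj0] vE]] := @kernel_vector A nat m.+1 e.
  move=> tau; apply: sep => x; rewrite -det_map_mx.
  apply: (@det0_kernel _ _ _ (\col_j rq x (nat_of_ord j)) ord0); last by rewrite mxE /rq leq0n subn0.
  apply/matrixP => i j; rewrite !mxE -[RHS](row0 (tau i) x); apply: eq_bigr => j' _.
  by rewrite !mxE mulrC.
(* Multiplication by the common denominator of the first N coefficients brings the numerator [w]
   into A as well. *)
pose v' j := (if (j <= m)%N then v j else 0) * (D N).1.
have v'0 j : (m < j)%N -> v' j = 0 by move=> mj; rewrite /v' leqNgt mj mul0r.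
have DN0 x : ev x (D N).1 != 0 by have [] := DP N.
have D0 : (D N).1 != 0 by apply/eqP => h; have := DN0 x0; rewrite h rmorph0 eqxx.
exists v', N, (fun k => \sum_(i < k.+1) (if (i <= m)%N then v i else 0) * (D N).2 (k - i)%N); split=> //.
- by exists j0 => //; rewrite /v' -ltnS j0m mulf_neq0.
- move=> x k kN; rewrite rmorph_sum; apply: eq_bigr => i _; rewrite !rmorphM -mulrA; congr (_ * _).
  have [_ <-] := DP N; first by rewrite mulrC.
  by rewrite (leq_ltn_trans (leq_subr _ _)).
- move=> x k kN; have kE : k = (k - N + N)%N by rewrite subnK.
  have mk' : (m <= k)%N by rewrite (leq_trans (ltnW mN)).
  rewrite (sum_trunc (f := fun i => ev x (v' i)) (fun j => c x (k - j)%N) mk'); last by move=> i /v'0->; rewrite rmorph0.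
  apply: (@mulIf _ (ev x (D k.+1).1)); first by have [] := DP k.+1.
  rewrite mul0r; transitivity (ev x (\sum_(j < m.+1) v j * e (k - N)%N j) * ev x (D N).1); last by rewrite vE rmorph0 mul0r.
  rewrite rmorph_sum !mulr_suml; apply: eq_bigr => i _; rewrite /v' -ltnS ltn_ord !rmorphM eE -kE.
  by rewrite -!mulrA; congr (_ * _); rewrite mulrC mulrA.
Qed.

Lemma series_rat : exists P Q : {poly A}, Q != 0 /\ forall x,
  (\poly_(i < l.+1) p x i) * map_poly (ev x) Q = (\poly_(i < m.+1) q x i) * map_poly (ev x) P.
Proof.
have [v [N [w [mN [j0 j0m vj0] v0 wE w0]]]] := series_kernel.
(* The reversed polynomials turn w / v, a quotient in 1 / t, into one in t; the two powers of X
   account for the reversal degrees l, m and N - 1. *)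
exists ('X^l * \poly_(i < N) w (N.-1 - i)%N), ('X^(N.-1) * \poly_(i < m.+1) v (m - i)%N); split.
  apply: mulf_neq0; first exact: monic_neq0 (monicXn _ _).
  apply/eqP => /(congr1 (fun S : {poly A} => S`_(m - j0)%N)).
  rewrite coef_poly coef0 ltnS leq_subr subKn// => /eqP; apply/negP; exact: vj0.
move=> x; case: N mN wE w0 => // N' mN wE w0; rewrite [N'.+1.-1]/=.
pose rQ := \poly_(i < m.+1) q x (m - i)%N; pose rP := \poly_(i < l.+1) p x (l - i)%N.
pose V := \poly_(i < m.+1) ev x (v i); pose W := \poly_(i < N'.+1) ev x (w i).
have rQE i : rQ`_i = rq x i by rewrite coef_poly /rq ltnS.
have rPE i : rP`_i = rp x i by rewrite coef_poly /rp ltnS.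
have VE i : V`_i = ev x (v i) by rewrite coef_poly ltnS; case: leqP => // /v0->; rewrite rmorph0.
have key : rQ * W = V * rP.
  apply/eqP; rewrite -subr_eq0; apply/eqP/polyP => n; rewrite coef0.
  pose T := \poly_(i < n.+1) c x i.
  have tr (S : {poly C}) i : (i < n.+1)%N -> (S * T)`_i = \sum_(j < i.+1) S`_j * c x (i - j)%N.
    move=> ni; rewrite coefM; apply: eq_bigr => j _; rewrite coef_poly.
    by rewrite (leq_ltn_trans (leq_subr _ _) ni).
  have e1 : low_zero n.+1 (rQ * T - rP).
    by move=> i ni; rewrite coefB tr// rPE -conv; apply/eqP; rewrite subr_eq0; apply/eqP/eq_bigr => j _; rewrite rQE.
  have e2 : low_zero n.+1 (V * T - W).
    move=> i ni; rewrite coefB tr// coef_poly; apply/eqP; rewrite subr_eq0; apply/eqP.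
    case: ltnP => h; first by rewrite -wE//; apply: eq_bigr => j _; rewrite VE.
    by rewrite -[RHS](w0 x i h); apply: eq_bigr => j _; rewrite VE.
  have -> : rQ * W - V * rP = V * (rQ * T - rP) - rQ * (V * T - W) by ring.
  by apply: (low_zeroD (low_zeroM _ e1) (low_zeroN (low_zeroM _ e2))).
apply/eqP; rewrite -subr_eq0; apply/eqP; apply: (@poly_disc0 _ _ 1 1) => // t t1.
have t0 : t != 0 by apply/eqP => t0; move: t1; rewrite t0 sub0r nrmN nrm1 ltxx.
have mp n (a : nat -> A) : map_poly (ev x) (\poly_(i < n.+1) a (n - i)%N) = \poly_(i < n.+1) ev x (a (n - i)%N).
  by apply/polyP => i; rewrite coef_map !coef_poly; case: ltnP => _ /=; rewrite ?rmorph0.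
have ti : t^-1 != 0 by rewrite invr_eq0.
have := congr1 (fun S : {poly C} => S.[t^-1]) key; rewrite /= !hornerM.
rewrite (rev_poly_horner m (q x) ti) (rev_poly_horner l (p x) ti) invrK.
rewrite hornerD hornerN !hornerM !rmorphM /= !map_polyXn !hornerM !hornerXn !mp.
rewrite (rev_poly_horner m (fun i => ev x (v i)) t0) (rev_poly_horner N' (fun i => ev x (w i)) t0) -/V -/W.
set a := (\poly_(i < m.+1) q x i).[t]; set b := (\poly_(i < l.+1) p x i).[t].
set V1 := V.[_]; set W1 := W.[_] => H.
have tm : t ^+ m != 0 by rewrite expf_neq0.
have tl : t ^+ l != 0 by rewrite expf_neq0.
have H' : a * W1 * t ^+ l = V1 * b * t ^+ m.
  have := congr1 (fun z => z * t ^+ m * t ^+ l) H; rewrite !exprVn => H'.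
  transitivity ((t ^+ m)^-1 * a * W1 * t ^+ m * t ^+ l); first by field.
  by rewrite H'; field.
transitivity (t ^+ N' * (V1 * b * t ^+ m - a * W1 * t ^+ l)); first by ring.
by rewrite H' subrr mulr0.
Qed.

End SeriesRat.

(* Restriction to [w = lam]: a denominator vanishing there is a multiple of
   ['X - lam], and then so is the numerator. *)
Lemma restrict_rat (R : realType) (A : idomainType) (X : Type) (ev : X -> {rmorphism A -> R[i]})
  (lam : A) (psi : X -> R[i] -> R[i]) (om : X -> R[i] -> R[i]) (s0 : R[i]) (r : R) (P Q : {poly A}) :
  (forall a, (forall x, ev x a = 0) -> a = 0) -> 0 < r ->
  (forall x, om x s0 = ev x lam) -> (forall x s, nrm (s - s0) < r -> s != s0 -> om x s != ev x lam) ->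
  (forall x, {for s0, continuous (om x)}) -> (forall x, {for s0, continuous (psi x)}) ->
  Q != 0 -> (forall x s, nrm (s - s0) < r ->
    psi x s * (map_poly (ev x) Q).[om x s] = (map_poly (ev x) P).[om x s]) ->
  exists P1 Q1 : A, Q1 != 0 /\ forall x, psi x s0 * ev x Q1 = ev x P1.
Proof.
move=> sep r0 om0 omn co cp.
have [n] := ubnP (size Q); elim: n P Q => // n IH P Q sQ Q0 H.
have hev x (S : {poly A}) : (map_poly (ev x) S).[om x s0] = ev x S.[lam] by rewrite om0 horner_map.
have [Ql|Ql] := eqVneq Q.[lam] 0; last first.
  by exists P.[lam], Q.[lam]; split=> // x; rewrite -!hev H// subrr nrm0.
have Pl : P.[lam] = 0.
  by apply: sep => x; rewrite -hev -H ?subrr ?nrm0// hev Ql rmorph0 mulr0.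
have /factor_theorem[Q1 QE] : root Q lam by rewrite rootE Ql.
have /factor_theorem[P1 PE] : root P lam by rewrite rootE Pl.
have Q10 : Q1 != 0 by apply: contra_neq Q0 => Q10; rewrite QE Q10 mul0r.
apply: (IH P1 Q1 _ Q10).
  by move: sQ; rewrite QE size_Mmonic ?monicXsubC// size_XsubC addn2 /= ltnS.
move=> x s sr.
pose u s := psi x s * (map_poly (ev x) Q1).[om x s] - (map_poly (ev x) P1).[om x s].
have un s' : nrm (s' - s0) < r -> s' != s0 -> u s' = 0.
  move=> s'r s's; have := H x s' s'r; rewrite QE PE !rmorphM /= !rmorphB /= !map_polyX !map_polyC /= !hornerM.
  rewrite !hornerXsubC mulrA => /eqP; rewrite -subr_eq0 -mulrBl mulf_eq0 => /orP[/eqP h|]; first exact: h.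
  by rewrite subr_eq0 (negbTE (omn x s' s'r s's)).
apply/eqP; rewrite -subr_eq0; apply/eqP; rewrite -/(u s).
(* At s0 the cancelled factor is zero and carries no information; there the identity follows by
   continuity. *)
have [->{s sr}|ss] := eqVneq s s0; last exact: un.
have cu : {for s0, continuous u}.
  have hc (S : {poly R[i]}) : {for s0, continuous (fun s => S.[om x s])}.
    apply: (@continuous_comp _ _ _ (om x) (fun w => S.[w])); first exact: co.
    have [dS _] := is_derive_horner S (om x s0).
    exact: derivable_continuous dS.
  by apply: (@continuousB R[i] _ _ (fun s => psi x s * (map_poly (ev x) Q1).[om x s])) => //; apply: continuousM.
apply: contrapT => /eqP u0.
have [e e0 eP] : exists2 e : R, 0 < e & forall s, nrm (s - s0) < e -> u s != 0.
  have /cu : nbhs (u s0) [set y | y != 0].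
    apply/nearP; exists (nrm (u s0)); first by rewrite nrm_gt0.
    by move=> w wf; apply/eqP => w0; move: wf; rewrite w0 sub0r nrmN ltxx.
  by move=> /nearP[e e0 h]; exists e.
pose d := Num.min e r / 2.
have d0 : 0 < d by rewrite divr_gt0// lt_min e0.
have nd : nrm (s0 + d%:C - s0) = d by rewrite addrC addKr /nrm ger0_norm/= ?lecR ?(ltW d0).
have dm : d < Num.min e r by rewrite ltr_pdivrMr// ltr_pMr ?ltr1n// lt_min e0.
move: dm; rewrite lt_min -nd => /andP[de dr].
have := eP _ de; rewrite un ?eqxx//; apply/eqP => h; move: d0; rewrite -nd h subrr nrm0 ltxx//.
Qed.

(** * Polynomial invariants of the field near s = 0 *)

Section MapDer.
Variables (S : comNzRingType) (d : {additive S -> S}).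
Hypothesis dM : forall a b, d (a * b) = d a * b + a * d b.

Lemma map_derM (p q : {poly S}) : map_poly d (p * q) = map_poly d p * q + p * map_poly d q.
Proof.
apply/polyP => i; rewrite coef_map coefD !coefM raddf_sum -big_split /=; apply: eq_bigr => j _.
by rewrite dM !coef_map.
Qed.

End MapDer.

Section TopCoef.
Variable S : comNzRingType.
Implicit Types p q : {poly S}.

Lemma coefM_top p q n m : (size p <= n.+1)%N -> (size q <= m.+1)%N -> (p * q)`_(n + m) = p`_n * q`_m.
Proof.
move=> pn qm; rewrite coefM (bigD1 (Ordinal (leq_addr m n : (n < (n + m).+1)%N)))//= addKn.
rewrite big1 ?addr0// => i; rewrite -val_eqE /= => ni.
have [lt|gt|eq] := ltngtP i n; last by rewrite eq eqxx in ni.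
  rewrite [q`_ _]nth_default ?mulr0// (leq_trans qm)//.
  by move: lt; lia.
by rewrite [p`_ _]nth_default ?mul0r// (leq_trans pn).
Qed.

(** The coefficient next to the top one of a product. Multiplying by X in place of lowering an index
    covers degree 0. *)
Lemma coefM_top1 p q n m : (size p <= n.+1)%N -> (size q <= m.+1)%N ->
  ('X * (p * q))`_(n + m) = p`_n * ('X * q)`_m + ('X * p)`_n * q`_m.
Proof.
move=> pn qm.
have dec k (f : {poly S}) : (size f <= k.+1)%N -> exists2 f1 : {poly S}, f = f`_k *: 'X^k + f1 & (size f1 <= k)%N.
  move=> fk; exists (f - f`_k *: 'X^k); first by rewrite addrC subrK.
  apply/leq_sizeP => j kj; rewrite coefB coefZ coefXn; move: kj; rewrite leq_eqVlt => /orP[/eqP<-|kj].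
    by rewrite eqxx mulr1 subrr.
  by rewrite nth_default ?(leq_trans fk)// gtn_eqF// mulr0 subr0.
have [p1 pE p1n] := dec _ _ pn; have [q1 qE q1m] := dec _ _ qm.
have top0 k (f1 : {poly S}) a : ('X * (a *: 'X^k + f1))`_k = ('X * f1)`_k.
  rewrite mulrDr -scalerAr -exprS coefD coefZ coefXn.
  by rewrite eqn_leq leqnSn /= ltnn mulr0 add0r.
rewrite {3}pE {2}qE !top0.
set a := p`_n in pE *; set b := q`_m in qE *.
have -> : 'X * (p * q) = (a * b) *: 'X^((n + m).+1) + a *: ('X^n * ('X * q1)) + b *: ('X^m * ('X * p1)) + 'X * (p1 * q1).
  by rewrite pE qE -!mul_polyC !exprS exprD polyCM; ring.
rewrite !coefD !coefZ coefXn eqn_leq leqnSn /= ltnn mulr0 add0r.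
rewrite coefXnM ltnNge leq_addr /= addKn coefXnM ltnNge leq_addl /= addnK.
rewrite [b * _]mulrC [X in _ + X]nth_default ?addr0//.
have [->|p10] := eqVneq p1 0; first by rewrite mul0r mulr0 size_poly0.
have [->|q10] := eqVneq q1 0; first by rewrite mulr0 mulr0 size_poly0.
rewrite (leq_trans (size_polyMleq _ _))// size_polyX /= (leq_ltn_trans (size_polyMleq _ _))//.
by rewrite prednK ?leq_add// addn_gt0 !size_poly_gt0 p10.
Qed.

End TopCoef.

Section OneVar.
Variable K : numFieldType.
Implicit Types a b d : {poly K}.

Lemma deriv_eq0 a : a^`() = 0 -> a = (a`_0)%:P.
Proof.
move=> a0; apply: size1_polyC; apply/leq_sizeP => -[//|j] _.
have := congr1 (fun p : {poly K} => p`_j) a0.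
by rewrite coef_deriv coef0 => /eqP; rewrite -mulr_natr mulf_eq0 pnatr_eq0 orbF => /eqP.
Qed.

(** A rational solution a / b of r' = e r + c is a polynomial: in lowest terms b1 divides a1 b1',
    hence b1', so b1' = 0. In other words, a pole would get worse under differentiation. *)
Lemma riccati_poly a b e (c : K) : b != 0 -> a^`() * b - a * b^`() = e * a * b + c *: b ^+ 2 ->
  exists r, a = r * b /\ r^`() = e * r + c%:P.
Proof.
move=> b0; set g := gcdp a b => E.
have g0 : g != 0 by rewrite gcdp_eq0 (negbTE b0) andbF.
have aE : a = (a %/ g) * g by rewrite divpK// dvdp_gcdl.
have bE : b = (b %/ g) * g by rewrite divpK// dvdp_gcdr.
have co : coprimep (a %/ g) (b %/ g) by apply: coprimep_div_gcd; rewrite b0 orbT.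
move: aE bE co; set a1 := a %/ g; set b1 := b %/ g => aE bE co.
have b10 : b1 != 0 by apply: contra_neq b0 => h; rewrite bE h mul0r.
have E1 : a1^`() * b1 - a1 * b1^`() = e * a1 * b1 + c *: b1 ^+ 2.
  apply: (mulIf (expf_neq0 2 g0)); move: E; rewrite aE bE !derivM -!mul_polyC => E.
  transitivity ((a1^`() * g + a1 * g^`()) * (b1 * g) - a1 * g * (b1^`() * g + b1 * g^`())); first by ring.
  by rewrite E; ring.
have dv : b1 %| b1^`().
  rewrite -(@Gauss_dvdpr _ _ a1); last by rewrite coprimep_sym.
  have -> : a1 * b1^`() = b1 * (a1^`() - e * a1 - c *: b1).
    move/eqP: E1; rewrite subr_eq addrC -subr_eq => /eqP <-; rewrite -!mul_polyC; ring.
  exact: dvdp_mulr.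
have d0 : b1^`() = 0.
  apply/eqP; apply: contraT => d0; have := dvdp_leq d0 dv.
  by rewrite leqNgt lt_size_deriv.
move: E1; have := deriv_eq0 d0; set k := b1`_0 => b1E; rewrite d0 mulr0 subr0 => E1.
have k0 : k != 0 by apply: contra_neq b10 => h; rewrite b1E h.
exists (k^-1 *: a1); split.
  rewrite {1}aE bE b1E -!mul_polyC; transitivity ((k^-1 * k)%:P * (a1 * g)); first by rewrite mulVf// mul1r.
  by rewrite polyCM; ring.
rewrite derivZ; apply: (@mulIf _ b1) => //.
rewrite -scalerAl E1 b1E -!mul_polyC.
transitivity (e * (k^-1%:P * a1) * k%:P + c%:P * ((k^-1 * k)%:P * k%:P)); first by rewrite polyCM; ring.
by rewrite mulVf// mul1r; ring.
Qed.

(** By degrees: for r != 0 the product mu X r has larger degree than r, whereas r' - c does not. *)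
Lemma riccati_poly0 (mu c : K) r : mu != 0 -> r^`() = mu *: 'X * r + c%:P -> r = 0.
Proof.
move=> mu0 E; apply/eqP; apply: contraT => r0.
have : size (mu *: 'X * r)%R = (size r).+1 by rewrite -scalerAl size_scale// mulrC size_mulX.
have -> : mu *: 'X * r = r^`() - c%:P by rewrite E addrK.
have s1 := lt_size_deriv r0.
have : (size (r^`() - c%:P)%R <= size r)%N.
  rewrite (leq_trans (size_polyD _ _))// size_polyN geq_max (ltnW s1) (leq_trans (size_polyC_leq1 _))//.
  by rewrite size_poly_gt0.
by move=> + E2; rewrite E2 ltnn.
Qed.

End OneVar.

Section Invariant.
Variables (K : numFieldType) (lam : K).
Hypothesis lam0 : lam != 0.
Local Notation U2 := {poly {poly K}}.
Local Notation U3 := {poly {poly {poly K}}}.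

Definition dt2 (p : U2) : U2 := map_poly (@deriv K) p.
Definition dt3 (p : U3) : U3 := map_poly dt2 p.
Definition dx3 (p : U3) : U3 := map_poly (@deriv {poly K}) p.

(* t is the innermost variable, then xi, then s. *)
Definition tU : U3 := 'X%:P%:P.
Definition xiU : U3 := 'X%:P.
Definition vf_xi : U3 := 3 * lam%:P%:P%:P * tU * xiU - 1 + 2 * xiU ^+ 3 * 'X ^+ 3.
Definition vf_s : U3 := - (lam%:P%:P%:P * tU * 'X) - xiU ^+ 2 * 'X ^+ 4.
Definition vf (p : U3) : U3 := dt3 p + vf_xi * dx3 p + vf_s * p^`().

Lemma dt2D p q : dt2 (p + q) = dt2 p + dt2 q. Proof. exact: raddfD. Qed.
Lemma dt2M p q : dt2 (p * q) = dt2 p * q + p * dt2 q.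
Proof. by apply: map_derM => a b; exact: derivM. Qed.
Lemma dt3M p q : dt3 (p * q) = dt3 p * q + p * dt3 q.
Proof. by apply: (map_derM (d := map_poly (@deriv K))) => a b; exact: dt2M. Qed.
Lemma dx3M p q : dx3 (p * q) = dx3 p * q + p * dx3 q.
Proof. by apply: map_derM => a b; exact: derivM. Qed.

Lemma vfM p q : vf (p * q) = vf p * q + p * vf q.
Proof. rewrite /vf dt3M dx3M derivM; ring. Qed.

Lemma vfB p q : vf (p - q) = vf p - vf q.
Proof.
rewrite /vf derivB; have -> : dt3 (p - q) = dt3 p - dt3 q by exact: raddfB.
have -> : dx3 (p - q) = dx3 p - dx3 q by exact: raddfB.
ring.
Qed.

Lemma vf_const (k : K) : vf k%:P%:P%:P = 0.
Proof. by rewrite /vf derivC /dt3 /dx3 /dt2 !map_polyC /= !map_polyC /= !derivC !mulr0 !addr0. Qed.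

(** The field induced on the divisor s = 0, to which [vf] is tangent since [vf_s] vanishes there. *)
Definition E2 (p : U2) : U2 := dt2 p + (3 * lam%:P%:P * 'X%:P * 'X - 1) * p^`().

Lemma vf_s0 p : (vf p).[0] = E2 p.[0].
Proof.
have h0 (f : U2 -> U2) : f 0 = 0 -> (map_poly f p).[0] = f p.[0] by move=> f0; rewrite !horner_coef0 coef_map_id0.
have g1 (a : U2) (b : U3) : (a%:P + b * 'X).[0] = a by rewrite hornerD hornerC hornerM hornerX mulr0 addr0.
have g2 (a b c d e : U3) : (a + b * c + d * e).[0] = a.[0] + b.[0] * c.[0] + d.[0] * e.[0].
  by rewrite !hornerD !hornerM.
have xi0 : vf_xi.[0] = 3 * lam%:P%:P * 'X%:P * 'X - 1.
  rewrite -[RHS](g1 _ (2 * xiU ^+ 3 * 'X ^+ 2)); congr (_.[0]).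
  rewrite polyCB !polyCM polyC_natr /vf_xi /xiU /tU; ring.
have s0 : vf_s.[0] = 0.
  rewrite -[RHS](g1 _ (- (lam%:P%:P%:P * tU) - xiU ^+ 2 * 'X ^+ 3)); congr (_.[0]).
  rewrite polyC0 /vf_s; ring.
rewrite /vf g2 xi0 s0 mul0r addr0 /dt3 /dx3.
by rewrite (h0 _ (raddf0 (map_poly (@deriv K)))) (h0 _ (raddf0 (@deriv {poly K}))).
Qed.

Lemma coef_E2 p k : (E2 p)`_k = (p`_k)^`() + (3 * k%:R * lam) *: ('X * p`_k) - k.+1%:R *: p`_k.+1.
Proof.
rewrite /E2 coefD coef_map mulrBl mul1r coefB coef_deriv.
have -> : 3 * lam%:P%:P * 'X%:P * 'X * p^`() = ((3 * lam)%:P * 'X)%:P * ('X * p^`()).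
  by rewrite !polyCM polyC_natr; ring.
rewrite coefCM coefXM coef_deriv -addrA; congr (_ + (_ - _)); last by rewrite -scaler_nat.
case: k => [|k] /=; first by rewrite mulr0 mulr0n mulr0 mul0r scale0r.
rewrite -mulr_natr -mul_polyC !polyCM !polyC_natr; ring.
Qed.

(** Let a and b be the top coefficients in xi, of degrees n and m. Comparing top terms gives (a /
    b)' = mu t (a / b) with mu = (3 m - v - 3 n + w) lam, so mu = 0 and a = k b. The next terms give
    a rational solution of r' = 3 lam t r + (n - m) k, which forces n = m; then mu = 0 yields w =
    v. *)
Lemma inv_low (w v : nat) (N M : U2) : N != 0 -> M != 0 ->
  (E2 N - w%:R * lam%:P%:P * 'X%:P * N) * M = N * (E2 M - v%:R * lam%:P%:P * 'X%:P * M) ->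
  [/\ w = v, size N = size M & exists k : K, lead_coef N = k *: lead_coef M].
Proof.
move=> N0 M0 E.
pose F (u : nat) (p : U2) : U2 := E2 p - u%:R * lam%:P%:P * 'X%:P * p.
have FE u p k : (F u p)`_k = (p`_k)^`() + ((3 * k%:R - u%:R) * lam) *: ('X * p`_k) - k.+1%:R *: p`_k.+1.
  rewrite coefB coef_E2.
  have -> : u%:R * lam%:P%:P * 'X%:P * p = ((u%:R * lam)%:P * 'X)%:P * p by rewrite !polyCM !polyC_natr.
  rewrite coefCM -!mul_polyC !(polyCM, polyCB) !polyC_natr; ring.
have FX u p k : ('X * F u p)`_k = (('X * p)`_k)^`() + ((3 * k%:R - 3 - u%:R) * lam) *: ('X * ('X * p)`_k) - k%:R *: p`_k.
  rewrite !coefXM; case: k => [|k] /=; first by rewrite deriv0 !mulr0 scaler0 mulr0n scale0r subr0 addr0.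
  by rewrite FE; congr (_ + _ *: _ - _); rewrite -natr1; ring.
have Fs u (p : U2) k : (size p <= k.+1)%N -> (size (F u p) <= k.+1)%N.
  move=> pk; apply/leq_sizeP => j jk; have pj i : (j <= i)%N -> p`_i = 0.
    by move=> ji; rewrite nth_default// (leq_trans pk)// (leq_trans jk).
  by rewrite FE !pj// deriv0 mulr0 !scaler0 subr0 addr0.
pose n := (size N).-1; pose m := (size M).-1.
have sN : size N = n.+1 by rewrite prednK// size_poly_gt0.
have sM : size M = m.+1 by rewrite prednK// size_poly_gt0.
have sN' : (size N <= n.+1)%N by rewrite sN.
have sM' : (size M <= m.+1)%N by rewrite sM.
have a0 : N`_n != 0 by rewrite -[N`_n]/(lead_coef N) lead_coef_eq0.
have b0 : M`_m != 0 by rewrite -[M`_m]/(lead_coef M) lead_coef_eq0.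
have E1 : F w N * M = N * F v M by [].
have T := congr1 (fun p : U2 => p`_(n + m)) E1.
have T1 := congr1 (fun p : U2 => ('X * p)`_(n + m)) E1.
rewrite /= (coefM_top (Fs w N n sN') sM') (coefM_top sN' (Fs v M m sM')) !FE in T.
rewrite /= (coefM_top1 (Fs w N n sN') sM') (coefM_top1 sN' (Fs v M m sM')) !FX !FE in T1.
have N1 : N`_n.+1 = 0 by rewrite nth_default.
have M1 : M`_m.+1 = 0 by rewrite nth_default.
rewrite N1 M1 !scaler0 !subr0 in T T1.
rewrite /lead_coef -/n -/m.
set a := N`_n in T T1 a0 *; set b := M`_m in T T1 b0 *.
set al := ('X * N)`_n in T1; set be := ('X * M)`_m in T1.
pose mu := (3 * m%:R - v%:R - (3 * n%:R - w%:R)) * lam.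
have [|r [ar rE]] := @riccati_poly _ a b (mu *: 'X) 0 b0.
  rewrite scale0r addr0; move/eqP: T; rewrite -subr_eq0 => /eqP T.
  apply/eqP; rewrite -subr_eq0 -[X in _ == X]T -!mul_polyC /mu !(polyCM, polyCB); apply/eqP; ring.
have mu0 : mu = 0.
  apply/eqP; apply: contraT => mu0; move: a0.
  by rewrite ar (riccati_poly0 mu0 rE) mul0r eqxx.
have rc : r = (r`_0)%:P by apply: deriv_eq0; rewrite rE mu0 scale0r mul0r addr0.
set k := r`_0 in rc; have aE : a = k *: b by rewrite ar rc mul_polyC.
have k0 : k != 0 by apply: contra_neq a0 => h; rewrite aE h scale0r.
have wv : 3 * m%:R - v%:R = 3 * n%:R - w%:R :> K.
  by move/eqP: mu0; rewrite mulf_eq0 (negbTE lam0) orbF subr_eq0 => /eqP.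
(* Here the term -1 of [vf_xi] takes effect: it lowers the degree in xi by one and produces the
   constant (n - m) k. *)
have [|r' [dr r'E]] := @riccati_poly _ (al - k *: be) b ((3 * lam) *: 'X) ((n%:R - m%:R) * k) b0.
  move/eqP: T1; rewrite -subr_eq0 => /eqP T1.
  apply/eqP; rewrite -subr_eq0 -[X in _ == X]T1.
  have wE : w%:R = 3 * n%:R - 3 * m%:R + v%:R :> K by rewrite -[3 * n%:R](subrK w%:R) -wv; ring.
  rewrite aE wE derivD derivN !derivZ -!mul_polyC !(polyCM, polyCB, polyCD) !polyC_natr; apply/eqP; ring.
have lam3 : 3 * lam != 0 by rewrite mulf_neq0// pnatr_eq0.
have r'0 := riccati_poly0 lam3 r'E.
move: r'E; rewrite r'0 deriv0 mulr0 add0r => /esym/eqP; rewrite polyC_eq0 mulf_eq0 (negbTE k0) orbF subr_eq0 eqr_nat.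
move=> /eqP nm; split; last by exists k.
  by move: wv; rewrite nm => /addrI/oppr_inj/eqP; rewrite eqr_nat eq_sym => /eqP.
by rewrite sN sM nm.
Qed.

Lemma low_decomp (p : U3) : p != 0 -> exists w (p1 : U3), p = p1 * 'X^w /\ p1.[0] != 0.
Proof.
move=> p0; have [w [q /implyP/(_ p0) q0 pE]] := multiplicity_XsubC p 0.
by exists w, q; rewrite pE subr0.
Qed.

(** The logarithmic derivative of s^w is -w (lam t + xi^2 s^3); its value on s = 0 is the extra term
    in [inv_low]. *)
Lemma vf_low w (p : U3) : vf (p * 'X^w) = (vf p - (w%:R * lam%:P%:P%:P * tU) * p - w%:R * xiU ^+ 2 * 'X ^+ 3 * p) * 'X^w.
Proof.
have vfX : vf 'X^w = - (w%:R * lam%:P%:P%:P * tU * 'X^w) - w%:R * xiU ^+ 2 * 'X ^+ 3 * 'X^w.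
  have mX (f : U2 -> U2) : f 0 = 0 -> f 1 = 0 -> map_poly f 'X^w = 0.
    move=> f0 f1; apply/polyP => i; rewrite coef_map_id0// coefXn coef0; by case: (i == w).
  rewrite /vf /dt3 /dx3 (mX _ (raddf0 (@deriv {poly K})) (derivC 1)).
  rewrite (mX dt2 (raddf0 (map_poly (@deriv K)))); last by rewrite /dt2 map_polyC /= derivC.
  rewrite mulr0 !add0r derivXn /vf_s; clear mX; case: w => [|w] /=; first by rewrite !mulr0n; ring.
  rewrite -mulr_natl (exprS _ w); ring.
by rewrite vfM vfX; ring.
Qed.

Lemma inv_pair (N1 M1 : U3) w v : N1.[0] != 0 -> M1.[0] != 0 ->
  vf (N1 * 'X^w) * (M1 * 'X^v) = N1 * 'X^w * vf (M1 * 'X^v) ->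
  [/\ w = v, size N1.[0] = size M1.[0] & exists k : K, lead_coef N1.[0] = k *: lead_coef M1.[0]].
Proof.
move=> N0 M0; rewrite !vf_low => E; apply: inv_low => //.
have X0 : ('X^w * 'X^v : U3) != 0 by rewrite -exprD monic_neq0// monicXn.
have E1 : (vf N1 - (w%:R * lam%:P%:P%:P * tU) * N1 - w%:R * xiU ^+ 2 * 'X ^+ 3 * N1) * M1
   = N1 * (vf M1 - (v%:R * lam%:P%:P%:P * tU) * M1 - v%:R * xiU ^+ 2 * 'X ^+ 3 * M1).
  apply: (mulIf X0); rewrite mulrACA E; ring.
have g (c e f B : U3) (k : U2) : ((c - k%:P * e - f * 'X * e) * B).[0] = (c.[0] - k * e.[0]) * B.[0].
  by rewrite hornerM !hornerD !hornerN !hornerM hornerC hornerX mulr0 mul0r subr0.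
have gE u (p : U3) : vf p - (u%:R * lam%:P%:P%:P * tU) * p - u%:R * xiU ^+ 2 * 'X ^+ 3 * p
  = vf p - (u%:R * lam%:P%:P * 'X%:P)%:P * p - (u%:R * xiU ^+ 2 * 'X ^+ 2) * 'X * p.
  by rewrite /tU !polyCM polyC_natr; ring.
move: E1; rewrite !gE [RHS]mulrC => /(congr1 (fun p : U3 => p.[0])).
by rewrite /= !g !vf_s0 [RHS]mulrC.
Qed.

(** With k the ratio of the leading coefficients of the lowest parts, N - k M satisfies the same
    relation. If it were nonzero, its lowest part would have the same order in s and the same degree
    in xi as that of M, but the coefficient in this degree has been cancelled. *)
Theorem vf_invariant (N M : U3) : M != 0 -> vf N * M = N * vf M -> exists k : K, N = k%:P%:P%:P * M.
Proof.
move=> M0 E; have [->|N0] := eqVneq N 0; first by exists 0; rewrite mul0r.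
have [w [N1 [NE N10]]] := low_decomp N0; have [v [M1 [ME M10]]] := low_decomp M0.
have [|wv sz [k kE]] := @inv_pair N1 M1 w v N10 M10; first by rewrite -NE -ME.
exists k; apply/eqP; rewrite -subr_eq0; apply: contraT => D0.
have [w2 [N2 [DE N20]]] := low_decomp D0.
have [|w2v sz2 _] := @inv_pair N2 M1 w2 v N20 M10.
  by rewrite -DE -ME vfB vfM vf_const mul0r add0r mulrBl mulrBl E; ring.
have N2E : N2 = N1 - k%:P%:P%:P * M1.
  have X0 : ('X^v : U3) != 0 by rewrite monic_neq0// monicXn.
  by apply: (mulIf X0); rewrite -{1}w2v -DE NE ME wv; ring.
have : lead_coef N2.[0] != 0 by rewrite lead_coef_eq0.
rewrite {1}/lead_coef sz2 N2E hornerD hornerN hornerM hornerC coefB coefCM mul_polyC.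
by rewrite -{1}sz -/(lead_coef N1.[0]) -/(lead_coef M1.[0]) kE subrr eqxx.
Qed.

End Invariant.

(** * Meromorphic functions on chains of discs, and monodromy *)

Section Meromorphy.
Variable R : realType.
Local Notation C := R[i].
Implicit Types (u G H : C -> C) (z w : C) (r : R).

Lemma hol_ringclass (w0 : C) r : ringclass (fun u => hol u w0 r).
Proof.
split=> [k z zr|f g hf hg z zr|f g hf hg z zr]; have [c d m] := derivable_ringclass z.
- exact: c.
- exact: (d f g (hf z zr) (hg z zr)).
- exact: (m f g (hf z zr) (hg z zr)).
Qed.

Lemma near_neq0 u z : {for z, continuous u} -> u z != 0 ->
  exists2 e : R, 0 < e & forall w, nrm (w - z) < e -> u w != 0.
Proof.
move=> cu uz; have /cu : nbhs (u z) [set y | y != 0].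
  apply/nearP; exists (nrm (u z)); first by rewrite nrm_gt0.
  by move=> w wf; apply/eqP => w0; move: wf; rewrite w0 sub0r nrmN ltxx.
by move=> /nearP[e e0 h]; exists e.
Qed.

Lemma ball_sub w0 r z : nrm (z - w0) < r -> exists2 s : R, 0 < s & forall w, nrm (w - z) < s -> nrm (w - w0) < r.
Proof.
move=> zr; exists (r - nrm (z - w0)); first by rewrite subr_gt0.
by move=> w; rewrite ltrBrDr; apply: le_lt_trans; exact: nrm_triangle.
Qed.

(** One quotient serves the whole disc. Asking H to be nonzero at one point is enough: by the
    identity theorem its zeros then contain no disc. *)
Definition mero_on w0 r u := exists G H, [/\ hol G w0 r, hol H w0 r,
  exists2 z, nrm (z - w0) < r & H z != 0 &
  forall z, nrm (z - w0) < r -> H z != 0 -> u z = G z / H z].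

Lemma hol_dense_neq0 H w0 r z (e : R) : hol H w0 r -> (exists2 z, nrm (z - w0) < r & H z != 0) ->
  nrm (z - w0) < r -> 0 < e -> exists2 z', nrm (z' - z) < e & nrm (z' - w0) < r /\ H z' != 0.
Proof.
move=> hH [z1 z1r Hz1] zr e0; apply: contrapT => h; move/eqP: Hz1; apply.
apply: (identity_ball hH zr) => //; have [s s0 sP] := ball_sub zr.
exists (Num.min e s); first by rewrite lt_min e0.
move=> w; rewrite lt_min => /andP[we ws]; apply: contrapT => /eqP Hw; apply: h; exists w => //.
by split=> //; exact: sP.
Qed.

Lemma mero_ringclass (w0 : C) r : 0 < r -> ringclass (mero_on w0 r).
Proof.
move=> r0; have [hc hD hM] := hol_ringclass w0 r.
have nz H1 H2 : hol H1 w0 r -> hol H2 w0 r -> (exists2 z, nrm (z - w0) < r & H1 z != 0) ->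
   (exists2 z, nrm (z - w0) < r & H2 z != 0) -> exists2 z, nrm (z - w0) < r & H1 z * H2 z != 0.
  move=> h1 h2 [z1 z1r H1z] e2.
  have [e e0 eP] := near_neq0 (derivable_continuous (h1 _ z1r)) H1z.
  have [z' z'e [z'r H2z]] := hol_dense_neq0 h2 e2 z1r e0.
  by exists z' => //; rewrite mulf_neq0// eP.
split=> [k|f g [G1 [H1 [hG1 hH1 n1 E1]]] [G2 [H2 [hG2 hH2 n2 E2]]]|f g [G1 [H1 [hG1 hH1 n1 E1]]] [G2 [H2 [hG2 hH2 n2 E2]]]].
- exists (cst k), (cst 1); split; [exact: hc|exact: hc| |by move=> z _ _ /=; rewrite divr1].
  by exists w0; rewrite ?subrr ?nrm0//= oner_neq0.
- exists (fun z => G1 z * H2 z + G2 z * H1 z), (fun z => H1 z * H2 z); split.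
  + exact: (hD (fun z => G1 z * H2 z) (fun z => G2 z * H1 z) (hM _ _ hG1 hH2) (hM _ _ hG2 hH1)).
  + exact: hM.
  + exact: nz.
  + move=> z zr; rewrite mulf_eq0 negb_or => /andP[a b]; rewrite E1// E2//; field.
    by rewrite a b.
- exists (fun z => G1 z * G2 z), (fun z => H1 z * H2 z); split; [exact: hM|exact: hM|exact: nz|].
  move=> z zr; rewrite mulf_eq0 negb_or => /andP[a b]; rewrite E1// E2//; field.
  by rewrite a b.
Qed.

Lemma hol_mero w0 r u : 0 < r -> hol u w0 r -> mero_on w0 r u.
Proof.
move=> r0 hu; have [hc _ _] := hol_ringclass w0 r.
exists u, (cst 1); split; [exact: hu|exact: hc| |by move=> z _ _; rewrite /= divr1].
by exists w0; rewrite ?subrr ?nrm0//= oner_neq0.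
Qed.

(** The conclusion concerns points near [z2] rather than [z2] itself, since the values of [w] at
    zeros of the denominator are arbitrary. *)
Lemma mero_zero (w : C -> C) w0 r z1 : mero_on w0 r w -> nrm (z1 - w0) < r -> zero_near w z1 ->
  forall z2 (e : R), nrm (z2 - w0) < r -> 0 < e -> exists2 z3, nrm (z3 - z2) < e & zero_near w z3.
Proof.
move=> [G [H [hG hH nH E]]] z1r [e1 e10 w1].
have G0 z : nrm (z - w0) < r -> G z = 0.
  have [z' z'e [z'r Hz']] := hol_dense_neq0 hH nH z1r e10.
  have [e2 e20 e2P] := near_neq0 (derivable_continuous (hH _ z'r)) Hz'.
  have [s s0 sP] := ball_sub z'e; have [s' s'0 s'P] := ball_sub z'r.
  apply: (identity_ball hG z'r); exists (Num.min e2 (Num.min s s')); first by rewrite !lt_min e20 s0.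
  move=> x; rewrite !lt_min => /and3P[xe xs xs'].
  have := E x (s'P _ xs') (e2P _ xe); rewrite w1 ?sP// => /esym/eqP.
  by rewrite mulf_eq0 invr_eq0 (negbTE (e2P _ xe)) orbF => /eqP.
move=> z2 e z2r e0; have [z3 z3e [z3r Hz3]] := hol_dense_neq0 hH nH z2r e0.
exists z3 => //; have [e3 e30 e3P] := near_neq0 (derivable_continuous (hH _ z3r)) Hz3.
have [s s0 sP] := ball_sub z3r.
exists (Num.min e3 s); first by rewrite lt_min e30.
by move=> x; rewrite lt_min => /andP[xe xs]; rewrite (E x (sP _ xs) (e3P _ xe)) G0 ?sP// mul0r.
Qed.

(** Each centre lies in the disc of its predecessor because |h| < r, so vanishing passes from disc
    to disc. *)
Lemma mero_chain (w : C -> C) z0 h r N z1 : nrm h < r -> (forall k, (k <= N)%N -> mero_on (z0 + k%:R * h) r w) ->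
  nrm (z1 - z0) < r -> zero_near w z1 -> forall z2 (e : R), nrm (z2 - (z0 + N%:R * h)) < r -> 0 < e ->
  exists2 z3, nrm (z3 - z2) < e & zero_near w z3.
Proof.
move=> hr mw z1r zw.
have r0 : 0 < r by apply: le_lt_trans hr; exact: nrm_ge0.
suff H k : (k <= N)%N -> exists2 z1, nrm (z1 - (z0 + k%:R * h)) < r & zero_near w z1.
  by move=> z2 e z2r e0; have [z1' a b] := H N (leqnn N); exact: (mero_zero (mw N (leqnn N)) a b).
elim: k => [|k IH] kN; first by exists z1; rewrite // mul0r addr0.
have [z1' a b] := IH (ltnW kN).
have zk : nrm (z0 + k.+1%:R * h - (z0 + k%:R * h)) < r by rewrite -natr1 [X in nrm X](_ : _ = h)//; ring.
by have [z3 z3r z3z] := mero_zero (mw k (ltnW kN)) a b zk r0; exists z3.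
Qed.

(** The relation A lm = B is carried along the chain to a point near z1 + 2 pi i. There A and B have
    their old values while lm has gained kp, so A kp = 0 at a point where A is nonzero. *)
Lemma monodromy (A B lm : C -> C) (kp : C) z0 h r N z1 (s : R) : nrm h < r -> N%:R * h = twopii R ->
  (forall k, (k <= N)%N -> mero_on (z0 + k%:R * h) r A) ->
  (forall k, (k <= N)%N -> mero_on (z0 + k%:R * h) r B) ->
  (forall z, A (z + twopii R) = A z) -> (forall z, B (z + twopii R) = B z) ->
  (forall z, derivable lm z 1) -> (forall z, lm (z + twopii R) = lm z + kp) ->
  nrm (z1 - z0) < r -> 0 < s -> (forall z, nrm (z - z1) < s -> A z * lm z = B z /\ A z != 0) -> kp = 0.
Proof.
move=> hr Nh mA mB pA pB dl pl z1r s0 H.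
have r0 : 0 < r by apply: le_lt_trans hr; exact: nrm_ge0.
pose w z := A z * lm z - B z.
have mw k : (k <= N)%N -> mero_on (z0 + k%:R * h) r w.
  move=> kN; have Mr := mero_ringclass (z0 + k%:R * h) r0; have [_ _ mM] := Mr.
  apply: (ringclassB Mr (f := fun z => A z * lm z)); last exact: mB.
  by apply: mM; [exact: mA|apply: hol_mero => // z _; exact: dl].
have zw : zero_near w z1 by exists s => // z zs; rewrite /w; have [-> _] := H z zs; rewrite subrr.
have [|z3 z3e [e e0 z3w]] := mero_chain hr mw z1r zw (z2 := z1 + twopii R) _ s0.
  by rewrite Nh opprD addrACA subrr addr0.
have z3' : nrm (z3 - twopii R - z1) < s by rewrite addrAC -addrA -opprD.
have [E An] := H _ z3'.
have := z3w z3; rewrite subrr nrm0 => /(_ e0); rewrite /w -[z3](subrK (twopii R)) pA pB pl -E => E2.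
apply: (mulfI An); rewrite mulr0 -[RHS]E2; ring.
Qed.

End Meromorphy.

(** * The chart y = exp z, p = q / y and its logarithm *)

Section Chart.
Variable R : realType.
Local Notation C := R[i].
Local Notation B := (C * C * C)%type.
Local Notation phase := 'rV[C]_4.
Local Notation point := Defs.point.
Implicit Types (g : phase -> C) (b : B) (x : phase).

Lemma near_rV x (P : phase -> Prop) : (\forall w \near x, P w) <->
  exists2 e : R, 0 < e & forall w : phase, (forall k, nrm (w 0 k - x 0 k) < e) -> P w.
Proof.
split=> [/nbhs_ballP[e /= e0 H]|[e e0 H]].
  have e1 : e = (complex.Re e)%:C by have := e0; rewrite ltcE /= => /andP[/eqP h _]; apply/eqP; rewrite eq_complex /= h !eqxx.
  exists (complex.Re e); first by have := e0; rewrite ltcE /= => /andP[_].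
  move=> w wP; apply: H; split=> // i j; rewrite ord1 -ball_normE /= distrC nrmE e1 ltcR; exact: wP.
apply/nbhs_ballP; exists e%:C => /=; first by rewrite ltcR.
move=> w [_ wP]; apply: H => k; have := wP 0 k; rewrite -ball_normE /= distrC nrmE ltcR.
by [].
Qed.

Lemma coord_all (P : 'I_4 -> Prop) : P iy -> P ip -> P it -> P iF -> forall k, P k.
Proof.
move=> h1 h2 h3 h4 [[|[|[|[|//]]]] lt].
- by rewrite (_ : Ordinal lt = iy)//; apply: val_inj.
- by rewrite (_ : Ordinal lt = ip)//; apply: val_inj.
- by rewrite (_ : Ordinal lt = it)//; apply: val_inj.
- by rewrite (_ : Ordinal lt = iF)//; apply: val_inj.
Qed.

Lemma chain_curve g (c : C -> phase) (s : C) (d : phase) :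
  (forall k, is_derive s 1 (fun w => c w 0 k : C) (d 0 k)) -> differentiable g (c s) ->
  is_derive s 1 (fun w => g (c w)) ('D_d g (c s)).
Proof.
move=> cd dg.
pose u k w : phase := (c w 0 k : C) *: (delta_mx 0 k : phase).
have ud k : is_derive s 1 (u k) (d 0 k *: delta_mx 0 k).
  have [dk <-] := cd k; have dk' : differentiable (fun w => c w 0 k : C) s by apply/derivable1_diffP.
  have du : differentiable (u k) s by exact: (differentiableZl (delta_mx 0 k : phase) dk').
  apply: DeriveDef; first exact/derivable1_diffP.
  by rewrite (deriveE _ du) (diffZl (delta_mx 0 k : phase) dk') /= -(deriveE _ dk').
have cE : c = u iy + u ip + u it + u iF.
  by apply/funext => w; apply/rowP; apply: coord_all; rewrite !fctE !mxE /= !mulr1 !mulr0 ?addr0 ?add0r.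
have [dc Dc] : is_derive s 1 c d.
  rewrite cE; apply: (is_derive_eq (is_deriveD (is_deriveD (is_deriveD (ud iy) (ud ip)) (ud it)) (ud iF))).
  by apply/rowP; apply: coord_all; rewrite !mxE /= !mulr1 !mulr0 ?addr0 ?add0r.
have dfc : differentiable c s by apply/derivable1_diffP.
have dgc : differentiable (g \o c) s by apply: differentiable_comp.
apply: DeriveDef; first exact/derivable1_diffP.
by rewrite -[LHS]/('D_1 (g \o c) s) (deriveE _ dgc) (diff_comp dfc dg) /= -(deriveE _ dfc) Dc -(deriveE _ dg).
Qed.

Definition pt b (t : C) : phase := point (cexp b.1.1) (b.1.2 * cexp (- b.1.1)) t b.2.

Lemma is_derive_point (a b c d : C -> C) (s a' b' c' d' : C) : is_derive s 1 a a' -> is_derive s 1 b b' ->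
  is_derive s 1 c c' -> is_derive s 1 d d' ->
  forall k, is_derive s 1 (fun w => point (a w) (b w) (c w) (d w) 0 k : C) (point a' b' c' d' 0 k).
Proof.
move=> da db dc dd; apply: coord_all.
- by rewrite (_ : (fun w => _) = a) ?mxE//; apply/funext => w; rewrite mxE.
- by rewrite (_ : (fun w => _) = b) ?mxE//; apply/funext => w; rewrite mxE.
- by rewrite (_ : (fun w => _) = c) ?mxE//; apply/funext => w; rewrite mxE.
- by rewrite (_ : (fun w => _) = d) ?mxE//; apply/funext => w; rewrite mxE.
Qed.

Lemma is_derive_cexpN (q z : C) : is_derive z 1 (fun w => q * cexp (- w)) (- (q * cexp (- z))).
Proof.
have E : (fun w => q * cexp (- w)) = (fun w => q * (cexp w)^-1) by apply/funext => w; rewrite cexpN.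
have [d1 v1] := is_derive_cexp z.
have dV : derivable (fun w => (cexp w)^-1) z 1 by exact: (derivableV (cexp_neq0 z) d1).
have EV : 'D_1 (fun w => (cexp w)^-1) z = - (cexp z) ^- 2 *: 'D_1 (@cexp R) z by exact: (deriveV (cexp_neq0 z) d1).
rewrite E; apply: DeriveDef.
  have [rc rD rM] := derivable_ringclass z; exact: (rM (cst q) (fun w => (cexp w)^-1) (rc q) dV).
have -> : 'D_1 (fun w => q * (cexp w)^-1) z = q *: 'D_1 (fun w => (cexp w)^-1) z.
  exact: (@deriveZ C C C (fun w => (cexp w)^-1) q z 1 dV).
rewrite EV v1 cexpN /GRing.scale /=; field; exact: cexp_neq0.
Qed.

Lemma pt_derive g b t : differentiable g (pt b t) ->
  [/\ is_derive b.1.1 1 (fun z => g (pt (z, b.1.2, b.2) t)) ('D_(point (cexp b.1.1) (- (b.1.2 * cexp (- b.1.1))) 0 0) g (pt b t)),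
      is_derive b.1.2 1 (fun q => g (pt (b.1.1, q, b.2) t)) ('D_(point 0 (cexp (- b.1.1)) 0 0) g (pt b t)),
      is_derive b.2 1 (fun F => g (pt (b.1.1, b.1.2, F) t)) ('D_(point 0 0 0 1) g (pt b t)) &
      is_derive t 1 (fun t => g (pt b t)) ('D_(point 0 0 1 0) g (pt b t))].
Proof.
move=> dg; case: b dg => [[z q] F] /= dg; split.
- apply: (@chain_curve g (fun z => pt (z, q, F) t) z (point (cexp z) (- (q * cexp (- z))) 0 0)) dg.
  exact: (is_derive_point (is_derive_cexp z) (is_derive_cexpN q z) (is_derive_cst t z 1) (is_derive_cst F z 1)).
- apply: (@chain_curve g (fun q => pt (z, q, F) t) q (point 0 (cexp (- z)) 0 0)) dg.
  apply: (is_derive_point (is_derive_cst (cexp z) q 1) _ (is_derive_cst t q 1) (is_derive_cst F q 1)) => /=.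
  have [rc rD rM] := derivable_ringclass q; have di : derivable (fun w : C => w) q 1 by exact: derivable_id.
  have E : (fun w => w * cexp (- z)) = (fun w => cexp (- z) *: w) by apply/funext => w; rewrite /GRing.scale /= mulrC.
  rewrite E; apply: DeriveDef; first by rewrite -E; exact: (rM id (cst (cexp (- z))) di (rc _)).
  have -> : 'D_1 (fun w => cexp (- z) *: w) q = cexp (- z) *: 'D_1 (fun w : C => w) q.
    exact: (@deriveZ C C C (fun w => w) (cexp (- z)) q 1 di).
  have -> : 'D_1 (fun w : C => w) q = 1 by exact: (@derive_id C C q 1).
  by rewrite /GRing.scale /= mulr1.
- apply: (@chain_curve g (fun F => pt (z, q, F) t) F (point 0 0 0 1)) dg.
  exact: (is_derive_point (is_derive_cst (cexp z) F 1) (is_derive_cst (q * cexp (- z)) F 1) (is_derive_cst t F 1) (is_derive_id F 1)).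
- apply: (@chain_curve g (fun t => pt (z, q, F) t) t (point 0 0 1 0)) dg.
  exact: (is_derive_point (is_derive_cst (cexp z) t 1) (is_derive_cst (q * cexp (- z)) t 1) (is_derive_id t 1) (is_derive_cst F t 1)).
Qed.

Lemma pt_continuous b t : {for b, continuous (pt ^~ t)}.
Proof.
move=> A /near_rV[e e0 eA].
have [rc rD rM] := @continuous_ringclass R B b.
have c11 : {for b, continuous (fun b : B => b.1.1)}.
  by apply: (@continuous_comp B (C * C)%type C fst fst); [exact: cvg_fst|exact: cvg_fst].
have c12 : {for b, continuous (fun b : B => b.1.2)}.
  by apply: (@continuous_comp B (C * C)%type C fst snd); [exact: cvg_fst|exact: cvg_snd].
have c2 : {for b, continuous (fun b : B => b.2)} by exact: cvg_snd.
have cx (z : C) : {for z, continuous (@cexp R)}.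
  by have [d _] := is_derive_cexp z; exact: derivable_continuous d.
have ce : {for b, continuous (fun b : B => cexp b.1.1)} by exact: (@continuous_comp B C C (fun b => b.1.1) (@cexp R) b c11 (cx _)).
have cn : {for b, continuous (fun b : B => cexp (- b.1.1))}.
  have cN := ringclassN (@continuous_ringclass R B b) (f := fun b => b.1.1) c11.
  exact: (@continuous_comp B C C (fun b => - b.1.1) (@cexp R) b cN (cx _)).
have cp : {for b, continuous (fun b : B => b.1.2 * cexp (- b.1.1))}.
  exact: (rM (fun b => b.1.2) (fun b => cexp (- b.1.1)) c12 cn).
have near1 (u : B -> C) : {for b, continuous u} -> \forall b' \near b, nrm (u b' - u b) < e.
  by move=> cu; apply: (cu (fun w => nrm (w - u b) < e)); exact: near_nrm.
apply: filterS3 (near1 _ ce) (near1 _ cp) (near1 _ c2) => b' h1 h2 h3.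
apply: eA; apply: coord_all; rewrite !mxE /=; [exact: h1|exact: h2| |exact: h3].
by rewrite subrr nrm0.
Qed.

End Chart.

Section Log.
Variable R : realType.
Local Notation C := R[i].
Local Notation ReC := (@complex.Re R).
Local Notation ImC := (@complex.Im R).

(** The principal branch on Re w > 0; it is used for w near 1 only, to lift points of phase space to
    the chart. *)
Definition clog (w : C) : C := ln (nrm w) +i* atan (ImC w / ReC w).

Lemma clogK (w : C) : 0 < ReC w -> cexp (clog w) = w.
Proof.
case: w => a b /= a0; set w := a +i* b.
have w0 : w != 0 by rewrite /w eq_complex /= negb_and (gt_eqF a0).
have r0 : 0 < nrm w by rewrite nrm_gt0.
have rE : nrm w ^+ 2 = a ^+ 2 + b ^+ 2.
  by rewrite /nrm normc_def /= sqr_sqrtr// addr_ge0// sqr_ge0.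
rewrite /clog /cexp /= lnK ?posrE//.
have an0 : a != 0 by rewrite gt_eqF.
have cE : cos (atan (b / a)) = a / nrm w.
  rewrite cos_atan; have -> : 1 + (b / a) ^+ 2 = (nrm w / a) ^+ 2 by rewrite !expr_div_n rE; field.
  by rewrite sqrtr_sqr ger0_norm ?invf_div// divr_ge0 ?ltW.
have sE : sin (atan (b / a)) = b / nrm w.
  have := atanK (b / a); rewrite /tan cE => h.
  have rn : nrm w != 0 by rewrite gt_eqF.
  transitivity (sin (atan (b / a)) / (a / nrm w) * (a / nrm w)); first by field; rewrite an0 rn.
  by rewrite h; field; rewrite an0 rn.
by rewrite cE sE /w; congr (_ +i* _); rewrite mulrC divfK// gt_eqF.
Qed.

Lemma Rcontinuous_ball (f : R -> R) x (e : R) : {for x, continuous f} -> 0 < e ->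
  exists2 d : R, 0 < d & forall y, `|y - x| < d -> `|f y - f x| < e.
Proof.
move=> cf e0; have /cf /nbhs_normP[d /= d0 H] : nbhs (f x) [set y | `|y - f x| < e].
  by apply/nbhs_normP; exists e => // y; rewrite /ball_ /= distrC.
by exists d => // y yd; apply: H; rewrite /ball_ /= distrC.
Qed.

Lemma clog_small (e : R) : 0 < e -> exists2 d : R, 0 < d & forall w, nrm (w - 1) < d ->
  0 < ReC w /\ nrm (clog w) < e.
Proof.
move=> e0; have e2 : 0 < e / 2 by rewrite divr_gt0.
have [d1 d10 h1] := Rcontinuous_ball (continuous_ln (@ltr01 R)) e2.
have [d2 d20 h2] := Rcontinuous_ball (@continuous_atan R 0) e2.
have half : 0 < 1 / 2 :> R by rewrite divr_gt0.
exists (Num.min d1 (Num.min (d2 / 2) (1 / 2))); first by rewrite !lt_min d10 half divr_gt0.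
move=> w; rewrite !lt_min => /and3P[w1 w2 w3].
have hr := nrm_ge_Re (w - 1); have hi := nrm_ge_Im (w - 1).
move: hr hi; rewrite !raddfB /= subr0 => hr hi.
have re : 1 / 2 < ReC w.
  have := le_lt_trans hr w3; rewrite ltr_norml => /andP[h _].
  by move: h; rewrite ltrBrDr addrC; apply: le_lt_trans; lra.
have re0 : 0 < ReC w by apply: lt_trans re; rewrite divr_gt0.
split=> //; apply: (le_lt_trans (nrm_le_ReIm _)); rewrite /clog /= [e]splitr; apply: ltrD.
  have := h1 (nrm w); rewrite ln1 subr0; apply; apply: le_lt_trans w1.
  have := le_nrmD (w - 1) 1; have := le_nrmD (1 - w) w; rewrite !subrK nrm1 -(nrm_distC w) => a b.
  by rewrite ler_norml; apply/andP; split; rewrite ?lerBlDr ?lerBrDr; lra.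
have := h2 (ImC w / ReC w); rewrite atan0 !subr0; apply; rewrite normrM normfV (gtr0_norm re0).
rewrite ltr_pdivrMr//; apply: (le_lt_trans hi); apply: (lt_trans w2).
by rewrite ltr_pM2l//; lra.
Qed.

End Log.

(** * Meromorphy along a circle around y = 0 *)

Section Tube.
Variable R : realType.
Local Notation C := R[i].
Local Notation B := (C * C * C)%type.
Local Notation phase := 'rV[C]_4.
Local Notation point := Defs.point.
Implicit Types (f g : phase -> C) (b c : B) (x : phase) (r : R) (z : C).

Lemma nbhs_pd b (P : B -> Prop) : nbhs b P -> exists2 s : R, 0 < s & forall b', pd b s b' -> P b'.
Proof.
move=> [[A1 A2] /= [[[P1 P2] /= [/nearP[s1 s10 h1] /nearP[s2 s20 h2]] PA] /nearP[s3 s30 h3]] AA].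
exists (Num.min s1 (Num.min s2 s3)); first by rewrite !lt_min s10 s20.
move=> [[b1 b2] b3] [/=]; rewrite !lt_min => /and3P[g1 _ _] /and3P[_ g2 _] /and3P[_ _ g3].
by apply: (AA (b1, b2, b3)); split; [apply: (PA (b1, b2)); split; [exact: h1|exact: h2]|exact: h3].
Qed.

(* In a tube point [b] = (q, t, F). *)
Definition tp z b : phase := pt (z, b.1.1, b.2) b.1.2.

Lemma tp_near z c (V : phase -> Prop) : (\forall x \near tp z c, V x) ->
  exists2 s : R, 0 < s & forall z' b, nrm (z' - z) < s -> pd c s b -> V (tp z' b).
Proof.
move=> /near_rV[e e0 eV].
have /(@pt_continuous R (z, c.1.1, c.2) c.1.2)/nbhs_pd[s s0 sP] :
    nbhs (pt (z, c.1.1, c.2) c.1.2) [set w : phase | forall k, nrm (w 0 k - tp z c 0 k) < e].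
  by apply/near_rV; exists e.
exists (Num.min s e); first by rewrite lt_min s0.
move=> z' b z's [b1 b2 b3]; apply: eV; move: z's b1 b2 b3; rewrite !lt_min => /andP[z1 _] /andP[b1 _] /andP[_ b2] /andP[b3 _].
have := sP (z', b.1.1, b.2); rewrite /pd /= => /(_ (And3 z1 b1 b3)) h.
have h1 := h iy; have h2 := h ip; have h4 := h iF; move: h1 h2 h4; rewrite !mxE /= => h1 h2 h4.
apply: coord_all; rewrite !mxE /=; [exact: h1|exact: h2|exact: b2|exact: h4].
Qed.

(** The chart is open: a point close to [tp z c] is lifted by adding to [z] the logarithm of the
    ratio of the y-coordinates. So a property failing on no phase-space neighbourhood of the point
    is met arbitrarily near in the chart. *)
Lemma tp_dense z c (V : phase -> Prop) : ~ (\forall x \near tp z c, ~ V x) ->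
  forall s : R, 0 < s -> exists z' b, [/\ nrm (z' - z) < s, pd c s b & V (tp z' b)].
Proof.
move=> nV s s0; apply: contrapT => nex; apply: nV.
have [d1 d10 d1P] := clog_small s0.
set y := cexp z; have y0 : 0 < nrm y by rewrite nrm_gt0 cexp_neq0.
have yn : y != 0 := cexp_neq0 z.
set p := c.1.1 * cexp (- z).
(* Chosen so that |y' - y| |p'| + |y| |p' - p| <= e1 (1 + |p| + |y|) = s / 2, which controls the new
   coordinate q = y' p'. *)
pose e1 := s / (2 * (1 + nrm y + nrm p)).
have m0 : 0 < 1 + nrm y + nrm p by rewrite -addrA ltr_pwDl// addr_ge0// nrm_ge0.
have e10 : 0 < e1 by rewrite divr_gt0// mulr_gt0.
apply/near_rV; exists (Num.min (Num.min (d1 * nrm y) s) (Num.min e1 1)).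
  by rewrite !lt_min mulr_gt0//= s0 e10 ltr01.
move=> w wP Vw; apply: nex.
have hy := wP iy; have hp := wP ip; have ht := wP it; have hF := wP iF.
move: hy hp ht hF; rewrite !mxE /= -/y -/p !lt_min.
move=> /andP[/andP[hy hys] /andP[hy1 _]] /andP[/andP[_ hps] /andP[hp1 hp2]] /andP[/andP[_ ht] _] /andP[/andP[_ hF] _].
set y' := w 0 iy in hy hys hy1; set p' := w 0 ip in hps hp1 hp2.
have wd : nrm (y' / y - 1) < d1.
  have -> : y' / y - 1 = (y' - y) / y by field.
  by rewrite nrmM nrmV ltr_pdivrMr.
have [re lsmall] := d1P _ wd.
have yE : cexp (z + clog (y' / y)) = y' by rewrite cexpD clogK// mulrC divfK.
exists (z + clog (y' / y)), (y' * p', w 0 it, w 0 iF); split.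
- by rewrite addrC addKr.
- split => //=.
  have -> : y' * p' - c.1.1 = (y' - y) * p' + y * (p' - p).
    have -> : c.1.1 = y * p by rewrite /p /y cexpN mulrCA mulfV// mulr1.
    by ring.
  apply: (le_lt_trans (le_nrmD _ _)); rewrite !nrmM.
  have p'1 : nrm p' <= 1 + nrm p by have := le_nrmD (p' - p) p; rewrite subrK => /le_trans; apply; rewrite lerD2r ltW.
  have E : s = e1 * (1 + nrm p + nrm y) + e1 * (1 + nrm p + nrm y).
    by rewrite /e1; field; rewrite gt_eqF// mulr_gt0.
  have a1 : nrm (y' - y) * nrm p' <= e1 * (1 + nrm p) by apply: (ler_pM (nrm_ge0 _) (nrm_ge0 _) (ltW hy1) p'1).
  have a2 : nrm y * nrm (p' - p) <= e1 * nrm y by rewrite mulrC ler_pM2r// ltW.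
  apply: (le_lt_trans (lerD a1 a2)); rewrite -mulrDr [ltRHS]E ltrDl.
  by rewrite mulr_gt0// addrAC.
- have -> : tp (z + clog (y' / y)) (y' * p', w 0 it, w 0 iF) = w; last exact: Vw.
  have y'0 : y' != 0 by rewrite -yE cexp_neq0.
  apply/rowP; apply: coord_all; rewrite !mxE //= ?cexpN ?yE//.
  by rewrite mulrAC mulfV// mul1r.
Qed.

End Tube.

Section Tube.
Variable R : realType.
Local Notation C := R[i].
Local Notation B := (C * C * C)%type.
Local Notation phase := 'rV[C]_4.
Implicit Types (f g h : phase -> C) (b c : B) (r rho : R) (z : C).

Lemma holomorphic_differentiable g (x : phase) : holomorphic_at g x -> differentiable g x.
Proof. by move=> /nbhs_singleton. Qed.

Lemma tp_derivable g z b : differentiable g (tp z b) -> derivable (fun z => g (tp z b)) z 1.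
Proof. by move=> dg; have [[d _] _ _ _] := pt_derive (b := (z, b.1.1, b.2)) dg. Qed.

Lemma tp_neq0 h z b : differentiable h (tp z b) -> h (tp z b) != 0 ->
  exists2 s : R, 0 < s & forall b', pd b s b' -> h (tp z b') != 0.
Proof.
move=> dh h0; have [|s s0 sP] := @tp_near R z b (fun x => h x != 0).
  have ch := differentiable_continuous dh.
  by apply: (ch (fun y => y != 0)); apply/nearP; exists (nrm (h (tp z b))); [rewrite nrm_gt0|move=> w wf; apply/eqP => w0; move: wf; rewrite w0 sub0r nrmN ltxx].
by exists s => // b' bb'; apply: sP => //; rewrite subrr nrm0.
Qed.

Lemma pd_shrink c b r s : pd c r b -> 0 < s -> exists2 s' : R, 0 < s' &
  forall b', pd b s' b' -> pd c r b' /\ pd b s b'.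
Proof.
move=> /pd_sub[s1 s10 h1] s0; exists (Num.min s1 s); first by rewrite lt_min s10.
by move=> b' bb'; split; [apply: h1|]; apply: pd_le bb'; rewrite ge_min lexx ?orbT.
Qed.

Variables (f : phase -> C) (z0 : C) (c : B).
Hypothesis mf : meromorphic f.

(** On the tube of radius [rho] about the angle [th] of the circle, [f] is one quotient g / h. *)
Let good (th rho : R) := exists V g h, [/\ forall x, V x -> holomorphic_at g x /\ holomorphic_at h x,
  forall x, V x -> ~ (\forall w \near x, h w = 0),
  forall x, V x -> h x != 0 -> f x = g x / h x &
  forall z b, nrm (z - (z0 + 0 +i* th)) < rho -> pd c rho b -> V (tp z b)].

Let nrm_im (x : R) : nrm (0 +i* x) = `|x|.
Proof. by rewrite /nrm normc_def /= expr0n /= add0r sqrtr_sqr. Qed.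

Let good_near th : exists2 s : R, 0 < s & forall th' rho, `|th' - th| < s -> rho < s -> good th' rho.
Proof.
have [V [g [h [[oV Vx] gh hn fE]]]] := mf (tp (z0 + 0 +i* th) c).
have [s s0 sP] := tp_near (open_nbhs_nbhs (conj oV Vx)).
exists (s / 2); first by rewrite divr_gt0.
move=> th' rho th's rs; exists V, g, h; split=> // z b zr br; apply: sP.
  apply: (le_lt_trans (nrm_triangle _ (z0 + 0 +i* th') _)); rewrite [s]splitr; apply: ltrD; first exact: lt_trans zr rs.
  rewrite opprD addrACA subrr add0r.
  by rewrite (_ : _ - _ = 0 +i* (th' - th)) ?nrm_im//; apply/eqP; rewrite eq_complex /= subrr !eqxx.
by apply: pd_le br; rewrite (le_trans (ltW rs))// ler_pdivrMr// ler_pMr// ler1n.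
Qed.

(** Compactness of the interval of angles replaces the local radii by a single one. *)
Let good_uniform : exists2 rho : R, 0 < rho & forall th, 0 <= th <= pi *+ 2 -> good th rho.
Proof.
have /compact_near_coveringP/(_ nat \oo (fun n th => good th n.+1%:R^-1)) := @segment_compact R 0 (pi *+ 2).
case=> [th _|N _ NP].
  have [s s0 sP] := good_near th.
  exists ([set th' | `|th' - th| < s], [set n | n.+1%:R^-1 < s]).
    split; first by apply/nbhs_normP; exists s => // y; rewrite /ball_ /= distrC.
    exact: near_infty_natSinv_lt (PosNum s0).
  by move=> [th' n] [/= h1 h2]; exact: sP.
exists N.+1%:R^-1; first by rewrite invr_gt0 ltr0n.
by move=> th thP; apply: (NP N) => //=; rewrite in_itv.
Qed.

(** On a slice [b] the denominator of a disc might vanish identically in z. For each disc in turn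
    the box is moved and shrunk around a slice where it does not, which is why the centre [c']
    differs from [c]. *)
Theorem mero_tube r : 0 < r -> exists N (dl : C) rho c' (r' : R), [/\ 0 < r', nrm dl < rho, N%:R * dl = twopii R,
  forall b, pd c' r' b -> pd c r b &
  forall k b, (k <= N)%N -> pd c' r' b -> mero_on (z0 + k%:R * dl) rho (fun z => f (tp z b))].
Proof.
move=> r0; have [rho rho0 gd] := good_uniform.
have pi2 : 0 < pi *+ 2 :> R by rewrite pmulrn_lgt0// pi_gt0.
pose N := (Num.truncn (pi *+ 2 / rho)).+1.
have NP : pi *+ 2 / rho < N%:R by exact: truncnS_gt.
have N0 : 0 < N%:R :> R by rewrite ltr0n.
pose th (k : nat) : R := k%:R * (pi *+ 2 / N%:R).
pose dl : C := 0 +i* (pi *+ 2 / N%:R).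
have kh (k : nat) : k%:R * dl = 0 +i* th k.
  rewrite /dl /th -[k%:R]/(1 *+ k) mulr_natl; apply/eqP; rewrite eq_complex.
  by rewrite !raddfMn /= mul0rn mulr_natl !eqxx.
have step (k : nat) : (k <= N.+1)%N -> exists c' (r' : R), [/\ 0 < r', forall b, pd c' r' b -> pd c r b,
   forall b, pd c' r' b -> pd c rho b &
   forall j b, (j < k)%N -> pd c' r' b -> mero_on (z0 + j%:R * dl) rho (fun z => f (tp z b))].
  elim: k => [_|k IH kN].
    exists c, (Num.min r rho); split=> //; first by rewrite lt_min r0.
      by move=> b; apply: pd_le; rewrite ge_min lexx.
    by move=> b; apply: pd_le; rewrite ge_min lexx orbT.
  have [c1 [r1 [r10 s1 s2 m1]]] := IH (ltnW kN).
  have thk : 0 <= th k <= pi *+ 2.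
    rewrite mulr_ge0//= ?divr_ge0 ?(ltW pi2)// /th mulrA ler_pdivrMr// mulrC ler_pM2l// ler_nat.
    by rewrite -ltnS.
  have [V [G [H [GH Hn fE VP]]]] := gd _ thk.
  have Vc : V (tp (z0 + 0 +i* th k) c1).
    by apply: VP; [rewrite subrr nrm0|apply/s2/pd_center].
  have nH : ~ (\forall x \near tp (z0 + 0 +i* th k) c1, ~ H x != 0).
    by move=> near0; apply: (Hn _ Vc); apply: filterS near0 => x /negP; rewrite negbK => /eqP.
  have m0 : 0 < Num.min rho r1 by rewrite lt_min rho0.
  have [s' [b' [z'P b'P Hz]]] := tp_dense nH m0.
  have z'r : nrm (s' - (z0 + 0 +i* th k)) < rho by move: z'P; rewrite lt_min => /andP[].
  have b'r : pd c1 r1 b' by apply: pd_le b'P; rewrite ge_min lexx orbT.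
  have dH := holomorphic_differentiable (GH _ (VP _ _ z'r (s2 _ b'r))).2.
  have [s3 s30 s3P] := tp_neq0 dH Hz.
  have [r2 r20 r2P] := pd_shrink b'r s30.
  exists b', r2; split=> //.
  - by move=> b /r2P[/s1].
  - by move=> b /r2P[/s2].
  - move=> j b; rewrite ltnS leq_eqVlt => /orP[/eqP->|jk] /r2P[b1 b3]; last exact: m1.
    rewrite kh; exists (fun z => G (tp z b)), (fun z => H (tp z b)); split.
    + by move=> z zr; apply: tp_derivable; apply: holomorphic_differentiable; have [] := GH _ (VP _ _ zr (s2 _ b1)).
    + by move=> z zr; apply: tp_derivable; apply: holomorphic_differentiable; have [] := GH _ (VP _ _ zr (s2 _ b1)).
    + by exists s' => //; exact: s3P.
    + by move=> z zr; apply: fE; exact: VP (s2 _ b1).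
have [c' [r' [r'0 s1 _ m]]] := step N.+1 (leqnn _).
exists N, dl, rho, c', r'; split=> //; last first.
- by rewrite kh /th /twopii; congr (_ +i* _); rewrite mulrC divfK// gt_eqF.
- rewrite /dl nrm_im ger0_norm ?divr_ge0 ?(ltW pi2)// ltr_pdivrMr// mulrC -ltr_pdivrMr//.
Qed.

End Tube.

(** * Exponentials and interpolation *)

Section Exponentials.
Variable R : realType.
Local Notation C := R[i].
Implicit Types (mu z q : C).

Lemma is_derive_cexpM mu z : is_derive z 1 (fun w => cexp (mu * w)) (mu * cexp (mu * z)).
Proof.
apply/is_derive_expandP => e e0.
have m0 : 0 < 1 + nrm mu by rewrite ltr_pwDl// nrm_ge0.
have c0 : 0 < nrm (cexp (mu * z)) by rewrite nrm_gt0 cexp_neq0.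
have e10 : 0 < e / (nrm (cexp (mu * z)) * (1 + nrm mu)) by rewrite divr_gt0// mulr_gt0.
have [dl dl0 H] := cexp_expand0 e10.
exists (dl / (1 + nrm mu)); first by rewrite divr_gt0.
move=> w wz.
have mw : nrm (mu * (w - z)) <= (1 + nrm mu) * nrm (w - z).
  by rewrite nrmM ler_wpM2r ?nrm_ge0// lerDr.
have /H h : nrm (mu * (w - z)) < dl.
  by apply: (le_lt_trans mw); rewrite mulrC -ltr_pdivlMr.
have -> : cexp (mu * w) - cexp (mu * z) - mu * cexp (mu * z) * (w - z) =
   cexp (mu * z) * (cexp (mu * (w - z)) - 1 - mu * (w - z)).
  have -> : mu * w = mu * z + mu * (w - z) by ring.
  by rewrite cexpD; ring.
rewrite nrmM; apply: (le_trans (ler_wpM2l (ltW c0) h)); rewrite mulrA.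
apply: (le_trans (ler_wpM2l _ mw)); first by rewrite mulr_ge0 ?(ltW e10) ?(ltW c0).
by rewrite mulrA ler_wpM2r ?nrm_ge0//; rewrite le_eqVlt; apply/orP; left; apply/eqP; field; rewrite !gt_eqF.
Qed.

Lemma two_neq0 : (2 : C) != 0.
Proof. by rewrite pnatr_eq0. Qed.

Lemma cexpMn z n : cexp (n%:R * z) = cexp z ^+ n.
Proof. by elim: n => [|n IH]; rewrite ?mul0r ?cexp0 ?expr0// -natr1 mulrDl mul1r cexpD IH exprSr. Qed.

Lemma is_derive_sum_ord n (f : nat -> C -> C) (d : nat -> C) z : (forall i, (i < n)%N -> is_derive z 1 (f i) (d i)) ->
  is_derive z 1 (fun w => \sum_(i < n) f i w) (\sum_(i < n) d i).
Proof.
elim: n => [|n IH] H.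
  rewrite (_ : (fun w => _) = cst 0) ?big_ord0; first exact: is_derive_cst.
  by apply/funext => w; rewrite big_ord0.
rewrite (_ : (fun w => _) = (fun w => \sum_(i < n) f i w) + f n); last by apply/funext => w; rewrite big_ord_recr.
rewrite big_ord_recr /=; apply: is_deriveD; last exact: H.
by apply: IH => i i_n; apply: H; exact: leq_trans i_n (leqnSn _).
Qed.

(** The inverse of a Vandermonde matrix expresses coefficients as fixed combinations of sample
    values, so they inherit differentiability in parameters. *)
Lemma interpolation n (y : nat -> C) : injective y -> exists L : nat -> nat -> C, forall (P : {poly C}),
  (size P <= n)%N -> forall J, (J < n)%N -> P`_J = \sum_(i < n) L J i * P.[y i].
Proof.
move=> yi; pose V := Vandermonde n (\row_(i < n) y i).
have uV : V \in unitmx.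
  rewrite unitmxE unitfE det_Vandermonde prodf_seq_neq0; apply/allP => i _ /=.
  rewrite prodf_seq_neq0; apply/allP => j _ /=; apply/implyP => ij.
  by rewrite !mxE subr_eq0; apply: contraTneq ij => /yi->; rewrite ltnn.
exists (fun J i => if insub J is Some J' then (if insub i is Some i' then invmx V i' J' else 0) else 0).
move=> P Pn J Jn; rewrite insubT.
pose p := \row_(j < n) P`_j.
have : p *m V *m invmx V = p by rewrite mulmxK.
move=> /matrixP/(_ 0 (Ordinal Jn)); rewrite !mxE /= => <-; apply: eq_bigr => i _.
rewrite valK mulrC; congr (_ * _); rewrite (horner_coef_wide _ Pn) !mxE; apply: eq_bigr => j _.
by rewrite !mxE.
Qed.

Lemma sum_shift2 (f g : nat -> C) n :
  \sum_(J < n.+2) (if (J : nat) is J'.+2 then f J' else 0) * g J = \sum_(J < n) f J * g J.+2.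
Proof. by rewrite !big_ord_recl /= !mul0r !add0r. Qed.

Lemma sum_shift1 (f g : nat -> C) n : f n = 0 ->
  \sum_(J < n.+2) (if (J : nat) is J'.+1 then f J' else 0) * g J = \sum_(J < n) f J * g J.+1.
Proof. by move=> f0; rewrite big_ord_recl /= mul0r add0r big_ord_recr /= f0 mul0r addr0. Qed.

Lemma sum_shift0 (f g : nat -> C) n : f n = 0 -> f n.+1 = 0 ->
  \sum_(J < n.+2) f J * g J = \sum_(J < n) f J * g J.
Proof. by move=> f0 f1; rewrite !big_ord_recr /= f0 f1 !mul0r !addr0. Qed.

End Exponentials.

(** * The coefficients are Laurent polynomials in y *)

Section Laurent.
Variable R : realType.
Local Notation C := R[i].
Local Notation B := (C * C * C)%type.
Variables (c : B) (r : R) (N : C) (Cf : nat -> B -> C).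
Hypothesis r0 : 0 < r.
Hypothesis Cs : forall b k, pd c r b -> sder (Cf k) b.
Hypothesis Crec : forall b k, pd c r b -> 2 * dz (Cf k) b =
    if k is k1.+1 then D0 (Cf k1) b + (if k1 is k2.+1 then (N - k2%:R) * Cf k2 b else 0) else 0.
Local Notation discz z := (nrm (z - c.1.1) < r).
Local Notation discq q := (nrm (q - c.1.2) < r).
Local Notation discF F := (nrm (F - c.2) < r).
(** Supplied in the first pass by continuation once around y = 0, and in the second by rationality
    in exp z. *)
Hypothesis Cmono : forall k q F (lm : C -> C) (kp : C), discq q -> discF F ->
  (forall z, derivable lm z 1) -> (forall z, lm (z + twopii R) = lm z + kp) ->
  (forall z, discz z -> Cf k (z, q, F) = lm z) -> kp = 0.

(** This is y^(J-k): Laurent polynomials with exponents from -k to k are indexed by J from 0 to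
    2k. *)
Let E (k J : nat) (z : C) := cexp ((J%:R - k%:R) * z).

Let zz (i : nat) : C := c.1.1 + (r / i.+2%:R)%:C.
Let zz_disc i : discz (zz i).
Proof.
rewrite /zz addrC addKr /nrm ger0_norm/= ?lecR ?divr_ge0 ?(ltW r0)//.
by rewrite ltr_pdivrMr// ltr_pMr// ltr1n.
Qed.
Let yy_inj : injective (fun i => cexp (zz i)).
Proof.
move=> i j; rewrite /zz !cexpD => /(mulfI (cexp_neq0 _)).
rewrite /cexp /= cos0 sin0 !mulr1 !mulr0 => -[/expR_inj].
by move=> /(mulfI (lt0r_neq0 r0)) /invr_inj /eqP; rewrite eqr_nat => /eqP [].
Qed.

Let EM k J z : E k J z * cexp z ^+ k = cexp z ^+ J.
Proof. by rewrite /E -!cexpMn -cexpD; congr cexp; ring. Qed.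
Let E1 k J z : cexp z * E k J z = E k.+1 J.+2 z.
Proof. by rewrite /E -cexpD; congr cexp; rewrite -!natr1; ring. Qed.
Let E2 k J z : E k J z / cexp z = E k.+1 J z.
Proof. by rewrite /E -cexpN -cexpD; congr cexp; rewrite -!natr1; ring. Qed.
Let E3 k J z : E k J z = E k.+1 J.+1 z.
Proof. by rewrite /E; congr cexp; rewrite -!natr1; ring. Qed.

Let pk k := forall q F, discq q -> discF F -> exists P : {poly C}, (size P <= k.*2.+1)%N /\
  forall z, discz z -> Cf k (z, q, F) = \sum_(J < k.*2.+1) P`_J * E k J z.

(** The coefficient of y^(J-k-1) in D0 (Cf k) + (N - (k - 1)) Cf (k - 1). Multiplication by y shifts
    J by two, derivation in F by one, division by y by none, because the exponent is counted from
    -(k + 1) at the next level. *)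
Definition laurent_rhs (a : nat -> nat -> C -> C -> C) k J q F : C :=
  (2 * q - 2 / 3) * (J%:R - k%:R) * a k J q F + be q * 'D_1 (fun q => a k J q F) q
  + (if J is J'.+1 then 2 * q * 'D_1 (a k J' q) F else 0)
  + (if J is J'.+2 then - ((J'%:R - k%:R) * a k J' q F) + al q * 'D_1 (fun q => a k J' q F) q else 0)
  + (if k is k'.+1 then (if J is J'.+2 then (N - k'%:R) * a k' J' q F else 0) else 0).

Let half_term (s d e : C) : d != 0 -> s / (2 * d) * (d * e) = s * e / 2.
Proof. by move=> d0; field. Qed.

Let half_term2 (s d : C) : d != 0 -> 2 * d * (s / (2 * d)) = s.
Proof. by move=> d0; field. Qed.

Let dneq (J k : nat) : J != k -> J%:R - k%:R != 0 :> C.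
Proof. by rewrite subr_eq0 eqr_nat. Qed.

Let D0_term (al be q2 y A A1 A2 e m : C) : y != 0 ->
  ((al * y + be / y) * A1 + A2) * e + A * ((q2 / y - y) * (m * e)) =
  (q2 * m * A + be * A1) * (e / y) + A2 * e + (- (m * A) + al * A1) * (y * e).
Proof. by move=> y0; field. Qed.

(** The recursion gives d_z of the next coefficient as a Laurent polynomial in y, to be integrated
    term by term. Only y^0, of index J = k + 1, integrates to a multiple of z; [Cmono] excludes it,
    and its vanishing is the equation with left side 0. *)
Theorem laurent : exists a : nat -> nat -> C -> C -> C, [/\
  forall k q F z, discq q -> discF F -> discz z -> Cf k (z, q, F) * cexp z ^+ k = \sum_(J < k.*2.+1) a k J q F * cexp z ^+ J,
  forall k J q F, (k.*2 < J)%N -> a k J q F = 0,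
  forall k J q F, discq q -> discF F -> derivable (fun q => a k J q F) q 1 /\ derivable (a k J q) F 1 &
  forall k J q F, discq q -> discF F -> (J < k.*2.+3)%N ->
    2 * (J%:R - k.+1%:R) * a k.+1 J q F = laurent_rhs a k J q F].
Proof.
have /choice[L LP] n := interpolation n yy_inj.
(* Defining the coefficients by interpolation at fixed values of z makes them differentiable in q
   and F at once. *)
pose a k J q F := if (J < k.*2.+1)%N then
  \sum_(i < k.*2.+1) L k.*2.+1 J i * (Cf k (zz i, q, F) * cexp (zz i) ^+ k) else 0.
have a0 k J q F : (k.*2 < J)%N -> a k J q F = 0 by move=> kJ; rewrite /a ltnNge kJ.
have aP k q F (P : {poly C}) : discq q -> discF F -> (size P <= k.*2.+1)%N ->
   (forall z, discz z -> Cf k (z, q, F) = \sum_(J < k.*2.+1) P`_J * E k J z) -> forall J, a k J q F = P`_J.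
  move=> hq hF sP PE J; rewrite /a; case: ltnP => kJ; last by rewrite nth_default// (leq_trans sP).
  rewrite (LP _ P sP J kJ); apply: eq_bigr => i _; congr (_ * _).
  rewrite PE ?zz_disc// mulr_suml (horner_coef_wide _ sP); apply: eq_bigr => j _.
  by rewrite -mulrA EM.
have ad k J q F : discq q -> discF F -> derivable (fun q => a k J q F) q 1 /\ derivable (a k J q) F 1.
  move=> hq hF; have [cq dq mq] := derivable_ringclass q; have [cF dF mF] := derivable_ringclass F.
  rewrite /a; case: (J < k.*2.+1)%N; last by split; [exact: cq|exact: cF].
  have sC i : sder (Cf k) (zz i, q, F) by apply: Cs; split=> //=; exact: zz_disc.
  have hq' i : derivable (fun q => L k.*2.+1 J i * (Cf k (zz i, q, F) * cexp (zz i) ^+ k)) q 1.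
    have [_ h _] := sC i.
    exact: (mq (cst (L k.*2.+1 J i)) (fun q => Cf k (zz i, q, F) * cexp (zz i) ^+ k) (cq _)
      (mq (fun q => Cf k (zz i, q, F)) (cst (cexp (zz i) ^+ k)) h (cq _))).
  have hF' i : derivable (fun F => L k.*2.+1 J i * (Cf k (zz i, q, F) * cexp (zz i) ^+ k)) F 1.
    have [_ _ h] := sC i.
    exact: (mF (cst (L k.*2.+1 J i)) (fun F => Cf k (zz i, q, F) * cexp (zz i) ^+ k) (cF _)
      (mF (fun F => Cf k (zz i, q, F)) (cst (cexp (zz i) ^+ k)) h (cF _))).
  have Sq := @ringclass_sum R C _ (derivable_ringclass q) 'I_(k.*2.+1) (index_enum _) xpredT
    (fun i q => L k.*2.+1 J i * (Cf k (zz i, q, F) * cexp (zz i) ^+ k)) hq'.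
  have SF := @ringclass_sum R C _ (derivable_ringclass F) 'I_(k.*2.+1) (index_enum _) xpredT
    (fun i F => L k.*2.+1 J i * (Cf k (zz i, q, F) * cexp (zz i) ^+ k)) hF'.
  by split; [exact: Sq|exact: SF].
have aE k q F z : pk k -> discq q -> discF F -> discz z -> Cf k (z, q, F) = \sum_(J < k.*2.+1) a k J q F * E k J z.
  move=> pkk hq hF hz; have [P [sP PE]] := pkk q F hq hF.
  by rewrite PE//; apply: eq_bigr => J _; rewrite (aP k q F P hq hF sP PE).
have D0E k q F z : pk k -> discq q -> discF F -> discz z -> D0 (Cf k) (z, q, F) =
   \sum_(J < k.*2.+3) ((2 * q - 2 / 3) * (J%:R - k%:R) * a k J q F + be q * 'D_1 (fun q => a k J q F) q
    + (if (J : nat) is J'.+1 then 2 * q * 'D_1 (a k J' q) F else 0)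
    + (if (J : nat) is J'.+2 then - ((J'%:R - k%:R) * a k J' q F) + al q * 'D_1 (fun q => a k J' q F) q else 0)) * E k.+1 J z.
  move=> pkk hq hF hz; set n := k.*2.+1; pose b : B := (z, q, F).
  have bb : pd c r b by split.
  pose A J (b : B) := a k J b.1.2 b.2; pose Y J (b : B) := E k J b.1.1.
  have [d1 d2 d3 d4] := D0_derivation b; have [sc sD sM] := sder_ringclass b.
  have sA J : sder (A J) b.
    have [h1 h2] := ad k J q F hq hF; have [h _ _] := derivable_ringclass z.
    by split; [exact: (h (a k J q F))|exact: h1|exact: h2].
  have sY J : sder (Y J) b.
    have [h _] := is_derive_cexpM (J%:R - k%:R) z.
    have [h1 _ _] := derivable_ringclass q; have [h2 _ _] := derivable_ringclass F.
    by split; [exact: h|exact: (h1 (E k J z))|exact: (h2 (E k J z))].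
  have D0A J : D0 (A J) b = (al q * cexp z + be q / cexp z) * 'D_1 (fun q => a k J q F) q + 2 * q * 'D_1 (a k J q) F.
    have z0 : dz (A J) b = 0 by exact: (@derive_cst C C C (a k J q F) z 1).
    by rewrite /D0 z0 mulr0 add0r.
  have D0Y J : D0 (Y J) b = ((2 * q - 2 / 3) / cexp z - cexp z) * ((J%:R - k%:R) * E k J z).
    have z0 : dz (Y J) b = (J%:R - k%:R) * E k J z by have [_ h] := is_derive_cexpM (J%:R - k%:R) z; exact: h.
    have q0 : dq (Y J) b = 0 by exact: (@derive_cst C C C (E k J z) q 1).
    have F0 : dF (Y J) b = 0 by exact: (@derive_cst C C C (E k J z) F 1).
    by rewrite /D0 z0 q0 F0 !mulr0 !addr0.
  have -> : D0 (Cf k) (z, q, F) = D0 (fun b => \sum_(J < n) A J b * Y J b) b.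
    apply: d4; have [s s0 sP] := pd_sub bb; exists s => // -[[z' q'] F'] /sP [/= h1 h2 h3].
    exact: aE.
  rewrite (derivation_sum (D0_derivation b) (f := fun (J : 'I_n) b => A J b * Y J b)); last first.
    by move=> J; apply: (sM (A J) (Y J)).
  have a00 J : (k.*2 < J)%N -> 'D_1 (fun q => a k J q F) q = 0.
    move=> kJ; rewrite (_ : (fun q => _) = cst 0); first exact: (@derive_cst C C C 0 q 1).
    by apply/funext => q'; exact: a0.
  have a0F J : (k.*2 < J)%N -> 'D_1 (a k J q) F = 0.
    move=> kJ; rewrite (_ : a k J q = cst 0); first exact: (@derive_cst C C C 0 F 1).
    by apply/funext => F'; exact: a0.
  pose f0 J := (2 * q - 2 / 3) * (J%:R - k%:R) * a k J q F + be q * 'D_1 (fun q => a k J q F) q.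
  pose f1 J := 2 * q * 'D_1 (a k J q) F.
  pose f2 J := - ((J%:R - k%:R) * a k J q F) + al q * 'D_1 (fun q => a k J q F) q.
  pose g J := E k.+1 J z.
  have f00 J : (k.*2 < J)%N -> f0 J = 0 by move=> kJ; rewrite /f0 a0// a00// !mulr0 addr0.
  transitivity (\sum_(J < n.+2) f0 J * g J + \sum_(J < n.+2) (if (J : nat) is J'.+1 then f1 J' else 0) * g J
     + \sum_(J < n.+2) (if (J : nat) is J'.+2 then f2 J' else 0) * g J).
    have fn0 : f0 n = 0 by exact: f00.
    have fn1 : f0 n.+1 = 0 by exact: f00.
    have f1n : f1 n = 0 by rewrite /f1 a0F ?mulr0.
    rewrite (sum_shift0 g fn0 fn1) (sum_shift1 g f1n) (sum_shift2 f2 g).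
    rewrite -!big_split /=; apply: eq_bigr => J _.
    have -> : D0 (fun b => A J b * Y J b) b = D0 (A J) b * Y J b + A J b * D0 (Y J) b := d3 (A J) (Y J) (sA J) (sY J).
    rewrite (D0A J) (D0Y J) /g -(E1 k J z) -(E2 k J z) -(E3 k J z).
    exact: (D0_term _ _ _ _ _ _ _ _ (cexp_neq0 z)).
  by rewrite -!big_split /=; apply: eq_bigr => J _; rewrite -!mulrDl.
have Eper k J z : E k J (z + twopii R) = E k J z.
  by apply: (mulIf (expf_neq0 k (cexp_neq0 z))); rewrite EM -[in LHS](cexp_periodic z) EM cexp_periodic.
have Ediag k z : E k k z = 1 by rewrite /E subrr mul0r cexp0.
have tp0 : twopii R != 0.
  by rewrite /twopii eq_complex /= negb_and eqxx /= mulrn_eq0 /= gt_eqF// pi_gt0.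
have step k : pk k -> (if k is k'.+1 then pk k' else True) -> pk k.+1 /\ forall J q F, discq q -> discF F ->
    (J < k.*2.+3)%N -> 2 * (J%:R - k.+1%:R) * a k.+1 J q F = laurent_rhs a k J q F.
  move=> pkk pk1; suff H q F : discq q -> discF F -> exists P : {poly C}, [/\ (size P <= k.+1.*2.+1)%N,
    forall z, discz z -> Cf k.+1 (z, q, F) = \sum_(J < k.+1.*2.+1) P`_J * E k.+1 J z &
    forall J, (J < k.*2.+3)%N -> 2 * (J%:R - k.+1%:R) * P`_J = laurent_rhs a k J q F].
    split=> [q F hq hF|J q F hq hF Jk]; have [P [sP PE PS]] := H q F hq hF; first by exists P.
    by rewrite (aP k.+1 q F P hq hF sP PE) PS.
  move=> hq hF; pose S J := laurent_rhs a k J q F; set n := k.*2.+3.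
  have dzE z : discz z -> 2 * dz (Cf k.+1) (z, q, F) = \sum_(J < n) S J * E k.+1 J z.
    move=> hz; rewrite Crec; last by split.
    rewrite (D0E k q F z pkk hq hF hz).
    have -> : (if k is k2.+1 then (N - k2%:R) * Cf k2 (z, q, F) else 0) =
       \sum_(J < n) (if k is k'.+1 then (if (J : nat) is J'.+2 then (N - k'%:R) * a k' J' q F else 0) else 0) * E k.+1 J z.
      rewrite /n; case: (k) pk1 => [_|k' pk1]; first by rewrite big1// => J _; rewrite mul0r.
      rewrite (aE k' q F z pk1 hq hF hz) (sum_shift2 (fun J' => (N - k'%:R) * a k' J' q F) (E k'.+2 ^~ z)).
      rewrite doubleS (sum_shift0 (f := fun J' => (N - k'%:R) * a k' J' q F) (fun J => E k'.+2 J.+2 z)).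
      - by rewrite mulr_sumr; apply: eq_bigr => J _; rewrite mulrA (E3 k') (E3 k'.+1).
      - by rewrite a0 ?mulr0.
      - by rewrite a0 ?mulr0// ltnS.
    by rewrite -big_split /=; apply: eq_bigr => J _; rewrite /S /laurent_rhs -mulrDl.
  (* Term-by-term primitive; the resonant index k + 1 is set aside and contributes the linear term
     [kap * z]. *)
  pose co (J : nat) : C := if J == k.+1 then 0 else S J / (2 * (J%:R - k.+1%:R)).
  pose lm0 (z : C) : C := \sum_(J < n) co J * E k.+1 J z.
  pose kap : C := S k.+1 / 2.
  have dlm0 (z : C) : is_derive z 1 lm0 (\sum_(J < n) co J * ((J%:R - k.+1%:R) * E k.+1 J z)).
    apply: (is_derive_sum_ord (f := fun J z => co J * E k.+1 J z) (d := fun J => co J * ((J%:R - k.+1%:R) * E k.+1 J z))) => J _.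
    exact: (is_deriveZ (co J) (is_derive_cexpM (J%:R - k.+1%:R) z)).
  have dlin (z : C) : is_derive z 1 (fun z : C => kap * z) kap.
    by have := is_deriveZ kap (is_derive_id z (1 : C)); rewrite /GRing.scale /= mulr1.
  have coS J z : co J * ((J%:R - k.+1%:R) * E k.+1 J z) + (if J == k.+1 then kap else 0) = S J * E k.+1 J z / 2.
    rewrite /co; case: eqP => [->|/eqP Jk]; first by rewrite Ediag /kap mul0r add0r mulr1.
    rewrite addr0; exact: (half_term _ _ (dneq Jk)).
  have kn : (k.+1 < n)%N by rewrite /n !ltnS -addnn (leq_trans (leq_addr k k))// leqnSn.
  have sumk : \sum_(J < n) (if (J : nat) == k.+1 then kap else 0) = kap.
    by rewrite -big_mkcond /= (big_pred1 (Ordinal kn)).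
  have dC (z : C) : discz z -> is_derive z 1 (fun z => Cf k.+1 (z, q, F)) (\sum_(J < n) co J * ((J%:R - k.+1%:R) * E k.+1 J z) + kap).
    move=> hz; have bw : pd c r (z, q, F) by split.
    have [h _ _] := Cs k.+1 bw; apply: DeriveDef; first exact: h.
    apply: (mulfI (two_neq0 R)); rewrite (dzE z hz) -sumk -big_split mulr_sumr; apply: eq_bigr => J _ /=.
    by rewrite coS; field.
  pose K : C := Cf k.+1 (c.1.1, q, F) - lm0 c.1.1 - kap * c.1.1.
  pose lm (z : C) : C := lm0 z + kap * z + K.
  have CE z : discz z -> Cf k.+1 (z, q, F) = lm z.
    move=> hz; have dU w : discz w -> is_derive w 1 (fun z => Cf k.+1 (z, q, F) - lm0 z - kap * z) 0.
      move=> hw; apply: (is_derive_eq (is_deriveB (is_deriveB (dC w hw) (dlm0 w)) (dlin w))).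
      by rewrite addrAC addrK subrr.
    have KE : Cf k.+1 (z, q, F) - lm0 z - kap * z = K := derive0_cst dU hz.
    by rewrite /lm -KE; ring.
  have kap0 : kap = 0.
    have := Cmono (k := k.+1) (lm := lm) (kp := kap * twopii R) hq hF _ _ CE.
    have H1 (z : C) : derivable lm z 1.
      by have [h _] := is_deriveD (is_deriveD (dlm0 z) (dlin z)) (is_derive_cst K z (1 : C)).
    have H2 z : lm (z + twopii R) = lm z + kap * twopii R.
      rewrite /lm /lm0; have -> : \sum_(J < n) co J * E k.+1 J (z + twopii R) = \sum_(J < n) co J * E k.+1 J z.
        by apply: eq_bigr => J _; rewrite Eper.
      by ring.
    by move=> /(_ H1 H2)/eqP; rewrite mulf_eq0 (negbTE tp0) orbF => /eqP.
  have S0 : S k.+1 = 0 by move/eqP: kap0; rewrite /kap mulf_eq0 invr_eq0 (negbTE (two_neq0 R)) orbF => /eqP.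
  (* The integration constant becomes the coefficient of y^0. *)
  pose cf (J : nat) : C := if J == k.+1 then K else co J.
  exists (\poly_(J < n) cf J); split; first exact: size_poly.
  - move=> z hz; rewrite (CE z hz) /lm kap0 mul0r addr0 /lm0.
    have -> : K = \sum_(J < n) (if (J : nat) == k.+1 then K else 0) * E k.+1 J z.
      rewrite (bigD1 (Ordinal kn))//= eqxx Ediag mulr1 big1 ?addr0// => J; rewrite -val_eqE /= => /negbTE ->.
      by rewrite mul0r.
    rewrite -big_split /=; apply: eq_bigr => J _; rewrite coef_poly ltn_ord -mulrDl /cf /co.
    by case: eqP => _; rewrite ?add0r ?addr0.
  - move=> J Jn; rewrite coef_poly Jn /cf /co; case: eqP => [->|/eqP Jk]; first by rewrite subrr mulr0 mul0r; exact: (esym S0).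
    rewrite -/(S J); exact: (half_term2 _ (dneq Jk)).
have pk0 : pk 0%N.
  move=> q F hq hF; exists (Cf 0%N (c.1.1, q, F))%:P; split; first exact: size_polyC_leq1.
  move=> z hz; rewrite big_ord_recl big_ord0 addr0 /E subrr mul0r cexp0 mulr1 coefC eqxx.
  apply: (@derive0_cst _ (fun z => Cf 0%N (z, q, F)) c.1.1 r) => // w hw.
  have bw : pd c r (w, q, F) by split.
  have [d1 _ _] := Cs 0%N bw; have := Crec 0%N bw => /eqP; rewrite mulf_eq0 pnatr_eq0 /= => /eqP dz0.
  by apply: DeriveDef.
have all_pk k : pk k /\ pk k.+1.
  elim: k => [|k [IH1 IH2]]; first by split=> //; have [] := step 0%N pk0 I.
  by split=> //; have [] := step k.+1 IH2 IH1.
exists a; split=> //.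
- move=> k q F z hq hF hz; have [pkk _] := all_pk k.
  rewrite aE// mulr_suml; apply: eq_bigr => J _; by rewrite -mulrA EM.
- move=> k J q F hq hF Jk; have [pkk _] := all_pk k; have [|_ H] := step k pkk; last exact: H.
  by case: k pkk Jk => // k _ _; have [] := all_pk k.
Qed.

End Laurent.

(** * Polynomial dependence on F *)

Section PolynomialInF.
Variable R : realType.
Local Notation C := R[i].
Variables (q0 F0 : C) (r : R).
Hypothesis r0 : 0 < r.
Local Notation discq q := (nrm (q - q0) < r).
Local Notation discF F := (nrm (F - F0) < r).
Implicit Types (u v : C -> C -> C) (h : C -> C).

(** The degree bound is common to all q, which makes the class stable under derivation in q. *)
Definition polyF u := exists d : nat, forall q, discq q -> exists P : {poly C}, (size P <= d)%N /\
  forall F, discF F -> u q F = P.[F].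

Lemma polyF_eq u v : (forall q F, discq q -> discF F -> u q F = v q F) -> polyF v -> polyF u.
Proof. by move=> uv [d H]; exists d => q hq; have [P [sP PE]] := H q hq; exists P; split=> // F hF; rewrite uv// PE. Qed.

Lemma polyF0 : polyF (fun _ _ => 0).
Proof. by exists 0%N => q _; exists 0; rewrite size_poly0; split=> // F _; rewrite horner0. Qed.

Lemma polyFD u v : polyF u -> polyF v -> polyF (fun q F => u q F + v q F).
Proof.
move=> [d H] [e K]; exists (maxn d e) => q hq; have [P [sP PE]] := H q hq; have [Q [sQ QE]] := K q hq.
exists (P + Q); split; last by move=> F hF; rewrite hornerD PE// QE.
by rewrite (leq_trans (size_polyD _ _))// geq_max !leq_max sP sQ orbT.
Qed.

Lemma polyFZ h u : polyF u -> polyF (fun q F => h q * u q F).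
Proof.
move=> [d H]; exists d => q hq; have [P [sP PE]] := H q hq.
exists (h q *: P); split; last by move=> F hF; rewrite hornerZ PE.
exact: leq_trans (size_scale_leq _ _) sP.
Qed.

Lemma polyF_dF u : polyF u -> polyF (fun q F => 'D_1 (u q) F).
Proof.
move=> [d H]; exists d => q hq; have [P [sP PE]] := H q hq; exists P^`(); split.
  by apply/leq_sizeP => j dj; rewrite coef_deriv nth_default ?mul0rn// (leq_trans sP)// (leq_trans dj).
move=> F hF; have s0 : 0 < r - nrm (F - F0) by rewrite subr_gt0.
have [_ <-] := is_derive_horner P F; apply: (derive_local s0) => w wF; apply: PE.
by apply: (le_lt_trans (nrm_triangle w F F0)); rewrite -ltrBrDr.
Qed.

(** The degree being bounded uniformly, the coefficients in F are combinations of the values at d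
    fixed points F, hence differentiable in q. *)
Lemma polyF_dq u : (forall q F, discq q -> discF F -> derivable (fun q => u q F) q 1) ->
  polyF u -> polyF (fun q F => 'D_1 (fun q => u q F) q).
Proof.
move=> du [d H]; pose FF (i : nat) : C := F0 + (r / i.+2%:R)%:C.
have FF_disc i : discF (FF i).
  rewrite /FF addrC addKr /nrm ger0_norm/= ?lecR ?divr_ge0 ?(ltW r0)//.
  by rewrite ltr_pdivrMr// ltr_pMr// ltr1n.
have FF_inj : injective FF.
  move=> i j /addrI /complexI /(mulfI (lt0r_neq0 r0)) /invr_inj /eqP; rewrite eqr_nat => /eqP [].
  by [].
have [L LP] := interpolation d FF_inj.
have uE q F : discq q -> discF F -> u q F = \sum_(J < d) (\sum_(i < d) u q (FF i) * L J i) * F ^+ J.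
  move=> hq hF; have [P [sP PE]] := H q hq; rewrite (PE F hF) (horner_coef_wide _ sP); apply: eq_bigr => J _.
  by rewrite (LP P sP J)//; congr (_ * _); apply: eq_bigr => i _; rewrite (PE (FF i) (FF_disc i)) mulrC.
exists d => q hq; exists (\poly_(J < d) (\sum_(i < d) 'D_1 (fun q => u q (FF i)) q * L J i)).
split; first exact: size_poly.
move=> F hF; rewrite horner_poly; have s0 : 0 < r - nrm (q - q0) by rewrite subr_gt0.
have dui (i : nat) : is_derive q 1 (fun q => u q (FF i)) ('D_1 (fun q => u q (FF i)) q).
  by apply: DeriveDef => //; exact: du.
have hs (g : C -> C) (g' k : C) : is_derive q 1 g g' -> is_derive q 1 (fun q => g q * k) (g' * k).
  move=> dg; have := is_deriveZ k dg; rewrite /GRing.scale /= mulrC.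
  by rewrite (_ : k \*: g = (fun q => g q * k))//; apply/funext => w; rewrite /GRing.scale /= mulrC.
have D : is_derive q 1 (fun q => \sum_(J < d) (\sum_(i < d) u q (FF i) * L J i) * F ^+ J)
   (\sum_(J < d) (\sum_(i < d) 'D_1 (fun q => u q (FF i)) q * L J i) * F ^+ J).
  apply: (is_derive_sum_ord (f := fun J q => (\sum_(i < d) u q (FF i) * L J i) * F ^+ J)
     (d := fun J => (\sum_(i < d) 'D_1 (fun q => u q (FF i)) q * L J i) * F ^+ J)) => J _.
  have DJ := is_derive_sum_ord (f := fun i q => u q (FF i) * L J i) (d := fun i => 'D_1 (fun q => u q (FF i)) q * L J i)
    (fun (i : nat) (_ : (i < d)%N) => hs _ _ (L J i) (dui i)).
  exact: (hs (fun q => \sum_(i < d) u q (FF i) * L J i) _ (F ^+ J) DJ).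
have [_ <-] := D; apply: (derive_local s0) => w wq; apply: uE => //.
by apply: (le_lt_trans (nrm_triangle w q q0)); rewrite -ltrBrDr.
Qed.

Lemma polyF_primitive u : (forall q F, discq q -> discF F -> derivable (u q) F 1) ->
  polyF (fun q F => 'D_1 (u q) F) -> polyF u.
Proof.
move=> du [d H]; exists d.+1 => q hq; have [P [sP PE]] := H q hq.
pose Q := \poly_(i < d.+1) (if i is i'.+1 then P`_i' / i%:R else 0).
have QE : Q^`() = P.
  apply/polyP => i; rewrite coef_deriv coef_poly ltnS; case: ltnP => id.
    by rewrite -[LHS]mulr_natr divfK// pnatr_eq0.
  by rewrite mul0rn nth_default// (leq_trans sP).
exists (Q + (u q F0 - Q.[F0])%:P); split.
  rewrite (leq_trans (size_polyD _ _))// geq_max size_poly (leq_trans (size_polyC_leq1 _))//.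
move=> F hF; rewrite hornerD hornerC.
have := @derive0_cst _ (fun F => u q F - Q.[F]) F0 r _ F hF.
have D w : discF w -> is_derive w 1 (fun F => u q F - Q.[F]) 0.
  move=> hw; have h1 : is_derive w 1 (u q) P.[w] by apply: DeriveDef; [exact: du|exact: PE].
  have := is_deriveB h1 (is_derive_horner Q w); rewrite QE => h; apply: (is_derive_eq h); exact: subrr.
by move=> /(_ D) <-; rewrite addrC subrK.
Qed.

Variables (N : C) (a : nat -> nat -> C -> C -> C).
Hypothesis q_neq0 : forall q, discq q -> q != 0.
Hypothesis a0 : forall k J q F, (k.*2 < J)%N -> a k J q F = 0.
Hypothesis ad : forall k J q F, discq q -> discF F -> derivable (fun q => a k J q F) q 1 /\ derivable (a k J q) F 1.
Hypothesis arec : forall k J q F, discq q -> discF F -> (J < k.*2.+3)%N ->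
    2 * (J%:R - k.+1%:R) * a k.+1 J q F = laurent_rhs N a k J q F.

Let adq k J q F : discq q -> discF F -> derivable (fun q => a k J q F) q 1.
Proof. by move=> hq hF; have [] := ad k J hq hF. Qed.
Let adF k J q F : discq q -> discF F -> derivable (a k J q) F 1.
Proof. by move=> hq hF; have [] := ad k J hq hF. Qed.

Let rest k J q F := (2 * q - 2 / 3) * (J%:R - k%:R) * a k J q F + be q * 'D_1 (fun q => a k J q F) q
  + (if J is J'.+2 then - ((J'%:R - k%:R) * a k J' q F) + al q * 'D_1 (fun q => a k J' q F) q else 0)
  + (if k is k'.+1 then (if J is J'.+2 then (N - k'%:R) * a k' J' q F else 0) else 0).

Let alg1 (A B T1 T2 T3 : C) : T1 + (A + B + T2 + T3) = A + B + T1 + T2 + T3.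
Proof. ring. Qed.
Let alg2 (A B T1 T2 T3 : C) : A + B + T1 + T2 + T3 = A + B + T2 + T3 + T1.
Proof. ring. Qed.

Let rest_polyF k J : polyF (a k J) -> (if J is J'.+2 then polyF (a k J') else True) ->
  (if k is k'.+1 then forall J, polyF (a k' J) else True) -> polyF (rest k J).
Proof.
move=> h1 h2 h3; rewrite /rest; apply: polyFD; first apply: polyFD; first apply: polyFD.
- exact: (polyFZ (fun q => (2 * q - 2 / 3) * (J%:R - k%:R)) h1).
- by apply: (polyFZ (@be R) (polyF_dq _ h1)) => q F; exact: adq.
- case: J h1 h2 => [|[|J']] _ h2; try exact: polyF0.
  apply: polyFD; last by apply: (polyFZ (@al R) (polyF_dq _ h2)) => q F; exact: adq.
  apply: polyF_eq (polyFZ (fun=> - (J'%:R - k%:R)) h2) => q F _ _; by rewrite mulNr.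
- case: k h3 {h1 h2} => [|k'] h3; first exact: polyF0.
  case: J => [|[|J']]; try exact: polyF0.
  exact: (polyFZ (fun=> N - k'%:R) (h3 J')).
Qed.

(** Off the diagonal the recursion can be divided by J - k. For the diagonal coefficient the
    equation of index k + 1 at the next level has left side 0 and contains 2 q d_F (a k k) besides
    terms already known; as q != 0, one integration in F remains. *)
Theorem polyF_coef k J : polyF (a k J).
Proof.
suff [H _] : (forall J, polyF (a k J)) /\ (if k is k'.+1 then forall J, polyF (a k' J) else True) by exact: H.
have diag k1 : (forall J, J != k1 -> polyF (a k1 J)) -> (if k1 is k'.+1 then forall J, polyF (a k' J) else True) ->
    forall J, polyF (a k1 J).
  move=> nd pr J1; have [->{J1}|] := eqVneq J1 k1; last exact: nd.
  apply: polyF_primitive => [q F|]; first exact: adF.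
  have rP : polyF (rest k1 k1.+1).
    apply: rest_polyF => //; first by apply: nd; rewrite eqn_leq ltnn.
    by case: (k1) nd => // k2 nd; apply: nd; rewrite eqn_leq ltnn andbF.
  apply: polyF_eq (polyFZ (fun q => - (2 * q)^-1) rP) => q F hq hF.
  have kk : (k1.+1 < k1.*2.+3)%N by rewrite !ltnS -addnn (leq_trans (leq_addr k1 k1))// leqnSn.
  have := arec hq hF kk; rewrite subrr mulr0 mul0r /laurent_rhs => E.
  have q2 : 2 * q != 0 by rewrite mulf_neq0 ?pnatr_eq0// q_neq0.
  apply: (mulfI q2); rewrite mulrA mulrN mulfV// mulN1r; apply/eqP; rewrite -subr_eq0 opprK; apply/eqP.
  by rewrite E /rest; exact: alg1.
elim: k => [|k [IH1 IH2]]; split=> //; apply: diag => // J1 J1k.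
  by apply: polyF_eq polyF0 => q F _ _; rewrite a0// lt0n.
case: (ltnP J1 k.*2.+3) => Jk; last by apply: polyF_eq polyF0 => q F _ _; rewrite a0// doubleS.
have rP : polyF (fun q F => rest k J1 q F + (if J1 is J'.+1 then 2 * q * 'D_1 (a k J' q) F else 0)).
  apply: polyFD; first by apply: rest_polyF => //; case: (J1) => [|[|J']].
  case: (J1) => [|J']; first exact: polyF0.
  exact: (polyFZ (fun q => 2 * q) (polyF_dF (IH1 J'))).
have d0 : 2 * (J1%:R - k.+1%:R) != 0 :> C by rewrite mulf_neq0 ?pnatr_eq0// subr_eq0 eqr_nat.
apply: polyF_eq (polyFZ (fun=> (2 * (J1%:R - k.+1%:R))^-1) rP) => q F hq hF.
apply: (mulfI d0); rewrite (arec hq hF Jk) mulrA mulfV// mul1r; exact: alg2.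
Qed.

End PolynomialInF.

(** * Evaluation of polynomials in exp z, and transfer of quotients *)

Section Evaluation.
Variable R : realType.
Local Notation C := R[i].
Implicit Types (y w t : C).

Lemma sample_disc (z0 : C) (r : R) (i : nat) : 0 < r -> nrm (z0 + (r / i.+2%:R)%:C - z0) < r.
Proof.
move=> r0; rewrite addrC addKr /nrm ger0_norm/= ?lecR ?divr_ge0 ?(ltW r0)//.
by rewrite ltr_pdivrMr// ltr_pMr// ltr1n.
Qed.

Lemma sample_cexp_inj (z0 : C) (r : R) : 0 < r -> injective (fun i : nat => cexp (z0 + (r / i.+2%:R)%:C)).
Proof.
move=> r0 i j; rewrite !cexpD => /(mulfI (cexp_neq0 _)).
rewrite /cexp /= cos0 sin0 !mulr1 !mulr0 => -[/expR_inj].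
by move=> /(mulfI (lt0r_neq0 r0)) /invr_inj /eqP; rewrite eqr_nat => /eqP [].
Qed.

Lemma poly_cexp0 (P : {poly C}) (z0 : C) (r : R) : 0 < r -> (forall z, nrm (z - z0) < r -> P.[cexp z] = 0) -> P = 0.
Proof.
move=> r0 H; have [L LP] := interpolation (size P) (sample_cexp_inj (z0 := z0) r0).
apply/polyP => J; rewrite coef0; case: (ltnP J (size P)) => Js; last by rewrite nth_default.
by rewrite (LP P (leqnn _) J Js) big1// => i _; rewrite H ?mulr0//; exact: sample_disc.
Qed.

Definition ev2 y w : {rmorphism {poly {poly C}} -> C} := [the {rmorphism _ -> _} of horner_eval y \o horner_eval w%:P].

Lemma ev2E y w a : ev2 y w a = (map_poly (horner_eval y) a).[w].
Proof. by have := horner_map (horner_eval y) a w%:P; rewrite /ev2 /= /horner_eval hornerC => ->. Qed.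

Lemma ev2_sep (z0 w0 : C) (r : R) a : 0 < r ->
  (forall z w, nrm (z - z0) < r -> nrm (w - w0) < r -> ev2 (cexp z) w a = 0) -> a = 0.
Proof.
move=> r0 H; apply/polyP => i; rewrite coef0; apply: (poly_cexp0 (z0 := z0) r0) => z hz.
have : map_poly (horner_eval (cexp z)) a = 0.
  by apply: (poly_disc0 (t0 := w0) r0) => w hw; rewrite -ev2E H.
by move=> /(congr1 (fun p : {poly C} => p`_i)); rewrite coef_map coef0.
Qed.

(** From the innermost variable outwards, the substitution is y, w, t. *)
Definition ev3 (Q : {poly {poly {poly C}}}) y w t := (map_poly (ev2 y w) Q).[t].

Lemma ev3_ringclass (T : Type) (S : (T -> C) -> Prop) Q (y w t : T -> C) : ringclass S ->
  S y -> S w -> S t -> S (fun x => ev3 Q (y x) (w x) (t x)).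
Proof.
move=> Sr Sy Sw St; have [Sc SD SM] := Sr.
have h1 (p : {poly C}) : S (fun x => p.[y x]).
  rewrite (_ : (fun x => _) = (fun x => \sum_(i < size p) p`_i * y x ^+ i)); last first.
    by apply/funext => x; rewrite horner_coef.
  apply: (@ringclass_sum R T S Sr _ _ _ (fun (i : 'I_(size p)) x => p`_i * y x ^+ i)) => i.
  exact: (SM (cst p`_i) (fun x => y x ^+ i) (Sc _) (ringclassX Sr _ Sy)).
have h2 (a : {poly {poly C}}) : S (fun x => ev2 (y x) (w x) a).
  rewrite (_ : (fun x => _) = (fun x => \sum_(i < size a) (a`_i).[y x] * w x ^+ i)); last first.
    apply/funext => x; rewrite ev2E (horner_coef_wide _ (size_poly _ _)).
    by apply: eq_bigr => i _; rewrite coef_map.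
  apply: (@ringclass_sum R T S Sr _ _ _ (fun (i : 'I_(size a)) x => (a`_i).[y x] * w x ^+ i)) => i.
  exact: (SM (fun x => (a`_i).[y x]) (fun x => w x ^+ i) (h1 _) (ringclassX Sr _ Sw)).
rewrite (_ : (fun x => _) = (fun x => \sum_(i < size Q) ev2 (y x) (w x) Q`_i * t x ^+ i)); last first.
  apply/funext => x; rewrite /ev3 (horner_coef_wide _ (size_poly _ _)).
  by apply: eq_bigr => i _; rewrite coef_map.
apply: (@ringclass_sum R T S Sr _ _ _ (fun (i : 'I_(size Q)) x => ev2 (y x) (w x) Q`_i * t x ^+ i)) => i.
exact: (SM (fun x => ev2 (y x) (w x) Q`_i) (fun x => t x ^+ i) (h2 _) (ringclassX Sr _ St)).
Qed.

(** u Q - P is annihilated by Qx, hence vanishes near a point where Qx is nonzero, hence on the disc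
    by the identity theorem. *)
Lemma quotient_transfer (u : C -> C) (t0 : C) (r : R) (Qx Px Q P : {poly C}) : 0 < r -> Qx != 0 ->
  (forall t, nrm (t - t0) < r -> derivable u t 1) ->
  (forall t, nrm (t - t0) < r -> u t * Qx.[t] = Px.[t]) -> Px * Q = Qx * P ->
  forall t, nrm (t - t0) < r -> u t * Q.[t] = P.[t].
Proof.
move=> r0 Qx0 du uQ E.
pose v t := u t * Q.[t] - P.[t].
have dv : hol v t0 r.
  move=> t ht; have Dr := derivable_ringclass t; have [_ _ mD] := Dr.
  have [dQ _] := is_derive_horner Q t; have [dP _] := is_derive_horner P t.
  exact: (ringclassB Dr (f := fun t => u t * Q.[t]) (g := fun t => P.[t]) (mD u (fun t => Q.[t]) (du t ht) dQ) dP).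
have vQ t : nrm (t - t0) < r -> Qx.[t] * v t = 0.
  move=> ht; have := congr1 (fun p : {poly C} => p.[t]) E; rewrite /= !hornerM => E2.
  by rewrite /v mulrBr -E2 -uQ//; ring.
have [t1 t1r Qt1] : exists2 t1, nrm (t1 - t0) < r & Qx.[t1] != 0.
  apply: contrapT => h; move/eqP: Qx0; apply; apply: (poly_disc0 (t0 := t0) r0) => t ht.
  by apply: contrapT => /eqP n; apply: h; exists t.
have [e e0 eP] : exists2 e : R, 0 < e & forall w, nrm (w - t1) < e -> Qx.[w] != 0.
  by have [dQ _] := is_derive_horner Qx t1; exact: (near_neq0 (derivable_continuous dQ) Qt1).
have [s s0 sP] := ball_sub t1r.
have zv : zero_near v t1.
  exists (Num.min e s); first by rewrite lt_min e0.
  move=> w; rewrite lt_min => /andP[we ws]; have /eqP := vQ w (sP w ws).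
  by rewrite mulf_eq0 (negbTE (eP w we)) => /eqP.
by move=> t ht; apply/eqP; rewrite -subr_eq0; apply/eqP; exact: (identity_ball dv t1r zv ht).
Qed.

(** Series division divides by [q m] only, so a power of [q m] brings [Cf k] into any class that
    contains the values of [phi]. This yields the functions A and B needed for monodromy. *)
Lemma ls_localize (phi : C * C * C -> C -> C) (t0 : C) (r0 : R) c (r : R) l m p q Cf :
  local_series phi t0 r0 c r l m p q Cf ->
  forall S, ringclass S -> (forall t, nrm (t - t0) < r0 -> S (phi ^~ t)) ->
  forall k, exists n B, [/\ S (q m), S B & forall b, pd c r b -> q m b ^+ n * Cf k b = B b].
Proof.
move=> ls S Sr St; have Sqp := ls_ring ls Sr St; have [Sc SD SM] := Sr.
have Sq := (Sqp m).1.
pose S2 u := exists n B, S B /\ forall b, pd c r b -> q m b ^+ n * u b = B b.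
have S2r : ringclass S2.
  split=> [k|u v [n [B1 [S1 E1]]] [n' [B2 [S2' E2]]]|u v [n [B1 [S1 E1]]] [n' [B2 [S2' E2]]]].
  - by exists 0%N, (cst k); split; [exact: Sc|move=> b _; rewrite expr0 mul1r].
  - exists (n + n')%N, (fun b => q m b ^+ n' * B1 b + q m b ^+ n * B2 b); split.
      exact: (SD (fun b => q m b ^+ n' * B1 b) (fun b => q m b ^+ n * B2 b)
        (SM _ _ (ringclassX Sr n' Sq) S1) (SM _ _ (ringclassX Sr n Sq) S2')).
    by move=> b bb; rewrite -E1// -E2// exprD; ring.
  - exists (n + n')%N, (fun b => B1 b * B2 b); split; first exact: SM.
    by move=> b bb; rewrite -E1// -E2// exprD; ring.
have S2_sub u : S u -> S2 u by move=> Su; exists 0%N, u; split=> // b _; rewrite expr0 mul1r.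
have S2rv z u n i : (forall j, S (u j)) -> S2 (rv z u n i).
  by move=> Su; apply: S2_sub; rewrite /rv; case: (i <= n)%N; [exact: Su|exact: Sc].
have Cf2 k : S2 (Cf k).
  elim/ltn_ind: k => k IH.
  have [n [B [SB BE]]] : S2 (fun b => rv 0 p l k b - \sum_(i < k) rv 0 q m i.+1 b * Cf (k - i.+1)%N b).
    apply: (ringclassB S2r (f := rv 0 p l k) (g := fun b => \sum_(i < k) rv 0 q m i.+1 b * Cf (k - i.+1)%N b)).
      by apply: S2rv => j; exact: (Sqp j).2.
    apply: (@ringclass_sum R _ S2 S2r _ _ _ (fun (i : 'I_k) b => rv 0 q m i.+1 b * Cf (k - i.+1)%N b)) => i.
    have [_ _ M2] := S2r; apply: (M2 (rv 0 q m i.+1) (Cf (k - i.+1)%N)).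
      by apply: S2rv => j; exact: (Sqp j).1.
    by apply: IH; rewrite ltn_subrL /= (leq_ltn_trans (leq0n i)).
  exists n.+1, B; split=> // b bb; rewrite -BE// exprSr -mulrA; congr (_ * _).
  have := ls_conv ls k bb; rewrite big_ord_recl subn0 [rv 0 q m ord0]/rv leq0n subn0 => <-.
  by rewrite addrK.
by move=> k; have [n [B [SB BE]]] := Cf2 k; exists n, B.
Qed.

End Evaluation.

(** * First pass: rationality in (y, F, t) for fixed q *)

Section RoundOne.
Variable R : realType.
Local Notation C := R[i].
Local Notation B := (C * C * C)%type.
Local Notation phase := 'rV[C]_4.
Local Notation point := Defs.point.
Local Notation H4 := (@hamiltonian4 R (1 / 3) 0 (- (1 / 3))).

Variable f : phase -> C.
Hypothesis mf : meromorphic f.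
Hypothesis rf : rational_in_t f.
Hypothesis ff : first_integral H4 f.

Let pde_alg (y yi t q a1 a2 a3 a4 : C) : y * yi = 1 ->
  a4 - 2 * t * (y * a1 - q * yi * a2) + (((2 * q - 2 / 3) / y - y) * (y * a1 - q * yi * a2)
    + (al q * y + be q / y) * (yi * a2) + 2 * q * a3) =
  (2 * y * (q * yi) - y ^+ 2 - 2 * t * y - 2 * (1 / 3 - 0)) * a1
  + (- ((q * yi) ^+ 2 - 2 * y * (q * yi) - 2 * t * (q * yi) - 2 * (0 - - (1 / 3)))) * a2 + a4 + 2 * y * (q * yi) * a3.
Proof.
move=> yyi; have y0 : y != 0 by apply: contraTneq (oner_neq0 C) => h; rewrite -yyi h mul0r eqxx.
have -> : yi = y^-1 by apply: (mulfI y0); rewrite yyi mulfV.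
by rewrite /al /be; field.
Qed.

(** The t-dependent part of the Hamiltonian field, -2t (y d_y - p d_p), generates the scaling that
    preserves q = y p, so it becomes -2t d_z. *)
Lemma chart_pde (b : B) (t : C) : holomorphic_at f (pt b t) ->
  'D_1 (fun t => f (pt b t)) t - 2 * t * dz (fun b => f (pt b t)) b + D0 (fun b => f (pt b t)) b = 0.
Proof.
move=> hf; have df := holomorphic_differentiable hf; have [[_ Ez] [_ Eq] [_ EF] [_ Et]] := pt_derive df.
have ez : dz (fun b => f (pt b t)) b = 'D_(point (cexp b.1.1) (- (b.1.2 * cexp (- b.1.1))) 0 0) f (pt b t) := Ez.
have eq : dq (fun b => f (pt b t)) b = 'D_(point 0 (cexp (- b.1.1)) 0 0) f (pt b t) := Eq.
have eF : dF (fun b => f (pt b t)) b = 'D_(point 0 0 0 1) f (pt b t) := EF.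
have := ff hf; rewrite hamiltonian_field4E !mxE /=.
rewrite /D0 ez eq eF Et !(deriveE _ df).
set L := 'd f (pt b t); pose e k : phase := delta_mx 0 k.
have dec (a1 a2 a3 a4 : C) : L (point a1 a2 a3 a4) = a1 * L (e iy) + a2 * L (e ip) + a3 * L (e it) + a4 * L (e iF).
  have -> : point a1 a2 a3 a4 = a1 *: e iy + a2 *: e ip + a3 *: e it + a4 *: e iF.
    by apply/rowP; apply: coord_all; rewrite !mxE /= ?mulr1 ?mulr0 ?addr0 ?add0r.
  by rewrite !linearD !linearZ.
rewrite !dec => E; have yyi : cexp b.1.1 * cexp (- b.1.1) = 1 by rewrite -cexpD subrr cexp0.
rewrite -[RHS]E; move: (L (e iy)) (L (e ip)) (L (e it)) (L (e iF)) yyi => a1 a2 a4 a3 yyi.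
apply: etrans (etrans _ (pde_alg t b.1.2 a1 a2 a3 a4 yyi)) _.
  move: ((2 * b.1.2 - 2 / 3) / cexp b.1.1 - cexp b.1.1) (al b.1.2 * cexp b.1.1 + be b.1.2 / cexp b.1.1) => k1 k2.
  by ring.
by ring.
Qed.

Variables (c0 : B) (t0 : C) (dl : R).
Hypothesis dl0 : 0 < dl.
Hypothesis hf : forall b t, pd c0 dl b -> nrm (t - t0) < dl -> holomorphic_at f (pt b t).
Hypothesis qn0 : forall q, nrm (q - c0.1.2) < dl -> q != 0.

Let derivs b t : pd c0 dl b -> nrm (t - t0) < dl ->
  [/\ derivable (fun z => f (pt (z, b.1.2, b.2) t)) b.1.1 1, derivable (fun q => f (pt (b.1.1, q, b.2) t)) b.1.2 1,
      derivable (fun F => f (pt (b.1.1, b.1.2, F) t)) b.2 1 & derivable (fun t => f (pt b t)) t 1].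
Proof.
move=> hb ht; have df := holomorphic_differentiable (hf hb ht).
have [[a1 _] [a2 _] [a3 _] [a4 _]] := pt_derive df.
split; [exact: a1|exact: a2|exact: a3|exact: a4].
Qed.

(** The denominator is y^k; for fixed q the Laurent coefficients supply a numerator polynomial in y
    and F. *)
Let series_poly (c : B) (r : R) (a : nat -> nat -> C -> C -> C) (Cf : nat -> B -> C) (q : C) : 0 < r ->
  nrm (q - c.1.2) < r ->
  (forall k J, polyF c.1.2 c.2 r (a k J)) ->
  (forall k q F z, nrm (q - c.1.2) < r -> nrm (F - c.2) < r -> nrm (z - c.1.1) < r ->
     Cf k (z, q, F) * cexp z ^+ k = \sum_(J < k.*2.+1) a k J q F * cexp z ^+ J) ->
  forall k, exists d n : {poly {poly C}}, forall z F, nrm (z - c.1.1) < r -> nrm (F - c.2) < r ->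
   ev2 (cexp z) F d != 0 /\ Cf k (z, q, F) * ev2 (cexp z) F d = ev2 (cexp z) F n.
Proof.
move=> r0 hq pF Ck k.
have /choice[P PE] J : exists P : {poly C}, forall F, nrm (F - c.2) < r -> a k J q F = P.[F].
  by have [d H] := pF k J; have [P [_ PE]] := H q hq; exists P.
exists ('X^k)%:P, (\sum_(J < k.*2.+1) map_poly polyC (P J) * ('X^J)%:P) => z F hz hF.
have evX n : ev2 (cexp z) F ('X^n)%:P = cexp z ^+ n by rewrite /ev2 /= /horner_eval hornerC hornerXn.
have evP p : ev2 (cexp z) F (map_poly polyC p) = p.[F].
  by rewrite /ev2 /= /horner_eval horner_map hornerC.
rewrite evX; split; first by rewrite expf_neq0// cexp_neq0.
rewrite (Ck k q F z hq hF hz) rmorph_sum; apply: eq_bigr => J _.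
have -> : ev2 (cexp z) F (map_poly polyC (P J) * ('X^J)%:P) = (P J).[F] * cexp z ^+ J.
  by rewrite rmorphM; congr (_ * _); [exact: evP|exact: evX].
by rewrite PE.
Qed.

(** The expansion is available on a small box only, but for each q of a small disc the resulting
    identity is extended to the whole original ranges of z, F and t. This keeps the later choice of
    level set and base point free. *)
Theorem round_one : exists q1 s, [/\ 0 < s, forall q, nrm (q - q1) < s -> nrm (q - c0.1.2) < dl &
  forall q, nrm (q - q1) < s -> exists P Q : {poly {poly {poly C}}}, Q != 0 /\
  forall z F t, nrm (z - c0.1.1) < dl -> nrm (F - c0.2) < dl -> nrm (t - t0) < dl ->
    f (pt (z, q, F) t) * ev3 Q (cexp z) F t = ev3 P (cexp z) F t].
Proof.
have [N [h [rho [c' [r' [r'0 hrho Nh sub1 mero]]]]]] := mero_tube c0.1.1 (c0.1.2, t0, c0.2) mf dl0.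
have rho0 : 0 < rho by apply: le_lt_trans hrho; exact: nrm_ge0.
pose cc : B := (c0.1.1, c'.1.1, c'.2); pose tt := c'.1.2.
pose r1 := Num.min r' (Num.min dl rho).
have r10 : 0 < r1 by rewrite !lt_min r'0 dl0.
have in1 b t : pd cc r1 b -> nrm (t - tt) < r1 -> [/\ pd c0 dl b, nrm (t - t0) < dl, nrm (b.1.1 - c0.1.1) < rho & pd c' r' (b.1.2, t, b.2)].
  move=> [b1 b2 b3] ht; move: b1 b2 b3 ht; rewrite !lt_min => /and3P[_ z1 z2] /and3P[q1 _ _] /and3P[F1 _ _] /and3P[t1 _ _].
  have h' : pd c' r' (b.1.2, t, b.2) by split.
  by have [a1 a2 a3] := sub1 _ h'; split.
pose phi (b : B) t := f (pt b t).
have [|||||c [r [l [m [p [q [Cf [rr sub ls]]]]]]]] := @local_rat R phi cc tt r1 r10.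
- move=> b t hb ht; have [g1 g2 _ _] := in1 b t hb ht.
  have cf := differentiable_continuous (holomorphic_differentiable (hf g1 g2)).
  have ct := @pt_continuous R b t.
  by move=> A nA; exact: (ct _ (cf A nA)).
- move=> b t hb ht; have [g1 g2 _ _] := in1 b t hb ht; have [a1 a2 a3 _] := derivs g1 g2; split; [exact: a1|exact: a2|exact: a3].
- move=> b t hb ht; have [g1 g2 _ _] := in1 b t hb ht; have [_ _ _ a4] := derivs g1 g2; exact: a4.
- move=> b t hb ht; have [g1 g2 _ _] := in1 b t hb ht; exact: chart_pde (hf g1 g2).
- move=> b hb; have [P [Q [Q0 PQ]]] := rf (cexp b.1.1) (b.1.2 * cexp (- b.1.1)) b.2.
  exists P, Q; split=> // t ht; have [g1 g2 _ _] := in1 b t hb ht; apply: PQ; exact: hf g1 g2.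
have ctr := pd_center c rr.
have htt0 : nrm (tt - tt) < r1 by rewrite subrr nrm0.
have Cmono k q' F (lm : C -> C) (kp : C) : nrm (q' - c.1.2) < r -> nrm (F - c.2) < r ->
  (forall z, derivable lm z 1) -> (forall z, lm (z + twopii R) = lm z + kp) ->
  (forall z, nrm (z - c.1.1) < r -> Cf k (z, q', F) = lm z) -> kp = 0.
  move=> hq hF dlm plm Clm.
  (* Functions meromorphic along the chain of discs and 2 pi i periodic in z. The values of [phi]
     belong to this class since z enters them through exp z alone. *)
  pose S (u : B -> C) := (forall k, (k <= N)%N -> mero_on (c0.1.1 + k%:R * h) rho (fun z => u (z, q', F))) /\
     (forall z, u (z + twopii R, q', F) = u (z, q', F)).
  have Sr : ringclass S.
    split=> [k0|u v [mu pu] [mv pv]|u v [mu pu] [mv pv]].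
    - by split=> // k1 k1N; have [Mc _ _] := mero_ringclass (c0.1.1 + k1%:R * h) rho0; exact: (Mc k0).
    - split=> [k1 k1N|z]; last by rewrite pu pv.
      have [_ MD _] := mero_ringclass (c0.1.1 + k1%:R * h) rho0.
      exact: (MD (fun z => u (z, q', F)) (fun z => v (z, q', F)) (mu k1 k1N) (mv k1 k1N)).
    - split=> [k1 k1N|z]; last by rewrite pu pv.
      have [_ _ MM] := mero_ringclass (c0.1.1 + k1%:R * h) rho0.
      exact: (MM (fun z => u (z, q', F)) (fun z => v (z, q', F)) (mu k1 k1N) (mv k1 k1N)).
  have bz z : nrm (z - c.1.1) < r -> pd c r (z, q', F) by move=> hz; split.
  have bc : pd cc r1 (c.1.1, q', F) by apply/sub/bz; rewrite subrr nrm0.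
  have St t : nrm (t - tt) < r1 -> S (phi ^~ t).
    move=> ht; have [_ _ _ g] := in1 _ t bc ht; split=> [k1 k1N|z]; first exact: (mero k1 (q', t, F) k1N g).
    by rewrite /phi /pt /= !cexpN !cexp_periodic.
  have [n [Bk [Sq SB BE]]] := ls_localize ls Sr St k.
  have [mA pA] := ringclassX Sr n Sq; have [mB pB] := SB.
  have c1rho : nrm (c.1.1 - c0.1.1) < rho.
    have htt : nrm (tt - tt) < r1 by rewrite subrr nrm0.
    by have [_ _ g _] := in1 _ tt bc htt.
  apply: (@monodromy R _ _ lm kp c0.1.1 h rho N c.1.1 r hrho Nh mA mB pA pB dlm plm c1rho rr) => z hz.
  have hb := bz z hz; split; first by rewrite -(Clm z hz) BE.
  by rewrite expf_neq0// (ls_q ls hb).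
have [a [aC a0 ad arec]] := @laurent R c r (l%:R - m%:R) Cf rr (ls_sder ls) (ls_rec ls) Cmono.
have hq0 q' : nrm (q' - c.1.2) < r -> nrm (q' - c0.1.2) < dl.
  move=> hq; have hb : pd c r (c.1.1, q', c.2) by have [a1 _ a3] := ctr; split.
  by have [[_ g _] _ _ _] := in1 _ tt (sub _ hb) htt0.
have pF k J := @polyF_coef R c.1.2 c.2 r rr (l%:R - m%:R) a (fun q' hq => qn0 (hq0 q' hq)) a0 ad arec k J.
exists c.1.2, r; split=> // q' hq.
have den := series_poly rr hq pF aC.
(* With q fixed, Kronecker's criterion is applied over polynomials in y and F, evaluated at the
   points (z, F) of the small box. *)
pose X := {zF : C * C | nrm (zF.1 - c.1.1) < r /\ nrm (zF.2 - c.2) < r}.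
pose bx (x : X) : B := ((sval x).1, q', (sval x).2).
have bxP (x : X) : pd c r (bx x) by case: x => -[z F] /= [h1 h2]; split.
pose ev (x : X) := ev2 (cexp (sval x).1) (sval x).2.
have x0 : X by exists (c.1.1, c.2); rewrite /= !subrr nrm0.
have [||||P [Q [Q0 PQ]]] := @series_rat R {poly {poly C}} X ev _ l m (fun x i => q i (bx x)) (fun x i => p i (bx x)) (fun x k => Cf k (bx x)) _ _ _ x0.
- move=> a1 Ha; apply: (ev2_sep (z0 := c.1.1) (w0 := c.2) rr) => z w hz hw.
  exact: (Ha (exist _ (z, w) (conj hz hw))).
- by move=> x; exact: ls_q ls _ (bxP x).
- move=> x k; apply: (etrans (etrans _ (ls_conv ls k (bxP x)))); last by rewrite /rv; case: (k <= l)%N.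
  by apply: eq_bigr => i _; rewrite /rv; case: (_ <= m)%N.
- by move=> k; have [d [n dn]] := den k; exists d, n => x; case: x => -[z F] /= [h1 h2]; exact: dn.
exists P, Q; split=> //.
pose u z F t := f (pt (z, q', F) t) * ev3 Q (cexp z) F t - ev3 P (cexp z) F t.
have u0 z F t : nrm (z - c.1.1) < r -> nrm (F - c.2) < r -> nrm (t - tt) < r1 -> u z F t = 0.
  move=> hz hF ht; pose x : X := exist _ (z, F) (conj hz hF).
  apply/eqP; rewrite subr_eq0; apply/eqP.
  apply: (@quotient_transfer R (phi (bx x)) tt r1 _ _ _ _ r10 _ _ (fun t ht => ls_eq ls (bxP x) ht) (PQ x) t ht).
    apply/eqP => /(congr1 (fun p : {poly C} => p`_m)); rewrite coef_poly ltnSn coef0 => /eqP.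
    by apply/negP; exact: ls_q ls _ (bxP x).
  move=> t' ht'; have [g1 g2 _ _] := in1 _ t' (sub _ (bxP x)) ht'.
  by have [_ _ _ a4] := derivs g1 g2.
have c1 : nrm (c.1.1 - c0.1.1) < dl /\ nrm (c.2 - c0.2) < dl.
  by have [[g1 _ g3] _ _ _] := in1 _ tt (sub _ ctr) htt0.
have tt1 : nrm (tt - t0) < dl.
  by have [_ g _ _] := in1 _ tt (sub _ ctr) htt0.
have hu (z F t : C) : nrm (z - c0.1.1) < dl -> nrm (F - c0.2) < dl -> nrm (t - t0) < dl ->
  [/\ derivable (fun z => u z F t) z 1, derivable (fun F => u z F t) F 1 & derivable (fun t => u z F t) t 1].
  move=> hz hF ht; have hb : pd c0 dl (z, q', F) by split=> //=; exact: hq0.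
  have [a1 _ a3 a4] := derivs hb ht.
  have [dc _] := is_derive_cexp z; have di (w : C) : derivable (fun w : C => w) w 1 by exact: (@derivable_id C C w 1).
  split.
  - have Dr := derivable_ringclass z; have [cD _ mD] := Dr.
    apply: (ringclassB Dr (f := fun z => f (pt (z, q', F) t) * ev3 Q (cexp z) F t) (g := fun z => ev3 P (cexp z) F t)).
      apply: (mD (fun z => f (pt (z, q', F) t)) (fun z => ev3 Q (cexp z) F t) a1).
      exact: (ev3_ringclass Q (y := @cexp R) (w := cst F) (t := cst t) Dr dc (cD F) (cD t)).
    exact: (ev3_ringclass P (y := @cexp R) (w := cst F) (t := cst t) Dr dc (cD F) (cD t)).
  - have Dr := derivable_ringclass F; have [cD _ mD] := Dr.
    apply: (ringclassB Dr (f := fun F => f (pt (z, q', F) t) * ev3 Q (cexp z) F t) (g := fun F => ev3 P (cexp z) F t)).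
      apply: (mD (fun F => f (pt (z, q', F) t)) (fun F => ev3 Q (cexp z) F t) a3).
      exact: (ev3_ringclass Q (y := cst (cexp z)) (w := fun w => w) (t := cst t) Dr (cD _) (di F) (cD t)).
    exact: (ev3_ringclass P (y := cst (cexp z)) (w := fun w => w) (t := cst t) Dr (cD _) (di F) (cD t)).
  - have Dr := derivable_ringclass t; have [cD _ mD] := Dr.
    apply: (ringclassB Dr (f := fun t => f (pt (z, q', F) t) * ev3 Q (cexp z) F t) (g := fun t => ev3 P (cexp z) F t)).
      apply: (mD (fun t => f (pt (z, q', F) t)) (fun t => ev3 Q (cexp z) F t) a4).
      exact: (ev3_ringclass Q (y := cst (cexp z)) (w := cst F) (t := fun w => w) Dr (cD _) (cD _) (di t)).
    exact: (ev3_ringclass P (y := cst (cexp z)) (w := cst F) (t := fun w => w) Dr (cD _) (cD _) (di t)).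
have [cz cF] := c1.
have [sF sF0 sFP] := ball_sub cF; have [st st0 stP] := ball_sub tt1.
(* Extension to the original box by the identity theorem in one variable at a time: z, then F, then
   t. *)
have u1 z F t : nrm (z - c0.1.1) < dl -> nrm (F - c.2) < Num.min r sF -> nrm (t - tt) < Num.min r1 st -> u z F t = 0.
  rewrite (lt_min _ r sF) (lt_min _ r1 st) => hz /andP[F1 F2] /andP[t1 t2].
  have hz1 : hol (fun z => u z F t) c0.1.1 dl.
    by move=> w hw; have [h1 _ _] := hu w F t hw (sFP F F2) (stP t t2); exact: h1.
  have zz1 : zero_near (fun z => u z F t) c.1.1 by exists r; [exact: rr|move=> w hw; exact: (u0 w F t hw F1 t1)].
  exact: (identity_ball hz1 cz zz1 hz).
have u2 z F t : nrm (z - c0.1.1) < dl -> nrm (F - c0.2) < dl -> nrm (t - tt) < Num.min r1 st -> u z F t = 0.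
  move=> hz hF ht; have t2 : nrm (t - tt) < st by move: ht; rewrite (lt_min _ r1 st) => /andP[].
  have hF1 : hol (fun F => u z F t) c0.2 dl.
    by move=> w hw; have [_ h2 _] := hu z w t hz hw (stP t t2); exact: h2.
  have zF1 : zero_near (fun F => u z F t) c.2.
    by exists (Num.min r sF); [by rewrite lt_min rr|move=> w hw; exact: (u1 z w t hz hw ht)].
  exact: (identity_ball hF1 cF zF1 hF).
move=> z F t hz hF ht; apply/eqP; rewrite -subr_eq0; apply/eqP.
have ht1 : hol (fun t => u z F t) t0 dl.
  by move=> w hw; have [_ _ h3] := hu z F w hz hF hw; exact: h3.
have zt1 : zero_near (fun t => u z F t) tt.
  by exists (Num.min r1 st); [by rewrite (lt_min _ r1 st) r10|move=> w hw; exact: (u2 z F w hz hF hw)].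
exact: (identity_ball ht1 tt1 zt1 ht).
Qed.

End RoundOne.

(** * Restriction to a level set of H *)

Section Restrictions.
Variable R : realType.
Local Notation C := R[i].
Implicit Types (y w t z q F : C).

Lemma ev2_horner2 y w (a : {poly {poly C}}) : ev2 y w a = a.[w%:P].[y].
Proof. by []. Qed.

Lemma ev2_swap y w (a : {poly {poly C}}) : ev2 y w (swapXY a) = ev2 w y a.
Proof. by rewrite !ev2_horner2 horner2_swapXY. Qed.

Lemma ev3_swap y F t (Q : {poly {poly {poly C}}}) : (map_poly (ev2 y t) (swapXY Q)).[F] = ev3 Q y F t.
Proof.
have E w s (T : {poly {poly {poly C}}}) : (map_poly (ev2 y w) T).[s] = (map_poly (map_poly (horner_eval y)) T).[s%:P].[w].
  have := ev2E w s (map_poly (map_poly (horner_eval y)) T).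
  rewrite ev2_horner2 => ->; rewrite -map_poly_comp; congr (_.[s]); apply: eq_map_poly => a /=.
  by rewrite /horner_eval -ev2E.
by rewrite /ev3 !E -swapXY_map horner2_swapXY.
Qed.

Lemma cexp_inj_near z : exists2 e : R, 0 < e & forall s, nrm (s - z) < e -> s != z -> cexp s != cexp z.
Proof.
have h0 : 0 < 1 / 2 :> R by rewrite divr_gt0.
have [e e0 H] := cexp_expand0 h0; exists e => // s se sz; apply/eqP => E.
have := H _ se; rewrite cexpD cexpN E mulfV ?cexp_neq0// subrr sub0r nrmN.
have n0 : 0 < nrm (s - z) by rewrite nrm_gt0 subr_eq0.
by rewrite -[leLHS]mul1r ler_pM2r// ler_pdivlMr// mul1r lern1.
Qed.

(* The value of F on the level set H = h0. *)
Definition levF (h0 z q t : C) := h0 + 2 * q * t + al q * cexp z - be q / cexp z.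

Definition rat2 (z0 t0 : C) (r : R) (u : C -> C -> C) := exists P Q : {poly {poly C}}, Q != 0 /\
  forall z t, nrm (z - z0) < r -> nrm (t - t0) < r -> u z t * ev2 (cexp z) t Q = ev2 (cexp z) t P.

(** Fixing z may annihilate the denominator; [restrict_rat] strips the factors responsible, by
    continuity of [u] in z. *)
Lemma rat2_fix_z z0 t0 (r : R) u z : rat2 z0 t0 r u -> nrm (z - z0) < r ->
  (forall t, nrm (t - t0) < r -> {for z, continuous (u ^~ t)}) ->
  exists P Q : {poly C}, Q != 0 /\ forall t, nrm (t - t0) < r -> u z t * Q.[t] = P.[t].
Proof.
move=> [P [Q [Q0 H]]] hz cu; have r0 : 0 < r by apply: le_lt_trans hz; exact: nrm_ge0.
have [e e0 eP] := cexp_inj_near z; have [s s0 sP] := ball_sub hz.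
pose X := {t : C | nrm (t - t0) < r}.
pose ev (x : X) : {rmorphism {poly C} -> C} := horner_eval (sval x).
have m0 : 0 < Num.min e s by rewrite lt_min e0.
have evE (x : X) (T : {poly {poly C}}) s1 : (map_poly (ev x) (swapXY T)).[cexp s1] = ev2 (cexp s1) (sval x) T.
  by rewrite -ev2_swap ev2E.
have [||||||||P1 [Q1 [Q10 PQ]]] := @restrict_rat R {poly C} X ev (cexp z)%:P (fun x s => u s (sval x)) (fun _ s => cexp s) z (Num.min e s) (swapXY P) (swapXY Q).
- by move=> a Ha; apply: (poly_disc0 (t0 := t0) r0) => t ht; exact: (Ha (exist _ t ht)).
- exact: m0.
- by move=> x; rewrite /ev /= /horner_eval hornerC.
- by move=> x s1; rewrite lt_min => /andP[h1 _] n1; rewrite /ev /= /horner_eval hornerC; exact: eP.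
- by move=> x; have [d _] := is_derive_cexp z; exact: derivable_continuous d.
- by move=> -[t ht]; exact: cu.
- by rewrite swapXY_eq0.
- move=> x s1; rewrite lt_min => /andP[_ h2]; rewrite !evE; apply: H; [exact: sP|exact: (svalP x)].
by exists P1, Q1; split=> // t ht; exact: (PQ (exist _ t ht)).
Qed.

Lemma rat2_fix_t z0 t0 (r : R) u t : rat2 z0 t0 r u -> nrm (t - t0) < r ->
  (forall z, nrm (z - z0) < r -> {for t, continuous (u z)}) ->
  exists P Q : {poly C}, Q != 0 /\ forall z, nrm (z - z0) < r -> u z t * Q.[cexp z] = P.[cexp z].
Proof.
move=> [P [Q [Q0 H]]] ht cu; have r0 : 0 < r by apply: le_lt_trans ht; exact: nrm_ge0.
have [s s0 sP] := ball_sub ht.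
pose X := {z : C | nrm (z - z0) < r}.
pose ev (x : X) : {rmorphism {poly C} -> C} := horner_eval (cexp (sval x)).
have evE (x : X) (T : {poly {poly C}}) s1 : (map_poly (ev x) T).[s1] = ev2 (cexp (sval x)) s1 T.
  by rewrite ev2E.
have [||||||||P1 [Q1 [Q10 PQ]]] := @restrict_rat R {poly C} X ev t%:P (fun x s => u (sval x) s) (fun _ s => s) t s P Q.
- by move=> a Ha; apply: (poly_cexp0 (z0 := z0) r0) => z hz; exact: (Ha (exist _ z hz)).
- exact: s0.
- by move=> x; rewrite /ev /= /horner_eval hornerC.
- by move=> x s1 _ n1; rewrite /ev /= /horner_eval hornerC.
- by move=> x; exact: cvg_id.
- by move=> -[z hz]; exact: cu.
- exact: Q0.
- by move=> x s1 h; rewrite !evE; apply: H; [exact: (svalP x)|exact: sP].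
by exists P1, Q1; split=> // z hz; exact: (PQ (exist _ z hz)).
Qed.

(** On the level set y F, and not F, is polynomial in y and t. Multiplication by y^d rewrites a
    polynomial in F as one in y F. *)
Lemma homogenize (y F : C) (A : idomainType) (e : {rmorphism A -> C}) (Y : A) (T : {poly A}) d : e Y = y ->
  (size T <= d.+1)%N ->
  (map_poly e (\poly_(i < d.+1) (T`_i * Y ^+ (d - i)))).[y * F] = y ^+ d * (map_poly e T).[F].
Proof.
move=> eY sT; rewrite (horner_coef_wide (n := d.+1)); last exact: leq_trans (size_poly _ _) (size_poly _ _).
rewrite (horner_coef_wide (n := d.+1)); last exact: leq_trans (size_poly _ _) sT.
rewrite mulr_sumr; apply: eq_bigr => i _; rewrite !coef_map coef_poly ltn_ord /= rmorphM rmorphXn eY exprMn.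
have id : (i <= d)%N by rewrite -ltnS.
have -> : y ^+ d = y ^+ (d - i) * y ^+ i by rewrite -exprD subnK.
by ring.
Qed.

(** The level set is a root of a linear polynomial in the variable y F, so [restrict_rat] applies
    even if the denominator vanishes identically on it. *)
Lemma restrict_level (h0 q z0 F0 t0 : C) (phi : C -> C -> C -> C) (dl r : R) (P Q : {poly {poly {poly C}}}) :
  Q != 0 -> 0 < r -> r <= dl -> (forall z t, nrm (z - z0) < r -> nrm (t - t0) < r -> nrm (levF h0 z q t - F0) < dl / 2) ->
  (forall z F t, nrm (z - z0) < dl -> nrm (F - F0) < dl -> nrm (t - t0) < dl ->
    {for F, continuous (fun F => phi z F t)} /\ phi z F t * ev3 Q (cexp z) F t = ev3 P (cexp z) F t) ->
  rat2 z0 t0 r (fun z t => phi z (levF h0 z q t) t).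
Proof.
move=> Q0 r0 rd lev H.
have d0 : 0 < dl by exact: lt_le_trans r0 rd.
pose X := {zt : C * C | nrm (zt.1 - z0) < r /\ nrm (zt.2 - t0) < r}.
pose ev (x : X) := ev2 (cexp (sval x).1) (sval x).2.
pose lv (x : X) := levF h0 (sval x).1 q (sval x).2.
pose Y : {poly {poly C}} := 'X%:P.
have evY (x : X) : ev x Y = cexp (sval x).1 by rewrite /ev ev2_horner2 hornerC hornerX.
have evC (x : X) k : ev x k%:P%:P = k by rewrite /ev ev2_horner2 !hornerC.
have evt (x : X) : ev x 'X = (sval x).2 by rewrite /ev ev2_horner2 hornerX hornerC.
(* This is y times the value of F on the level set, which has no denominator left. *)
pose lam : {poly {poly C}} := Y * h0%:P%:P + (2 * q)%:P%:P * 'X * Y + (al q)%:P%:P * Y * Y - (be q)%:P%:P.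
have lamE (x : X) : ev x lam = cexp (sval x).1 * lv x.
  have gen (a b k e : {poly {poly C}}) : ev x (Y * a + b * 'X * Y + k * Y * Y - e) =
      ev x Y * ev x a + ev x b * ev x 'X * ev x Y + ev x k * ev x Y * ev x Y - ev x e.
    by rewrite rmorphB !rmorphD !rmorphM.
  by rewrite /lam gen !evC evY evt /lv /levF; field; exact: cexp_neq0.
pose d := maxn (size P) (maxn (size Q) (maxn (size (swapXY P)) (size (swapXY Q)))).
pose hom (T : {poly {poly {poly C}}}) := \poly_(i < d.+1) ((swapXY T)`_i * Y ^+ (d - i)).
have Yn n : Y ^+ n != 0 by rewrite expf_neq0// polyC_eq0 polyX_eq0.
have xz (x : X) : nrm ((sval x).1 - z0) < r by case: x => -[? ?] [].
have xt (x : X) : nrm ((sval x).2 - t0) < r by case: x => -[? ?] [].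
have sd (T : {poly {poly {poly C}}}) x s : (size (swapXY T) <= d.+1)%N ->
   (map_poly (ev x) (hom T)).[cexp (sval x).1 * (lv x + s)] = cexp (sval x).1 ^+ d * ev3 T (cexp (sval x).1) (lv x + s) (sval x).2.
  by move=> sT; rewrite (homogenize (lv x + s) (evY x) sT) ev3_swap.
have sP : (size (swapXY P) <= d.+1)%N by rewrite (leq_trans _ (leqnSn _))// !leq_max leqnn !orbT.
have sQ : (size (swapXY Q) <= d.+1)%N by rewrite (leq_trans _ (leqnSn _))// !leq_max leqnn !orbT.
have cadd (x : X) : {for 0, continuous (fun s : C => lv x + s)}.
  by have [cc cD _] := @continuous_ringclass R C 0; exact: (cD (cst (lv x)) (fun s => s) (cc _) (@cvg_id _ _)).
have inF (x : X) s : nrm s < dl / 2 -> nrm (lv x + s - F0) < dl.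
  move=> hs; rewrite addrAC [dl]splitr; apply: (le_lt_trans (le_nrmD _ _)); apply: ltrD => //.
  by apply: lev; [exact: xz|exact: xt].
have d2 : 0 < dl / 2 by rewrite divr_gt0.
have lt1 a : a < r -> a < dl by move=> h; exact: lt_le_trans h rd.
have [||||||||P1 [Q1 [Q10 PQ]]] := @restrict_rat R {poly {poly C}} X ev lam
   (fun x s => phi (sval x).1 (lv x + s) (sval x).2) (fun x s => cexp (sval x).1 * (lv x + s)) 0 (dl / 2) (hom P) (hom Q).
- move=> a Ha; apply: (ev2_sep (z0 := z0) (w0 := t0) r0) => z t hz ht.
  exact: (Ha (exist _ (z, t) (conj hz ht))).
- exact: d2.
- by move=> x; rewrite addr0 lamE.
- move=> x s _ s0; rewrite lamE; apply: contra_neq s0 => /(mulfI (cexp_neq0 _))/eqP.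
  by rewrite -subr_eq0 addrAC subrr add0r => /eqP.
- move=> x; have [cc cD cM] := @continuous_ringclass R C 0.
  exact: (cM (cst (cexp (sval x).1)) (fun s => lv x + s) (cc _) (cadd x)).
- move=> x; have [|||cphi _] := H (sval x).1 (lv x) (sval x).2.
  + exact/lt1/xz.
  + by have := inF x 0; rewrite addr0; apply; rewrite nrm0.
  + exact/lt1/xt.
  have cphi' : {for lv x + 0, continuous (fun F => phi (sval x).1 F (sval x).2)} by rewrite (addr0 (lv x)); exact: cphi.
  exact: (@continuous_comp C C C (fun s => lv x + s) (fun F => phi (sval x).1 F (sval x).2) 0 (cadd x) cphi').
- apply: contra_neq Q0 => /polyP hQ; apply/eqP; rewrite -(swapXY_eq0 Q); apply/eqP/polyP => i.
  have := hQ i; rewrite coef_poly !coef0; case: ltnP => [_ /eqP|id _].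
    by rewrite mulf_eq0 (negbTE (Yn _)) orbF => /eqP.
  by rewrite nth_default// (leq_trans sQ).
- move=> x s; rewrite subr0 => hs; rewrite !sd// mulrCA; congr (_ * _).
  by have [|||_ ->] := H (sval x).1 (lv x + s) (sval x).2; [exact/lt1/xz|exact: inF|exact/lt1/xt|].
exists P1, Q1; split=> // z t hz ht; have E := PQ (exist _ (z, t) (conj hz ht)).
by rewrite -(addr0 (levF h0 z q t)); exact: E.
Qed.

End Restrictions.

(** * Taylor chains and rationality from a linear recurrence *)

Section Taylor.
Variable R : realType.
Local Notation C := R[i].
Local Notation ReC := (@complex.Re R).
Implicit Types (u : C -> C) (h : nat -> C -> C).

(** The real mean value theorem along the segment, applied to Re (k u) for k = 1 and k = -i; hence
    the factor 2. *)
Lemma mean_value_bound u (du : C -> C) (w0 z : C) (r K : R) : (forall w, nrm (w - w0) < r -> is_derive w 1 u (du w)) ->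
  nrm (z - w0) < r -> (forall w, nrm (w - w0) <= nrm (z - w0) -> nrm (du w) <= K) ->
  nrm (u z - u w0) <= 2 * (K * nrm (z - w0)).
Proof.
move=> hu zr hK; have r0 : 0 < r by apply: le_lt_trans zr; exact: nrm_ge0.
pose p (s : R) : C := w0 + s%:C * (z - w0).
have pin (s : R) : 0 <= s <= 1 -> nrm (p s - w0) <= nrm (z - w0).
  by move=> s01; apply: nrm_segment => //; rewrite subrr nrm0 nrm_ge0.
have key (k : C) : nrm k = 1 -> `|ReC (k * (u z - u w0))| <= K * nrm (z - w0).
  move=> k1; pose h s := ReC (k * u (p s)); pose h' s := ReC (k * (du (p s) * (z - w0))).
  have hd (s : R) : 0 <= s <= 1 -> is_derive s 1 h (h' s).
    move=> s01; have ps := le_lt_trans (pin s s01) zr.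
    have cv : (fun t : R => t^-1 *: (h (t *: 1 + s) - h s)) @ 0^' --> h' s.
      apply/cvgrPdist_le => e e0.
      have B0 : 0 < nrm (z - w0) + 1 by rewrite ltr_wpDl// nrm_ge0.
      have [dl dl0 H] := (is_derive_expandP u (p s) (du (p s))).1 (hu _ ps) _ (divr_gt0 e0 B0).
      rewrite /dnbhs /within /=; apply/nbhs_normP; exists (dl / (nrm (z - w0) + 1)); first exact: divr_gt0.
      move=> t; rewrite /ball_ /= sub0r normrN ltr_pdivlMr// => td t0.
      have pts : p (t + s) - p s = t%:C * (z - w0) by rewrite /p rmorphD/=; ring.
      have nt : nrm t%:C = `|t| by rewrite /nrm normc_def /= expr0n /= addr0 sqrtr_sqr.
      have := H (p (t + s)); rewrite pts !nrmM nt => Hp.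
      have E : t^-1 *: (h (t *: 1 + s) - h s) - h' s = t^-1 * ReC (k * (u (p (t + s)) - u (p s) - du (p s) * (t%:C * (z - w0)))).
        have -> : k * (u (p (t + s)) - u (p s) - du (p s) * (t%:C * (z - w0))) =
          k * u (p (t + s)) - k * u (p s) - t%:C * (k * (du (p s) * (z - w0))) by ring.
        have tz (w : C) : ReC (t%:C * w) = t * ReC w by case: w => a b /=; rewrite mul0r subr0.
        by rewrite !raddfB /= tz -/(h _) -/(h _) -/(h' _) /GRing.scale /= mulr1; field.
      rewrite distrC E normrM normfV ler_pdivrMl ?normr_gt0//; apply: (le_trans (nrm_ge_Re _)).
      rewrite nrmM k1 mul1r; apply: (le_trans (Hp _)).
        by apply: le_lt_trans td; rewrite ler_wpM2l// lerDl.
      rewrite mulrCA ler_wpM2l// mulrAC ler_pdivrMr// ler_pM2l// lerDl.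
      exact: ler01.
    by apply: DeriveDef; [apply/cvg_ex; exists (h' s)|apply: cvg_lim cv].
  have [||c c01 E] := @MVT_segment _ h h' 0 1 ler01.
  - by move=> s; rewrite in_itv /= => /andP[s0 s1]; apply: hd; rewrite !ltW.
  - apply: continuous_in_subspaceT => s; rewrite inE /= in_itv /= => /hd[ds _].
    by apply: differentiable_continuous; apply/derivable1_diffP.
  move: E; rewrite subr0 mulr1 /h /p rmorph1 mul1r rmorph0 mul0r addr0 [w0 + _]addrC subrK => E.
  rewrite mulrBr raddfB /= E /h'; apply: (le_trans (nrm_ge_Re _)); rewrite !nrmM k1 mul1r.
  by apply: ler_wpM2r; [exact: nrm_ge0|apply: hK; apply: pin; move: c01; rewrite in_itv].
apply: (le_trans (nrm_le_ReIm _)); rewrite mulr_natl mulr2n; apply: lerD.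
  by have := key 1 (nrm1 R); rewrite mul1r.
have n1 : nrm (0 +i* -1 : C) = 1 by rewrite /nrm normc_def /= expr0n /= add0r sqrrN expr1n sqrtr1.
have := key _ n1; case: (u z - u w0) => a b /=; by rewrite mul0r mulN1r sub0r opprK.
Qed.

(** Then [h k] is the k-th derivative of [h 0] divided by k!. In this normalization the recursion
    for the top coefficients is exactly such a chain. *)
Definition tchain (q0 : C) (r : R) h := forall k q, nrm (q - q0) < r -> is_derive q 1 (h k) (k.+1%:R * h k.+1 q).

Variables (q0 : C) (r : R).
Hypothesis r0 : 0 < r.

(** Since the derivative of [h k] is a multiple of [h k.+1] and [h k] vanishes at q0, a bound of
    order n for [h k.+1] integrates to one of order n + 1 for [h k]. *)
Lemma tchain_flat h : tchain q0 r h -> (forall k, h k q0 = 0) -> flat_at (h 0%N) q0.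
Proof.
move=> ch h0 n; move: 0%N; elim: n => [|n IH] k.
  have q00 : nrm (q0 - q0) < r by rewrite subrr nrm0.
  have [d _] := ch k q0 q00; have [dl dl0 H] := (continuous_nrmP _ _).1 (derivable_continuous d) 1 ltr01.
  by exists 1, dl; split=> // w /H; rewrite h0 subr0 expr0 mulr1.
have [M [dl [dl0 H]]] := IH k.+1; exists (2 * (nrm (k.+1%:R : C) * `|M|)), (Num.min dl r).
split; first by rewrite lt_min dl0.
move=> w; rewrite lt_min => /andP[wd wr].
have := @mean_value_bound (h k) (fun q => k.+1%:R * h k.+1 q) q0 w r (nrm (k.+1%:R : C) * (`|M| * nrm (w - q0) ^+ n)) (ch k) wr.
rewrite h0 subr0 => mv; apply: le_trans (mv _) _; last by rewrite exprS le_eqVlt; apply/orP; left; apply/eqP; ring.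
move=> v vw; rewrite nrmM; apply: ler_wpM2l; first exact: nrm_ge0.
apply: (le_trans (H v (le_lt_trans vw wd))).
apply: (le_trans (ler_wpM2r _ (ler_norm M))); first by rewrite exprn_ge0// nrm_ge0.
by apply: ler_wpM2l => //; apply: lerXn2r => //; rewrite nnegrE nrm_ge0.
Qed.

Lemma tchainD h1 h2 : tchain q0 r h1 -> tchain q0 r h2 -> tchain q0 r (fun k q => h1 k q + h2 k q).
Proof. by move=> c1 c2 k q hq; apply: (is_derive_eq (is_deriveD (c1 k q hq) (c2 k q hq))); rewrite mulrDr. Qed.

Lemma tchainZ (a : C) h1 : tchain q0 r h1 -> tchain q0 r (fun k q => a * h1 k q).
Proof. by move=> c1 k q hq; apply: (is_derive_eq (is_deriveZ a (c1 k q hq))); rewrite /GRing.scale /= mulrCA. Qed.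

Lemma tchain_sum n (H : nat -> nat -> C -> C) : (forall i, tchain q0 r (H i)) ->
  tchain q0 r (fun k q => \sum_(i < n) H i k q).
Proof.
move=> cH k q hq; apply: (is_derive_eq (is_derive_sum_ord (fun i (_ : (i < n)%N) => cH i k q hq))).
by rewrite mulr_sumr.
Qed.

(** Leibniz rule: the chain of (q - q0) times the bottom function. *)
Definition tshift h k q : C := (q - q0) * h k q + (if k is k'.+1 then h k' q else 0).

Lemma tchain_shift h : tchain q0 r h -> tchain q0 r (tshift h).
Proof.
move=> ch k q hq.
have d1 : is_derive q 1 (fun q : C => q - q0) 1.
  by apply: (is_derive_eq (is_deriveB (is_derive_id q (1 : C)) (is_derive_cst q0 q (1 : C)))); rewrite subr0.
have dM := is_deriveM d1 (ch k q hq).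
have d2 : is_derive q 1 (fun q => if k is k'.+1 then h k' q else 0) (k%:R * h k q).
  case: (k) => [|k']; last exact: ch.
  by rewrite mul0r; exact: is_derive_cst.
apply: (is_derive_eq (is_deriveD dM d2)); rewrite /tshift /GRing.scale /= -!natr1; ring.
Qed.

Lemma tshift_iter h i : tchain q0 r h -> [/\ tchain q0 r (iter i tshift h), forall q, iter i tshift h 0%N q = (q - q0) ^+ i * h 0%N q &
  forall k, iter i tshift h k q0 = if (i <= k)%N then h (k - i)%N q0 else 0].
Proof.
move=> ch; elim: i => [|i [c1 z1 v1]] /=; first by split=> // [q|k]; rewrite ?expr0 ?mul1r ?subn0.
split; first exact: tchain_shift.
  by move=> q; rewrite /tshift addr0 z1 exprS mulrA.
by case=> [|k]; rewrite /tshift subrr mul0r add0r// v1 ltnS subSS.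
Qed.

Lemma tchain_cst (a : C) : tchain q0 r (fun k _ => if k is 0%N then a else 0).
Proof. by move=> k q hq; rewrite mulr0; case: k => [|k]; exact: is_derive_cst. Qed.

(** The recurrence says that the sum of om i (q - q0)^i, multiplied by [h 0], has no Taylor
    coefficients from order N on. Minus its Taylor polynomial, the product is flat and vanishes on
    the disc of radius r / 8 provided by [flat_zero]. *)
Lemma tchain_rational h m N (om : nat -> C) : tchain q0 r h -> (exists2 i, (i <= m)%N & om i != 0) ->
  (forall k, (N <= k)%N -> \sum_(i < m.+1) (if (i <= k)%N then om i * h (k - i)%N q0 else 0) = 0) ->
  exists D P : {poly C}, D != 0 /\ forall q, nrm (q - q0) < r / 8 -> h 0%N q * D.[q] = P.[q].
Proof.
move=> ch [i0 i0m omi] rec.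
pose H k q := \sum_(i < m.+1) om i * iter i tshift h k q.
have cH : tchain q0 r H.
  by apply: (@tchain_sum m.+1 (fun i k q => om i * iter i tshift h k q)) => i; apply: tchainZ; have [] := tshift_iter i ch.
have HN k : (N <= k)%N -> H k q0 = 0.
  move=> Nk; rewrite -[RHS](rec k Nk); apply: eq_bigr => i _; have [_ _ ->] := tshift_iter i ch.
  by case: ifP => _; rewrite ?mulr0.
(* The negated Taylor polynomial of [H 0], written as a chain. *)
pose T k q := \sum_(j < N) - H j q0 * iter j tshift (fun k _ => if k is 0%N then 1 else 0) k q.
have cT : tchain q0 r T.
  apply: (@tchain_sum N (fun j k q => - H j q0 * iter j tshift (fun k _ => if k is 0%N then 1 else 0) k q)) => j.
  by apply: tchainZ; have [] := tshift_iter j (tchain_cst 1).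
have fl : flat_at (fun q => H 0%N q + T 0%N q) q0.
  apply: (tchain_flat (tchainD cH cT)) => k.
  have TE : T k q0 = \sum_(j < N) (if (j : nat) == k then - H j q0 else 0).
    apply: eq_bigr => j _; have [_ _ ->] := tshift_iter j (tchain_cst 1).
    have [->|jk] := eqVneq (j : nat) k; first by rewrite leqnn subnn mulr1.
    by case: leqP => kj; rewrite ?mulr0//; case E : (k - j)%N => [|x]; rewrite ?mulr0//; move: jk; rewrite eqn_leq kj /leq E.
  rewrite TE; case: (ltnP k N) => kN; last first.
    by rewrite HN// add0r big1// => j _; rewrite ltn_eqF// (leq_trans (ltn_ord j)).
  rewrite -big_mkcond /= (big_pred1 (Ordinal kN)) /=; first by rewrite subrr.
  by move=> j /=; apply/eqP/eqP => [jk|->//]; exact: val_inj.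
have hz := flat_zero r0 _ fl.
pose D := \poly_(i < m.+1) om i; pose P := \poly_(j < N) H j q0.
exists (D \Po ('X - q0%:P)), (P \Po ('X - q0%:P)); split.
  apply/eqP => D0; have : D = 0.
    apply: (@poly_disc0 _ D 0 1) => // t _.
    have := congr1 (fun S : {poly C} => S.[t + q0]) D0; rewrite /= horner_comp horner0 !hornerE.
    by rewrite addrK.
  by move=> /(congr1 (fun S : {poly C} => S`_i0)); rewrite coef_poly ltnS i0m coef0 => /eqP; rewrite (negbTE omi).
move=> q hq; have e : H 0%N q + T 0%N q = 0.
  apply: hz => // w hw; have := is_deriveD (cH 0%N w hw) (cT 0%N w hw).
  by move=> [d _]; exact: d.
rewrite !horner_comp !hornerE !horner_poly; apply/eqP; rewrite -subr_eq0 -[X in _ == X]e; apply/eqP; congr (_ + _).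
  rewrite mulr_sumr; apply: eq_bigr => i _; have [_ -> _] := tshift_iter i ch; ring.
rewrite -sumrN; apply: eq_bigr => j _; have [_ -> _] := tshift_iter j (tchain_cst 1); ring.
Qed.

End Taylor.

(** * The recursion after elimination of F *)

Section Coefficients.
Variable R : realType.
Local Notation C := R[i].
Variables (q0 : C) (r : R) (N : C) (b : nat -> nat -> C -> C).
Hypothesis r0 : 0 < r.
Local Notation disc q := (nrm (q - q0) < r).
Implicit Types (q : C) (u v : C -> C).

Definition lead_part k J q : C := (2 * q - 2 / 3) * (J%:R - k%:R) * b k J q + be q * 'D_1 (b k J) q.
Definition shift_part k J q : C :=
  if J is J'.+2 then - ((J'%:R - k%:R) * b k J' q) + al q * 'D_1 (b k J') q else 0.
Definition prev_part k J q : C :=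
  if k is k'.+1 then (if J is J'.+2 then (N - k'%:R) * b k' J' q else 0) else 0.

Hypothesis b0 : forall k J q, (k.*2 < J)%N -> b k J q = 0.
Hypothesis bd : forall k J q, disc q -> derivable (b k J) q 1.
Hypothesis brec : forall k J q, disc q -> (J < k.*2.+3)%N ->
  2 * (J%:R - k.+1%:R) * b k.+1 J q = lead_part k J q + shift_part k J q + prev_part k J q.

Let der k J q : disc q -> is_derive q 1 (b k J) ('D_1 (b k J) q).
Proof. by move=> hq; apply: DeriveDef => //; exact: bd. Qed.

Let Db0 k J q : (k.*2 < J)%N -> 'D_1 (b k J) q = 0.
Proof.
move=> kJ; rewrite (_ : b k J = cst 0); first exact: (@derive_cst C C C 0 q 1).
by apply/funext => q'; exact: b0.
Qed.

Lemma is_derive_al q : is_derive q 1 (@al R) 1.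
Proof. by apply: (is_derive_eq (is_deriveD (is_derive_id q (1 : C)) (is_derive_cst (2 / 3 : C) q (1 : C)))); rewrite addr0. Qed.

Lemma is_derive_be q : is_derive q 1 (@be R) (2 * q - 2 / 3).
Proof.
have h := is_deriveB (is_derive_id q (1 : C)) (is_derive_cst (2 / 3 : C) q (1 : C)).
by apply: (is_derive_eq (is_deriveM (is_derive_id q (1 : C)) h)); rewrite !fctE /GRing.scale /=; ring.
Qed.

Let mulder u v q (du dv : C) : is_derive q 1 u du -> is_derive q 1 v dv ->
  is_derive q 1 (fun q => u q * v q) (u q * dv + v q * du).
Proof. by move=> hu hv; apply: (is_derive_eq (is_deriveM hu hv)). Qed.

(** The equations of index k and k + 2 both contain the derivative of [b k k], with the factors be
    and al. Eliminating it leaves [W] on one side and coefficients of level k + 1 on the other. *)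
Let W k q : C := al q * (shift_part k k q + prev_part k k q) - be q * (lead_part k k.+2 q + prev_part k k.+2 q).

Let WE k q : disc q -> W k q = -2 * (al q * b k.+1 k q + be q * b k.+1 k.+2 q).
Proof.
move=> hq; have kk : (k <= k.*2)%N by rewrite -addnn leq_addr.
have k1 : (k < k.*2.+3)%N by rewrite ltnS; do 2!apply: leqW.
have k2 : (k.+2 < k.*2.+3)%N by rewrite !ltnS -addnn leq_addr.
have := brec hq k1; have := brec hq k2; rewrite /W [lead_part k k q]/lead_part [shift_part k k.+2 q]/shift_part.
rewrite subrr mulr0 !mul0r oppr0 !add0r.
have -> : k%:R - k.+1%:R = -1 :> C by rewrite -natr1; ring.
have -> : k.+2%:R - k.+1%:R = 1 :> C by rewrite -!natr1; ring.
move: (lead_part k k.+2 q) (prev_part k k.+2 q) (shift_part k k q) (prev_part k k q) ('D_1 (b k k) q) => A A' B B' D E1 E2.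
have E1' : A + A' = 2 * b k.+1 k.+2 q - al q * D.
  by transitivity (2 * 1 * b k.+1 k.+2 q - al q * D); [rewrite E1; ring|rewrite mulr1].
have E2' : B + B' = - 2 * b k.+1 k q - be q * D.
  by transitivity (2 * -1 * b k.+1 k q - be q * D); [rewrite E2; ring|ring].
by rewrite E1' E2'; ring.
Qed.

(** The resonant equation, level k + 2 and J = k + 2, reads 0 = (al b(k+1, k) + be b(k+1, k+2))' +
    (N - k) b(k, k), because al' = 1 and be' = 2 q - 2/3. So the diagonal coefficient, the
    integration constant of its level, is determined as soon as N != k. *)
Lemma coef_diag k q : disc q -> 2 * (N - k%:R) * b k k q = 'D_1 (W k) q.
Proof.
move=> hq; have k2 : (k.+2 < k.+1.*2.+3)%N by rewrite doubleS !ltnS; do 2!apply: leqW; rewrite -addnn leq_addr.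
have s0 : 0 < r - nrm (q - q0) by rewrite subr_gt0.
have -> : 'D_1 (W k) q = 'D_1 (fun q => -2 * (al q * b k.+1 k q + be q * b k.+1 k.+2 q)) q.
  apply: (derive_local s0) => w wq; apply: WE.
  by apply: (le_lt_trans (nrm_triangle w q q0)); rewrite -ltrBrDr.
have h1 := mulder (is_derive_al q) (der k.+1 k hq); have h2 := mulder (is_derive_be q) (der k.+1 k.+2 hq).
have [_ ->] := is_deriveZ (-2 : C) (is_deriveD h1 h2).
have := brec hq k2; rewrite subrr mulr0 mul0r /lead_part /shift_part /prev_part.
have -> : k%:R - k.+1%:R = -1 :> C by rewrite -natr1; ring.
have -> : k.+2%:R - k.+1%:R = 1 :> C by rewrite -!natr1; ring.
rewrite /GRing.scale /=; move: ('D_1 _ q) ('D_1 _ q) => D1 D2 E.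
apply/eqP; rewrite -subr_eq0 -(mulr0 2) E; apply/eqP; ring.
Qed.

(** For J = 2k + 2 the recursion is 2 (k + 1) b(k+1, 2k+2) = al b(k, 2k)' - k b(k, 2k); the factor
    (2 / al)^k absorbs the last term. *)
Lemma coef_top k q : disc q -> al q != 0 ->
  is_derive q 1 (fun q => b k k.*2 q * (2 / al q) ^+ k) (k.+1%:R * (b k.+1 k.+1.*2 q * (2 / al q) ^+ k.+1)).
Proof.
move=> hq a0.
have k2 : (k.*2.+2 < k.*2.+3)%N by [].
have E : 2 * k.+1%:R * b k.+1 k.+1.*2 q = - (k%:R * b k k.*2 q) + al q * 'D_1 (b k k.*2) q.
  have e1 : b k k.*2.+2 q = 0 by apply: b0.
  have e2 : 'D_1 (b k k.*2.+2) q = 0 by apply: Db0.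
  have := brec hq k2; rewrite /lead_part /shift_part e1 e2 !mulr0 !add0r doubleS.
  have -> : prev_part k k.*2.+2 q = 0.
    by rewrite /prev_part; case: (k) => // k'; rewrite b0 ?mulr0// doubleS.
  have -> : k.*2.+2%:R - k.+1%:R = k.+1%:R :> C by rewrite -addnn -!natr1 natrD; ring.
  have -> : k.*2%:R - k%:R = k%:R :> C by rewrite -addnn natrD; ring.
  by rewrite addr0.
have dV : is_derive q 1 (fun q => 2 / al q) (- (2 / al q ^+ 2)).
  have [d1 e1] := is_derive_al q.
  have dv : derivable (fun q => (al q)^-1) q 1 by exact: (derivableV a0 d1).
  have ev : 'D_1 (fun q => (al q)^-1) q = - (al q) ^- 2 *: 'D_1 (@al R) q by exact: (deriveV a0 d1).
  have hv : is_derive q 1 (fun q => (al q)^-1) (- (al q) ^- 2) by apply: DeriveDef => //; rewrite ev e1 /GRing.scale /= mulr1.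
  by apply: (is_derive_eq (is_deriveZ (2 : C) hv)); rewrite /GRing.scale /= mulrN.
have dX n : is_derive q 1 (fun q => (2 / al q) ^+ n) (- (n%:R / al q * (2 / al q) ^+ n)).
  elim: n => [|n IH].
    by rewrite mul0r mul0r oppr0 (_ : (fun q => _) = cst 1); [exact: is_derive_cst|apply/funext => w; rewrite expr0].
  rewrite (_ : (fun q => _) = (fun q => (2 / al q) * (2 / al q) ^+ n)); last by apply/funext => w; rewrite exprS.
  apply: (is_derive_eq (mulder dV IH)); rewrite [(2 / al q) ^+ n.+1]exprS; move: ((2 / al q) ^+ n) => X; rewrite -[n.+1%:R]natr1; field; exact: a0.
apply: (is_derive_eq (mulder (der k k.*2 hq) (dX k))).
apply: (mulfI (two_neq0 R)); rewrite !mulrA E [(2 / al q) ^+ k.+1]exprS; move: ((2 / al q) ^+ k) ('D_1 _ q) => X D1; field; exact: a0.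
Qed.

Section Rational.
Variables (q2 : C) (s : R) (D : {poly C}).
Hypothesis sub : forall q, nrm (q - q2) < s -> disc q.
Hypothesis D0 : forall q, nrm (q - q2) < s -> D.[q] != 0.
Local Notation disc2 q := (nrm (q - q2) < s).

(** All denominators are powers of one polynomial without zeros on the disc, so that infinitely many
    coefficients are rational on a common domain. *)
Definition rat_q u := exists n (P : {poly C}), forall q, disc2 q -> u q * D.[q] ^+ n = P.[q].

Lemma rat_q_ringclass : ringclass rat_q.
Proof.
split=> [k|u v [n [P uE]] [n' [P' vE]]|u v [n [P uE]] [n' [P' vE]]].
- by exists 0%N, k%:P => q _; rewrite expr0 mulr1 hornerC.
- exists (n + n')%N, (P * D ^+ n' + P' * D ^+ n) => q hq.
  by rewrite !hornerE -uE// -vE// exprD; ring.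
- exists (n + n')%N, (P * P') => q hq.
  by rewrite !hornerE -uE// -vE// exprD; ring.
Qed.

Lemma rat_q_eq u v : (forall q, disc2 q -> u q = v q) -> rat_q v -> rat_q u.
Proof. by move=> uv [n [P vE]]; exists n, P => q hq; rewrite uv// vE. Qed.

Lemma rat_q_poly (P : {poly C}) : rat_q (fun q => P.[q]).
Proof. by exists 0%N, P => q _; rewrite expr0 mulr1. Qed.

Lemma rat_q_derive u : (forall q, disc2 q -> derivable u q 1) -> rat_q u -> rat_q (fun q => 'D_1 u q).
Proof.
move=> du [n [P uE]]; exists n.+1, (P^`() * D - n%:R%:P * P * D^`()) => q hq.
have s0 : 0 < s - nrm (q - q2) by rewrite subr_gt0.
have hu : is_derive q 1 u ('D_1 u q) by apply: DeriveDef => //; exact: du.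
have hD : is_derive q 1 (fun q => D.[q] ^+ n) ((D ^+ n)^`()).[q].
  by have := is_derive_horner (D ^+ n) q; rewrite (_ : (fun w => _) = (fun q => D.[q] ^+ n))//; apply/funext => w; rewrite horner_exp.
have [_ e1] := mulder hu hD.
have e2 : 'D_1 (fun q => u q * D.[q] ^+ n) q = P^`().[q].
  have [_ <-] := is_derive_horner P q; apply: (derive_local s0) => w wq; apply: uE.
  by apply: (le_lt_trans (nrm_triangle w q q2)); rewrite -ltrBrDr.
have K : ((D ^+ n)^`()).[q] * D.[q] = n%:R * D.[q] ^+ n * D^`().[q].
  rewrite deriv_exp hornerMn hornerM horner_exp -mulr_natl; case: (n) => [|n'] /=; first by rewrite !mul0r.
  by rewrite exprS; ring.
have e3 : (P^`() * D - n%:R%:P * P * D^`()).[q] = P^`().[q] * D.[q] - n%:R * P.[q] * D^`().[q].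
  by rewrite hornerD hornerN !hornerM hornerC.
rewrite e3 -uE// -e2 e1 exprS; apply/eqP; rewrite -subr_eq0; apply/eqP.
transitivity (- u q * (((D ^+ n)^`()).[q] * D.[q] - n%:R * D.[q] ^+ n * D^`().[q])); first by ring.
by rewrite K subrr mulr0.
Qed.

Lemma al_rat : rat_q (@al R).
Proof. by apply: rat_q_eq (rat_q_poly ('X + (2 / 3)%:P)) => q _; rewrite !hornerE. Qed.

Lemma be_rat : rat_q (@be R).
Proof. by apply: rat_q_eq (rat_q_poly ('X * ('X - (2 / 3)%:P))) => q _; rewrite !hornerE. Qed.

Let RD u v := (let: And3 _ h _ := rat_q_ringclass in h) u v.
Let RM u v := (let: And3 _ _ h := rat_q_ringclass in h) u v.
Let RC k := (let: And3 h _ _ := rat_q_ringclass in h) k.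

Let rb_d k J : rat_q (b k J) -> rat_q (fun q => 'D_1 (b k J) q).
Proof. by apply: rat_q_derive => q /sub; exact: bd. Qed.

Let lead_rat k J : rat_q (b k J) -> rat_q (lead_part k J).
Proof.
move=> h; have hp : rat_q (fun q => (2 * q - 2 / 3) * (J%:R - k%:R)).
  apply: rat_q_eq (rat_q_poly ((2%:P * 'X - (2 / 3)%:P) * (J%:R - k%:R)%:P)) => q _; by rewrite !hornerE.
exact: (RD (RM hp h) (RM be_rat (rb_d h))).
Qed.

Let shift_rat k J : (if J is J'.+2 then rat_q (b k J') else True) -> rat_q (shift_part k J).
Proof.
rewrite /shift_part; case: J => [|[|J']] h; try exact: RC.
apply: (@RD (fun q => - ((J'%:R - k%:R) * b k J' q)) (fun q => al q * 'D_1 (b k J') q)); last exact: (RM al_rat (rb_d h)).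
apply: rat_q_eq (RM (RC (- (J'%:R - k%:R))) h) => q _; by rewrite /= mulNr.
Qed.

Let prev_rat k J : (if k is k'.+1 then forall J, rat_q (b k' J) else True) -> rat_q (prev_part k J).
Proof.
rewrite /prev_part; case: k => [|k'] h; first exact: RC.
case: J => [|[|J']]; try exact: RC.
exact: (RM (RC (N - k'%:R)) (h J')).
Qed.

(** Off the diagonal the recursion itself gives the coefficient, on it [coef_diag], whose factor N -
    (k + 1) is nonzero for N = 0. Only [b 0 0] escapes, its factor being N itself, and has to be
    rational by hypothesis. *)
Theorem coef_rational : N = 0 -> rat_q (b 0%N 0%N) -> forall k J, rat_q (b k J).
Proof.
move=> N0 h00 k J.
suff [H _] : (forall J, rat_q (b k J)) /\ (if k is k'.+1 then forall J, rat_q (b k' J) else True) by exact: H.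
elim: k => [|k [IH1 IH2]]; split=> //.
  by case=> // J'; apply: rat_q_eq (RC 0) => q _; rewrite b0.
have nd J1 : J1 != k.+1 -> rat_q (b k.+1 J1).
  move=> J1k; case: (ltnP J1 k.*2.+3) => Jk; last by apply: rat_q_eq (RC 0) => q _; rewrite b0// doubleS.
  have d0 : 2 * (J1%:R - k.+1%:R) != 0 :> C by rewrite mulf_neq0 ?pnatr_eq0// subr_eq0 eqr_nat.
  have hr : rat_q (fun q => lead_part k J1 q + shift_part k J1 q + prev_part k J1 q).
    apply: (@RD (fun q => lead_part k J1 q + shift_part k J1 q)); last exact: prev_rat.
    by apply: (@RD (lead_part k J1)); [exact: lead_rat|apply: shift_rat; case: (J1) => [|[|J']]].
  apply: rat_q_eq (RM (RC (2 * (J1%:R - k.+1%:R))^-1) hr) => q hq.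
  by apply: (mulfI d0); rewrite (brec (sub hq) Jk) /= mulrA mulfV// mul1r.
move=> J1; have [->{J1}|] := eqVneq J1 k.+1; last exact: nd.
(* At level k + 1 this involves only coefficients off the diagonal, besides those of level k. *)
have hW : rat_q (W k.+1).
  have hX : rat_q (fun q => shift_part k.+1 k.+1 q + prev_part k.+1 k.+1 q).
    apply: (@RD (shift_part k.+1 k.+1)); last exact: prev_rat.
    by apply: shift_rat; case: (k) nd => // k' nd; apply: nd; rewrite (ltn_eqF (leqnSn k'.+1)).
  have hZ : rat_q (fun q => lead_part k.+1 k.+3 q + prev_part k.+1 k.+3 q).
    apply: (@RD (lead_part k.+1 k.+3)); last exact: prev_rat.
    by apply: lead_rat; apply: nd; rewrite !eqSS (gtn_eqF (leqnSn k.+1)).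
  exact: (ringclassB rat_q_ringclass (RM al_rat hX) (RM be_rat hZ)).
have k0 : 2 * (N - k.+1%:R) != 0 by rewrite N0 sub0r mulf_neq0 ?oppr_eq0 ?pnatr_eq0.
have dW q : disc2 q -> derivable (W k.+1) q 1.
  move=> hq; have s0 : 0 < s - nrm (q - q2) by rewrite subr_gt0.
  have h1 := mulder (is_derive_al q) (der k.+2 k.+1 (sub hq)); have h2 := mulder (is_derive_be q) (der k.+2 k.+3 (sub hq)).
  have [d _] := is_deriveZ (-2 : C) (is_deriveD h1 h2); apply: (derivable_local s0) d => w wq.
  apply: esym; apply: WE; apply: sub; apply: (le_lt_trans (nrm_triangle w q q2)); by rewrite -ltrBrDr.
apply: rat_q_eq (RM (RC (2 * (N - k.+1%:R))^-1) (rat_q_derive dW hW)) => q hq.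
by apply: (mulfI k0); rewrite (coef_diag k.+1 (sub hq)) /= mulrA mulfV// mul1r.
Qed.

End Rational.

End Coefficients.

(** * Second pass: joint rationality in (y, q, t) on a level set *)

Section RoundTwo.
Variable R : realType.
Local Notation C := R[i].
Local Notation B := (C * C * C)%type.

(** A(exp z) lm - Q(exp z) is entire and vanishes on a disc, hence everywhere; comparing z with z +
    2 pi i leaves A(exp z) kp = 0. *)
Lemma monodromy_entire (A Q : {poly C}) (lm : C -> C) (kp z0 : C) (r : R) : A != 0 -> 0 < r ->
  (forall z, derivable lm z 1) -> (forall z, lm (z + twopii R) = lm z + kp) ->
  (forall z, nrm (z - z0) < r -> A.[cexp z] * lm z = Q.[cexp z]) -> kp = 0.
Proof.
move=> A0 r0 dlm plm H; pose w z := A.[cexp z] * lm z - Q.[cexp z].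
have dw z : derivable w z 1.
  have Dr := derivable_ringclass z; have [_ _ mD] := Dr.
  have hc (S : {poly C}) : derivable (fun z => S.[cexp z]) z 1.
    have [d1 _] := is_derive_cexp z; have [d2 _] := is_derive_horner S (cexp z).
    rewrite (_ : (fun z => _) = (fun z => \sum_(i < size S) S`_i * cexp z ^+ i)); last by apply/funext => x; rewrite horner_coef.
    have [cD _ _] := Dr.
    exact: (@ringclass_sum R C _ Dr 'I_(size S) (index_enum _) xpredT (fun i z => S`_i * cexp z ^+ i)
       (fun i => mD (cst S`_i) (fun z => cexp z ^+ i) (cD _) (ringclassX Dr i d1))).
  exact: (ringclassB Dr (f := fun z => A.[cexp z] * lm z) (g := fun z => Q.[cexp z]) (mD _ _ (hc A) (dlm z)) (hc Q)).
have w0 z : w z = 0.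
  have hw : hol w z0 (nrm (z - z0) + r) by move=> x _; exact: dw.
  have z00 : nrm (z0 - z0) < nrm (z - z0) + r by rewrite subrr nrm0 ltr_wpDl// nrm_ge0.
  have zn : zero_near w z0 by exists r => // x hx; rewrite /w H// subrr.
  by apply: (identity_ball hw z00 zn); rewrite ltrDl.
have [z Az] : exists z, A.[cexp z] != 0.
  apply: contrapT => h; move/eqP: A0; apply; apply: (poly_cexp0 (z0 := z0) r0) => z _.
  by apply: contrapT => /eqP n; apply: h; exists z.
apply: (mulfI Az); rewrite mulr0; have := w0 (z + twopii R); have := w0 z.
rewrite /w cexp_periodic plm => /eqP; rewrite subr_eq0 => /eqP <-; rewrite mulrDr addrAC subrr add0r.
by [].
Qed.

(** The i-th term has degree at most 2 k + deg (v i) - i in y, and d - m is the maximum of deg (v i)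
    - i over the nonzero [v i]. Reading off the coefficient of y^(2k+d-m) leaves a scalar recurrence
    between top coefficients; [om] is nonzero where the maximum is attained. *)
Lemma top_recurrence (m N : nat) (v Bp : nat -> {poly C}) : (m < N)%N -> (exists2 j, (j <= m)%N & v j != 0) ->
  (forall k, (size (Bp k) <= k.*2.+1)%N) ->
  (forall k, (N <= k)%N -> \sum_(i < m.+1) v i * 'X^i * Bp (k - i)%N = 0) ->
  exists om : nat -> C, (exists2 j, (j <= m)%N & om j != 0) /\
    forall k, (N <= k)%N -> \sum_(i < m.+1) om i * (Bp (k - i)%N)`_((k - i).*2) = 0.
Proof.
move=> mN [j jm vj] sB H.
pose Pd d := [exists i : 'I_m.+1, (v i != 0) && ((size (v i)).-1 + (m - i) == d)%N].
have exP : exists d, Pd d.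
  exists ((size (v j)).-1 + (m - j))%N; apply/existsP; exists (Ordinal (jm : (j < m.+1)%N)) => /=.
  by rewrite vj eqxx.
have bP d : Pd d -> (d <= \max_(i < m.+1) ((size (v i)).-1 + (m - i)))%N.
  move=> /existsP[i /andP[_ /eqP <-]]; exact: (leq_bigmax (F := fun i : 'I_m.+1 => ((size (v i)).-1 + (m - i))%N) i).
have [d /existsP[i0 /andP[vi0 /eqP di0]] d_max] := ex_maxnP exP bP.
have dP (i : 'I_m.+1) : v i != 0 -> ((size (v i)).-1 + (m - i) <= d)%N.
  by move=> vi; apply: d_max; apply/existsP; exists i; rewrite vi eqxx.
pose om (i : nat) : C := if (m <= d + i)%N then (v i)`_(d + i - m) else 0.
exists om; split.
  exists i0; first by rewrite -ltnS.
  have i0m : (i0 <= m)%N by rewrite -ltnS.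
  have dE : (d + i0 - m = (size (v i0)).-1)%N by rewrite -di0 -addnA subnK// addnK.
  by rewrite /om dE ifT ?lead_coef_eq0// -di0 -addnA subnK// leq_addl.
move=> k Nk; have mk : (m <= k)%N by rewrite (leq_trans (ltnW mN)).
have := congr1 (fun p : {poly C} => p`_(k.*2 + d - m)) (H k Nk); rewrite coef0 coef_sum => E.
rewrite -[RHS]E; apply: eq_bigr => i _.
have im : (i <= m)%N by rewrite -ltnS.
rewrite /om; case: ifP => hd; last first.
  have -> : v i = 0; last by rewrite !mul0r coef0.
  apply/eqP; apply: contraFT hd => vi; have := dP i vi; move: im; clear; lia.
have sv : (size (v i * 'X^i)%R <= (d + i - m + i).+1)%N.
  have [->|vi] := eqVneq (v i) 0; first by rewrite mul0r size_poly0.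
  rewrite size_mulXn//; have := dP i vi; have : (0 < size (v i))%N by rewrite size_poly_gt0.
  by move: im hd; clear; lia.
have -> : (k.*2 + d - m = (d + i - m + i) + (k - i).*2)%N by move: im hd mk; clear; lia.
by rewrite (coefM_top sv (sB (k - i)%N)) coefMXn ltnNge leq_addl /= addnK.
Qed.

Let ev3_cst (k y w t : C) : ev3 k%:P%:P%:P y w t = k.
Proof. by rewrite /ev3 map_polyC /= !hornerC /horner_eval !hornerC. Qed.

Variables (g : C -> C -> C -> C) (z0 q0 t0 : C) (r0 : R).
Hypothesis r0_gt0 : 0 < r0.
Local Notation dz0 z := (nrm (z - z0) < r0).
Local Notation dq0 q := (nrm (q - q0) < r0).
Local Notation dt0 t := (nrm (t - t0) < r0).
Hypothesis g_cont : forall (b : B) t, dz0 b.1.1 -> dq0 b.1.2 -> dt0 t -> {for b, continuous (fun b : B => g b.1.1 b.1.2 t)}.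
Hypothesis g_der : forall z q t, dz0 z -> dq0 q -> dt0 t ->
  [/\ derivable (fun z => g z q t) z 1, derivable (fun q => g z q t) q 1 & derivable (g z q) t 1].
Hypothesis g_pde : forall z q t, dz0 z -> dq0 q -> dt0 t ->
  'D_1 (g z q) t - 2 * t * 'D_1 (fun z => g z q t) z + (((2 * q - 2 / 3) / cexp z - cexp z) * 'D_1 (fun z => g z q t) z
     + (al q * cexp z + be q / cexp z) * 'D_1 (fun q => g z q t) q) = 0.
Hypothesis g_rat : forall q, dq0 q -> rat2 z0 t0 r0 (fun z t => g z q t).
Hypothesis al_neq0 : forall q, dq0 q -> al q != 0.

Let phi (b : B) t := g b.1.1 b.1.2 t.
Let cc : B := (z0, q0, 0).

Lemma round_two_series : exists c r l m p q Cf, [/\ 0 < r, forall b, pd c r b -> dz0 b.1.1 /\ dq0 b.1.2 &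
  local_series phi t0 r0 c r l m p q Cf].
Proof.
have [|||||c [r [l [m [p [q [Cf [rr sub ls]]]]]]]] := @local_rat R phi cc t0 r0 r0_gt0.
- by move=> b t [h1 h2 _] ht; exact: g_cont.
- move=> b t [h1 h2 _] ht; have [d1 d2 _] := g_der h1 h2 ht; split; [exact: d1|exact: d2|].
  have [h _ _] := derivable_ringclass b.2; exact: (h (g b.1.1 b.1.2 t)).
- by move=> b t [h1 h2 _] ht; have [_ _ d3] := g_der h1 h2 ht; exact: d3.
- move=> b t [h1 h2 _] ht; rewrite /D0.
  have -> : dF (phi^~ t) b = 0 by exact: (@derive_cst C C C (g b.1.1 b.1.2 t) b.2 1).
  by rewrite mulr0 addr0; exact: (g_pde h1 h2 ht).
- move=> b [h1 h2 _]; have [|P [Q [Q0 PQ]]] := rat2_fix_z (g_rat h2) h1.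
    by move=> t ht; have [d _ _] := g_der h1 h2 ht; exact: derivable_continuous d.
  by exists P, Q.
by exists c, r, l, m, p, q, Cf; split=> // b /sub[].
Qed.

Section WithSeries.
Variables (c : B) (r : R) (l m : nat) (p q Cf : nat -> B -> C).
Hypothesis rr : 0 < r.
Hypothesis sub : forall b, pd c r b -> dz0 b.1.1 /\ dq0 b.1.2.
Hypothesis ls : local_series phi t0 r0 c r l m p q Cf.
Local Notation dz1 z := (nrm (z - c.1.1) < r).
Local Notation dq1 q := (nrm (q - c.1.2) < r).
Local Notation dF1 F := (nrm (F - c.2) < r).

Let inz z : dz1 z -> dz0 z.
Proof. by move=> hz; have [_ h2 h3] := pd_center c rr; have [] := @sub (z, c.1.2, c.2) (And3 hz h2 h3). Qed.
Let inq x : dq1 x -> dq0 x.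
Proof. by move=> hq; have [h1 _ h3] := pd_center c rr; have [] := @sub (c.1.1, x, c.2) (And3 h1 hq h3). Qed.

(** The third coordinate is a dummy, carried along so that the results on (z, q, F) apply unchanged;
    the coefficients inherit independence of it from the values of [phi]. *)
Lemma Cf_indep k z x F F' : dz1 z -> dq1 x -> dF1 F -> dF1 F' -> Cf k (z, x, F) = Cf k (z, x, F').
Proof.
move=> hz hx hF hF'; pose S (u : B -> C) := forall z x F F', u (z, x, F) = u (z, x, F').
have Sr : ringclass S by split=> [k0|u v su sv|u v su sv] z1 x1 F1 F2 //; rewrite (su z1 x1 F1 F2) (sv z1 x1 F1 F2).
have St t : dt0 t -> S (phi^~ t) by [].
have [n [Bk [Sq SB BE]]] := ls_localize ls Sr St k.
have b1 : pd c r (z, x, F) by split.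
have b2 : pd c r (z, x, F') by split.
apply: (mulfI (expf_neq0 n (ls_q ls b1))); rewrite BE// (SB z x F F') -BE//; congr (_ ^+ n * _); exact: Sq.
Qed.

(** For fixed q and t the integral is now rational in exp z, so periodicity in z propagates without
    recourse to continuation in phase space. *)
Lemma Cf_mono k x F (lm : C -> C) (kp : C) : dq1 x -> dF1 F -> (forall z, derivable lm z 1) ->
  (forall z, lm (z + twopii R) = lm z + kp) -> (forall z, dz1 z -> Cf k (z, x, F) = lm z) -> kp = 0.
Proof.
move=> hx hF dlm plm Clm.
pose S (u : B -> C) := exists P Q : {poly C}, Q != 0 /\ forall z, dz1 z -> u (z, x, F) * Q.[cexp z] = P.[cexp z].
have Sr : ringclass S.
  split=> [k0|u v [P [Q [Q0 E]]] [P' [Q' [Q'0 E']]]|u v [P [Q [Q0 E]]] [P' [Q' [Q'0 E']]]].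
  - by exists k0%:P, 1; split; [exact: oner_neq0|move=> z _; rewrite !hornerE].
  - exists (P * Q' + P' * Q), (Q * Q'); split; first by rewrite mulf_neq0.
    by move=> z hz; rewrite !(hornerD, hornerM) -E// -E'// /=; ring.
  - exists (P * P'), (Q * Q'); split; first by rewrite mulf_neq0.
    by move=> z hz; rewrite !(hornerD, hornerM) -E// -E'// /=; ring.
have St t : dt0 t -> S (phi^~ t).
  move=> ht; have [|P [Q [Q0 PQ]]] := rat2_fix_t (g_rat (inq hx)) ht.
    by move=> z hz; have [_ _ d] := g_der hz (inq hx) ht; exact: derivable_continuous d.
  by exists P, Q; split=> // z /inz; exact: PQ.
have [n [Bk [[P1 [Q1 [Q10 E1]]] [P2 [Q2 [Q20 E2]]] BE]]] := ls_localize ls Sr St k.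
have bz z : dz1 z -> pd c r (z, x, F) by split.
have P10 : P1 != 0.
  apply: contra_neq Q10 => P0; apply: (poly_cexp0 (z0 := c.1.1) rr) => z hz.
  by apply: (mulfI (ls_q ls (bz z hz))); rewrite E1// P0 horner0 mulr0.
have A0 : P1 ^+ n * Q2 != 0 by rewrite mulf_neq0// expf_neq0.
apply: (monodromy_entire (Q := Q1 ^+ n * P2) (z0 := c.1.1) A0 rr dlm plm) => z hz.
rewrite (hornerM (P1 ^+ n)) (hornerM (Q1 ^+ n)) !horner_exp -(E1 z hz) -(E2 z hz) -(BE _ (bz z hz)) exprMn (Clm z hz).
by ring.
Qed.

(** Rationality in (y, t) at the one value q = c.1.2 gives a linear recurrence for the top
    coefficients, which are Taylor coefficients there. This makes [b 0 0] rational in q, then all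
    coefficients, and Kronecker's criterion applies over polynomials in y and q. *)
Theorem round_two_core : exists q2 (s : R) (P Q : {poly {poly {poly C}}}), [/\ 0 < s, forall x, nrm (x - q2) < s -> dq1 x, Q != 0 &
  forall z x t, nrm (z - c.1.1) < s -> nrm (x - q2) < s -> dt0 t -> g z x t * ev3 Q (cexp z) x t = ev3 P (cexp z) x t].
Proof.
have [a [aC a0 ad arec]] := @laurent R c r (l%:R - m%:R) Cf rr (ls_sder ls) (ls_rec ls) Cf_mono.
have [c1 c2 c3] := pd_center c rr.
have bP z x : dz1 z -> dq1 x -> pd c r (z, x, c.2) by split.
have qpoly0 z x : dz1 z -> dq1 x -> \poly_(i < m.+1) q i (z, x, c.2) != 0.
  move=> hz hx; apply/eqP => /(congr1 (fun p : {poly C} => p`_m)); rewrite coef_poly ltnSn coef0 => /eqP.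
  by apply/negP; exact: ls_q ls _ (bP z x hz hx).
have gd z x t : dz1 z -> dq1 x -> dt0 t -> derivable (g z x) t 1.
  by move=> hz hx ht; have [_ _ d] := g_der (inz hz) (inq hx) ht; exact: d.
(* If the numerator vanishes identically then g = 0, and 0 / 1 represents it. *)
case: (ls_lead ls) => [pl|p0]; last first.
  exists c.1.2, r, (0 : C)%:P%:P%:P, (1 : C)%:P%:P%:P; split=> //; first by rewrite !polyC_eq0 oner_neq0.
  move=> z x t hz hx ht.
  have pE : (\poly_(i < l.+1) p i (z, x, c.2)) * 1%:P = (\poly_(i < m.+1) q i (z, x, c.2)) * 0%:P.
    rewrite mulr0; apply/polyP => i; rewrite mulr1 coef_poly coef0; case: ifP => // _.
    exact: p0 _ _ (bP z x hz hx).
  have T := @quotient_transfer R (g z x) t0 r0 _ _ _ _ r0_gt0 (qpoly0 z x hz hx) (fun t ht => gd z x t hz hx ht)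
     (fun t ht => ls_eq ls (bP z x hz hx) ht) pE t ht.
  by rewrite !hornerC in T; rewrite (ev3_cst 1) (ev3_cst 0).
pose b k J x := a k J x c.2.
have aF k J x F : dq1 x -> dF1 F -> a k J x F = a k J x c.2.
  move=> hx hF; apply/eqP; rewrite -subr_eq0; apply/eqP; case: (ltnP J k.*2.+1) => kJ; last by rewrite !a0// subrr.
  have : \poly_(j < k.*2.+1) (a k j x F - a k j x c.2) = 0.
    apply: (poly_cexp0 (z0 := c.1.1) rr) => z hz; rewrite horner_poly.
    transitivity (\sum_(j < k.*2.+1) a k j x F * cexp z ^+ j - \sum_(j < k.*2.+1) a k j x c.2 * cexp z ^+ j).
      by rewrite -sumrB; apply: eq_bigr => j _; rewrite mulrBl.
    by rewrite -!aC// (Cf_indep k hz hx hF c3) subrr.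
  by move=> /(congr1 (fun p : {poly C} => p`_J)); rewrite coef_poly kJ coef0.
have b0 k J x : (k.*2 < J)%N -> b k J x = 0 by move=> kJ; exact: a0.
have bd k J x : dq1 x -> derivable (b k J) x 1 by move=> hx; have [h _] := ad k J x c.2 hx c3; exact: h.
have brec k J x : dq1 x -> (J < k.*2.+3)%N ->
    2 * (J%:R - k.+1%:R) * b k.+1 J x = lead_part b k J x + shift_part b k J x + prev_part (l%:R - m%:R) b k J x.
  move=> hx Jk; rewrite (arec k J x c.2 hx c3 Jk) /laurent_rhs.
  have -> : (if J is J'.+1 then 2 * x * 'D_1 (a k J' x) c.2 else 0) = 0.
    case: (J) => // J'; suff -> : 'D_1 (a k J' x) c.2 = 0 by rewrite mulr0.
    rewrite -[RHS](@derive_cst C C C (a k J' x c.2) c.2 1).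
    by apply: (derive_local rr) => F hF; exact: aF.
  by rewrite addr0.
have bC k z x : dz1 z -> dq1 x -> Cf k (z, x, c.2) * cexp z ^+ k = \sum_(J < k.*2.+1) b k J x * cexp z ^+ J.
  by move=> hz hx; exact: aC.
have gam0 : b 0%N 0%N c.1.2 != 0.
  have hb := bP _ _ c1 c2; have := bC 0%N _ _ c1 c2; rewrite expr0 mulr1 big_ord_recl big_ord0 addr0 expr0 mulr1 => <-.
  have := ls_conv ls 0 hb; rewrite big_ord_recl big_ord0 addr0 /rv /= !subn0 => E.
  by apply: contra_neq (pl _ hb) => C0; rewrite -E C0 mulr0.
(* At k = 0 every term of the diagonal formula except the left side is zero, so l - m annihilates
   the nonzero leading coefficient [b 0 0]. *)
have N0 : l%:R - m%:R = 0 :> C.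
  have := coef_diag bd brec 0 c2; rewrite subr0.
  have -> : (fun x => al x * (shift_part b 0 0 x + prev_part (l%:R - m%:R) b 0 0 x)
      - be x * (lead_part b 0 2 x + prev_part (l%:R - m%:R) b 0 2 x)) = cst 0.
    apply/funext => x.
    rewrite /shift_part /prev_part /lead_part; have -> : b 0%N 2%N = cst 0 by apply/funext => w; exact: b0.
    have -> : 'D_1 (cst 0 : C -> C) x = 0 by exact: (@derive_cst C C C 0 x 1).
    by rewrite /= !mulr0 !addr0 !mulr0 subrr.
  have -> : 'D_1 (cst 0 : C -> C) c.1.2 = 0 by exact: (@derive_cst C C C 0 c.1.2 1).
  by move=> /eqP; rewrite !mulf_eq0 (negbTE gam0) orbF pnatr_eq0 /= => /eqP.
pose X1 := {z : C | dz1 z}.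
pose ev1 (x : X1) : {rmorphism {poly C} -> C} := horner_eval (cexp (sval x)).
pose b1 (x : X1) : B := (sval x, c.1.2, c.2).
have b1P (x : X1) : pd c r (b1 x) by apply: bP => //; exact: svalP x.
have rvE (n : nat) (u : nat -> B -> C) i (w : B) : rv 0 u n i w = if (i <= n)%N then u (n - i)%N w else 0.
  by rewrite /rv; case: (i <= n)%N.
(* Only z varies here: a denominator with coefficients polynomial in y, for q frozen at c.1.2. *)
have [||||v [N1 [w1 [mN vj v0 _ vz]]]] := @series_kernel R {poly C} X1 ev1 _ l m (fun x i => q i (b1 x)) (fun x i => p i (b1 x)) (fun x k => Cf k (b1 x))
   _ _ _ (exist _ c.1.1 c1).
- by move=> A HA; apply: (poly_cexp0 (z0 := c.1.1) rr) => z hz; exact: (HA (exist _ z hz)).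
- by move=> x; exact: ls_q ls _ (b1P x).
- move=> x k; apply: (etrans (etrans _ (ls_conv ls k (b1P x)))); last by rewrite rvE.
  by apply: eq_bigr => i _; rewrite rvE.
- move=> k; exists 'X^k, (\poly_(J < k.*2.+1) b k J c.1.2) => x.
  rewrite /ev1 /= /horner_eval hornerXn horner_poly; split; first by rewrite expf_neq0// cexp_neq0.
  by apply: bC => //; exact: svalP x.
pose Bp k : {poly C} := \poly_(J < k.*2.+1) b k J c.1.2.
have [||om [omj omr]] := @top_recurrence m N1 v Bp mN vj.
- by move=> k; exact: size_poly.
- move=> k Nk; apply: (poly_cexp0 (z0 := c.1.1) rr) => z hz; rewrite horner_sum.
  have mk : (m <= k)%N by rewrite (leq_trans (ltnW mN)).
  have := vz (exist _ z hz) k Nk.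
  rewrite (sum_trunc (f := fun i => ev1 (exist _ z hz) (v i)) (fun j => Cf (k - j)%N (b1 (exist _ z hz))) mk); last first.
    by move=> i mi; rewrite v0// rmorph0.
  move=> /(congr1 (fun x => x * cexp z ^+ k)); rewrite mul0r mulr_suml => E; rewrite -[RHS]E; apply: eq_bigr => i _.
  rewrite !hornerM hornerXn horner_poly -(bC (k - i)%N z c.1.2 hz c2) /ev1 /= /horner_eval /b1 /=.
  have ik : (i <= k)%N by rewrite (leq_trans _ mk)// -ltnS.
  have -> : cexp z ^+ k = cexp z ^+ i * cexp z ^+ (k - i) by rewrite -exprD subnKC.
  by ring.
(* The scaling by (2 / al)^k is the one that turns the top coefficients into a Taylor chain; at the
   centre it only rescales the recurrence. *)
pose h k x := b k k.*2 x * (2 / al x) ^+ k.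
have ch : tchain c.1.2 r h by move=> k x hx; apply: (coef_top b0 bd brec k hx); exact/al_neq0/inq.
have al0 : al c.1.2 != 0 by apply/al_neq0/inq.
have e0 : 2 / al c.1.2 != 0 by rewrite mulf_neq0 ?invr_eq0 ?two_neq0.
have [||D [P0 [D0 DP]]] := @tchain_rational R c.1.2 r rr h m N1 (fun i => om i * (2 / al c.1.2) ^+ i) ch.
- by have [j jm oj] := omj; exists j => //; rewrite mulf_neq0// expf_neq0.
- move=> k Nk; have mk : (m <= k)%N by rewrite (leq_trans (ltnW mN)).
  transitivity ((2 / al c.1.2) ^+ k * \sum_(i < m.+1) om i * (Bp (k - i)%N)`_((k - i).*2)); last by rewrite omr// mulr0.
  rewrite mulr_sumr; apply: eq_bigr => i _; have ik : (i <= k)%N by rewrite (leq_trans _ mk)// -ltnS.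
  rewrite ik /h coef_poly ltnSn.
  have -> : (2 / al c.1.2) ^+ k = (2 / al c.1.2) ^+ i * (2 / al c.1.2) ^+ (k - i) by rewrite -exprD subnKC.
  by ring.
have r8 : 0 < r / 8 by rewrite divr_gt0.
have r8r : r / 8 <= r by rewrite ler_pdivrMr// ler_pMr// ler1n.
have [q2 q2r Dq2] : exists2 x, nrm (x - c.1.2) < r / 8 & D.[x] != 0.
  apply: contrapT => hn; move/eqP: D0; apply; apply: (poly_disc0 (t0 := c.1.2) r8) => x hx.
  by apply: contrapT => /eqP n; apply: hn; exists x.
have [e1 e10 e1P] : exists2 e : R, 0 < e & forall w, nrm (w - q2) < e -> D.[w] != 0.
  by have [d _] := is_derive_horner D q2; exact: near_neq0 (derivable_continuous d) Dq2.
have [e2 e20 e2P] := ball_sub q2r.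
pose s := Num.min r (Num.min e1 e2).
have s0 : 0 < s by rewrite !lt_min rr e10.
have s_r x : x < s -> x < r by rewrite lt_min => /andP[].
have sD x : nrm (x - q2) < s -> D.[x] != 0 by rewrite !lt_min => /and3P[_ + _]; exact: e1P.
have s8 x : nrm (x - q2) < s -> nrm (x - c.1.2) < r / 8 by rewrite !lt_min => /and3P[_ _ +]; exact: e2P.
have s1 x : nrm (x - q2) < s -> dq1 x by move=> /s8 hx; exact: lt_le_trans hx r8r.
(* The bottom function of the chain is [b 0 0] itself, which starts the induction. *)
have rat k J : rat_q q2 s D (b k J).
  apply: (coef_rational b0 bd brec s1 N0).
  exists 1%N, P0 => x hx; rewrite expr1 -(DP x (s8 x hx)) /h expr0 mulr1.
  by [].
pose X := {zx : C * C | nrm (zx.1 - c.1.1) < s /\ nrm (zx.2 - q2) < s}.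
pose ev (x : X) := ev2 (cexp (sval x).1) (sval x).2.
pose bx (x : X) : B := ((sval x).1, (sval x).2, c.2).
have xz (x : X) : dz1 (sval x).1 by case: x => -[z w] /= [h1 _]; exact: s_r.
have xq (x : X) : nrm ((sval x).2 - q2) < s by case: x => -[z w] /= [_ h2].
have bxP (x : X) : pd c r (bx x) by apply: bP; [exact: xz|exact/s1/xq].
have evP (x : X) (T : {poly C}) : ev x (map_poly polyC T) = T.[(sval x).2].
  by rewrite /ev /ev2 /= /horner_eval horner_map hornerC.
have evX (x : X) n : ev x ('X^n)%:P = cexp (sval x).1 ^+ n by rewrite /ev /ev2 /= /horner_eval hornerC hornerXn.
pose Den (u : X -> C) := exists d n, forall x, ev x d != 0 /\ u x * ev x d = ev x n.
have Denr : ringclass Den.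
  split=> [k|u w [d [n E]] [d' [n' E']]|u w [d [n E]] [d' [n' E']]].
  - by exists 1, (map_poly polyC k%:P) => x; rewrite rmorph1 evP hornerC mulr1 oner_neq0.
  - exists (d * d'), (n * d' + n' * d) => x; have [dn0 un] := E x; have [dn0' un'] := E' x.
    rewrite rmorphD !rmorphM mulf_neq0//; split=> //; rewrite -un -un'; ring.
  - exists (d * d'), (n * n') => x; have [dn0 un] := E x; have [dn0' un'] := E' x.
    rewrite !rmorphM mulf_neq0//; split=> //; rewrite -un -un'; ring.
have DenC k : Den (fun x => Cf k (bx x)).
  have [Dc DD DM] := Denr.
  have D1 J : Den (fun x => b k J (sval x).2).
    have [n [T TE]] := rat k J; exists (map_poly polyC (D ^+ n)), (map_poly polyC T) => x.
    by rewrite !evP horner_exp -TE ?expf_neq0 ?sD//; exact: xq.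
  have D2 n : Den (fun x => cexp (sval x).1 ^+ n).
    by exists 1, ('X^n)%:P => x; rewrite evX rmorph1 mulr1 oner_neq0.
  have D3 : Den (fun x => (cexp (sval x).1 ^+ k)^-1).
    by exists ('X^k)%:P, 1 => x; rewrite evX rmorph1 mulVf ?expf_neq0 ?cexp_neq0.
  have D4 := @ringclass_sum R X Den Denr 'I_(k.*2.+1) (index_enum _) xpredT (fun J x => b k J (sval x).2 * cexp (sval x).1 ^+ J)
    (fun J => DM _ _ (D1 J) (D2 J)).
  have [d [n E]] := DM _ _ D4 D3; exists d, n => x; have [dn0 un] := E x; split=> //.
  rewrite -un; congr (_ * _); rewrite -(bC k _ _ (xz x) (s1 _ (xq x))) mulfK// expf_neq0// cexp_neq0.
  by [].
have x0 : X by exists (c.1.1, q2); rewrite /= !subrr nrm0.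
have [||||P [Q [Q0 PQ]]] := @series_rat R {poly {poly C}} X ev _ l m (fun x i => q i (bx x)) (fun x i => p i (bx x)) (fun x k => Cf k (bx x)) _ _ _ x0.
- move=> a1 Ha; apply: (ev2_sep (z0 := c.1.1) (w0 := q2) s0) => z w hz hw.
  exact: (Ha (exist _ (z, w) (conj hz hw))).
- by move=> x; exact: ls_q ls _ (bxP x).
- move=> x k; apply: (etrans (etrans _ (ls_conv ls k (bxP x)))); last by rewrite rvE.
  by apply: eq_bigr => i _; rewrite rvE.
- exact: DenC.
exists q2, s, P, Q; split=> // z x t hz hx ht.
pose zx : X := exist _ (z, x) (conj hz hx).
exact: (@quotient_transfer R (g z x) t0 r0 _ _ _ _ r0_gt0 (qpoly0 z x (s_r _ hz) (s1 x hx)) (fun t ht => gd z x t (s_r _ hz) (s1 x hx) ht)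
   (fun t ht => ls_eq ls (bxP zx) ht) (PQ zx) t ht).
Qed.

End WithSeries.

Theorem round_two : exists z1 q1 (s : R) (P Q : {poly {poly {poly C}}}), [/\ 0 < s,
  forall z, nrm (z - z1) < s -> dz0 z, forall x, nrm (x - q1) < s -> dq0 x, Q != 0 &
  forall z x t, nrm (z - z1) < s -> nrm (x - q1) < s -> dt0 t -> g z x t * ev3 Q (cexp z) x t = ev3 P (cexp z) x t].
Proof.
have [c [r [l [m [p [q [Cf [rr sub ls]]]]]]]] := round_two_series.
have [q2 [s [P [Q [s0 sq Q0 H]]]]] := round_two_core rr sub ls.
have [c1 c2 c3] := pd_center c rr.
exists c.1.1, q2, (Num.min r s), P, Q; split=> //.
- by rewrite lt_min rr.
- by move=> z; rewrite lt_min => /andP[hz _]; have [] := sub (z, c.1.2, c.2) (And3 hz c2 c3).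
- by move=> x; rewrite lt_min => /andP[_ /sq hx]; have [] := sub (c.1.1, x, c.2) (And3 c1 hx c3).
- by move=> z x t; rewrite !lt_min => /andP[_ hz] /andP[_ hx]; exact: H.
Qed.

End RoundTwo.

(** * Polynomials evaluated along the flow *)

Section ConstantIntegral.
Variable R : realType.
Local Notation C := R[i].
Local Notation B := (C * C * C)%type.

(** How a derivation acts on polynomials in [sg] follows from its action on coefficients and on
    [sg], by induction on the polynomial. The form with [G] allows the variables to be adjoined one
    by one. *)
Lemma poly_derivation (S : comNzRingType) (E : B -> {rmorphism S -> C}) (sg : B -> C) (b : B) (dl : (B -> C) -> C)
  (D1 : S -> C) (G : {poly S} -> C) : derivation_at b dl -> sder sg b ->
  (forall a, sder (fun b => E b a) b /\ dl (fun b => E b a) = D1 a) -> G 0 = 0 ->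
  (forall Q c, G (Q * 'X + c%:P) = G Q * sg b + (map_poly (E b) Q).[sg b] * dl sg + D1 c) ->
  forall P, sder (fun b => (map_poly (E b) P).[sg b]) b /\ dl (fun b => (map_poly (E b) P).[sg b]) = G P.
Proof.
move=> [d1 d2 d3 d4] ss HE G0 GS; have [sc sD sM] := sder_ringclass b.
elim/poly_ind => [|Q k [IH1 IH2]].
  have -> : (fun b => (map_poly (E b) 0).[sg b]) = cst 0 by apply/funext => b'; rewrite rmorph0 horner0.
  by split; [exact: (sc 0)|rewrite G0; exact: (d1 0)].
have -> : (fun b => (map_poly (E b) (Q * 'X + k%:P)).[sg b]) = (fun b => (map_poly (E b) Q).[sg b] * sg b + E b k).
  apply/funext => b'; have -> : map_poly (E b') (Q * 'X + k%:P) = map_poly (E b') Q * 'X + (E b' k)%:P.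
    by rewrite rmorphD rmorphM /= map_polyX map_polyC.
  by rewrite hornerD hornerM hornerX hornerC.
have [sk dk] := HE k.
have sQ := sM _ _ IH1 ss; split; first exact: (sD (fun b => (map_poly (E b) Q).[sg b] * sg b) (fun b => E b k)).
have -> : dl (fun b => (map_poly (E b) Q).[sg b] * sg b + E b k) = dl (fun b => (map_poly (E b) Q).[sg b] * sg b) + dl (fun b => E b k).
  exact: (d2 (fun b => (map_poly (E b) Q).[sg b] * sg b) (fun b => E b k) sQ sk).
have -> : dl (fun b => (map_poly (E b) Q).[sg b] * sg b) = dl (fun b => (map_poly (E b) Q).[sg b]) * sg b + (map_poly (E b) Q).[sg b] * dl sg.
  exact: (d3 (fun b => (map_poly (E b) Q).[sg b]) sg IH1 ss).
rewrite dk IH2; exact: (esym (GS Q k)).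
Qed.

Lemma map_polyX0 (S : nzRingType) (f : {additive S -> S}) : f 1 = 0 -> map_poly f 'X = 0.
Proof.
by move=> f1; apply/polyP => i; rewrite coef_map coefX coef0; case: (i == 1)%N; rewrite ?raddf0.
Qed.

Let leibniz_X (S : nzRingType) (a b c d x q e f : S) : a = b + c -> b = d * x + q * e -> e = 0 -> c = f -> a = d * x + f.
Proof. by move=> -> -> -> ->; rewrite mulr0 addr0. Qed.

Section Evaluate.
Variables (tau xi sg : B -> C) (lam : C).

Definition ce1 b : {rmorphism {poly C} -> C} := horner_eval (tau b).
Definition ce2 b : {rmorphism {poly {poly C}} -> C} := [the {rmorphism _ -> _} of horner_eval (xi b) \o map_poly (ce1 b)].
Definition ce3 b : {rmorphism {poly {poly {poly C}}} -> C} := [the {rmorphism _ -> _} of horner_eval (sg b) \o map_poly (ce2 b)].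

Lemma ce2E b p : ce2 b p = (map_poly (ce1 b) p).[xi b]. Proof. by []. Qed.
Lemma ce3E b p : ce3 b p = (map_poly (ce2 b) p).[sg b]. Proof. by []. Qed.
Lemma ce2X b : ce2 b 'X = xi b. Proof. by rewrite ce2E map_polyX hornerX. Qed.
Lemma ce2C b p : ce2 b p%:P = p.[tau b]. Proof. by rewrite ce2E map_polyC /= hornerC. Qed.
Lemma ce3X b : ce3 b 'X = sg b. Proof. by rewrite ce3E map_polyX hornerX. Qed.
Lemma ce3C b p : ce3 b p%:P = ce2 b p. Proof. by rewrite ce3E map_polyC /= hornerC. Qed.

Lemma vf_derivation b dl : derivation_at b dl -> sder tau b -> sder xi b -> sder sg b -> dl tau = 1 ->
  dl xi = ce3 b (vf_xi lam) -> dl sg = ce3 b (vf_s lam) ->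
  forall P, sder (fun b => ce3 b P) b /\ dl (fun b => ce3 b P) = ce3 b (vf lam P).
Proof.
move=> ddl st sx ss dt dx ds; have [d1 _ _ _] := ddl; have [sc _ _] := sder_ringclass b.
pose E0 (b : B) : {rmorphism C -> C} := [the {rmorphism C -> C} of idfun].
have L1 p : sder (fun b => ce1 b p) b /\ dl (fun b => ce1 b p) = (p^`()).[tau b].
  have mE b' : map_poly (E0 b') p = p by apply: map_poly_id.
  have mE2 Q : map_poly (E0 b) Q = Q by apply: map_poly_id.
  have := @poly_derivation C E0 tau b dl (fun=> 0) (fun p => (p^`()).[tau b]) ddl st _ _ _ p.
  rewrite (_ : (fun b => (map_poly (E0 b) p).[tau b]) = (fun b => ce1 b p)); last first.
    by apply/funext => b'; rewrite mE.
  apply.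
  - by move=> k; split; [exact: (sc k)|exact: (d1 k)].
  - by rewrite linear0 horner0.
  - move=> Q k; rewrite derivD derivM derivX derivC addr0 mulr1 !hornerE dt mulr1 ?addr0.
    by rewrite mE2.
have L2 p : sder (fun b => ce2 b p) b /\ dl (fun b => ce2 b p) = ce2 b (dt2 p) + ce2 b p^`() * dl xi.
  apply: (@poly_derivation {poly C} ce1 xi b dl (fun a => (a^`()).[tau b]) (fun p => ce2 b (dt2 p) + ce2 b p^`() * dl xi) ddl sx L1).
  - have -> : dt2 (0 : {poly {poly C}}) = 0 by exact: raddf0.
    by rewrite linear0 !rmorph0 mul0r addr0.
  - move=> Q k; have -> : dt2 (Q * 'X + k%:P) = dt2 Q * 'X + (k^`())%:P.
      rewrite dt2D dt2M; congr (_ + _); last by rewrite /dt2 map_polyC.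
      have -> : dt2 ('X : {poly {poly C}}) = 0; last by rewrite mulr0 addr0.
      by apply/polyP => i; rewrite coef_map coefX coef0 /=; case: (i == 1)%N; rewrite ?derivC ?linear0.
    rewrite derivD derivM derivX derivC addr0 mulr1 -ce2E.
    have e1 : ce2 b (dt2 Q * 'X + (k^`())%:P) = ce2 b (dt2 Q) * xi b + (k^`()).[tau b].
      by rewrite rmorphD rmorphM ce2X ce2C.
    have e2 : ce2 b (Q^`() * 'X + Q) = ce2 b Q^`() * xi b + ce2 b Q by rewrite rmorphD rmorphM ce2X.
    by rewrite e1 e2; ring.
have L3 P : sder (fun b => ce3 b P) b /\ dl (fun b => ce3 b P) = ce3 b (dt3 P) + ce3 b (dx3 P) * dl xi + ce3 b P^`() * dl sg.
  apply: (@poly_derivation {poly {poly C}} ce2 sg b dl (fun a => ce2 b (dt2 a) + ce2 b a^`() * dl xi)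
    (fun P => ce3 b (dt3 P) + ce3 b (dx3 P) * dl xi + ce3 b P^`() * dl sg) ddl ss L2).
  - have -> : dt3 (0 : {poly {poly {poly C}}}) = 0 by exact: raddf0.
    have -> : dx3 (0 : {poly {poly {poly C}}}) = 0 by exact: raddf0.
    by rewrite linear0 !rmorph0 !mul0r !addr0.
  - move=> Q k.
    have dx1 : map_poly (@deriv C) (1 : {poly {poly C}}) = 0.
      have h0 : ((1 : {poly C})^`() : {poly C}) = 0 by exact: (derivC (1 : C)).
      by apply: (etrans (map_polyC (@deriv C) (1 : {poly C}))); rewrite /= h0.
    have e3 : dt3 (Q * 'X + k%:P) = dt3 Q * 'X + (dt2 k)%:P.
      have h1 : dt3 (Q * 'X + k%:P) = dt3 (Q * 'X) + dt3 k%:P by exact: raddfD.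
      have h2 : dt3 k%:P = (dt2 k)%:P by exact: (map_polyC (map_poly (@deriv C)) k).
      have h3 : dt3 ('X : {poly {poly {poly C}}}) = 0 by exact: (@map_polyX0 _ (map_poly (@deriv C)) dx1).
      exact: (leibniz_X h1 (dt3M Q 'X) h3 h2).
    have e4 : dx3 (Q * 'X + k%:P) = dx3 Q * 'X + (k^`())%:P.
      have h1 : dx3 (Q * 'X + k%:P) = dx3 (Q * 'X) + dx3 k%:P by exact: raddfD.
      have h2 : dx3 k%:P = (k^`())%:P by exact: (map_polyC (@deriv {poly C}) k).
      have h3 : dx3 ('X : {poly {poly {poly C}}}) = 0 by exact: (@map_polyX0 _ (@deriv {poly C}) (derivC 1)).
      exact: (leibniz_X h1 (dx3M Q 'X) h3 h2).
    have h (A : {poly {poly {poly C}}}) (a : {poly {poly C}}) : ce3 b (A * 'X + a%:P) = ce3 b A * sg b + ce2 b a.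
      by rewrite rmorphD rmorphM ce3X ce3C.
    have h2 (A A' : {poly {poly {poly C}}}) : ce3 b (A * 'X + A') = ce3 b A * sg b + ce3 b A' by rewrite rmorphD rmorphM ce3X.
    have e5 : (Q * 'X + k%:P)^`() = Q^`() * 'X + Q by rewrite derivD derivM derivX derivC addr0 mulr1.
    rewrite -ce3E (etrans (congr1 (ce3 b) e3) (h _ _)) (etrans (congr1 (ce3 b) e4) (h _ _)) (etrans (congr1 (ce3 b) e5) (h2 _ _)).
    move: (ce3 b (dt3 Q)) (ce3 b (dx3 Q)) (ce3 b Q^`()) (ce3 b Q) (ce2 b (dt2 k)) (ce2 b k^`()) => m1 m2 m3 m4 m5 m6.
    by ring.
move=> P; have [h1 h2] := L3 P; split; first exact: h1.
have gen (A X1 B1 Y1 D1 : {poly {poly {poly C}}}) : ce3 b (A + X1 * B1 + Y1 * D1) = ce3 b A + ce3 b X1 * ce3 b B1 + ce3 b Y1 * ce3 b D1.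
  by rewrite !rmorphD !rmorphM.
by rewrite h2 /vf gen dx ds mulrC [ce3 b (vf_s lam) * _]mulrC [ce3 b (vf_xi lam) * _]mulrC [ce3 b P^`() * _]mulrC; ring.
Qed.

Lemma ce3_vf_xi b : ce3 b (vf_xi lam) = 3 * lam * tau b * xi b - 1 + 2 * xi b ^+ 3 * sg b ^+ 3.
Proof.
have c3 (k : C) : ce3 b k%:P%:P%:P = k by rewrite ce3C ce2C hornerC.
have tE : ce3 b (tU C) = tau b by rewrite /tU ce3C ce2C hornerX.
have xE : ce3 b (xiU C) = xi b by rewrite /xiU ce3C ce2X.
have gen (t x s k : {poly {poly {poly C}}}) : ce3 b (3 * k * t * x - 1 + 2 * x ^+ 3 * s ^+ 3)
   = 3 * ce3 b k * ce3 b t * ce3 b x - 1 + 2 * ce3 b x ^+ 3 * ce3 b s ^+ 3.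
  have g0 (u v : {poly {poly {poly C}}}) : ce3 b (3 * k * t * x - 1 + 2 * u * v)
     = 3 * ce3 b k * ce3 b t * ce3 b x - 1 + 2 * ce3 b u * ce3 b v.
    by rewrite rmorphD rmorphB rmorph1 !rmorphM !rmorph_nat.
  by apply: (etrans (g0 (x ^+ 3) (s ^+ 3))); rewrite !rmorphXn.
by rewrite /vf_xi gen c3 tE xE ce3X.
Qed.

Lemma ce3_vf_s b : ce3 b (vf_s lam) = - (lam * tau b * sg b) - xi b ^+ 2 * sg b ^+ 4.
Proof.
have c3 (k : C) : ce3 b k%:P%:P%:P = k by rewrite ce3C ce2C hornerC.
have tE : ce3 b (tU C) = tau b by rewrite /tU ce3C ce2C hornerX.
have xE : ce3 b (xiU C) = xi b by rewrite /xiU ce3C ce2X.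
have gen (t x s k : {poly {poly {poly C}}}) : ce3 b (- (k * t * s) - x ^+ 2 * s ^+ 4)
   = - (ce3 b k * ce3 b t * ce3 b s) - ce3 b x ^+ 2 * ce3 b s ^+ 4.
  have g0 (u v : {poly {poly {poly C}}}) : ce3 b (- (k * t * s) - u * v) = - (ce3 b k * ce3 b t * ce3 b s) - ce3 b u * ce3 b v.
    by rewrite rmorphB rmorphN !rmorphM.
  by apply: (etrans (g0 (x ^+ 2) (s ^+ 4))); rewrite !rmorphXn.
by rewrite /vf_s gen c3 tE xE ce3X.
Qed.

End Evaluate.

End ConstantIntegral.

(** * Coordinates at the rational solution y = -2t/3, p = 2t/3 *)

Section InvariantChart.
Variable R : realType.
Local Notation C := R[i].
Local Notation B := (C * C * C)%type.
Local Notation U3 := {poly {poly {poly C}}}.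

Definition om : C := (- (1 / 2)) +i* (Num.sqrt 3 / 2).
(** Equal to 2i / sqrt 3, since 1 + 2 om = i sqrt 3; the linearization at the rational solution has
    eigenvalues lam t and -lam t. *)
Definition lam : C := 2 / 3 * (1 + 2 * om).

Lemma om2 : om * om = - 1 - om.
Proof.
have s3 : Num.sqrt 3 * Num.sqrt 3 = 3 :> R by rewrite -expr2 sqr_sqrtr// ler0n.
rewrite /om; move: (Num.sqrt 3) s3 => s s3.
by apply/eqP; rewrite eq_complex /=; apply/andP; split; apply/eqP; lra.
Qed.

Lemma om_neq0 : om != 0.
Proof.
apply/eqP => h; have := om2; rewrite h mul0r subr0 => /esym/eqP.
by rewrite oppr_eq0 oner_eq0.
Qed.

Lemma lam_neq0 : lam != 0.
Proof.
apply/eqP => h; have : lam * lam = - (4 / 3).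
  have -> : lam * lam = 4 / 9 * (1 + 4 * om + 4 * (om * om)) by rewrite /lam; field.
  by rewrite om2; field.
rewrite h mul0r => /esym/eqP; rewrite oppr_eq0 mulf_eq0 invr_eq0.
by rewrite !pnatr_eq0.
Qed.

Lemma om1_neq0 : 1 - om^-1 != 0.
Proof.
apply/eqP => h; have h1 : om = 1 by move/eqP: h; rewrite subr_eq0 => /eqP h; rewrite -[om]invrK -h invr1.
have := om2; rewrite h1 mulr1 => /eqP; rewrite -subr_eq0 (_ : 1 - (-1 - 1) = 3); last by ring.
by rewrite pnatr_eq0.
Qed.

Definition fY (b : B) : C := cexp b.1.1.
Definition fP (b : B) : C := b.1.2 * cexp (- b.1.1).
Definition fT (b : B) : C := b.2.
(** [fx] and [fz] are x and s: eigencoordinates centred at the rational solution. *)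
Definition fx b := (fY b + 2 / 3 * fT b) + om * (fP b - 2 / 3 * fT b).
Definition fz b := (fY b + 2 / 3 * fT b) + (om * om) * (fP b - 2 / 3 * fT b).
Definition fxi b := fx b * ((fz b)^-1 * (fz b)^-1).

Lemma fPE b : fY b * fP b = b.1.2.
Proof. by rewrite /fP mulrCA -cexpD subrr cexp0 mulr1. Qed.

Section Derivation.
Variable b : B.
Let k1 := - (2 * b.2) + ((2 * b.1.2 - 2 / 3) / cexp b.1.1 - cexp b.1.1).
Let k2 := al b.1.2 * cexp b.1.1 + be b.1.2 / cexp b.1.1.
(** The field on a level set in the coordinates (z, q, t); the third slot, formerly F, is now the
    time, so [dF] acts as d/dt. *)
Definition dl (u : B -> C) : C := k1 * dz u b + k2 * dq u b + 1 * dF u b.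

Lemma dl_derivation : derivation_at b dl.
Proof. exact: (derivation_lin k1 k2 1 (dz_derivation b) (dq_derivation b) (dF_derivation b)). Qed.

Let HD u v := sder u b /\ dl u = v.

Let HDc k : HD (cst k) 0.
Proof. by have [sc _ _] := sder_ringclass b; have [d1 _ _ _] := dl_derivation; split; [exact: sc|exact: d1]. Qed.

Let HDD u v u' v' : HD u u' -> HD v v' -> HD (fun b => u b + v b) (u' + v').
Proof.
move=> [su <-] [sv <-]; have [_ sD _] := sder_ringclass b; have [_ d2 _ _] := dl_derivation.
by split; [exact: (sD u v su sv)|exact: (d2 u v su sv)].
Qed.

Let HDM u v u' v' : HD u u' -> HD v v' -> HD (fun b => u b * v b) (u' * v b + u b * v').
Proof.
move=> [su <-] [sv <-]; have [_ _ sM] := sder_ringclass b; have [_ _ d3 _] := dl_derivation.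
by split; [exact: (sM u v su sv)|exact: (d3 u v su sv)].
Qed.

Let HDN u u' : HD u u' -> HD (fun b => - u b) (- u').
Proof.
move=> h; have := HDM (HDc (-1)) h; rewrite mul0r add0r /= mulN1r.
by rewrite (_ : (fun b => -1 * u b) = (fun b => - u b))//; apply/funext => b'; rewrite mulN1r.
Qed.

Let dvars (u : B -> C) (a1 a2 a3 : C) : is_derive b.1.1 1 (fun z => u (z, b.1.2, b.2)) a1 ->
  is_derive b.1.2 1 (fun q => u (b.1.1, q, b.2)) a2 -> is_derive b.2 1 (fun t => u (b.1.1, b.1.2, t)) a3 ->
  HD u (k1 * a1 + k2 * a2 + 1 * a3).
Proof. by move=> [h1 <-] [h2 <-] [h3 <-]; exact: (conj (And3 h1 h2 h3) (erefl (dl u))). Qed.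

Let HY : HD fY (2 * (fY b * fP b) - 2 / 3 - 2 * fT b * fY b - fY b ^+ 2).
Proof.
have h := @dvars fY _ _ _ (is_derive_cexp b.1.1) (is_derive_cst (cexp b.1.1) b.1.2 1) (is_derive_cst (cexp b.1.1) b.2 1).
suff <- : k1 * cexp b.1.1 + k2 * 0 + 1 * 0 = 2 * (fY b * fP b) - 2 / 3 - 2 * fT b * fY b - fY b ^+ 2 by exact: h.
rewrite fPE /k1 /fY /fT; have := cexp_neq0 b.1.1; move: (cexp b.1.1) => y y0.
by field.
Qed.

Let HP : HD fP (2 * (fY b * fP b) + 2 / 3 + 2 * fT b * fP b - fP b ^+ 2).
Proof.
have hq : is_derive b.1.2 1 (fun q : C => q * cexp (- b.1.1)) (cexp (- b.1.1)).
  have [rc rD rM] := derivable_ringclass b.1.2; have di : derivable (fun w : C => w) b.1.2 1 by exact: derivable_id.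
  apply: DeriveDef; first exact: (rM (fun w => w) (cst (cexp (- b.1.1))) di (rc _)).
  have e : 'D_1 (fun w : C => w * cst (cexp (- b.1.1)) w) b.1.2 = b.1.2 *: 'D_1 (cst (cexp (- b.1.1))) b.1.2 + cst (cexp (- b.1.1)) b.1.2 *: 'D_1 (fun w : C => w) b.1.2.
    exact: (@deriveM _ _ (fun w : C => w) (cst (cexp (- b.1.1))) b.1.2 1 di (rc _)).
  by apply: (etrans e); rewrite derive_cst (@derive_id C C b.1.2 1) /GRing.scale /= mulr0 add0r mulr1.
have h := @dvars fP _ _ _ (is_derive_cexpN b.1.2 b.1.1) hq (is_derive_cst (b.1.2 * cexp (- b.1.1)) b.2 1).
suff <- : k1 * - (b.1.2 * cexp (- b.1.1)) + k2 * cexp (- b.1.1) + 1 * 0 = 2 * (fY b * fP b) + 2 / 3 + 2 * fT b * fP b - fP b ^+ 2 by exact: h.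
rewrite fPE /k1 /k2 /al /be /fP /fT cexpN; have := cexp_neq0 b.1.1; move: (cexp b.1.1) => y y0.
by field.
Qed.

Let HT : HD fT 1.
Proof.
have h := @dvars fT _ _ _ (is_derive_cst b.2 b.1.1 1) (is_derive_cst b.2 b.1.2 1) (is_derive_id b.2 1).
suff <- : k1 * 0 + k2 * 0 + 1 * 1 = 1 :> C by exact: h.
by rewrite !mulr0 !add0r mulr1.
Qed.

Let HL w : HD (fun b => (fY b + 2 / 3 * fT b) + w * (fP b - 2 / 3 * fT b))
  (2 * (fY b * fP b) - 2 / 3 - 2 * fT b * fY b - fY b ^+ 2 + 2 / 3
   + w * (2 * (fY b * fP b) + 2 / 3 + 2 * fT b * fP b - fP b ^+ 2 - 2 / 3)).
Proof.
have hT := HDM (HDc (2 / 3)) HT; have hv := HDM (HDc w) (HDD HP (HDN hT)).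
have [h1 h2] := HDD (HDD HY hT) hv; split; first exact: h1.
apply: (etrans h2) => /=; move: (fY b) (fP b) (fT b) => y p t; by ring.
Qed.

Let Hx : HD fx (lam * fT b * fx b - fz b ^+ 2).
Proof.
have [h1 h2] := HL om; split; first exact: h1.
apply: (etrans h2); rewrite /fx /fz /lam; move: (fY b) (fP b) (fT b) om om2 => y p t o o2.
apply/eqP; rewrite -subr_eq0; apply/eqP.
(* The discrepancy between the two sides is a multiple of om^2 + om + 1 = 0. *)
have h : (2 * (y * p) - 2 / 3 - 2 * t * y - y ^+ 2 + 2 / 3 + o * (2 * (y * p) + 2 / 3 + 2 * t * p - p ^+ 2 - 2 / 3))
   - (2 / 3 * (1 + 2 * o) * t * ((y + 2 / 3 * t) + o * (p - 2 / 3 * t)) - ((y + 2 / 3 * t) + (- 1 - o) * (p - 2 / 3 * t)) ^+ 2)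
  = (o * o - (-1 - o)) * ((p - 2 / 3 * t) ^+ 2 - 4 / 3 * t * (p - 2 / 3 * t)).
  by field.
by rewrite !o2 h o2 subrr mul0r.
Qed.

Let Hz : HD fz (- (lam * fT b * fz b) - fx b ^+ 2).
Proof.
have [h1 h2] := HL (om * om); split; first exact: h1.
apply: (etrans h2); rewrite /fx /fz /lam; move: (fY b) (fP b) (fT b) om om2 => y p t o o2.
apply/eqP; rewrite -subr_eq0; apply/eqP.
have h : (2 * (y * p) - 2 / 3 - 2 * t * y - y ^+ 2 + 2 / 3 + (-1 - o) * (2 * (y * p) + 2 / 3 + 2 * t * p - p ^+ 2 - 2 / 3))
   - (- (2 / 3 * (1 + 2 * o) * t * ((y + 2 / 3 * t) + (-1 - o) * (p - 2 / 3 * t))) - ((y + 2 / 3 * t) + o * (p - 2 / 3 * t)) ^+ 2)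
  = (o * o - (-1 - o)) * ((p - 2 / 3 * t) ^+ 2 - 4 / 3 * t * (p - 2 / 3 * t)).
  by field.
by rewrite !o2 h o2 subrr mul0r.
Qed.

Hypothesis z0 : fz b != 0.

Let HV : HD (fun b => (fz b)^-1) (- (- (lam * fT b * fz b) - fx b ^+ 2) / fz b ^+ 2).
Proof.
have [sz <-] := Hz; split; first exact: sderV.
have [s1 s2 s3] := sz.
have e (h : C -> C) (x y : C) : h x = y -> y != 0 -> derivable h x 1 -> 'D_1 (fun w => (h w)^-1) x = - (y ^- 2) * 'D_1 h x.
  by move=> <- hx dh; exact: (@deriveV _ _ h x 1 hx dh).
have bE : fz (b.1.1, b.1.2, b.2) = fz b by case: (b) => -[].
have e1 : dz (fun b => (fz b)^-1) b = - (fz b ^- 2) * dz fz b.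
  exact: (e (fun z => fz (z, b.1.2, b.2)) b.1.1 (fz b) bE z0 s1).
have e2 : dq (fun b => (fz b)^-1) b = - (fz b ^- 2) * dq fz b.
  exact: (e (fun q => fz (b.1.1, q, b.2)) b.1.2 (fz b) bE z0 s2).
have e3 : dF (fun b => (fz b)^-1) b = - (fz b ^- 2) * dF fz b.
  exact: (e (fun t => fz (b.1.1, b.1.2, t)) b.2 (fz b) bE z0 s3).
rewrite /dl e1 e2 e3; move: (dz fz b) (dq fz b) (dF fz b) (fz b ^- 2) => a1 a2 a3 a4; by ring.
Qed.

Lemma chart_vf P : sder (fun b => ce3 fT fxi fz b P) b /\ dl (fun b => ce3 fT fxi fz b P) = ce3 fT fxi fz b (vf lam P).
Proof.
have [sx dx] := HDM Hx (HDM HV HV); have [sT dT] := HT; have [sz dz'] := Hz.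
apply: (vf_derivation dl_derivation sT sx sz dT).
  apply: (etrans dx); rewrite ce3_vf_xi /fxi; move: (fx b) (fz b) (fT b) lam z0 => x z t l zn0; by field.
apply: (etrans dz'); rewrite ce3_vf_s /fxi; move: (fx b) (fz b) (fT b) lam z0 => x z t l zn0; by field.
Qed.

End Derivation.

Local Notation ce := (ce3 fT fxi fz).

Lemma fz_continuous b : {for b, continuous fz}.
Proof.
have [rc rD rM] := @continuous_ringclass R B b.
have c11 : {for b, continuous (fun b : B => b.1.1)}.
  by apply: (@continuous_comp B (C * C)%type C fst fst); [exact: cvg_fst|exact: cvg_fst].
have c12 : {for b, continuous (fun b : B => b.1.2)}.
  by apply: (@continuous_comp B (C * C)%type C fst snd); [exact: cvg_fst|exact: cvg_snd].
have c2 : {for b, continuous (fun b : B => b.2)} by exact: cvg_snd.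
have cx (z : C) : {for z, continuous (@cexp R)}.
  by have [d _] := is_derive_cexp z; exact: derivable_continuous d.
have ce : {for b, continuous fY} by exact: (@continuous_comp B C C (fun b => b.1.1) (@cexp R) b c11 (cx _)).
have cn : {for b, continuous (fun b : B => cexp (- b.1.1))}.
  have cN := ringclassN (@continuous_ringclass R B b) (f := fun b => b.1.1) c11.
  exact: (@continuous_comp B C C (fun b => - b.1.1) (@cexp R) b cN (cx _)).
have cp : {for b, continuous fP} by exact: (rM (fun b => b.1.2) (fun b => cexp (- b.1.1)) c12 cn).
have ct := rM (cst (2 / 3)) fT (rc (2 / 3)) c2.
have cv := rD fP _ cp (ringclassN (@continuous_ringclass R B b) ct).
have cw := rM (cst (om * om)) _ (rc _) cv.
exact: (rD _ _ (rD fY _ ce ct) cw).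
Qed.

Lemma chart_ringclass : @ringclass R B (fun u => exists P : U3, forall b, fz b != 0 -> u b = ce b P).
Proof.
split=> [k|u v [P hP] [Q hQ]|u v [P hP] [Q hQ]].
- by exists k%:P%:P%:P => b _; rewrite ce3C ce2C hornerC.
- by exists (P + Q) => b bz; rewrite rmorphD hP// hQ.
- by exists (P * Q) => b bz; rewrite rmorphM hP// hQ.
Qed.

(** x = xi s^2 is polynomial, and p and y are recovered linearly from x, s and t because om differs
    from om^2; so polynomials in (y, q, t) become polynomials in (t, xi, s). *)
Lemma chart_ev3 Q : exists N : U3, forall b, fz b != 0 -> ev3 Q (cexp b.1.1) b.1.2 b.2 = ce b N.
Proof.
have Sr := chart_ringclass; have [Sc SD SM] := Sr.
pose S (u : B -> C) := exists P : U3, forall b, fz b != 0 -> u b = ce b P.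
have ST : S fT by exists (tU C) => b _; rewrite /tU ce3C ce2C hornerX.
have Sz : S fz by exists 'X => b _; rewrite ce3X.
have Sxi : S fxi by exists (xiU C) => b _; rewrite /xiU ce3C ce2X.
have Sx : S fx.
  have [P hP] := SM _ _ Sxi (SM _ _ Sz Sz); exists P => b bz; rewrite -hP// /fxi.
  by move: (fx b) (fz b) bz => x z zn0; field.
have omm : om - om * om != 0.
  have -> : om - om * om = om * om * (- (1 - om^-1)) by have := om_neq0; move: om => o o0; field.
  by rewrite mulf_neq0 ?oppr_eq0 ?om1_neq0// mulf_neq0// om_neq0.
have SE u v : (forall b, u b = v b) -> S u -> S v by move=> uv [P hP]; exists P => b bz; rewrite -uv hP.
have SP : S fP.
  apply: (SE _ _ _ (SD _ _ (SM _ _ (Sc (om - om * om)^-1) (ringclassB Sr Sx Sz)) (SM _ _ (Sc (2 / 3)) ST))) => b.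
  rewrite /fx /fz /=; move: (fY b) (fP b) (fT b) om omm => y p t o o0; by field.
have SY : S fY.
  apply: (SE _ _ _ (ringclassB Sr Sx (SD _ _ (SM _ _ (Sc (2 / 3)) ST) (SM _ _ (Sc om) (ringclassB Sr SP (SM _ _ (Sc (2 / 3)) ST)))))) => b.
  rewrite /fx /=; move: (fY b) (fP b) (fT b) om => y p t o; by ring.
have Sq : S (fun b => b.1.2) by apply: (SE _ _ fPE (SM _ _ SY SP)).
exact: (ev3_ringclass Q Sr SY Sq ST).
Qed.

End InvariantChart.

(** * A rational integral on a level set is locally constant *)

Section ConstantOnChart.
Variable R : realType.
Local Notation C := R[i].
Local Notation B := (C * C * C)%type.
Local Notation U3 := {poly {poly {poly C}}}.
Local Notation om := (om R).
Local Notation ce := (ce3 (@fT R) (@fxi R) (@fz R)).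

Lemma box_continuous (b : B) : [/\ {for b, continuous (fun b : B => b.1.2)}, {for b, continuous (fun b : B => b.2)}
  & {for b, continuous (fun b : B => cexp b.1.1)}].
Proof.
have c11 : {for b, continuous (fun b : B => b.1.1)}.
  by apply: (@continuous_comp B (C * C)%type C fst fst); [exact: cvg_fst|exact: cvg_fst].
have c12 : {for b, continuous (fun b : B => b.1.2)}.
  by apply: (@continuous_comp B (C * C)%type C fst snd); [exact: cvg_fst|exact: cvg_snd].
have c2 : {for b, continuous (fun b : B => b.2)} by exact: cvg_snd.
have cx (z : C) : {for z, continuous (@cexp R)}.
  by have [d _] := is_derive_cexp z; exact: derivable_continuous d.
by split; [exact: c12|exact: c2|exact: (@continuous_comp B C C (fun b => b.1.1) (@cexp R) b c11 (cx _))].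
Qed.

Lemma near_neq0_pd (u : B -> C) b : {for b, continuous u} -> u b != 0 ->
  exists2 s : R, 0 < s & forall b', pd b s b' -> u b' != 0.
Proof.
move=> cu ub; have /cu/nbhs_pd[s s0 h] : nbhs (u b) [set y | y != 0].
  apply/nearP; exists (nrm (u b)); first by rewrite nrm_gt0.
  by move=> w wf; apply/eqP => w0; move: wf; rewrite w0 sub0r nrmN ltxx.
by exists s.
Qed.

(** The q with s = zeta at given z and t, so that (z, s, t) may serve as independent coordinates. *)
Definition qz (zeta z t : C) : C := cexp z * (2 / 3 * t + (zeta - (cexp z + 2 / 3 * t)) * (om * om)^-1).

Lemma fz_qz zeta z t : fz (z, qz zeta z t, t) = zeta.
Proof.
rewrite /fz /fY /fP /fT /qz /= cexpN; have := cexp_neq0 z; have := om_neq0 R.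
by move: (cexp z) om => y o o0 y0; field; rewrite y0 o0.
Qed.

Lemma qz_fz (b : B) : qz (fz b) b.1.1 b.2 = b.1.2.
Proof.
rewrite /fz /fY /fP /fT /qz /= cexpN; have := cexp_neq0 b.1.1; have := om_neq0 R.
by move: (cexp b.1.1) om => y o o0 y0; field; rewrite y0 o0.
Qed.

(** For fixed s and t, xi is an affine function of exp z with nonzero slope, and therefore varies
    independently of s and t. *)
Lemma fxi_qz zeta z t : fxi (z, qz zeta z t, t) =
  (1 - om^-1) * (zeta^-1 * zeta^-1) * cexp z + (2 / 3 * t * (1 - om^-1) + zeta * om^-1) * (zeta^-1 * zeta^-1).
Proof.
rewrite /fxi fz_qz; move: (zeta^-1 * zeta^-1) => k.
rewrite /fx /fY /fP /fT /qz /= cexpN; have := cexp_neq0 z; have := om_neq0 R.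
by move: (cexp z) om => y o o0 y0; field; rewrite y0 o0.
Qed.

(** Algebraic independence of t, xi and s on a box: for fixed s and t a relation becomes a
    polynomial in exp z vanishing on a disc; varying s and then t annihilates all coefficients. *)
Lemma ce_sep (b1 : B) (s : R) (A : U3) : 0 < s -> (forall b, pd b1 s b -> fz b != 0) ->
  (forall b, pd b1 s b -> ce b A = 0) -> A = 0.
Proof.
move=> s0 fz0 A0; pose Fq (b : B) := qz b.1.2 b.1.1 b.2; pose b0 : B := (b1.1.1, fz b1, b1.2).
have cF : {for b0, continuous Fq}.
  have Sr := @continuous_ringclass R B b0; have [rc rD rM] := Sr; have [c12 c2 cy] := box_continuous b0.
  have ct := rM (cst (2 / 3)) (fun b => b.2) (rc (2 / 3)) c2.
  have c1 := ringclassB Sr c12 (rD (fun b => cexp b.1.1) _ cy ct).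
  have c3 := rM _ (cst (om * om)^-1) c1 (rc _).
  exact: (rM (fun b => cexp b.1.1) _ cy (rD _ _ ct c3)).
have /cF/nbhs_pd[e e0 he] : nbhs (Fq b0) [set q | nrm (q - b1.1.2) < s].
  apply/nearP; exists s => // w; rewrite (_ : Fq b0 = b1.1.2)//.
  exact: qz_fz.
pose r := Num.min e s; have r0 : 0 < r by rewrite lt_min e0 s0.
have inb z zeta t : nrm (z - b1.1.1) < r -> nrm (zeta - fz b1) < r -> nrm (t - b1.2) < r -> pd b1 s (z, qz zeta z t, t).
  move=> hz hw ht; have le1 (x : R) : x < r -> x < e /\ x < s by rewrite lt_min => /andP.
  have [z1 z2] := le1 _ hz; have [w1 _] := le1 _ hw; have [t1 t2] := le1 _ ht.
  split; [exact: z2| |exact: t2]; exact: (he (z, zeta, t) (And3 z1 w1 t1)).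
pose evt t : {rmorphism {poly C} -> C} := horner_eval t.
pose W t (zeta : C) : {poly C} := (map_poly (map_poly (evt t)) A).[zeta%:P].
pose evc t (c : C) : {rmorphism {poly {poly C}} -> C} := [the {rmorphism _ -> _} of horner_eval c \o map_poly (evt t)].
have WE t zeta c : (W t zeta).[c] = (map_poly (evc t c) A).[zeta].
  have mc : map_poly (evc t c) A = map_poly (horner_eval c) (map_poly (map_poly (evt t)) A).
    exact: (map_poly_comp (horner_eval c) (map_poly (evt t)) A).
  have e1 : horner_eval c zeta%:P = zeta by rewrite /horner_eval hornerC.
  rewrite mc -{2}e1; exact: (esym (horner_map (horner_eval c) (map_poly (map_poly (evt t)) A) zeta%:P)).
have W0 t zeta c : nrm (zeta - fz b1) < r -> nrm (t - b1.2) < r -> (W t zeta).[c] = 0.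
  move=> hw ht; have zn : zeta != 0.
    have h : nrm (b1.1.1 - b1.1.1) < r by rewrite subrr nrm0.
    by have := fz0 _ (inb _ _ _ h hw ht); rewrite fz_qz.
  set a := (1 - om^-1) * (zeta^-1 * zeta^-1).
  set d := (2 / 3 * t * (1 - om^-1) + zeta * om^-1) * (zeta^-1 * zeta^-1).
  have a0 : a != 0 by rewrite mulf_neq0 ?om1_neq0// mulf_neq0// invr_eq0.
  have : W t zeta \Po (a *: 'X + d%:P) = 0.
    apply: (@poly_cexp0 R _ b1.1.1 r r0) => z hz.
    rewrite horner_comp hornerD hornerZ hornerX hornerC -fxi_qz WE.
    have := A0 _ (inb _ _ _ hz hw ht); rewrite ce3E fz_qz => h; exact: h.
  move=> /(congr1 (fun p : {poly C} => p.[(c - d) / a])); rewrite horner_comp hornerD hornerZ hornerX hornerC horner0.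
  by rewrite mulrC mulfVK// subrK.
apply/polyP => i; rewrite coef0; apply/polyP => j; rewrite coef0.
apply: (@poly_disc0 R _ b1.2 r r0) => t ht.
have h : map_poly (evt t) A`_i = 0.
  apply: (@poly_disc0 R _ 0 r r0) => c _.
  have : map_poly (evc t c) A = 0.
    by apply: (@poly_disc0 R _ (fz b1) r r0) => zeta hw; rewrite -WE W0.
  by move=> /(congr1 (fun p : {poly C} => p`_i)); rewrite coef_map coef0.
by have := congr1 (fun p : {poly C} => p`_j) h; rewrite coef_map coef0.
Qed.

Lemma ev3_sep (b1 : B) (s : R) (Q : U3) : 0 < s -> (forall b, pd b1 s b -> ev3 Q (cexp b.1.1) b.1.2 b.2 = 0) -> Q = 0.
Proof.
move=> s0 H; apply/polyP => i; rewrite coef0; apply: (ev2_sep (z0 := b1.1.1) (w0 := b1.1.2) s0) => z w hz hw.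
have : map_poly (ev2 (cexp z) w) Q = 0.
  apply: (@poly_disc0 R _ b1.2 s s0) => t ht; exact: (H (z, w, t) (And3 hz hw ht)).
by move=> /(congr1 (fun p : {poly C} => p`_i)); rewrite coef_map coef0.
Qed.

Lemma fz_nonzero (c : B) (r : R) : 0 < r -> exists2 b, pd c r b & fz b != 0.
Proof.
move=> r0; apply: contrapT => ne.
have z0 q : nrm (q - c.1.2) < r -> fz (c.1.1, q, c.2) = 0.
  move=> hq; apply/eqP; apply: contraT => h; case: ne; exists (c.1.1, q, c.2) => //.
  by have [h1 _ h3] := pd_center c r0; split.
pose p : {poly C} := (om * om * cexp (- c.1.1)) *: 'X + (cexp c.1.1 + 2 / 3 * c.2 - om * om * (2 / 3 * c.2))%:P.
have /(congr1 (fun p : {poly C} => p`_1)) : p = 0.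
  apply: (@poly_disc0 R _ c.1.2 r r0) => q hq; rewrite -(z0 q hq) /p hornerD hornerZ hornerX hornerC /fz /fY /fP /fT /=.
  by move: (cexp c.1.1) (cexp (- c.1.1)) om => y yi o; ring.
rewrite /p coefD coefZ coefX coefC addr0 mulr1 coef0 => /eqP.
by rewrite !mulf_eq0 (negbTE (om_neq0 R)) (negbTE (cexp_neq0 _)).
Qed.

Theorem constant_integral (g : B -> C) (c : B) (r : R) (P Q : U3) : 0 < r -> Q != 0 ->
  (forall b, pd c r b -> sder g b) -> (forall b, pd c r b -> dl b g = 0) ->
  (forall b, pd c r b -> g b * ev3 Q (cexp b.1.1) b.1.2 b.2 = ev3 P (cexp b.1.1) b.1.2 b.2) ->
  exists b1 (s : R) k, [/\ 0 < s, forall b, pd b1 s b -> pd c r b & forall b, pd b1 s b -> g b = k].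
Proof.
move=> r0 Q0 gd g0 gPQ; have [b1 hb1 fz1] := fz_nonzero c r0.
have [s1 s10 h1] := near_neq0_pd (@fz_continuous R b1) fz1; have [s2 s20 h2] := pd_sub hb1.
pose s := Num.min s1 s2; have s0 : 0 < s by rewrite lt_min s10 s20.
have in1 b : pd b1 s b -> fz b != 0 by move=> hb; apply/h1/(pd_le _ hb); rewrite ge_min lexx.
have in2 b : pd b1 s b -> pd c r b by move=> hb; apply/h2/(pd_le _ hb); rewrite ge_min lexx orbT.
have [N NE] := chart_ev3 P; have [M ME] := chart_ev3 Q.
have gMN b : pd b1 s b -> g b * ce b M = ce b N.
  by move=> hb; rewrite -(NE b (in1 b hb)) -(ME b (in1 b hb)); exact: gPQ (in2 b hb).
have M0 : M != 0.
  apply: contra_neq Q0 => M0; apply: (ev3_sep (b1 := b1) s0) => b hb.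
  by rewrite (ME b (in1 b hb)) M0 rmorph0.
(* Differentiating g M = N along the flow, where g is constant, gives vf N = g vf M, hence the
   relation free of g. *)
have inv b : pd b1 s b -> ce b (vf (lam R) N * M - N * vf (lam R) M) = 0.
  move=> hb; have [_ _ d3 d4] := dl_derivation b; have [sM dM] := chart_vf (in1 b hb) M; have [_ dN] := chart_vf (in1 b hb) N.
  have [e e0 he] := pd_sub hb.
  have hN : dl b (fun b => g b * ce b M) = dl b (fun b => ce b N).
    by apply: d4; exists e => // b' /he/gMN.
  have hM : dl b (fun b => g b * ce b M) = dl b g * ce b M + g b * dl b (fun b => ce b M).
    exact: (d3 g (fun b => ce b M) (gd b (in2 b hb)) sM).
  have E : ce b (vf (lam R) N) = g b * ce b (vf (lam R) M).
    by rewrite -dN -hN hM (g0 b (in2 b hb)) mul0r add0r dM.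
  have gen (a1 a2 a3 a4 : U3) : ce b (a1 * a2 - a3 * a4) = ce b a1 * ce b a2 - ce b a3 * ce b a4.
    by rewrite rmorphB !rmorphM.
  apply: (etrans (gen _ _ _ _)); rewrite E -(gMN b hb).
  by move: (ce b M) (ce b (vf (lam R) M)) => x y; ring.
have /(vf_invariant (lam_neq0 R) M0)[k Nk] : vf (lam R) N * M = N * vf (lam R) M.
  by apply/eqP; rewrite -subr_eq0; apply/eqP; exact: (ce_sep s0 in1 inv).
have gk b : pd b1 s b -> (g b - k) * ev3 Q (cexp b.1.1) b.1.2 b.2 = 0.
  move=> hb; rewrite (ME b (in1 b hb)) mulrBl (gMN b hb) Nk.
  have -> : ce b (k%:P%:P%:P * M) = k * ce b M by rewrite rmorphM ce3C ce2C hornerC.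
  by rewrite subrr.
have [b2 hb2 Q2] : exists2 b2, pd b1 s b2 & ev3 Q (cexp b2.1.1) b2.1.2 b2.2 != 0.
  apply: contrapT => ne; move/eqP: Q0; apply; apply: (ev3_sep (b1 := b1) s0) => b hb.
  by apply/eqP; apply: contraT => h; case: ne; exists b.
have cQ : {for b2, continuous (fun b : B => ev3 Q (cexp b.1.1) b.1.2 b.2)}.
  have [c12 c2 cy] := box_continuous b2.
  exact: (ev3_ringclass Q (@continuous_ringclass R B b2) cy c12 c2).
have [s3 s30 h3] := near_neq0_pd cQ Q2; have [s4 s40 h4] := pd_sub hb2.
exists b2, (Num.min s3 s4), k; split; first by rewrite lt_min s30 s40.
  by move=> b hb; apply/in2/h4/(pd_le _ hb); rewrite ge_min lexx orbT.
move=> b hb; have n3 : ev3 Q (cexp b.1.1) b.1.2 b.2 != 0 by apply/h3/(pd_le _ hb); rewrite ge_min lexx.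
have n4 : pd b1 s b by apply/h4/(pd_le _ hb); rewrite ge_min lexx orbT.
have /eqP := gk b n4; rewrite mulf_eq0 (negbTE n3) orbF subr_eq0 => /eqP h; exact: h.
Qed.

End ConstantOnChart.

(** * The integral restricted to a level set *)

Section LevelChart.
Variable R : realType.
Local Notation C := R[i].
Local Notation B := (C * C * C)%type.
Local Notation phase := 'rV[C]_4.
Local Notation point := Defs.point.
Local Notation H4 := (@hamiltonian4 R (1 / 3) 0 (- (1 / 3))).
Variables (f : phase -> C) (h0 : C).

Definition level_pt (z q t : C) : phase := pt (z, q, levF h0 z q t) t.
Definition level_fun (z q t : C) : C := f (level_pt z q t).

Let levFE (z q t : C) : levF h0 z q t = h0 + 2 * q * t + al q * cexp z - be q * cexp (- z).
Proof. by rewrite /levF cexpN. Qed.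

Let levF_z (z q t : C) : is_derive z 1 (fun z => levF h0 z q t) (al q * cexp z + be q * cexp (- z)).
Proof.
have [c1 e1] := is_derive_cexp z; have dz1 : is_derive z 1 (fun z => al q * cexp z) (al q * cexp z).
  apply: DeriveDef; first exact: (@derivableZ C C C (@cexp R) (al q) z 1 c1).
  by apply: (etrans (@deriveZ C C C (@cexp R) (al q) z 1 c1)); rewrite e1.
have E : (fun z => levF h0 z q t) = cst (h0 + 2 * q * t) + (fun z => al q * cexp z) - (fun z => be q * cexp (- z)).
  by apply/funext => w; rewrite !fctE levFE.
rewrite E; apply: (is_derive_eq (is_deriveB (is_deriveD (is_derive_cst (h0 + 2 * q * t) z 1) dz1) (is_derive_cexpN (be q) z))).
by rewrite add0r opprK.
Qed.

Let levF_q (z q t : C) : is_derive q 1 (fun q => levF h0 z q t) (2 * t + cexp z - (2 * q - 2 / 3) * cexp (- z)).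
Proof.
move: (cexp z) (cexp (- z)) (levFE z) => y yi h.
pose p : {poly C} := h0%:P + (2 * t)%:P * 'X + y%:P * ('X + (2 / 3)%:P) - yi%:P * ('X * ('X - (2 / 3)%:P)).
have E : (fun q => levF h0 z q t) = (fun q => p.[q]).
  apply/funext => w; rewrite h /p /al /be !(hornerD, hornerN, hornerM, hornerC, hornerX); ring.
rewrite E; apply: (is_derive_eq (is_derive_horner p q)).
rewrite /p !(derivD, derivN, derivM, derivC, derivX) !(hornerD, hornerN, hornerM, hornerC, hornerX).
by ring.
Qed.

Let levF_t (z q t : C) : is_derive t 1 (fun t => levF h0 z q t) (2 * q).
Proof.
pose p : {poly C} := (h0 + al q * cexp z - be q * cexp (- z))%:P + (2 * q)%:P * 'X.
have E : (fun t => levF h0 z q t) = (fun t => p.[t]).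
  apply/funext => w; rewrite levFE /p !(hornerD, hornerM, hornerC, hornerX); ring.
rewrite E; apply: (is_derive_eq (is_derive_horner p t)).
rewrite /p !(derivD, derivM, derivC, derivX) !(hornerD, hornerM, hornerC, hornerX).
by ring.
Qed.

Lemma levF_continuous (b : B) (tau : B -> C) : {for b, continuous tau} ->
  {for b, continuous (fun b : B => levF h0 b.1.1 b.1.2 (tau b))}.
Proof.
move=> ct; have [c12 _ cy] := box_continuous b.
have c11 : {for b, continuous (fun b : B => - b.1.1)}.
  by apply: (ringclassN (@continuous_ringclass R B b)); apply: (@continuous_comp B (C * C)%type C fst fst); [exact: cvg_fst|exact: cvg_fst].
have cyi : {for b, continuous (fun b : B => cexp (- b.1.1))}.
  have cx (z : C) : {for z, continuous (@cexp R)} by have [d _] := is_derive_cexp z; exact: derivable_continuous d.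
  exact: (@continuous_comp B C C (fun b => - b.1.1) (@cexp R) b c11 (cx _)).
have Sr := @continuous_ringclass R B b; have [rc rD rM] := Sr.
have ca := rD (fun b : B => b.1.2) (cst (2 / 3)) c12 (rc _).
have cb := rM (fun b : B => b.1.2) _ c12 (ringclassB Sr c12 (rc (2 / 3))).
have ch := rD (cst h0) _ (rc h0) (rM _ tau (rM (cst 2) (fun b : B => b.1.2) (rc 2) c12) ct).
have := ringclassB Sr (rD _ _ ch (rM _ (fun b : B => cexp b.1.1) ca cy)) (rM _ (fun b : B => cexp (- b.1.1)) cb cyi).
rewrite (_ : (fun b => levF h0 b.1.1 b.1.2 (tau b)) = (fun b : B => cst h0 b + cst 2 b * b.1.2 * tau b + (b.1.2 + cst (2 / 3) b) * cexp b.1.1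
   - b.1.2 * (b.1.2 - cst (2 / 3) b) * cexp (- b.1.1))).
  by move=> h; exact: h.
by apply/funext => b'; rewrite levFE.
Qed.

Section Point.
Variables (z q t : C).
Local Notation X := (level_pt z q t).
Hypothesis hX : holomorphic_at f X.

Let df : differentiable f X := holomorphic_differentiable hX.

Lemma level_derive : [/\ is_derive z 1 (fun z => level_fun z q t) ('D_(point (cexp z) (- (q * cexp (- z))) 0 (al q * cexp z + be q * cexp (- z))) f X),
  is_derive q 1 (fun q => level_fun z q t) ('D_(point 0 (cexp (- z)) 0 (2 * t + cexp z - (2 * q - 2 / 3) * cexp (- z))) f X) &
  is_derive t 1 (level_fun z q) ('D_(point 0 0 1 (2 * q)) f X)].
Proof.
split.
- apply: (@chain_curve R f (fun z => level_pt z q t) z (point (cexp z) (- (q * cexp (- z))) 0 (al q * cexp z + be q * cexp (- z)))) df.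
  exact: (is_derive_point (is_derive_cexp z) (is_derive_cexpN q z) (is_derive_cst t z 1) (levF_z z q t)).
- apply: (@chain_curve R f (fun q => level_pt z q t) q (point 0 (cexp (- z)) 0 (2 * t + cexp z - (2 * q - 2 / 3) * cexp (- z)))) df.
  have hq : is_derive q 1 (fun w => w * cexp (- z)) (cexp (- z)).
    have E : (fun w : C => w * cexp (- z)) = (fun w => ('X * (cexp (- z))%:P : {poly C}).[w]).
      by apply/funext => w; rewrite hornerM hornerX hornerC.
    rewrite E; apply: (is_derive_eq (is_derive_horner _ q)).
    by rewrite derivM derivX derivC mulr0 addr0 mul1r hornerC.
  exact: (is_derive_point (is_derive_cst (cexp z) q 1) hq (is_derive_cst t q 1) (levF_q z q t)).
- apply: (@chain_curve R f (fun t => level_pt z q t) t (point 0 0 1 (2 * q))) df.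
  exact: (is_derive_point (is_derive_cst (cexp z) t 1) (is_derive_cst (q * cexp (- z)) t 1) (is_derive_id t 1) (levF_t z q t)).
Qed.

Let Dsplit (a1 a2 a3 a4 : C) : 'D_(point a1 a2 a3 a4) f X = 'D_(point a1 a2 a3 0) f X + a4 * 'D_(point 0 0 0 1) f X.
Proof.
rewrite !(deriveE _ df); have -> : point a1 a2 a3 a4 = point a1 a2 a3 0 + a4 *: point 0 0 0 1.
  by apply/rowP; apply: coord_all; rewrite !mxE /= ?mulr1 ?mulr0 ?addr0 ?add0r.
by rewrite linearD linearZ.
Qed.

(** The Hamiltonian field is tangent to the level sets of H: along the remaining coordinates [levF]
    has derivative 2 q, which is the F-component of the field. *)
Lemma level_pde : first_integral H4 f ->
  'D_1 (level_fun z q) t - 2 * t * 'D_1 (fun z => level_fun z q t) z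
   + (((2 * q - 2 / 3) / cexp z - cexp z) * 'D_1 (fun z => level_fun z q t) z
     + (al q * cexp z + be q / cexp z) * 'D_1 (fun q => level_fun z q t) q) = 0.
Proof.
move=> ff; have [[_ ->] [_ ->] [_ ->]] := level_derive.
pose b : B := (z, q, levF h0 z q t).
have [[_ Ez] [_ Eq] [_ EF] [_ Et]] := pt_derive (b := b) df.
have := chart_pde ff (b := b) hX; rewrite /D0.
have ez : dz (fun b => f (pt b t)) b = 'D_(point (cexp z) (- (q * cexp (- z))) 0 0) f X := Ez.
have eq : dq (fun b => f (pt b t)) b = 'D_(point 0 (cexp (- z)) 0 0) f X := Eq.
have eF : dF (fun b => f (pt b t)) b = 'D_(point 0 0 0 1) f X := EF.
rewrite ez eq eF Et /b /= => E.
rewrite (Dsplit (cexp z)) (Dsplit 0 (cexp (- z))) (Dsplit 0 0 1 (2 * q)).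
move: ('D_(point (cexp z) (- (q * cexp (- z))) 0 0) f X) ('D_(point 0 (cexp (- z)) 0 0) f X) ('D_(point 0 0 0 1) f X)
  ('D_(point 0 0 1 0) f X) E => a1 a2 a3 a4 E.
rewrite cexpN; have := cexp_neq0 z; move: (cexp z) E => y E y0.
by apply: (etrans _ E); field.
Qed.

(** The three coordinate directions span the tangent space of the level set, and H has F-derivative
    1; so the gradient of [f] is d_F f times the gradient of H. *)
Lemma level_dependent : 'D_1 (fun z => level_fun z q t) z = 0 -> 'D_1 (fun q => level_fun z q t) q = 0 ->
  'D_1 (level_fun z q) t = 0 -> ~~ row_free (col_mx (gradient H4 X) (gradient f X)).
Proof.
have [[_ ->] [_ ->] [_ ->]] := level_derive.
rewrite !(deriveE _ df); set L := 'd f X; pose e k : phase := delta_mx 0 k.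
have dec (a1 a2 a3 a4 : C) : L (point a1 a2 a3 a4) = a1 * L (e iy) + a2 * L (e ip) + a3 * L (e it) + a4 * L (e iF).
  have -> : point a1 a2 a3 a4 = a1 *: e iy + a2 *: e ip + a3 *: e it + a4 *: e iF.
    by apply/rowP; apply: coord_all; rewrite !mxE /= ?mulr1 ?mulr0 ?addr0 ?add0r.
  by rewrite !linearD !linearZ.
have pE k : partial f k X = L (e k) by rewrite /partial (deriveE _ df).
rewrite !dec => E1 E2 E3.
have := hamiltonian_field4E (1 / 3) 0 (- (1 / 3)) X; rewrite /= !mxE /= /hamiltonian_field => /rowP HF.
have Hp := HF iy; have Hy := HF ip; have HF1 := HF it; have Ht := HF iF; rewrite !mxE /= in Hp Hy HF1 Ht.
have y0 := cexp_neq0 z.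
have yyi : cexp z * cexp (- z) = 1 by rewrite -cexpD subrr cexp0.
have yiE : cexp (- z) = (cexp z)^-1 by rewrite cexpN.
have prop : gradient f X = L (e iF) *: gradient H4 X.
  apply/rowP; apply: coord_all; rewrite !mxE !pE ?Hp ?HF1.
  - rewrite (oppr_inj Hy); move: E1 E2; rewrite yiE /al /be; move: (L (e iy)) (L (e ip)) (L (e it)) (L (e iF)) (cexp z) y0 => a1 a2 a3 a4 y yn E1 E2.
    apply/eqP; rewrite -subr_eq0; apply/eqP.
    (* Weights 1 / y and q / y on the z- and q-directions cancel the p-derivative and isolate the
       y-derivative. *)
    have h : y^-1 * 0 + q * y^-1 * 0 = 0 :> C by ring.
    apply: (etrans _ h); rewrite -[X in _ = y^-1 * X + _]E1 -[X in _ = _ + q * y^-1 * X]E2; by field.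
  - move: E2; rewrite yiE; move: (L (e iy)) (L (e ip)) (L (e it)) (L (e iF)) (cexp z) y0 => a1 a2 a3 a4 y yn E2.
    by apply/eqP; rewrite -subr_eq0; apply/eqP; apply: (mulfI (invr_neq0 yn)); rewrite mulr0 -[RHS]E2; field.
  - rewrite (etrans (esym (opprK _)) (congr1 -%R Ht)); move: E3; rewrite yiE; move: (L (e iy)) (L (e ip)) (L (e it)) (L (e iF)) (cexp z) y0 => a1 a2 a3 a4 y yn E3.
    by apply/eqP; rewrite -subr_eq0; apply/eqP; rewrite -[RHS]E3; field.
  - by rewrite mulr1.
apply/negP => /row_free_inj inj.
pose w : 'rV[C]_(1 + 1) := row_mx (L (e iF))%:M (- 1%:M).
have w0 : w *m col_mx (gradient H4 X) (gradient f X) = 0 *m col_mx (gradient H4 X) (gradient f X).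
  by rewrite mul0mx /w mul_row_col mul_scalar_mx mulNmx mul1mx prop subrr.
have /(congr1 (@rsubmx C 1 1 1)) := inj _ _ _ w0.
rewrite /w row_mxKr => /matrixP/(_ 0 0); rewrite !mxE /= => /eqP; by rewrite oppr_eq0 oner_eq0.
Qed.

End Point.

End LevelChart.

(** * Functional dependence and the conclusion *)

Section Main.
Variable R : realType.
Local Notation C := R[i].
Local Notation B := (C * C * C)%type.
Local Notation phase := 'rV[C]_4.
Local Notation H4 := (@hamiltonian4 R (1 / 3) 0 (- (1 / 3))).

Lemma dl_pde (g : C -> C -> C -> C) (b : B) :
  'D_1 (g b.1.1 b.1.2) b.2 - 2 * b.2 * 'D_1 (fun z => g z b.1.2 b.2) b.1.1
   + (((2 * b.1.2 - 2 / 3) / cexp b.1.1 - cexp b.1.1) * 'D_1 (fun z => g z b.1.2 b.2) b.1.1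
     + (al b.1.2 * cexp b.1.1 + be b.1.2 / cexp b.1.1) * 'D_1 (fun q => g b.1.1 q b.2) b.1.2) = 0 ->
  dl b (fun b => g b.1.1 b.1.2 b.2) = 0.
Proof.
case: b => [[z q] t]; rewrite /dl /dz /dq /dF [_.1.1]/= [_.1.2]/= [_.2]/=.
move: ('D_1 (fun z => g z q t) z) ('D_1 (fun q => g z q t) q) ('D_1 (g z q) t) => a1 a2 a3.
move: ((2 * q - 2 / 3) / cexp z - cexp z) (al q * cexp z + be q / cexp z) => k1 k2 E.
by apply: (etrans _ E); ring.
Qed.

(** The one-variable identity theorem in z, then q, then t; separate differentiability of [G] is
    what each of the three steps consumes. *)
Lemma identity_pd (G : B -> C) (c b1 : B) (r s : R) (k : C) : 0 < s -> (forall b, pd c r b -> sder G b) ->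
  (forall b, pd b1 s b -> pd c r b) -> (forall b, pd b1 s b -> G b = k) -> forall b, pd c r b -> G b = k.
Proof.
move=> s0 dG sub Gk; have [c1 c2 c3] := sub _ (pd_center b1 s0).
have ext (u : C -> C) (w0 w1 : C) : hol u w0 r -> nrm (w1 - w0) < r -> (forall w, nrm (w - w1) < s -> u w = k) ->
    forall w, nrm (w - w0) < r -> u w = k.
  move=> hu h1 h2 w hw; apply/eqP; rewrite -subr_eq0; apply/eqP.
  apply: (identity_ball (u := fun w => u w - k) (z1 := w1) _ h1 _ hw).
    move=> w' hw'; have Dr := derivable_ringclass w'; have [rc _ _] := Dr.
    exact: (ringclassB Dr (hu _ hw') (rc k)).
  by exists s => // w' hw'; rewrite h2// subrr.
have k1 z q t : nrm (z - c.1.1) < r -> nrm (q - b1.1.2) < s -> nrm (t - b1.2) < s -> G (z, q, t) = k.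
  move=> hz hq ht; apply: (ext (fun z => G (z, q, t)) c.1.1 b1.1.1 _ c1 _ z hz); last by move=> w hw; apply: Gk; split.
  have [_ q2 t2] : pd c r (b1.1.1, q, t) by apply: sub; split; rewrite //= subrr nrm0.
  by move=> w hw; have [d _ _] := dG (w, q, t) (And3 hw q2 t2); exact: d.
have k2 z q t : nrm (z - c.1.1) < r -> nrm (q - c.1.2) < r -> nrm (t - b1.2) < s -> G (z, q, t) = k.
  move=> hz hq ht; apply: (ext (fun q => G (z, q, t)) c.1.2 b1.1.2 _ c2 _ q hq); last by move=> w hw; exact: k1.
  have [_ _ t2] : pd c r (b1.1.1, b1.1.2, t) by apply: sub; split; rewrite //= subrr nrm0.
  by move=> w hw; have [_ d _] := dG (z, w, t) (And3 hz hw t2); exact: d.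
move=> [[z q] t] [/= hz hq ht]; apply: (ext (fun t => G (z, q, t)) c.2 b1.2 _ c3 _ t ht); last by move=> w hw; exact: k2.
by move=> w hw; have [_ _ d] := dG (z, q, w) (And3 hz hq hw); exact: d.
Qed.

Lemma dense_tp (D : set phase) z c (s : R) : dense D -> 0 < s -> exists z' b, [/\ nrm (z' - z) < s, pd c s b & D (tp z' b)].
Proof.
move=> dD s0; apply: (@tp_dense R z c D) => // nD.
have [|x [xO Dx]] := dD ([set x | ~ D x]^°) _ (@open_interior _ _); first by exists (tp z c).
exact: (interior_subset xO Dx).
Qed.

Section Contradiction.
Variable f : phase -> C.
Hypothesis mf : meromorphic f.
Hypothesis rf : rational_in_t f.
Hypothesis ff : first_integral H4 f.

Section Level.
Variables (z1 q1 F1 t1 q0 : C) (rho s : R).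
Hypothesis rho0 : 0 < rho.
Hypothesis hq1 : nrm (q1 - q0) < s.
Hypothesis hf : forall z q F t, nrm (z - z1) < rho -> nrm (q - q0) < s -> nrm (F - F1) < rho -> nrm (t - t1) < rho ->
  holomorphic_at f (pt (z, q, F) t).
Hypothesis al0 : forall q, nrm (q - q0) < s -> al q != 0.
Hypothesis fPQ : forall q, nrm (q - q0) < s -> exists P Q : {poly {poly {poly C}}}, Q != 0 /\
  forall z F t, nrm (z - z1) < rho -> nrm (F - F1) < rho -> nrm (t - t1) < rho ->
    f (pt (z, q, F) t) * ev3 Q (cexp z) F t = ev3 P (cexp z) F t.

Let h1 := F1 - levF 0 z1 q1 t1.
Let levF1 : levF h1 z1 q1 t1 = F1.
Proof. rewrite /h1 /levF; ring. Qed.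

Let small_radius : exists2 r, 0 < r /\ r <= rho & forall z q t, nrm (z - z1) < r -> nrm (q - q1) < r -> nrm (t - t1) < r ->
  nrm (q - q0) < s /\ nrm (levF h1 z q t - F1) < rho / 2.
Proof.
have r2 : 0 < rho / 2 by rewrite divr_gt0.
have [_ c2 _] := box_continuous (z1, q1, t1).
have cl := levF_continuous (h0 := h1) c2.
have /cl/nbhs_pd[e e0 he] : nbhs (levF h1 z1 q1 t1) [set F | nrm (F - F1) < rho / 2].
  by rewrite levF1; apply/nearP; exists (rho / 2).
have [s5 s50 h5] := ball_sub hq1.
exists (Num.min e (Num.min s5 rho)).
  by split; [rewrite !lt_min e0 s50 rho0|rewrite !ge_min lexx !orbT].
have le1 (x : R) : x < Num.min e (Num.min s5 rho) -> x < e /\ x < s5.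
  by rewrite lt_min => /andP[h]; rewrite lt_min => /andP[h' _].
move=> z q t /le1[hz _] /le1[hq hq'] /le1[ht _]; split; first exact: h5.
exact: (he (z, q, t) (And3 hz hq ht)).
Qed.

(** The level [h1] is the one through the given point. Constancy is first found near some other
    point of the level set, where the second pass succeeds, and is carried back to the given point
    by the identity theorem. *)
Lemma level_degenerate : ~~ row_free (col_mx (gradient H4 (pt (z1, q1, F1) t1)) (gradient f (pt (z1, q1, F1) t1))).
Proof.
have [r [r0 rrho] hr] := small_radius; pose g := level_fun f h1.
have rho2 : rho / 2 < rho by rewrite ltr_pdivrMr// ltr_pMr// ltr1n.
have hol1 z q t : nrm (z - z1) < r -> nrm (q - q1) < r -> nrm (t - t1) < r -> holomorphic_at f (level_pt h1 z q t).
  move=> hz hq ht; have [a1 a2] := hr z q t hz hq ht; apply: (hf _ a1 (lt_trans a2 rho2)); [exact: lt_le_trans hz rrho|exact: lt_le_trans ht rrho].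
have g_cont (b : B) t : nrm (b.1.1 - z1) < r -> nrm (b.1.2 - q1) < r -> nrm (t - t1) < r ->
    {for b, continuous (fun b : B => g b.1.1 b.1.2 t)}.
  move=> hz hq ht A nA; have cf := differentiable_continuous (holomorphic_differentiable (hol1 _ _ _ hz hq ht)).
  have := @pt_continuous R (b.1.1, b.1.2, levF h1 b.1.1 b.1.2 t) t _ (cf A nA) => /nbhs_pd[e e0 he].
  have cl : {for b, continuous (fun b : B => levF h1 b.1.1 b.1.2 t)} by apply: levF_continuous; exact: cst_continuous.
  have [s5 s50 h5] : exists2 s5 : R, 0 < s5 & forall b', pd b s5 b' -> nrm (levF h1 b'.1.1 b'.1.2 t - levF h1 b.1.1 b.1.2 t) < e.
    have /cl/nbhs_pd[s5 s50 h5] : nbhs (levF h1 b.1.1 b.1.2 t) [set F | nrm (F - levF h1 b.1.1 b.1.2 t) < e] by exact: near_nrm.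
    by exists s5.
  have m0 : 0 < Num.min e s5 by rewrite lt_min e0 s50.
  have [_ c2 _] := box_continuous b; have [c12 _ _] := box_continuous b.
  have c11 : {for b, continuous (fun b : B => b.1.1)}.
    by apply: (@continuous_comp B (C * C)%type C fst fst); [exact: cvg_fst|exact: cvg_fst].
  have near1 (u : B -> C) : {for b, continuous u} -> \forall b' \near b, nrm (u b' - u b) < Num.min e s5.
    by move=> cu; apply: (cu (fun w => nrm (w - u b) < Num.min e s5)); exact: near_nrm.
  have le3 (x : R) : x < Num.min e s5 -> x < e /\ x < s5 by rewrite lt_min => /andP.
  apply: filterS3 (near1 _ c11) (near1 _ c12) (near1 _ c2) => b' /le3[x1 y1] /le3[x2 y2] /le3[_ y3].
  apply: (he (b'.1.1, b'.1.2, levF h1 b'.1.1 b'.1.2 t)); split; [exact: x1|exact: x2|].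
  exact: (h5 b' (And3 y1 y2 y3)).
have g_der z q t : nrm (z - z1) < r -> nrm (q - q1) < r -> nrm (t - t1) < r ->
    [/\ derivable (fun z => g z q t) z 1, derivable (fun q => g z q t) q 1 & derivable (g z q) t 1].
  move=> hz hq ht; have [[a1 _] [a2 _] [a3 _]] := level_derive (hol1 z q t hz hq ht).
  by split; [exact: a1|exact: a2|exact: a3].
have g_pde z q t : nrm (z - z1) < r -> nrm (q - q1) < r -> nrm (t - t1) < r ->
   'D_1 (g z q) t - 2 * t * 'D_1 (fun z => g z q t) z + (((2 * q - 2 / 3) / cexp z - cexp z) * 'D_1 (fun z => g z q t) z
     + (al q * cexp z + be q / cexp z) * 'D_1 (fun q => g z q t) q) = 0.
  by move=> hz hq ht; exact: (level_pde (hol1 z q t hz hq ht) ff).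
have zz : nrm (z1 - z1) < r by rewrite subrr nrm0.
have tt : nrm (t1 - t1) < r by rewrite subrr nrm0.
have g_rat q : nrm (q - q1) < r -> rat2 z1 t1 r (fun z t => g z q t).
  move=> hq; have [hq0 _] := hr z1 q t1 zz hq tt; have [P [Q [Q0 PQ]]] := fPQ hq0.
  apply: (@restrict_level R h1 q z1 F1 t1 (fun z F t => f (pt (z, q, F) t)) rho r P Q Q0 r0 rrho).
    by move=> z t hz ht; have [_ h] := hr z q t hz hq ht; exact: h.
  move=> z F t hz hF ht; split; last exact: PQ.
  have df := holomorphic_differentiable (hf hz hq0 hF ht).
  have [_ _ [d _] _] := pt_derive (b := (z, q, F)) df; exact: derivable_continuous d.
have a0 q : nrm (q - q1) < r -> al q != 0 by move=> hq; have [h _] := hr z1 q t1 zz hq tt; exact: al0.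
have [z2 [q2 [s2 [P [Q [s20 hz2 hq2 Q0 PQ]]]]]] := round_two r0 g_cont g_der g_pde g_rat a0.
pose m := Num.min s2 r; have m0 : 0 < m by rewrite lt_min s20 r0.
pose G (b : B) := g b.1.1 b.1.2 b.2; pose c1 : B := (z1, q1, t1); pose c2 : B := (z2, q2, t1).
have sub2 b : pd c2 m b -> [/\ nrm (b.1.1 - z2) < s2, nrm (b.1.2 - q2) < s2 & nrm (b.2 - t1) < r].
  have le1 (x : R) : x < m -> x < s2 /\ x < r by rewrite lt_min => /andP.
  by move=> [/le1[x1 _] /le1[x2 _] /le1[_ x3]].
have sub b : pd c2 m b -> pd c1 r b.
  by move=> /sub2[x1 x2 x3]; split; [exact: hz2|exact: hq2|exact: x3].
have sG b : pd c1 r b -> sder G b by move=> [x1 x2 x3]; exact: (g_der _ _ _ x1 x2 x3).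
have [b3 [s3 [k [s30 sub3 Gk]]]] : exists b3 (s3 : R) k, [/\ 0 < s3, forall b, pd b3 s3 b -> pd c2 m b & forall b, pd b3 s3 b -> G b = k].
  apply: (@constant_integral R G c2 m P Q m0 Q0).
  - by move=> b /sub/sG.
  - by move=> b /sub[x1 x2 x3]; exact: (dl_pde (g_pde _ _ _ x1 x2 x3)).
  - by move=> b /sub2[x1 x2 x3]; exact: (PQ _ _ _ x1 x2 x3).
have Gc : forall b, pd c1 r b -> G b = k.
  by apply: (identity_pd s30 sG _ Gk) => b /sub3/sub.
have qq : nrm (q1 - q1) < r by rewrite subrr nrm0.
have d0 (u : C -> C) (w0 : C) : (forall w, nrm (w - w0) < r -> u w = k) -> 'D_1 u w0 = 0.
  by move=> h; rewrite (derive_local (g := cst k) r0)//; exact: (@derive_cst C C C k w0 1).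
have := @level_dependent R f h1 z1 q1 t1 (hol1 _ _ _ zz qq tt).
rewrite /level_pt levF1; apply.
- by apply: d0 => w hw; exact: (Gc (w, q1, t1) (And3 hw qq tt)).
- by apply: d0 => w hw; exact: (Gc (z1, w, t1) (And3 zz hw tt)).
- by apply: d0 => w hw; exact: (Gc (z1, q1, w) (And3 zz qq hw)).
Qed.

End Level.

(** Density of independent points is used twice: once for a base point where [f] is holomorphic, and
    again inside the small disc of values q that the first pass delivers, for a point contradicting
    [level_degenerate]. *)
Lemma not_independent : ~ functionally_independent H4 f.
Proof.
rewrite /functionally_independent => dD.
have h2 : 0 < 1 / 2 :> R by rewrite divr_gt0.
(* Staying within 1/2 of q = 1 avoids q = 0, needed for polynomial dependence on F, and the zero q =
   -2/3 of [al]. *)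
have [z0 [[[q0 t0] F0] [_ [/= hq0 _ _] [_ hf0 _]]]] := dense_tp 0 (1, 0, 0) dD h2.
have [s1 s10 hs1] := tp_near (near_join hf0); have [s2 s20 hs2] := ball_sub hq0.
pose rho := Num.min s1 s2; have rho0 : 0 < rho by rewrite lt_min s10 s20.
have le1 (x : R) : x < rho -> x < s1 /\ x < s2 by rewrite lt_min => /andP.
have hf b t : pd (z0, q0, F0) rho b -> nrm (t - t0) < rho -> holomorphic_at f (pt b t).
  case: b => [[z q] F] [/= /le1[hz _] /le1[hq _] /le1[hF _]] /le1[ht _].
  exact: (hs1 z (q, t, F) hz (And3 hq ht hF)).
have far (w : C) : 1 / 2 <= nrm (w - 1) -> forall q, nrm (q - q0) < rho -> q != w.
  move=> hw q /le1[_ /hs2 hq]; apply/eqP => qw; move: hq; rewrite qw => /lt_le_trans/(_ hw).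
  by rewrite ltxx.
have nR (x : R) : 0 <= x -> nrm (x%:C) = x.
  by move=> x0; rewrite /nrm normc_def /= expr0n addr0 sqrtr_sqr ger0_norm.
have n1 : nrm (1 : C) = 1 by rewrite -[1 in LHS](rmorph1 (real_complex R)) nR.
have qn0 q : nrm (q - q0) < rho -> q != 0.
  by apply: far; rewrite sub0r nrmN n1; lra.
have al0 q : nrm (q - q0) < rho -> al q != 0.
  move=> hq; rewrite /al addr_eq0; apply: (far (- (2 / 3)) _ q hq).
  have -> : - (2 / 3) - 1 = - ((5 / 3 : R)%:C) :> C.
    by rewrite !(rmorphM, fmorphV, rmorph_nat); field.
  by rewrite nrmN nR; lra.
have [q1 [s [s0 hs PQ]]] := round_one mf rf ff rho0 hf qn0.
have r2 : 0 < rho / 2 by rewrite divr_gt0.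
pose m := Num.min s (rho / 2); have m0 : 0 < m by rewrite lt_min s0 r2.
(* An independent point over the disc of admissible q; the radius rho / 2 leaves a box of the same
   size around it inside the region of holomorphy. *)
have [z1 [[[q2 t1] F1] [hz1 [/= hq2 ht1 hF1] [_ _ frk]]]] := dense_tp z0 (q1, t0, F0) dD m0.
have le2 (x : R) : x < m -> x < s /\ x < rho / 2 by rewrite lt_min => /andP.
have [_ hz1'] := le2 _ hz1; have [hq2' _] := le2 _ hq2; have [_ ht1'] := le2 _ ht1; have [_ hF1'] := le2 _ hF1.
have tri (x y w : C) : nrm (x - y) < rho / 2 -> nrm (y - w) < rho / 2 -> nrm (x - w) < rho.
  by move=> a1 a2; apply: (le_lt_trans (nrm_triangle x y w)); rewrite [rho]splitr ltrD.
have := @level_degenerate z1 q2 F1 t1 q1 (rho / 2) s r2 hq2'.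
move=> /(_ _ _ _)/negP; apply.
- move=> z q F t hz hq hF ht; apply: hf; last exact: tri ht ht1'.
  by split; [exact: tri hz hz1'|exact: hs|exact: tri hF hF1'].
- by move=> q /hs; exact: al0.
- move=> q hq; have [P [Q [Q0 E]]] := PQ q hq; exists P, Q; split; first exact: Q0.
  by move=> z F t hz hF ht; apply: E; [exact: tri hz hz1'|exact: tri hF hF1'|exact: tri ht ht1'].
- exact: frk.
Qed.

End Contradiction.

End Main.

Theorem theorem1p1 (R : realType) : ~ integrable_rational_in_t (@hamiltonian4 R (1 / 3) 0 (- (1 / 3))).
Proof.
move=> [_ [f [-> [_ mf] [_ rf] [_ ff] [_ fi]]]].
exact: (not_independent mf rf ff fi).
Qed.
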